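(* Let $n\ge3$, $\sigma_0>0$, $A>0$, $\lambda>0$, let $M$ be an $n$-dimensional asymptotically conic manifold, let $V:M\to\mathbf{R}$ be a short-range potential obeying $$|V(x)|\le A\left(\langle x\rangle^{-2-2\sigma_0}+\lambda^{1/2}\langle x\rangle^{-1-2\sigma_0}\right)\quad\text{for all }x\in M,$$ and let $H:=-\Delta_M+V$. Then $H$ has no non-zero eigenfunctions and no resonances (incoming or outgoing) at $\lambda$.
   Context: Asymptotically conic manifold (with $n\ge3$, $\sigma_0>0$): a smooth connected $n$-dimensional Riemannian manifold $(M,g)$ which, outside a compact set $K_0\subset M$, is parameterized as $M\setminus K_0=\{(r,\omega): r>R_0,\ \omega\in\partial M\}$ for some $R_0>1$, where $(\partial M,h)$ is a smooth compact $(n-1)$-dimensional Riemannian manifold, and there $g=dr^2+r^2h[r]_{ab}(\omega)\,d\omega^a d\omega^b$ with $h[r]_{ab}=h_{ab}(\omega)+r^{-2\sigma_0}e_{ab}(r,\omega)$, where $|e_{ab}(r,y)|+r|\partial_re_{ab}(r,y)|+|\nabla_ye_{ab}(r,y)|_h\le C$ on $M\setminus K_0$; qualitatively, $e_{ab}(1/s,y)$ is also assumed to extend smoothly to $[0,1/R_0]\times\partial M$. The weight $\langle x\rangle$ equals $r$ on $M\setminus K_0$ and is extended smoothly to $K_0$ so that it stays between $R_0/2$ and $R_0$ there. $L^2(M)$ is with respect to the Riemannian measure $dg$; $\Delta_M$ is the Laplace–Beltrami operator. $\|f\|_{H^{0,m}(M)}:=\|\langle x\rangle^mf\|_{L^2(M)}$,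 and similarly on subsets of $M$. A short-range potential is a real function $V$ with $\langle x\rangle^{1+2\sigma_0}V\in L^\infty(M)$. $H$ is essentially self-adjoint. An eigenfunction at $\lambda$ is $u\in L^2(M)$ with $Hu=\lambda u$. For $\lambda=\kappa^2$, $\kappa\ge0$, $H$ has an outgoing (resp. incoming) resonance at $\lambda$ if $Hu=\lambda u$ has a solution $u\in H^{0,-3/2+\sigma}(M)$ for some $\sigma>0$ such that $u\notin\bigcup_{\sigma>0}H^{0,-1/2+\sigma}(M)$ and $\partial_ru-i\kappa u$ (resp. $\partial_ru+i\kappa u$) lies in $H^{0,-1/2+\sigma'}(M\setminus K_0)$ for some $\sigma'>0$. *)

(* Defs.v *)
From HB Require Import structures.
From mathcomp Require Import all_boot all_order all_algebra.
From mathcomp Require Import complex.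
From mathcomp Require Import all_classical all_reals all_analysis.
Set Implicit Arguments.
Unset Strict Implicit.
Unset Printing Implicit Defensive.
Import Order.TTheory GRing.Theory Num.Theory.
Import numFieldNormedType.Exports.
Local Open Scope classical_set_scope.
Local Open Scope ring_scope.
Local Open Scope complex_scope.

Section Euclidean.
Context {R : realType}.

Definition partial n (i : 'I_n) (f : 'rV[R]_n -> R) (x : 'rV[R]_n) : R :=
  'D_(delta_mx 0 i) f x.

Fixpoint partials n (s : seq 'I_n) (f : 'rV[R]_n -> R) : 'rV[R]_n -> R :=
  if s is i :: s' then partial i (partials s' f) else f.

(** C^oo on an open set [U]; the values of [f] off [U] are irrelevant. *)
Definition smooth_on n (U : set 'rV[R]_n) (f : 'rV[R]_n -> R) : Prop :=
  forall (s : seq 'I_n) (x : 'rV[R]_n), U x ->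
    {for x, continuous (partials s f)} /\
    forall i, derivable (partials s f) x (delta_mx 0 i).

Definition cons_coord n (r : R) (y : 'rV[R]_n) : 'rV[R]_n.+1 :=
  row_mx r%:M y.

(** dr^2 + k_ab dy^a dy^b, r being the first coordinate. *)
Definition warped_mx n (k : 'M[R]_n) : 'M[R]_n.+1 :=
  @block_mx R 1 n 1 n 1%:M 0 0 k.

(** Lebesgue integral over R^n of a nonnegative Borel function, as an iterated
    integral (Tonelli). *)
Fixpoint lebesgue_int n : ('rV[R]_n -> \bar R) -> \bar R :=
  match n with
  | 0%N => fun f => f 0
  | m.+1 => fun f =>
      (\int[@lebesgue_measure R]_t lebesgue_int (fun y => f (cons_coord t y)))%E
  end.

End Euclidean.

(** [cmap] is only meaningful on [cdom], and [cinv] only on [cimg]. *)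
Record chart (R : realType) (T : Type) (n : nat) := Chart {
  cdom : set T;
  cmap : T -> 'rV[R]_n;
  cinv : 'rV[R]_n -> T }.

Definition cimg (R : realType) (T : Type) n (c : chart R T n) : set 'rV[R]_n :=
  cmap c @` cdom c.

Definition is_chart (R : realType) (T : topologicalType) n
    (c : chart R T n) : Prop :=
  [/\ open (cdom c), open (cimg c),
      (forall p, cdom c p -> cinv c (cmap c p) = p),
      (forall p, cdom c p -> {for p, continuous (cmap c)}) &
      (forall x, cimg c x -> {for x, continuous (cinv c)})].

Definition smooth_transition (R : realType) (T : Type) n
    (c c' : chart R T n) : Prop :=
  forall j : 'I_n, smooth_on (cmap c @` (cdom c `&` cdom c'))
    (fun x => cmap c' (cinv c x) 0 j).

(** Smooth manifold without boundary (nonempty, since its carrier is pointed),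
    with its maximal atlas. *)
Record manifold (R : realType) (n : nat) := Manifold {
  carrier :> ptopologicalType;
  atlas : set (chart R carrier n);
  manifold_hausdorff : hausdorff_space carrier;
  manifold_second_countable : @second_countable carrier;
  atlas_chart : forall c, atlas c -> is_chart c;
  atlas_cover : forall p : carrier, exists c, atlas c /\ cdom c p;
  atlas_compatible : forall c c', atlas c -> atlas c' -> smooth_transition c c';
  atlas_maximal : forall c, is_chart c ->
    (forall c', atlas c' -> smooth_transition c c' /\ smooth_transition c' c) ->
    atlas c }.

Section Manifold.
Context {R : realType} {n : nat} (M : manifold R n).

Definition chart_at (p : M) : chart R M n := projT1 (cid (atlas_cover p)).

Definition smooth_fun (f : M -> R) : Prop :=
  forall c, atlas c -> smooth_on (cimg c) (f \o cinv c).

Definition borel : Type := g_sigma_algebraType (@open M).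
HB.instance Definition _ := Measurable.on borel.

(** Riemannian metric: its matrix in every chart of the maximal atlas. With
    row vectors, the Jacobian of the transition map has entries
    J_(a,k) = d x'_k / d x_a, whence the law g_c = J g_c' J^T. *)
Record metric := Metric {
  gmx :> chart R M n -> 'rV[R]_n -> 'M[R]_n;
  gmx_smooth : forall c, atlas c ->
    forall i j, smooth_on (cimg c) (fun x => gmx c x i j);
  gmx_sym : forall c x, atlas c -> cimg c x -> (gmx c x)^T = gmx c x;
  gmx_pos : forall c x, atlas c -> cimg c x ->
    forall v : 'rV[R]_n, v != 0 -> 0 < (v *m gmx c x *m v^T) 0 0;
  gmx_transition : forall c c' p, atlas c -> atlas c' ->
    cdom c p -> cdom c' p ->
    let J := jacobian (cmap c' \o cinv c) (cmap c p) in
    gmx c (cmap c p) = J *m gmx c' (cmap c' p) *m J^T }.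

Variable g : metric.

Definition vol_density (c : chart R M n) (x : 'rV[R]_n) : R :=
  Num.sqrt (\det (g c x)).

(** [mu] is the Riemannian measure dg. This determines it uniquely, as
    countably many charts cover [M]. *)
Definition is_riemannian_measure (mu : {measure set borel -> \bar R}) : Prop :=
  forall (c : chart R M n) (B : set M), atlas c ->
    measurable (B : set borel) -> B `<=` cdom c ->
    mu B = lebesgue_int
      (fun x => (\1_(cmap c @` B) x * vol_density c x)%:E).

(** Laplace-Beltrami operator on smooth functions,
    |g|^(-1/2) d_i (|g|^(1/2) g^(ij) d_j f), in some chart at the point. *)
Definition laplacian (f : M -> R) (p : M) : R :=
  let c := chart_at p in
  (vol_density c (cmap c p))^-1 *
  \sum_(i < n) partial i
    (fun x => vol_density c x *
       \sum_(j < n) invmx (g c x) i j * partial j (f \o cinv c) x)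
    (cmap c p).

End Manifold.

Section ComplexFunctions.
Context {R : realType} {n : nat} {M : manifold R n}.
Implicit Types (u v f phi : M -> R[i]) (D : set M).

Definition ReF u : M -> R := fun x => complex.Re (u x).
Definition ImF u : M -> R := fun x => complex.Im (u x).

(** Extension of a real-linear operator on real functions to complex ones. *)
Definition complexify (L : (M -> R) -> M -> R) u : M -> R[i] :=
  fun x => L (ReF u) x +i* L (ImF u) x.

Definition test_fun D phi : Prop :=
  [/\ smooth_fun (ReF phi), smooth_fun (ImF phi) &
      exists K : set M, [/\ compact K, K `<=` D &
        forall x, ~ K x -> phi x = 0]].

Variable mu : {measure set (borel M) -> \bar R}.

Definition L2norm2 D u : \bar R :=
  (\int[mu]_(x in D) (ReF u x ^+ 2 + ImF u x ^+ 2)%:E)%E.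

Definition in_L2 D u : Prop :=
  [/\ measurable_fun (D : set (borel M)) (ReF u : borel M -> R),
      measurable_fun (D : set (borel M)) (ImF u : borel M -> R) &
      (L2norm2 D u < +oo)%E].

Definition inner D u v : R[i] :=
  let f x := u x * conjc (v x) in
  Rintegral mu D (ReF f : borel M -> R) +i*
  Rintegral mu D (ImF f : borel M -> R).

(** [H] is a symmetric operator with domain the test functions on [M];
    its adjoint acts in the sense of distributions. *)
Definition adjoint_graph (H : (M -> R[i]) -> M -> R[i]) u f : Prop :=
  forall phi, test_fun setT phi -> inner setT u (H phi) = inner setT f phi.

(** The closure of [H] is its adjoint (the converse inclusion being symmetry). *)
Definition essentially_self_adjoint (H : (M -> R[i]) -> M -> R[i]) : Prop :=
  forall u f, in_L2 setT u -> in_L2 setT f -> adjoint_graph H u f ->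
    forall eps : R, 0 < eps -> exists phi,
      [/\ test_fun setT phi,
          (L2norm2 setT (fun x => u x - phi x)%R < eps%:E)%E &
          (L2norm2 setT (fun x => f x - H phi x)%R < eps%:E)%E].

Definition solves (H : (M -> R[i]) -> M -> R[i]) (lam : R) u : Prop :=
  adjoint_graph H u (fun x => lam%:C * u x).

Definition eigenfunction (H : (M -> R[i]) -> M -> R[i]) (lam : R) u : Prop :=
  in_L2 setT u /\ solves H lam u.

End ComplexFunctions.

(** The chart (r, y) of the cone end induced by a chart [c] of the
    cross-section [N]. *)
Definition end_chart (R : realType) (T N : Type) n (K0 : set T)
    (rad : T -> R) (ang : T -> N) (endpt : R -> N -> T)
    (c : chart R N n) : chart R T n.+1 :=
  Chart [set p | ~ K0 p /\ cdom c (ang p)]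
        (fun p => cons_coord (rad p) (cmap c (ang p)))
        (fun x : 'rV[R]_(1 + n) => endpt (lsubmx x 0 0) (cinv c (rsubmx x))).

(** Asymptotically conic manifold of dimension [n] (for [0 < n], [n.-1.+1] is
    [n]), together with its weight <x>. In coordinates y on the cross-section,
    [ac_e c r y] is the matrix of e_ab(r, y). *)
Record asymptotically_conic (R : realType) (n : nat) (sigma0 : R) :=
    AsymptoticallyConic {
  ac_space :> manifold R n.-1.+1;
  ac_g : metric ac_space;
  ac_connected : connected [set: ac_space];
  ac_bd : manifold R n.-1;
  ac_h : metric ac_bd;
  ac_bd_compact : compact [set: ac_bd];
  ac_K0 : set ac_space;
  ac_K0_compact : compact ac_K0;
  ac_R0 : R;
  ac_R0_gt1 : 1 < ac_R0;
  ac_rad : ac_space -> R;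
  ac_ang : ac_space -> ac_bd;
  ac_endpt : R -> ac_bd -> ac_space;
  (* [(ac_rad, ac_ang)] is a diffeomorphism from the complement of K_0 onto
     (R_0, +oo) x bd M, with inverse [ac_endpt] *)
  ac_end_to : forall p, ~ ac_K0 p ->
    ac_R0 < ac_rad p /\ ac_endpt (ac_rad p) (ac_ang p) = p;
  ac_end_from : forall r w, ac_R0 < r ->
    [/\ ~ ac_K0 (ac_endpt r w), ac_rad (ac_endpt r w) = r &
        ac_ang (ac_endpt r w) = w];
  ac_end_atlas : forall c, atlas c ->
    atlas (end_chart ac_K0 ac_rad ac_ang ac_endpt c);
  ac_e : chart R ac_bd n.-1 -> R -> 'rV[R]_n.-1 -> 'M[R]_n.-1;
  ac_g_end : forall c r y, atlas c -> ac_R0 < r -> cimg c y ->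
    ac_g (end_chart ac_K0 ac_rad ac_ang ac_endpt c) (cons_coord r y) =
    warped_mx
      (r ^+ 2 *: (ac_h c y + (r `^ (- (2 * sigma0))) *: ac_e c r y));
  (* The components e_ab and their derivatives are bounded, uniformly in r,
     locally uniformly in each chart of the compact cross-section;
     the last term is |d_y e_ab|_h. *)
  ac_e_bound : forall c (K : set 'rV[R]_n.-1), atlas c ->
    compact K -> K `<=` cimg c ->
    exists C : R, forall r y a b, ac_R0 < r -> K y ->
      `|ac_e c r y a b| + r * `|derive1 (fun t => ac_e c t y a b) r| +
      (let v := \row_k partial k (fun z => ac_e c r z a b) y in
       Num.sqrt ((v *m invmx (ac_h c y) *m v^T) 0 0)) <= C;
  (* e_ab(1/s, y) extends smoothly to [0, 1/R_0] x bd M *)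
  ac_e_extends : forall c a b, atlas c ->
    exists (O : set 'rV[R]_n.-1.+1) (E : 'rV[R]_n.-1.+1 -> R),
      [/\ open O, smooth_on O E,
          (forall s y, 0 <= s <= ac_R0^-1 -> cimg c y -> O (cons_coord s y)) &
          (forall s y, 0 < s < ac_R0^-1 -> cimg c y ->
             E (cons_coord s y) = ac_e c s^-1 y a b)];
  ac_weight : ac_space -> R;
  ac_weight_smooth : smooth_fun ac_weight;
  ac_weight_end : forall p, ~ ac_K0 p -> ac_weight p = ac_rad p;
  ac_weight_K0 : forall p, ac_K0 p -> ac_R0 / 2 <= ac_weight p <= ac_R0 }.

Section Resonances.
Context {R : realType} {n : nat} {sigma0 : R}.
Variable M : asymptotically_conic n sigma0.
Variable mu : {measure set (borel M) -> \bar R}.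
Implicit Types (u w : M -> R[i]) (V : M -> R).

Definition schrodinger V : (M -> R[i]) -> M -> R[i] :=
  complexify (fun f x => - laplacian (ac_g M) f x + V x * f x).

Definition short_range V : Prop :=
  measurable_fun [set: borel M] (V : borel M -> R) /\
  exists C : R, {ae mu, forall x : borel M,
    (ac_weight (x : M)) `^ (1 + 2 * sigma0) * `|V x| <= C}.

Definition in_H0 (m : R) (D : set M) u : Prop :=
  in_L2 mu D (fun x => (ac_weight x `^ m)%:C * u x).

(** Formal adjoint of d/dr on the end, f |-> - |g|^(-1/2) d_r (|g|^(1/2) f). *)
Definition radial_adjoint (f : M -> R) (p : M) : R :=
  let c := end_chart (@ac_K0 _ _ _ M) (@ac_rad _ _ _ M) (@ac_ang _ _ _ M)
             (@ac_endpt _ _ _ M) (chart_at (ac_ang p)) in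
  - ((vol_density (ac_g M) c (cmap c p))^-1 *
     partial ord0 (fun x => vol_density (ac_g M) c x * f (cinv c x))
       (cmap c p)).

(** [w] is the distributional derivative d_r u on the end. *)
Definition is_radial_derivative u w : Prop :=
  forall phi, test_fun (~` (@ac_K0 _ _ _ M)) phi ->
    inner mu (~` (@ac_K0 _ _ _ M)) u (complexify radial_adjoint phi) =
    inner mu (~` (@ac_K0 _ _ _ M)) w phi.

(** [eps = 1]: outgoing; [eps = -1]: incoming. *)
Definition resonance (eps : R) (H : (M -> R[i]) -> M -> R[i])
    (lam : R) : Prop :=
  exists kappa : R, [/\ 0 <= kappa, lam = kappa ^+ 2 & exists u,
    [/\ exists sigma : R, 0 < sigma /\ in_H0 (- (3 / 2) + sigma) setT u,
        solves mu H lam u,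
        ~ (exists sigma : R, 0 < sigma /\ in_H0 (- (1 / 2) + sigma) setT u) &
        exists w : M -> R[i], is_radial_derivative u w /\
          exists sigma' : R, 0 < sigma' /\
            in_H0 (- (1 / 2) + sigma') (~` (@ac_K0 _ _ _ M))
              (fun x => w x - (0 +i* (eps * kappa)) * u x)]].

Definition outgoing_resonance := resonance 1.
Definition incoming_resonance := resonance (-1).

End Resonances.

(* Main.v *)
Require Import Defs.
From HB Require Import structures.
From mathcomp Require Import all_boot all_order all_algebra.
From mathcomp Require Import complex.
From mathcomp Require Import all_classical all_reals all_analysis.
From mathcomp Require Import measurable_realfun perm.
From mathcomp Require Import ring lra.
Set Implicit Arguments.
Unset Strict Implicit.
Unset Printing Implicit Defensive.
Import Order.TTheory GRing.Theory Num.Theory.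
Import numFieldNormedType.Exports.
Local Open Scope classical_set_scope.
Local Open Scope ring_scope.

(* Essential self-adjointness turns an eigenfunction [u] at [lam] into an [L2]
   limit of test functions [f] with [Lap f - (V - lam) f -> 0], so every
   estimate is proved for smooth compactly supported [f] and passes to the
   limit. On the end, with [r] the radius, a Carleman estimate with weight
   [exp (tau r + de r / (1 + ka r))] and multiplier [2 r d_r + (n - 1)] holds
   uniformly in [tau >= 0]; it bootstraps square integrability of [u] to that of
   [exp (tau r) u] for all [tau], and then [tau -> oo] forces [u = 0] for large
   [r]. A second Carleman estimate, with the convexified weight
   [exp (- gamma |x - x0|^2)] in a chart, propagates the vanishing to the
   connected manifold.

   For a resonance [u] with radial derivative [w], essential self-adjointness
   applied to radial cutoffs of [u] shows that the flux [Im (w conj u)] through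
   radial shells vanishes. Hence [kappa^2 |u|^2] is controlled on weighted shells
   by [|w - i eps kappa u|^2], and [u] decays better than a resonance may. *)

(** * Smooth functions on Euclidean space *)

(** Three obstacles shape the argument. Eigenfunctions are only distributional solutions, so no
    estimate may mention their gradient: gradients occur for test functions alone and are traded for
    zeroth order terms by energy identities before the limit is taken. The Laplacian is computed in
    a chart chosen at each point; its independence of the chart, on which every global identity
    rests, comes from its weak form. An L2 eigenfunction has no exponential decay to begin with, so
    the Carleman weight on the end must interpolate: for [ka > 0] the term [de r / (1 + ka r)] is
    bounded, and for [ka = L^-2] it agrees with [de r] on [r <= L] up to [de]; hence finite mass at
    rate [tau] controls the mass at rate [tau + de]. Positivity in that estimate is the radial
    derivative of [lam r], which is where [lam > 0] enters, and the potential is small against it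
    because [r V] tends to 0. The geometry near infinity is used through three facts: [|dr| = 1],
    [r Lap r] tends to [n - 1], and [r Hess r] is asymptotic to the metric of the level sets of
    [r]. *)

Section Calculus.
Context {R : realType}.

Lemma is_derive_line (V : normedModType R) (f : V -> R) (y v : V) (t : R) :
  derivable f (y + t *: v) v ->
  is_derive t 1 (fun s => f (y + s *: v)) ('D_v f (y + t *: v)).
Proof.
move=> df.
have e : (fun h : R => h^-1 *: (((fun s => f (y + s *: v)) \o shift t) (h *: (1:R)) - f (y + t *: v)))
  = (fun h : R => h^-1 *: ((f \o shift (y + t *: v)) (h *: v) - f (y + t *: v))).
  apply/funext => h /=; congr (_ *: (f _ - _)).
  by rewrite scalerDl [h *: 1]mulr1 addrCA.
split; first by rewrite /derivable e.
by rewrite /derive e.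
Qed.

Lemma derivable_line_iff (V : normedModType R) (f : V -> R) (x v : V) (l : R) :
  is_derive (0:R) 1 (fun s => f (x + s *: v)) l -> is_derive x v f l.
Proof.
have e : (fun h : R => h^-1 *: (((fun s => f (x + s *: v)) \o shift 0) (h *: (1:R)) - f (x + 0 *: v)))
  = (fun h : R => h^-1 *: ((f \o shift x) (h *: v) - f x)).
  apply/funext => h /=; rewrite scale0r !addr0; congr (_ *: (f _ - _)).
  by rewrite [h *: 1]mulr1 addrC.
move=> [d1 d2]; split.
  by move: d1; rewrite /derivable e.
by move: d2; rewrite /derive e.
Qed.

(** Only the derivative of [f] along [v] enters: the rule is the one-variable chain rule on the line
    through [x] in the direction [v]. *)
Lemma is_derive_comp1 (V : normedModType R) (F : R -> R) (f : V -> R) (x v : V) (F' : R) :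
  is_derive (f x) 1 F F' -> derivable f x v ->
  is_derive x v (F \o f) (F' * 'D_v f x).
Proof.
move=> [dF <-] df.
apply: derivable_line_iff.
have df0 : derivable f (x + 0 *: v) v by rewrite scale0r addr0.
have [g1 g2] := is_derive_line df0.
have dg : differentiable (fun s : R => f (x + s *: v)) 0 by apply/derivable1_diffP.
have dF0 : differentiable F (f (x + 0 *: v)).
  rewrite scale0r addr0; exact: (derivable1_diffP F (f x)).1 dF.
have dFg : differentiable (F \o (fun s : R => f (x + s *: v))) 0.
  exact: differentiable_comp.
split; first exact/derivable1_diffP.
rewrite -[fun s => _]/(F \o (fun s : R => f (x + s *: v))) deriveE//.
rewrite (diff_comp dg dF0) /=.
have E c : 'd F (f (x + 0 *: v)) c = c * 'd F (f (x + 0 *: v)) 1.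
  by rewrite -[c in LHS]mulr1 -[c * 1]/(c *: (1 : R)) linearZ.
rewrite E; apply: etrans (congr2 *%R (esym (deriveE _ dg)) (esym (deriveE _ dF0))) _.
by rewrite g2 mulrC scale0r addr0.
Qed.

Lemma MVT_bound (g : R -> R) (dg : R -> R) (a e : R) :
  (forall s : R, 0 <= s <= 1 -> is_derive s 1 g (dg s)) ->
  (forall s : R, 0 <= s <= 1 -> `|dg s - a| <= e) ->
  `|g 1 - g 0 - a| <= e.
Proof.
move=> Hd Hb.
have [|||c] := @MVT _ g dg 0 1.
- exact: ltr01.
- by move=> s; rewrite in_itv /= => /andP[/ltW ? /ltW ?]; apply: Hd; apply/andP.
- apply: derivable_within_continuous => s; rewrite in_itv /= => /Hd.
  by case.
rewrite in_itv /= => /andP[c0 c1] ->.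
by rewrite subr0 mulr1; apply: Hb; rewrite !ltW.
Qed.

(** Corners of the path from 0 to [h] that moves along one coordinate at a time. *)
Definition hyb n (j : nat) (h : 'rV[R]_n) : 'rV[R]_n :=
  \row_i (if (i < j)%N then h 0 i else 0).

Lemma mx_norm_le m n (x : 'M[R]_(m, n)) (e : R) :
  0 <= e -> (forall i j, `|x i j| <= e) -> `|x| <= e.
Proof.
move=> e0 H; by rewrite [`|x|]mx_normrE; apply/bigmax_leP; split=> // -[i j] _; exact: H.
Qed.

Lemma coord_le_norm m n (x : 'M[R]_(m, n)) i j : `|x i j| <= `|x|.
Proof.
rewrite [leRHS]mx_normrE.
exact: (@le_bigmax _ _ _ 0 (fun ij => `|x ij.1 ij.2|) (i, j)).
Qed.

Lemma hyb_step_norm n (j : 'I_n) (h : 'rV[R]_n) s : 0 <= s <= 1 ->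
  `|hyb j h + s *: (h 0 j *: delta_mx 0 j)| <= `|h|.
Proof.
move=> /andP[s0 s1]; apply: mx_norm_le => // i k; rewrite !mxE ord1 eqxx /=.
have [->|kj] := eqVneq k j.
  rewrite ltnn add0r mulr1 normrM ger0_norm //.
  by apply: le_trans (coord_le_norm h 0 j); apply: ler_piMl.
by rewrite !mulr0 addr0; case: ifP => _; rewrite ?normr0 ?normr_ge0 ?coord_le_norm.
Qed.

Lemma hybS n (j : 'I_n) (h : 'rV[R]_n) :
  hyb j.+1 h = hyb j h + 1 *: (h 0 j *: delta_mx 0 j).
Proof.
apply/rowP => k; rewrite !mxE eqxx /= mul1r ltnS leq_eqVlt.
have [->|kj] := eqVneq k j; first by rewrite eqxx ltnn /= mulr1 add0r.
have -> : ((k : nat) == j) = false by apply/negbTE.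
by rewrite /= mulr0 addr0.
Qed.

Lemma derive_scale_dir (V : normedModType R) (f : V -> R) (x v : V) (c : R) :
  derivable f x v -> is_derive x (c *: v) f (c * 'D_v f x).
Proof.
move=> df; apply: derivable_line_iff.
have df0 : derivable f (x + (c *: (0:R)) *: v) v by rewrite scaler0 scale0r addr0.
have := is_derive_line df0.
have -> : (fun s : R => f (x + s *: (c *: v))) =
   (fun s => f (x + s *: v)) \o (fun s => c *: s).
  by apply/funext => s /=; rewrite scalerA mulrC.
move=> H.
have dc : derivable (fun s : R => c *: s) 0 1 by apply: derivableZ; exact: derivable_id.
have := is_derive_comp1 H dc.
rewrite scaler0 scale0r addr0 deriveZ; last exact: derivable_id.
by rewrite derive_id [c *: 1]mulr1 [_ * c]mulrC.
Qed.

Section C1.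
Variable n : nat.
Implicit Types (f : 'rV[R]_n -> R) (x h : 'rV[R]_n) (U : set 'rV[R]_n).

(** Telescope the increment along the corners [hyb j h] and apply the mean value theorem on each
    edge, where the partial derivative is uniformly close to its value at [x]. *)
Lemma C1_estimate f x :
  (forall i, \forall y \near x, derivable f y (delta_mx 0 i)) ->
  (forall i, {for x, continuous (partial i f)}) ->
  forall e : R, 0 < e -> \forall h \near (0 : 'rV[R]_n),
    `|f (x + h) - f x - \sum_i partial i f x * h 0 i| <= e * `|h|.
Proof.
move=> dn cn e e0.
(* The denominator [n.+1] rather than [n] also covers dimension 0. *)
pose e' := e / (n.+1)%:R.
have e'0 : 0 < e' by rewrite divr_gt0.
have H i : \forall y \near x, derivable f y (delta_mx 0 i) /\
    `|partial i f y - partial i f x| <= e'.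
  near=> y; split; first by near: y; exact: dn.
  rewrite distrC; near: y.
  exact: (cvgrPdist_le _ _).1 (cn i) _ e'0.
have /nbhs_ballP[d /= d0 Hd] : \forall y \near x, forall i, derivable f y (delta_mx 0 i) /\
    `|partial i f y - partial i f x| <= e'.
  exact: (@filter_forall _ _ (fun i => [set y | derivable f y (delta_mx 0 i) /\
    `|partial i f y - partial i f x| <= e']) (nbhs x) _ H).
apply/nbhs_ballP; exists d => //= h; rewrite -ball_normE /= sub0r normrN => hd.
have tel : f (x + h) - f x = \sum_(j < n) (f (x + hyb j.+1 h) - f (x + hyb j h)).
  rewrite -(big_mkord xpredT (fun j => f (x + hyb j.+1 h) - f (x + hyb j h))).
  rewrite (telescope_sumr (fun j => f (x + hyb j h))) //.
  congr (f _ - f _); last first.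
    by rewrite -[LHS]addr0; congr (_ + _); apply/rowP => i; rewrite !mxE ltn0.
  by congr (_ + _); apply/rowP => i; rewrite !mxE ltn_ord.
rewrite tel -sumrB; apply: le_trans (ler_norm_sum _ _ _) _.
apply: (@le_trans _ _ (\sum_(i < n) e' * `|h|)); last first.
  rewrite sumr_const card_ord -mulrnAl; apply: ler_wpM2r => //.
  by rewrite /e' -mulr_natr mulrAC ler_pdivrMr // ler_pM2l // ler_nat.
apply: ler_sum => j _.
have inb s : 0 <= s <= 1 -> ball x d (x + hyb j h + s *: (h 0 j *: delta_mx 0 j)).
  move=> s01; rewrite -ball_normE /= -addrA opprD addNKr normrN.
  exact: le_lt_trans (hyb_step_norm _ _ s01) hd.
have -> : f (x + hyb j.+1 h) = (fun s : R => f (x + hyb j h + s *: (h 0 j *: delta_mx 0 j))) 1.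
  by rewrite /= hybS addrA.
have -> : f (x + hyb j h) = (fun s : R => f (x + hyb j h + s *: (h 0 j *: delta_mx 0 j))) 0.
  by rewrite /= scale0r addr0.
apply: (@MVT_bound (fun s : R => f (x + hyb j h + s *: (h 0 j *: delta_mx 0 j))) (fun s => h 0 j * partial j f (x + hyb j h + s *: (h 0 j *: delta_mx 0 j)))).
  move=> s s01; have [dv _] := Hd _ (inb _ s01) j.
  have D := derive_scale_dir (h 0 j) dv.
  have := is_derive_line (@ex_derive _ _ _ _ _ _ _ D).
  by rewrite (@derive_val _ _ _ _ _ _ _ D).
move=> s s01; have [_ dv] := Hd _ (inb _ s01) j.
rewrite [partial j f x * _]mulrC -mulrBr normrM mulrC.
by apply: ler_pM => //; exact: coord_le_norm.
Unshelve. all: by end_near. Qed.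

Definition lin_part (a : 'I_n -> R) (h : 'rV[R]_n) : R := \sum_i a i * h 0 i.

Lemma lin_part_linear a : linear (lin_part a).
Proof.
move=> c u v; rewrite /lin_part scaler_sumr -big_split /=; apply: eq_bigr => i _.
by rewrite !mxE [LHS]mulrDr mulrCA.
Qed.

HB.instance Definition _ a := GRing.isLinear.Build R 'rV[R]_n R _ (lin_part a) (lin_part_linear a).

Lemma lin_part_continuous a : continuous (lin_part a).
Proof.
move=> x; apply: differentiable_continuous.
rewrite (_ : lin_part a = \sum_i (fun h : 'rV[R]_n => a i *: h 0 i)); last first.
  by apply/funext => h; rewrite /lin_part fct_sumE.
by apply: differentiable_sum => i; apply: differentiableZ; exact: differentiable_coord.
Qed.

(** Bridge between [smooth_on], which speaks of coordinate derivatives only, and the Frechet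
    derivative on which the chain rule rests. *)
Lemma C1_diff f x :
  (forall i, \forall y \near x, derivable f y (delta_mx 0 i)) ->
  (forall i, {for x, continuous (partial i f)}) ->
  differentiable f x /\ forall h, 'd f x h = \sum_i partial i f x * h 0 i.
Proof.
move=> dn cn; have E := C1_estimate dn cn.
pose L := lin_part (fun i => partial i f x).
have Lo : (f : 'rV[R]_n -> R^o) \o shift x = cst (f x) + (L : 'rV[R]_n -> R^o) +o_ (0 : 'rV[R]_n) id.
  apply/eqaddoP => e e0; have := E e e0; apply: filterS => h /=.
  by rewrite !fctE /= [h + x]addrC opprD addrA.
have dL := diff_unique (@lin_part_continuous (fun i => partial i f x)) Lo.
split; last by move=> h; rewrite dL.
apply/diff_locallyP; rewrite dL; split => //; exact: lin_part_continuous.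
Qed.

Lemma chain_partial m (Phi : 'rV[R]_m -> 'rV[R]_n) f (x v : 'rV[R]_m) :
  differentiable f (Phi x) ->
  (forall k, derivable (fun y => Phi y 0 k) x v) ->
  is_derive x v (f \o Phi) (\sum_k partial k f (Phi x) * 'D_v (fun y => Phi y 0 k) x).
Proof.
move=> df dPhi.
pose g (s : R) := Phi (x + s *: v).
have dg : derivable g 0 1.
  apply/derivable_mxP => i j; rewrite (ord1 i).
  have /is_derive_line[] : derivable (fun y => Phi y 0 j) (x + 0 *: v) v.
    by rewrite scale0r addr0.
  by [].
have dgd : differentiable g 0 by apply/derivable1_diffP.
have g0 : g 0 = Phi x by rewrite /g scale0r addr0.
have dfg : differentiable (f \o g) 0 by apply: differentiable_comp => //; rewrite g0.
apply: derivable_line_iff; split; first exact/derivable1_diffP.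
have -> : (fun s => (f \o Phi) (x + s *: v)) = f \o g by [].
have dfg0 : differentiable f (g 0) by rewrite g0.
rewrite deriveE// (diff_comp dgd dfg0) /= -[X in 'd f _ X]deriveE // derive_mx // g0.
rewrite [X in 'd f _ X]row_sum_delta linear_sum; apply: eq_bigr => k _ /=.
rewrite linearZ /= -(deriveE (delta_mx 0 k) df) mulrC mxE; congr (_ * _).
have /is_derive_line[_] : derivable (fun y => Phi y 0 k) (x + 0 *: v) v.
  by rewrite scale0r addr0.
by rewrite /g scale0r addr0.
Qed.

(** Smoothness graded by the order of differentiation. Closure under sums, products and compositions
    goes by induction on the order, with the function generalised; the definition by sequences of
    partials has no such induction. *)
Fixpoint Ck (k : nat) U f : Prop :=
  (forall x, U x -> {for x, continuous f}) /\
  (if k is k'.+1 then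
     forall i, (forall x, U x -> derivable f x (delta_mx 0 i)) /\ Ck k' U (partial i f)
   else True).

Lemma smooth_on_partial U f i : smooth_on U f -> smooth_on U (partial i f).
Proof.
move=> H s x Ux; have := H (rcons s i) x Ux.
suff -> : partials (rcons s i) f = partials s (partial i f) by [].
by elim: s => //= j s ->.
Qed.

Lemma smooth_onP U f : smooth_on U f <-> forall k, Ck k U f.
Proof.
split.
  move=> H k; elim: k f H => [|k IH] f H /=.
    by split => // x Ux; have [] := H [::] x Ux.
  split; first by move=> x Ux; have [] := H [::] x Ux.
  move=> i; split; last exact/IH/smooth_on_partial.
  by move=> x Ux; have [_] := H [::] x Ux; apply.
move=> H s.
suff G : forall k, Ck k U (partials s f).
  move=> x Ux; have [/= c /(_ _)h] := G 1%N; split; first exact: c.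
  by move=> i; have [+ _] := h i; apply.
elim: s => //= i s IH k; by have [/= _ /(_ i)[]] := IH k.+1.
Qed.

Lemma open_near_eq U f (g : 'rV[R]_n -> R) x : open U -> U x ->
  (forall y, U y -> f y = g y) -> \near x, f x = g x.
Proof.
move=> oU Ux fg; have : \near x, U x by exact: open_nbhs_nbhs.
by apply: filterS => y /fg.
Qed.

Lemma near_eq_cont (T : topologicalType) (f g : T -> R) (x : T) : (\near x, f x = g x) ->
  {for x, continuous f} -> {for x, continuous g}.
Proof.
move=> fg cf; rewrite /prop_for /continuous_at -(nbhs_singleton fg).
exact/(cvg_trans _ cf)/near_eq_cvg.
Qed.

Lemma Ck_ext k U f (g : 'rV[R]_n -> R) : open U ->
  (forall y, U y -> f y = g y) -> Ck k U f -> Ck k U g.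
Proof.
move=> oU; elim: k f g => [|k IH] f g fg /= [c d].
  by split=> // x Ux; apply: near_eq_cont (c _ Ux); exact: open_near_eq fg.
split; first by move=> x Ux; apply: near_eq_cont (c _ Ux); exact: open_near_eq fg.
move=> i; have [d1 d2] := d i; split.
  move=> x Ux; apply: near_eq_derivable (d1 _ Ux); exact: open_near_eq fg.
apply: IH d2 => y Uy; apply: near_eq_derive; exact: open_near_eq fg.
Qed.

Lemma Ck_cont k U f x : Ck k U f -> U x -> {for x, continuous f}.
Proof. by case: k => [|k] /= [c _]; exact: c. Qed.

Lemma Ck_der k U f x i : Ck k.+1 U f -> U x -> derivable f x (delta_mx 0 i).
Proof. by move=> /= [_ /(_ i)[+ _]]; apply. Qed.

Lemma Ck_partial k U f i : Ck k.+1 U f -> Ck k U (partial i f).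
Proof. by move=> /= [_ /(_ i)[]]. Qed.

Lemma CkW k U f : Ck k.+1 U f -> Ck k U f.
Proof.
elim: k f => [|k IH] f /= [c d]; first by split.
split=> // i; have [d1 d2] := d i; split => //; exact: IH.
Qed.

Lemma Ck_diff k U f x : open U -> Ck k.+1 U f -> U x -> differentiable f x.
Proof.
move=> oU cf Ux; have [] := @C1_diff f x => //.
  move=> i; apply: (@filterS _ (nbhs x) _ U); last exact: open_nbhs_nbhs.
  by move=> y Uy; exact: Ck_der cf Uy.
by move=> i; apply: Ck_cont (Ck_partial i cf) Ux.
Qed.

Lemma Ck_cst k U (c : R) : Ck k U (cst c).
Proof.
elim: k c => [|k IH] c /=; first by split=> // x _; exact: cst_continuous.
split=> [x _|i]; first exact: cst_continuous.
split=> [x _|]; first exact: derivable_cst.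
rewrite (_ : partial i _ = cst 0); first exact: IH.
by apply/funext => x; rewrite /partial derive_cst.
Qed.

Lemma CkD k U f g : open U -> Ck k U f -> Ck k U g -> Ck k U (fun x => f x + g x).
Proof.
move=> oU; elim: k f g => [|k IH] f g cf cg.
  by split=> // x Ux; apply: (@continuousD _ _ _ f g); [exact: Ck_cont cf Ux|exact: Ck_cont cg Ux].
split.
  by move=> x Ux; apply: (@continuousD _ _ _ f g); [exact: Ck_cont cf Ux|exact: Ck_cont cg Ux].
move=> i; split.
  by move=> x Ux; apply: (@derivableD _ _ _ f g); [exact: Ck_der cf Ux|exact: Ck_der cg Ux].
apply: (@Ck_ext k U (fun x => partial i f x + partial i g x)) => //.
  move=> y Uy; rewrite /partial -(@deriveD _ _ _ f g) //; first exact: Ck_der cf Uy.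
  exact: Ck_der cg Uy.
by apply: IH; exact: Ck_partial.
Qed.

Lemma CkM k U f g : open U -> Ck k U f -> Ck k U g -> Ck k U (fun x => f x * g x).
Proof.
move=> oU; elim: k f g => [|k IH] f g cf cg.
  by split=> // x Ux; apply: (@continuousM _ _ f g); [exact: Ck_cont cf Ux|exact: Ck_cont cg Ux].
split.
  by move=> x Ux; apply: (@continuousM _ _ f g); [exact: Ck_cont cf Ux|exact: Ck_cont cg Ux].
move=> i; split.
  by move=> x Ux; apply: (@derivableM _ _ f g); [exact: Ck_der cf Ux|exact: Ck_der cg Ux].
apply: (@Ck_ext k U (fun x => f x * partial i g x + g x * partial i f x)) => //.
  move=> y Uy; rewrite /partial (@deriveM _ _ f g) //; first exact: Ck_der cf Uy.
  exact: Ck_der cg Uy.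
by apply: CkD => //; apply: IH => //; (exact: Ck_partial || exact: CkW).
Qed.

Lemma Ck_sum k U (I : Type) (r : seq I) (P : pred I) (F : I -> 'rV[R]_n -> R) : open U ->
  (forall i, P i -> Ck k U (F i)) -> Ck k U (fun x => \sum_(i <- r | P i) F i x).
Proof.
move=> oU H; elim: r => [|a r IH].
  rewrite (_ : (fun _ => _) = cst 0); first exact: Ck_cst.
  by apply/funext => x; rewrite big_nil.
case Pa : (P a).
  rewrite (_ : (fun _ => _) = (fun x => F a x + \sum_(i <- r | P i) F i x)).
    by apply: CkD => //; exact: H.
  by apply/funext => x; rewrite big_cons Pa.
rewrite (_ : (fun _ => _) = (fun x => \sum_(i <- r | P i) F i x)) //.
by apply/funext => x; rewrite big_cons Pa.
Qed.

Lemma Ck_prod k U (I : Type) (r : seq I) (P : pred I) (F : I -> 'rV[R]_n -> R) : open U ->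
  (forall i, P i -> Ck k U (F i)) -> Ck k U (fun x => \prod_(i <- r | P i) F i x).
Proof.
move=> oU H; elim: r => [|a r IH].
  rewrite (_ : (fun _ => _) = cst 1); first exact: Ck_cst.
  by apply/funext => x; rewrite big_nil.
case Pa : (P a).
  rewrite (_ : (fun _ => _) = (fun x => F a x * \prod_(i <- r | P i) F i x)).
    by apply: CkM => //; exact: H.
  by apply/funext => x; rewrite big_cons Pa.
rewrite (_ : (fun _ => _) = (fun x => \prod_(i <- r | P i) F i x)) //.
by apply/funext => x; rewrite big_cons Pa.
Qed.

Lemma Ck_coord k U (j : 'I_n) : Ck k U (fun x => x 0 j).
Proof.
case: k => [|k] /=; first by split => // x _; exact: coord_continuous.
split; first by move=> x _; exact: coord_continuous.
have dc (x : 'rV[R]_n) : differentiable (fun y : 'rV[R]_n => y 0 j) x by exact: differentiable_coord.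
move=> i; split; first by move=> x _; apply: diff_derivable.
rewrite (_ : partial i _ = cst ((j == i)%:R)); first exact: Ck_cst.
apply/funext => x; rewrite /partial /=.
apply: (@derive_val _ _ _ _ _ _ _ (_ : is_derive x (delta_mx 0 i) _ _)).
apply: derivable_line_iff.
rewrite (_ : (fun s : R => _) = (fun s => x 0 j + (j == i)%:R *: s)); last first.
  by apply/funext => s; rewrite !mxE eqxx /= mulrC.
rewrite -[X in is_derive _ _ _ X]add0r.
apply: is_deriveD.
by apply: is_derive_eq; rewrite [_ *: _]mulr1.
Qed.

End C1.

(** The tower of successive derivatives is part of the witness: for [expR], the inverse, the square
    root or [exp (-1/x)] it can be written down explicitly, and its tail witnesses smoothness of the
    derivative. *)
Definition smooth1 (I : set R) (F : R -> R) : Prop :=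
  exists2 T : nat -> R -> R, T 0%N = F &
    forall k x, I x -> is_derive x 1 (T k) (T k.+1 x).

Lemma smooth1_cont I F x : smooth1 I F -> I x -> {for x, continuous F}.
Proof.
move=> [T <- H] Ix; apply: differentiable_continuous; apply/derivable1_diffP.
by have [] := H 0%N x Ix.
Qed.

Lemma Ck_comp1 n k (U : set 'rV[R]_n) (I : set R) (F : R -> R) f : open U ->
  smooth1 I F -> (forall x, U x -> I (f x)) -> Ck k U f -> Ck k U (F \o f).
Proof.
move=> oU + UI; move=> sF.
have cc F' x : smooth1 I F' -> U x -> {for x, continuous f} -> {for x, continuous (F' \o f)}.
  move=> sF' Ux cf; apply: continuous_comp => //; apply: smooth1_cont sF' _; exact: UI.
elim: k F sF => [|k IH] F sF cf.
  by split=> // x Ux; apply: cc => //; exact: Ck_cont cf Ux.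
split; first by move=> x Ux; apply: cc => //; exact: Ck_cont cf Ux.
case: sF => T T0 HT.
have D x i : U x -> is_derive x (delta_mx 0 i) (F \o f) (T 1%N (f x) * partial i f x).
  move=> Ux; apply: is_derive_comp1; first by rewrite -T0; apply: HT; exact: UI.
  exact: Ck_der cf Ux.
move=> i; split; first by move=> x Ux; have [] := D x i Ux.
apply: (@Ck_ext _ k U (fun x => (T 1%N \o f) x * partial i f x)) => //.
  by move=> y Uy; have [_] := D y i Uy; rewrite /partial => ->.
apply: CkM => //; last exact: Ck_partial.
apply: IH; last exact: CkW.
by exists (fun k => T k.+1) => // j x Ix; exact: HT.
Qed.

(** The first derivatives of [f \o Phi] are sums of products of some [partial j f \o Phi] with
    smooth functions, so the induction on [k] runs over all smooth [f] at once. *)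
Lemma Ck_comp m n k (U : set 'rV[R]_m) (W : set 'rV[R]_n) (Phi : 'rV[R]_m -> 'rV[R]_n) f :
  open U -> open W -> (forall x, U x -> W (Phi x)) ->
  (forall j, smooth_on U (fun x => Phi x 0 j)) ->
  (forall x, U x -> {for x, continuous Phi}) ->
  smooth_on W f -> Ck k U (f \o Phi).
Proof.
move=> oU oW UW sPhi cPhi.
have cc f' x : smooth_on W f' -> U x -> {for x, continuous (f' \o Phi)}.
  move=> sf Ux; apply: continuous_comp; first exact: cPhi.
  by have [] := sf [::] _ (UW _ Ux).
elim: k f => [|k IH] f sf; first by split=> // x Ux; exact: cc.
split; first by move=> x Ux; exact: cc.
have D x i : U x -> is_derive x (delta_mx 0 i) (f \o Phi)
   (\sum_j partial j f (Phi x) * partial i (fun y => Phi y 0 j) x).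
  move=> Ux; apply: chain_partial.
    by apply: (@Ck_diff _ 0 W) => //; [exact: (smooth_onP _ _).1 sf 1%N|exact: UW].
  by move=> j; have [_] := sPhi j [::] x Ux; apply.
move=> i; split; first by move=> x Ux; have [] := D x i Ux.
apply: (@Ck_ext _ k U (fun x => \sum_j (partial j f \o Phi) x * partial i (fun y => Phi y 0 j) x)) => //.
  by move=> y Uy; have [_] := D y i Uy; rewrite /partial => ->.
apply: Ck_sum => // j _; apply: CkM => //; first exact/IH/smooth_on_partial.
exact: (smooth_onP _ _).1 (smooth_on_partial i (sPhi j)) k.
Qed.

End Calculus.

Section Smooth.
Context {R : realType}.

Section Schwarz.
Variable n : nat.
Implicit Types (f : 'rV[R]_n -> R) (x h : 'rV[R]_n) (U : set 'rV[R]_n).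

(** Mean value theorem twice, along [u] and then along [v]. The left-hand side is symmetric in [u]
    and [v] while the right-hand side is not, which yields the symmetry of second derivatives. *)
Lemma second_difference f x (u v : 'rV[R]_n) (e : R) : 0 < e ->
  (forall s t : R, 0 <= s <= e -> 0 <= t <= e -> derivable f (x + s *: u + t *: v) u /\
    derivable ('D_u f) (x + s *: u + t *: v) v) ->
  exists s t : R, [/\ 0 <= s <= e, 0 <= t <= e &
   f (x + e *: u + e *: v) - f (x + e *: u) - f (x + e *: v) + f x =
   'D_v ('D_u f) (x + s *: u + t *: v) * e * e].
Proof.
move=> e0 H.
have ee : 0 <= e <= e by rewrite lexx ltW.
have e00 : 0 <= (0 : R) <= e by rewrite lexx ltW.
pose phi (s : R) := f (x + s *: u + e *: v) - f (x + s *: u).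
have dphi (s : R) : 0 <= s <= e -> is_derive s 1 phi
    ('D_u f (x + s *: u + e *: v) - 'D_u f (x + s *: u)).
  move=> s01; apply: is_deriveB.
    have [d1 _] := H s e s01 ee.
    have d2 : derivable f (x + e *: v + s *: u) u by rewrite addrAC.
    have := is_derive_line d2; rewrite [x + e *: v + s *: u]addrAC.
    by under eq_fun do rewrite addrAC.
  have [d1 _] := H s 0 s01 e00; move: d1; rewrite scale0r addr0 => d1.
  exact: is_derive_line.
have [|||s] := @MVT _ phi (fun s => 'D_u f (x + s *: u + e *: v) - 'D_u f (x + s *: u)) 0 e.
- exact: e0.
- by move=> s; rewrite in_itv /= => /andP[/ltW ? /ltW ?]; apply: dphi; apply/andP.
- apply: derivable_within_continuous => s; rewrite in_itv /= => /dphi.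
  by case.
rewrite in_itv /= => /andP[/ltW s0 /ltW s1] E1.
have s01 : 0 <= s <= e by apply/andP.
pose psi (t : R) := 'D_u f (x + s *: u + t *: v).
have dpsi (t : R) : 0 <= t <= e -> is_derive t 1 psi ('D_v ('D_u f) (x + s *: u + t *: v)).
  by move=> t01; apply: is_derive_line; have [] := H s t s01 t01.
have [|||t] := @MVT _ psi (fun t => 'D_v ('D_u f) (x + s *: u + t *: v)) 0 e.
- exact: e0.
- by move=> t; rewrite in_itv /= => /andP[/ltW ? /ltW ?]; apply: dpsi; apply/andP.
- apply: derivable_within_continuous => t; rewrite in_itv /= => /dpsi.
  by case.
rewrite in_itv /= => /andP[/ltW t0 /ltW t1] E2.
exists s, t; split => //; first by apply/andP.
move: E1; rewrite /phi scale0r addr0 subr0 => E1.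
move: E2; rewrite /psi scale0r addr0 subr0 => E2.
by rewrite E2 in E1; rewrite -E1; ring.
Qed.

(** The second difference over a small square is [e^2] times either mixed derivative at some point
    of the square; both are continuous at [x]. *)
Lemma partialC U f i j x : open U -> Ck 2 U f -> U x ->
  partial i (partial j f) x = partial j (partial i f) x.
Proof.
move=> oU cf Ux; apply/eqP; rewrite -subr_eq0 -normr_eq0 eq_le normr_ge0 andbT; apply/ler_addgt0Pl => d d0; rewrite addr0.
have cij k l : {for x, continuous (partial k (partial l f))}.
  by apply: Ck_cont (_ : Ck 0 U _) Ux; do 2!apply: Ck_partial.
have d20 : 0 < d / 2 by rewrite divr_gt0.
have N k l : \forall y \near x, `|partial k (partial l f) x - partial k (partial l f) y| <= d / 2.
  exact: (cvgrPdist_le _ _).1 (cij k l) _ d20.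
have : \forall y \near x, [/\ U y, `|partial i (partial j f) x - partial i (partial j f) y| <= d / 2 &
   `|partial j (partial i f) x - partial j (partial i f) y| <= d / 2].
  apply: (@filterS _ (nbhs x) _ _ _ _ (filterI (open_nbhs_nbhs (conj oU Ux)) (filterI (N i j) (N j i)))).
  by move=> y [? [? ?]].
move=> /nbhs_ballP[r /= r0 Hr].
(* Points of the square are within [2 e < r] of [x]. *)
pose e := r / 4.
have e0 : 0 < e by rewrite divr_gt0.
have inb k l (s t : R) : 0 <= s <= e -> 0 <= t <= e ->
    ball x r (x + s *: (delta_mx 0 k : 'rV[R]_n) + t *: delta_mx 0 l).
  move=> /andP[s0 s1] /andP[t0 t1]; rewrite -ball_normE /= -addrA opprD addNKr normrN.
  have -> : r = e + e + e + e by rewrite /e; field.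
  apply: (@le_lt_trans _ _ (e + e)).
    apply: mx_norm_le => [|a b]; first by rewrite addr_ge0 // ltW.
    rewrite !mxE; apply: le_trans (ler_normD _ _) _.
    rewrite !normrM (ger0_norm s0) (ger0_norm t0).
    apply: lerD.
      by apply: le_trans s1; rewrite -[leRHS]mulr1 ler_wpM2l //; case: (_ && _); rewrite ?normr0 ?normr1.
    by apply: le_trans t1; rewrite -[leRHS]mulr1 ler_wpM2l //; case: (_ && _); rewrite ?normr0 ?normr1.
  by rewrite -addrA ltrDl addr_gt0.
have D k l (s t : R) : 0 <= s <= e -> 0 <= t <= e ->
   derivable f (x + s *: (delta_mx 0 k : 'rV[R]_n) + t *: delta_mx 0 l) (delta_mx 0 k) /\
   derivable ('D_(delta_mx 0 k) f) (x + s *: (delta_mx 0 k : 'rV[R]_n) + t *: delta_mx 0 l) (delta_mx 0 l).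
  move=> s01 t01; have [Uy _ _] := Hr _ (inb k l s t s01 t01).
  by split; [exact: Ck_der cf Uy | exact: Ck_der (Ck_partial k cf) Uy].
have [s [t [s1 t1 E]]] := second_difference e0 (D j i).
have [s' [t' [s1' t1' E']]] := second_difference e0 (D i j).
have EE : partial i (partial j f) (x + s *: delta_mx 0 j + t *: delta_mx 0 i) =
  partial j (partial i f) (x + s' *: delta_mx 0 i + t' *: delta_mx 0 j).
  have aux (a b A B : R) : a = A * e * e -> b = B * e * e -> a = b -> A = B.
    move=> -> -> AB; have en0 : e != 0 by rewrite gt_eqF.
    by have := congr1 (fun z => z / e / e) AB; rewrite !mulfK.
  apply: aux E E' _; rewrite [x + e *: delta_mx 0 i + e *: _]addrAC; ring.
have [_ A _] := Hr _ (inb j i s t s1 t1).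
have [_ _ B] := Hr _ (inb i j s' t' s1' t1').
have aux (P Q a b : R) : `|P - a| <= d / 2 -> `|Q - b| <= d / 2 -> a = b -> `|P - Q| <= d.
  move=> H1 H2 ab; rewrite (_ : P - Q = (P - a) - (Q - b)); last by rewrite ab; ring.
  by apply: le_trans (ler_normB _ _) _; rewrite [leRHS]splitr; exact: lerD.
exact: aux A B EE.
Qed.

End Schwarz.

Section SmoothOn.
Variable n : nat.
Implicit Types (f g : 'rV[R]_n -> R) (x h : 'rV[R]_n) (U : set 'rV[R]_n).

Lemma smooth_on_ext U f g : open U -> (forall y, U y -> f y = g y) ->
  smooth_on U f -> smooth_on U g.
Proof. by move=> oU fg /smooth_onP H; apply/smooth_onP => k; exact: Ck_ext (H k). Qed.

Lemma smooth_on_sub U U' f : U' `<=` U -> smooth_on U f -> smooth_on U' f.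
Proof. by move=> UU H s x /UU; exact: H. Qed.

Lemma smooth_on_loc U f : (forall x, U x -> exists W, [/\ W x & smooth_on W f]) ->
  smooth_on U f.
Proof. by move=> H s x /H [W [Wx sf]]; exact: sf. Qed.

Lemma smooth_on_cst U (c : R) : smooth_on U (fun=> c).
Proof. by apply/smooth_onP => k; exact: Ck_cst. Qed.

Lemma smooth_onD U f g : open U -> smooth_on U f -> smooth_on U g ->
  smooth_on U (fun x => f x + g x).
Proof.
by move=> oU /smooth_onP sf /smooth_onP sg; apply/smooth_onP => k; exact: CkD.
Qed.

Lemma smooth_onM U f g : open U -> smooth_on U f -> smooth_on U g ->
  smooth_on U (fun x => f x * g x).
Proof.
by move=> oU /smooth_onP sf /smooth_onP sg; apply/smooth_onP => k; exact: CkM.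
Qed.

Lemma smooth_on_sum U (I : Type) (r : seq I) (P : pred I) (F : I -> 'rV[R]_n -> R) : open U ->
  (forall i, P i -> smooth_on U (F i)) -> smooth_on U (fun x => \sum_(i <- r | P i) F i x).
Proof.
move=> oU H; apply/smooth_onP => k; apply: Ck_sum => // i Pi.
exact: (smooth_onP _ _).1 (H i Pi) k.
Qed.

Lemma smooth_on_prod U (I : Type) (r : seq I) (P : pred I) (F : I -> 'rV[R]_n -> R) : open U ->
  (forall i, P i -> smooth_on U (F i)) -> smooth_on U (fun x => \prod_(i <- r | P i) F i x).
Proof.
move=> oU H; apply/smooth_onP => k; apply: Ck_prod => // i Pi.
exact: (smooth_onP _ _).1 (H i Pi) k.
Qed.

Lemma smooth_on_coord U (j : 'I_n) : smooth_on U (fun x => x 0 j).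
Proof. by apply/smooth_onP => k; exact: Ck_coord. Qed.

Lemma smooth_on_comp1 U (I : set R) (F : R -> R) f : open U ->
  smooth1 I F -> (forall x, U x -> I (f x)) -> smooth_on U f -> smooth_on U (F \o f).
Proof.
move=> oU sF UI /smooth_onP sf; apply/smooth_onP => k; exact: Ck_comp1 sF UI (sf k).
Qed.

Lemma smooth_on_cont U f x : smooth_on U f -> U x -> {for x, continuous f}.
Proof. by move=> H Ux; have [] := H [::] x Ux. Qed.

Lemma smooth_on_der U f x i : smooth_on U f -> U x -> derivable f x (delta_mx 0 i).
Proof. by move=> H Ux; have [_] := H [::] x Ux; apply. Qed.

Lemma smooth_on_diff U f x : open U -> smooth_on U f -> U x -> differentiable f x.
Proof. by move=> oU /smooth_onP sf Ux; exact: Ck_diff (sf 1%N) Ux. Qed.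

Lemma smooth_on_comp m (U : set 'rV[R]_m) (W : set 'rV[R]_n) (Phi : 'rV[R]_m -> 'rV[R]_n) f :
  open U -> open W -> (forall y, U y -> W (Phi y)) ->
  (forall j, smooth_on U (fun y => Phi y 0 j)) ->
  (forall y, U y -> {for y, continuous Phi}) ->
  smooth_on W f -> smooth_on U (f \o Phi).
Proof. by move=> *; apply/smooth_onP => k; exact: (@Ck_comp _ _ _ _ _ W). Qed.

End SmoothOn.

(** Functions of one variable are viewed as functions on row vectors of length 1, so that sums,
    products and compositions of [smooth1] functions are inherited from [smooth_on]. *)
Lemma smooth1_of_line (I : set R) (F : R -> R) :
  smooth_on [set x : 'rV[R]_1 | I (x 0 0)] (fun x => F (x 0 0)) -> smooth1 I F.
Proof.
move=> H.
have e0 (t : R) : (0 + t *: (delta_mx 0 0 : 'rV[R]_1)) 0 0 = t by rewrite !mxE /= add0r mulr1.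
exists (fun k t => partials (nseq k 0) (fun x : 'rV[R]_1 => F (x 0 0)) (0 + t *: delta_mx 0 0)).
  by apply/funext => t /=; rewrite e0.
move=> k t It; apply: is_derive_line.
have It' : I ((0 + t *: (delta_mx 0 0 : 'rV[R]_1)) 0 0) by rewrite e0.
by have [_] := H (nseq k 0) _ It'; apply.
Qed.

Lemma smooth1_line (I : set R) (F : R -> R) : open I -> smooth1 I F ->
  smooth_on [set x : 'rV[R]_1 | I (x 0 0)] (fun x => F (x 0 0)).
Proof.
move=> oI sF; apply: (@smooth_on_comp1 _ _ I F (fun x => x 0 0)) => //.
  by apply: (@open_comp _ _ (fun x : 'rV[R]_1 => x 0 0)) => // x _; exact: coord_continuous.
exact: smooth_on_coord.
Qed.

Lemma open_line (I : set R) : open I -> open [set x : 'rV[R]_1 | I (x 0 0)].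
Proof.
by move=> oI; apply: (@open_comp _ _ (fun x : 'rV[R]_1 => x 0 0)) => // x _; exact: coord_continuous.
Qed.

Lemma smooth1_cst I (c : R) : smooth1 I (fun=> c).
Proof.
exists (fun k => if k is 0%N then fun=> c else fun=> 0) => // -[|k] x _; exact: is_derive_cst.
Qed.

Lemma smooth1_id I : smooth1 I (fun x : R => x).
Proof.
exists (fun k => if k is k'.+1 then (if k' is 0%N then fun=> 1 else fun=> 0) else id) => //.
by move=> -[|[|k]] x _; first exact: is_derive_id; exact: is_derive_cst.
Qed.

Lemma smooth1D (I : set R) F G : open I -> smooth1 I F -> smooth1 I G ->
  smooth1 I (fun x => F x + G x).
Proof.
move=> oI sF sG; apply: smooth1_of_line.
by apply: smooth_onD; [exact: open_line|exact: smooth1_line|exact: smooth1_line].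
Qed.

Lemma smooth1M (I : set R) F G : open I -> smooth1 I F -> smooth1 I G ->
  smooth1 I (fun x => F x * G x).
Proof.
move=> oI sF sG; apply: smooth1_of_line.
by apply: smooth_onM; [exact: open_line|exact: smooth1_line|exact: smooth1_line].
Qed.

Lemma smooth1_comp (I J : set R) F G : open I -> open J -> (forall x, I x -> J (G x)) ->
  smooth1 J F -> smooth1 I G -> smooth1 I (fun x => F (G x)).
Proof.
move=> oI oJ IJ sF sG; apply: smooth1_of_line.
apply: (@smooth_on_comp1 _ _ J F (fun x => G (x 0 0))) => //; first exact: open_line.
  by move=> x; exact: IJ.
exact: smooth1_line.
Qed.

Lemma smooth1_sub (I J : set R) F : J `<=` I -> smooth1 I F -> smooth1 J F.
Proof. by move=> JI [T T0 H]; exists T => // k x /JI; exact: H. Qed.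

Lemma smooth1_expR I : smooth1 I (@expR R).
Proof. by exists (fun=> expR) => // k x _; exact: is_derive_expR. Qed.

Lemma is_derive_near (V : normedModType R) (f g : V -> R) (x v : V) (df : R) :
  (\near x, f x = g x) -> is_derive x v f df -> is_derive x v g df.
Proof. by move=> fg H; exact: near_eq_is_derive fg H. Qed.

Lemma is_deriveMf (V : normedModType R) (f g : V -> R) x v df dg :
  is_derive x v f df -> is_derive x v g dg ->
  is_derive x v (fun y => f y * g y) (f x * dg + g x * df).
Proof. by move=> Hf Hg; have := is_deriveM Hf Hg. Qed.

Lemma is_deriveDf (V : normedModType R) (f g : V -> R) x v df dg :
  is_derive x v f df -> is_derive x v g dg ->
  is_derive x v (fun y => f y + g y) (df + dg).
Proof. by move=> Hf Hg; have := is_deriveD Hf Hg. Qed.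

Lemma is_deriveCf (V : normedModType R) (f : V -> R) x v df (c : R) :
  is_derive x v f df -> is_derive x v (fun y => c * f y) (c * df).
Proof.
move=> Hf; have := is_deriveMf (is_derive_cst c x v) Hf.
by rewrite mulr0 addr0.
Qed.

Lemma is_deriveXf (V : normedModType R) (f : V -> R) x v df k :
  is_derive x v f df -> is_derive x v (fun y => f y ^+ k) (k%:R * f x ^+ k.-1 * df).
Proof.
move=> Hf; elim: k => [|k IH].
  by rewrite !mul0r; under eq_fun do rewrite expr0; exact: is_derive_cst.
have := is_deriveMf Hf IH.
under eq_fun do rewrite -exprS.
rewrite (_ : _ + _ = k.+1%:R * f x ^+ k.+1.-1 * df) //.
case: k {IH} => [|k]; first by rewrite /=; ring.
rewrite /= exprS -(natr1 k.+1); ring.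
Qed.

Lemma is_deriveVf (V : normedModType R) (f : V -> R) x v df : f x != 0 ->
  is_derive x v f df -> is_derive x v (fun y => (f y)^-1) (- (f x)^-1 ^+ 2 * df).
Proof.
move=> f0 Hf; have H : is_derive (f x) 1 (fun y : R => y^-1) (- (f x) ^- 2 *: 1).
  exact: (@is_deriveV _ id (f x) 1 1).
have := is_derive_comp1 H (@ex_derive _ _ _ _ _ _ _ Hf).
by rewrite (@derive_val _ _ _ _ _ _ _ Hf) [_ *: 1]mulr1 exprVn.
Qed.

Lemma is_derive_eqf (V : normedModType R) (f : V -> R) x v df dg :
  is_derive x v f df -> df = dg -> is_derive x v f dg.
Proof. by move=> H <-. Qed.

Lemma is_derive_compf (V : normedModType R) (F : R -> R) (f : V -> R) (x v : V) (F' df : R) :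
  is_derive (f x) 1 F F' -> is_derive x v f df ->
  is_derive x v (fun y => F (f y)) (F' * df).
Proof.
move=> HF Hf; have := is_derive_comp1 HF (@ex_derive _ _ _ _ _ _ _ Hf).
by rewrite (@derive_val _ _ _ _ _ _ _ Hf).
Qed.

Lemma is_deriveNf (V : normedModType R) (f : V -> R) x v df :
  is_derive x v f df -> is_derive x v (fun y => - f y) (- df).
Proof.
move=> Hf; have := is_deriveCf (-1) Hf.
by under eq_fun do rewrite mulN1r; rewrite mulN1r.
Qed.

Lemma is_deriveBf (V : normedModType R) (f g : V -> R) x v df dg :
  is_derive x v f df -> is_derive x v g dg ->
  is_derive x v (fun y => f y - g y) (df - dg).
Proof. by move=> Hf Hg; apply: is_deriveDf => //; exact: is_deriveNf. Qed.

Lemma smooth1_inv : smooth1 [set x : R | x != 0] (fun x => x^-1).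
Proof.
exists (fun k x => (-1) ^+ k * k`!%:R * (x^-1) ^+ k.+1).
  by apply/funext => x; rewrite expr0 mul1r expr1 fact0 mul1r.
move=> k x /= x0.
apply: is_derive_eqf.
  by apply: is_deriveCf; apply: is_deriveXf; apply: is_deriveVf => //; exact: is_derive_id.
by rewrite factS natrM /= !exprS; ring.
Qed.

Lemma smooth1_sqrt : smooth1 [set x : R | 0 < x] (@Num.sqrt R).
Proof.
(* Falling factorial of 1/2: the k-th derivative of the square root is [c k] times the power of
   exponent [1/2 - k]. *)
pose c k : R := \prod_(i < k) (2^-1 - i%:R).
exists (fun k x => c k * (Num.sqrt x * (x^-1) ^+ k)).
  by apply/funext => x; rewrite /c big_ord0 mul1r expr0 mulr1.
move=> k x /= x0.
have x1 : x != 0 by rewrite gt_eqF.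
have H2 := is_derive1_sqrt x0.
apply: is_derive_eqf.
  apply: is_deriveCf; apply: (is_deriveMf H2).
  by apply: is_deriveXf; apply: is_deriveVf.
have s2 : Num.sqrt x ^+ 2 = x by rewrite sqr_sqrtr // ltW.
have s0 : Num.sqrt x != 0 by rewrite gt_eqF // sqrtr_gt0.
rewrite /c big_ord_recr /= -/(c k).
have -> : (2 * Num.sqrt x)^-1 = 2^-1 * Num.sqrt x * x^-1.
  by rewrite -[in x^-1]s2; field.
case: k => [|k]; first by rewrite !expr0 expr1 mulr0n /=; ring.
by rewrite /= !exprS -natr1; ring.
Qed.

Lemma open_neq0 : open [set x : R | x != 0].
Proof.
rewrite (_ : mkset _ = ~` [set 0]); first by apply: closed_openC; exact: closed_eq.
by apply/seteqP; split=> x /= /eqP.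
Qed.

Lemma smooth_onV n (U : set 'rV[R]_n) f : open U -> smooth_on U f ->
  (forall x, U x -> f x != 0) -> smooth_on U (fun x => (f x)^-1).
Proof. by move=> oU sf f0; exact: smooth_on_comp1 smooth1_inv f0 sf. Qed.

Lemma smooth_on_sqrt n (U : set 'rV[R]_n) f : open U -> smooth_on U f ->
  (forall x, U x -> 0 < f x) -> smooth_on U (fun x => Num.sqrt (f x)).
Proof. by move=> oU sf f0; exact: smooth_on_comp1 smooth1_sqrt f0 sf. Qed.

Lemma smooth_on_det n m (U : set 'rV[R]_n) (A : 'rV[R]_n -> 'M[R]_m) : open U ->
  (forall i j, smooth_on U (fun x => A x i j)) -> smooth_on U (fun x => \det (A x)).
Proof.
move=> oU sA; apply: smooth_on_sum => // s _; apply: smooth_onM => //.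
  exact: smooth_on_cst.
by apply: smooth_on_prod.
Qed.

Lemma smooth_on_inv n m (U : set 'rV[R]_n) (A : 'rV[R]_n -> 'M[R]_m) i j : open U ->
  (forall i j, smooth_on U (fun x => A x i j)) ->
  (forall x, U x -> \det (A x) != 0) -> smooth_on U (fun x => invmx (A x) i j).
Proof.
move=> oU sA dA.
apply: (@smooth_on_ext _ _ (fun x => (\det (A x))^-1 * cofactor (A x) j i)) => //.
  by move=> y Uy; rewrite /invmx unitmxE unitfE dA // !mxE.
apply: smooth_onM => //.
  by apply: smooth_onV => //; exact: smooth_on_det.
rewrite /cofactor; apply: smooth_onM => //; first exact: smooth_on_cst.
apply: smooth_on_det => // a b.
rewrite (_ : (fun _ => _) = (fun x => A x (lift j a) (lift i b))) //.
by apply/funext => x; rewrite !mxE.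
Qed.

(* [x |-> exp (-1/x)] and its derivatives are [P(1/x) exp(-1/x)], [P] a polynomial. *)
Definition flat (p : {poly R}) (x : R) : R :=
  if 0 < x then p.[x^-1] * expR (- x^-1) else 0.

(** With [y = 1/x] one has [d/dx = - y^2 d/dy], which turns [p(y) exp(-y)] into
    [y^2 (p - p')(y) exp(-y)]. *)
Definition flat_next (p : {poly R}) : {poly R} := 'X^2 * (p - p^`()).

Lemma monomial_exp_bound k (y : R) : 0 <= y -> y ^+ k * expR (- y) <= k`!%:R.
Proof.
move=> y0; rewrite expRN ler_pdivrMr ?expR_gt0 //.
case: k => [|k]; first by rewrite expr0 fact0 mul1r -[leLHS]addr0 (le_trans _ (expR_ge1Dx y)) // lerD2l.
have := expR_ge1Dxn k y0 => H.
rewrite mulrC -ler_pdivrMr ?ltr0n ?fact_gt0 //; apply: le_trans H.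
by rewrite lerDr.
Qed.

Lemma poly_exp_bound (p : {poly R}) : exists2 C : R, 0 <= C & forall y : R, 0 <= y ->
  `|p.[y]| * expR (- y) <= C.
Proof.
exists (\sum_(i < size p) `|p`_i| * i`!%:R); first by apply: sumr_ge0 => i _; rewrite mulr_ge0.
move=> y y0; rewrite horner_coef.
apply: (@le_trans _ _ ((\sum_(i < size p) `|p`_i * y ^+ i|) * expR (- y))).
  by rewrite ler_wpM2r ?expR_ge0 // ler_norm_sum.
rewrite mulr_suml; apply: ler_sum => i _.
rewrite normrM -mulrA ler_wpM2l // ger0_norm ?exprn_ge0 //; exact: monomial_exp_bound.
Qed.

Lemma is_derive0_quadratic (F : R -> R) (C : R) : F 0 = 0 ->
  (forall h, `|F h| <= C * h ^+ 2) -> is_derive (0 : R) 1 F 0.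
Proof.
move=> F0 HF.
have C0 : 0 <= C.
  by have := HF 1; rewrite expr1n mulr1; apply: le_trans.
have L : (fun h : R => h^-1 *: ((F \o shift 0) (h *: (1 : R)) - F 0)) @ 0^' --> (0 : R).
  apply/cvgrPdist_le => e e0; near=> h.
  rewrite sub0r normrN F0 subr0 /= addr0 [h *: 1]mulr1 normrM normfV.
  have h0 : 0 < `|h| by rewrite normr_gt0; near: h; exact: nbhs_dnbhs_neq.
  rewrite mulrC ler_pdivrMr //; apply: le_trans (HF h) _.
  rewrite -normr_id -[h ^+ 2]real_normK ?num_real // expr2 mulrA normr_id ler_wpM2r //.
  have : `|h| < e / (C + 1).
    near: h; apply: dnbhs0_lt; rewrite divr_gt0 // ltr_wpDl //.
  rewrite ltr_pdivlMr ?ltr_wpDl // => H; apply: le_trans (ltW H).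
  by rewrite mulrC ler_wpM2l // lerDl.
split; first by apply/cvg_ex; exists 0.
exact: cvg_lim L.
Unshelve. all: by end_near. Qed.

Lemma flat_derive p (x : R) : is_derive x 1 (flat p) (flat (flat_next p) x).
Proof.
have [x0|x0|->] := ltgtP x 0.
- have -> : flat (flat_next p) x = 0 by rewrite /flat ltNge ltW.
  apply: (is_derive_near _ (is_derive_cst 0 x 1)).
  apply: (@filterS _ (nbhs x) _ _ _ _ (lt_nbhsl x0)).
  by move=> y y0; rewrite /flat ltNge ltW.
- rewrite {2}/flat x0.

  have H : is_derive x 1 (fun y : R => y^-1) (- x^-1 ^+ 2 * 1).
    by apply: is_deriveVf; rewrite gt_eqF.
  have H1 := is_derive_compf (is_derive_poly p x^-1) H.
  have H2 := @is_derive_compf _ expR (fun y : R => - y^-1) x 1 _ _ (is_derive_expR (- x^-1)) (is_deriveNf H).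
  apply: is_derive_near (is_derive_eqf (is_deriveMf H1 H2) _).
    apply: (@filterS _ (nbhs x) _ _ _ _ (lt_nbhsr x0)).
    by move=> y y0; rewrite /flat y0.
  by rewrite /flat_next !hornerE /=; ring.
- have -> : flat (flat_next p) 0 = 0 by rewrite /flat ltxx.
  (* The factor [y^2] with [y = 1/h] makes the bound on [flat p h] quadratic in [h], hence the
     derivative at 0 vanishes. *)
  have [C C0 HC] := poly_exp_bound ('X^2 * p).
  apply: (@is_derive0_quadratic _ C); first by rewrite /flat ltxx.
  move=> h; rewrite /flat; case: ifPn => [h0|_]; last by rewrite normr0 mulr_ge0 // sqr_ge0.
  have hV : 0 <= h^-1 by rewrite invr_ge0 ltW.
  have := HC _ hV; rewrite hornerM hornerXn normrM normrX ger0_norm // normrM.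
  rewrite (ger0_norm (expR_ge0 _)) exprVn -mulrA mulrC ler_pdivrMr ?exprn_gt0 //.
Qed.

Lemma smooth1_flat I p : smooth1 I (flat p).
Proof.
exists (fun k => flat (iter k flat_next p)) => // k x _; exact: flat_derive.
Qed.

(** The denominator never vanishes, since [x] and [1 - x] are not both nonpositive. The values are 0
    up to 0 and 1 from 1 on; all cutoffs of the proof are built from this function. *)
Definition step (x : R) : R := flat 1 x / (flat 1 x + flat 1 (1 - x)).

Lemma flat1_ge0 x : 0 <= flat 1 x.
Proof. by rewrite /flat; case: ifP => // _; rewrite hornerC mul1r expR_ge0. Qed.

Lemma flat1_gt0 x : 0 < x -> 0 < flat 1 x.
Proof. by rewrite /flat => ->; rewrite hornerC mul1r expR_gt0. Qed.

Lemma flat1_le0 x : x <= 0 -> flat 1 x = 0.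
Proof. by move=> x0; rewrite /flat ltNge x0. Qed.

Lemma step_den x : 0 < flat 1 x + flat 1 (1 - x).
Proof.
have [x0|x0] := ltP 0 x; first by rewrite ltr_pwDl ?flat1_gt0 ?flat1_ge0.
by rewrite ltr_wpDl ?flat1_ge0 // flat1_gt0 // subr_gt0 (le_lt_trans x0).
Qed.

Lemma step_ge0 x : 0 <= step x.
Proof. by rewrite divr_ge0 ?flat1_ge0 // ltW // step_den. Qed.

Lemma step_le1 x : step x <= 1.
Proof. by rewrite ler_pdivrMr ?step_den // mul1r lerDl flat1_ge0. Qed.

Lemma step0 x : x <= 0 -> step x = 0.
Proof. by move=> x0; rewrite /step flat1_le0 // mul0r. Qed.

Lemma step1 x : 1 <= x -> step x = 1.
Proof.
move=> x1; have H : 0 < x := lt_le_trans ltr01 x1.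
by rewrite /step (@flat1_le0 (1 - x)) ?subr_le0 // addr0 divff // gt_eqF // flat1_gt0.
Qed.

Lemma smooth1_step : smooth1 setT step.
Proof.
have oT : open [set: R] by exact: openT.
apply: smooth1M => //; first exact: smooth1_flat.
apply: (@smooth1_comp _ [set x : R | x != 0] (fun x => x^-1)).
- exact: oT.
- exact: open_neq0.
- by move=> x _ /=; rewrite gt_eqF // step_den.
- exact: smooth1_inv.
apply: smooth1D => //; first exact: smooth1_flat.
apply: (@smooth1_comp _ setT (flat 1) (fun x => 1 - x)) => //; first exact: smooth1_flat.
apply: smooth1D => //; first exact: smooth1_cst.
rewrite (_ : -%R = (fun x : R => -1 * x)); last by apply/funext => x; rewrite mulN1r.
by apply: smooth1M => //; [exact: smooth1_cst|exact: smooth1_id].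
Qed.

End Smooth.

(** * Lebesgue measure and integration by parts *)

Section BorelSpace.
Context {R : realType}.

(** For a manifold this alias is convertible with [borel], so one set of lemmas on continuous
    functions serves both manifolds and Euclidean spaces. *)
Definition bspace (T : ptopologicalType) : Type := g_sigma_algebraType (@open T).
HB.instance Definition _ (T : ptopologicalType) := Measurable.on (bspace T).

Lemma bspace_open (T : ptopologicalType) (U : set T) : open U -> measurable (U : set (bspace T)).
Proof. by move=> oU; exact: sub_sigma_algebra. Qed.

Lemma bspace_closed (T : ptopologicalType) (U : set T) : closed U -> measurable (U : set (bspace T)).
Proof. by move=> cU; rewrite -[U]setCK; apply: measurableC; apply: bspace_open; exact: closed_openC. Qed.

Lemma open_restrict_preimage (T T' : topologicalType) (U : set T) (f : T -> T') (W : set T') :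
  open U -> (forall x, U x -> {for x, continuous f}) -> open W -> open (U `&` f @^-1` W).
Proof.
move=> oU cf oW; rewrite openE => x [Ux Wx].
apply: filterI; first exact: open_nbhs_nbhs.
by apply: (cf x Ux); exact: open_nbhs_nbhs.
Qed.

Lemma cont_measurable (T T' : ptopologicalType) (U : set T) (f : T -> T') : open U ->
  (forall x, U x -> {for x, continuous f}) ->
  measurable_fun (U : set (bspace T)) (f : bspace T -> bspace T').
Proof.
move=> oU cf; apply: (@measurability _ _ (bspace T) (bspace T') U f (@open T') erefl) => _ [W oW <-].
by apply: bspace_open; exact: open_restrict_preimage.
Qed.

Lemma cont_measurableR (T : ptopologicalType) (U : set T) (f : T -> R) : open U ->
  (forall x, U x -> {for x, continuous f}) ->
  measurable_fun (U : set (bspace T)) (f : bspace T -> R).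
Proof.
move=> oU cf; apply: (measurability _ (RGenOpens.measurableE R)) => _ [_ [a [b ->]] <-].
by apply: bspace_open; apply: open_restrict_preimage => //; exact: interval_open.
Qed.

Definition eucl n : Type := bspace 'rV[R]_n.
HB.instance Definition _ n := Measurable.on (eucl n).

Definition cons_pair n (p : measurableTypeR R * eucl n) : eucl n.+1 := cons_coord p.1 p.2.
Definition uncons n (x : eucl n.+1) : measurableTypeR R * eucl n :=
  ((x : 'rV[R]_n.+1) 0 0, rsubmx (x : 'rV[R]_(1 + n))).

Lemma cons_coord0 n (t : R) (y : 'rV[R]_n) : cons_coord t y 0 0 = t.
Proof.
rewrite /cons_coord (_ : 0 = lshift n 0 :> 'I_(1 + n)); last exact: val_inj.
by rewrite (@row_mxEl _ 1 1 n) mxE eqxx.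
Qed.

Lemma cons_coordS n (t : R) (y : 'rV[R]_n) (i : 'I_n) : cons_coord t y 0 (lift ord0 i) = y 0 i.
Proof.
rewrite /cons_coord (_ : lift ord0 i = rshift 1 i :> 'I_(1 + n)); last exact: val_inj.
by rewrite (@row_mxEr _ 1 1 n).
Qed.

Lemma cons_pairK n : cancel (@cons_pair n) (@uncons n).
Proof.
move=> [t y]; rewrite /uncons /cons_pair cons_coord0 /=; congr (_, _).
by rewrite /cons_coord row_mxKr.
Qed.

Lemma cons_coord_uncons n (x : 'rV[R]_n.+1) : cons_coord (x 0 0) (rsubmx (x : 'rV[R]_(1 + n))) = x.
Proof.
apply/rowP => i; case: (unliftP ord0 i) => [j ->|->]; last by rewrite cons_coord0.
rewrite cons_coordS mxE; congr (x _ _); exact: val_inj.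
Qed.

Lemma cons_coord_line m (t : R) (y : 'rV[R]_m) : cons_coord t y = cons_coord 0 y + t *: delta_mx 0 0.
Proof.
apply/rowP => i; case: (unliftP ord0 i) => [j ->|->].
  have := cons_coordS t y j; have := cons_coordS 0 y j.
  by move: (cons_coord 0 y) (cons_coord t y) => u v uE vE; rewrite !mxE uE vE /= mulr0 addr0.
have := cons_coord0 t y; have := cons_coord0 0 y.
by move: (cons_coord 0 y) (cons_coord t y) => u v uE vE; rewrite !mxE uE vE /= add0r mulr1.
Qed.

Lemma cons_coord_dist n (t t' : R) (y y' : 'rV[R]_n) (e : R) : 0 <= e ->
  `|t - t'| <= e -> `|y - y'| <= e -> `|cons_coord t y - cons_coord t' y'| <= e.
Proof.
move=> e0 He Hy; apply: mx_norm_le => // i j; rewrite (ord1 i).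
have E (A B : 'rV[R]_n.+1) : (A - B) 0 j = A 0 j - B 0 j by rewrite !mxE.
rewrite E; case: (unliftP ord0 j) => [k ->|->]; last by rewrite !cons_coord0.
rewrite !cons_coordS; apply: le_trans Hy.
by have := coord_le_norm (y - y') 0 k; rewrite !mxE.
Qed.

(** The Borel sets of the product space have to lie in the product sigma-algebra; this rests on
    second countability: the preimage of an open set is a countable union of products of balls. *)
Lemma measurable_cons n : measurable_fun setT (@cons_pair n).
Proof.
apply: (@measurability _ _ (measurableTypeR R * eucl n)%type (eucl n.+1) setT _ (@open 'rV[R]_n.+1) erefl) => _ [W oW <-].
rewrite setTI.
pose box (i : rat * 'rV[rat]_n * nat) : set (measurableTypeR R * eucl n) :=
  (ball (ratr i.1.1 : R) i.2.+1%:R^-1) `*`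
  (ball (map_mx ratr i.1.2 : 'rV[R]_n) (i.2.+1%:R^-1 : R)).
(* Countable index: a rational centre together with a radius [1/(k+1)]; boxes not contained in the
   preimage are replaced by the empty set. *)
pose F i := if `[< box i `<=` @cons_pair n @^-1` W >] then box i else set0.
rewrite (_ : _ @^-1` _ = \bigcup_i F i).
  apply: countable_bigcupT_measurable => // i; rewrite /F; case: ifP => // _.
  apply: measurableX; first by apply: open_measurable; exact: ball_open.
  by apply: bspace_open; exact: ball_open.
apply/seteqP; split=> [[t y] /= Wty|z [i _]]; last first.
  by rewrite /F; case: ifPn => // /asboolP H /H.
have /nbhs_ballP[e /= e0 He] : nbhs (cons_coord t y) W by exact: open_nbhs_nbhs.
have [k Hk] : exists k : nat, k.+1%:R^-1 < e / 2.
  have /ltr_add_invr[k] : (0 : R) < e / 2 by rewrite divr_gt0.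
  by rewrite add0r => Hk; exists k.
have k0 : (0 : R) < k.+1%:R^-1 by rewrite invr_gt0.
have rat_near (s : R) : exists q : rat, `|s - ratr q| < k.+1%:R^-1.
  have : s - k.+1%:R^-1 < s + k.+1%:R^-1 by rewrite ltrBlDr -addrA ltrDl addr_gt0.
  move=> /rat_in_itvoo[q]; rewrite in_itv /= => /andP[a b]; exists q.
  by rewrite ltr_distlC; apply/andP.
have [q Hq] := rat_near t.
have /choice[v Hv] := fun i : 'I_n => rat_near (y 0 i).
have Hv' : `|y - map_mx ratr (\row_i v i)| < k.+1%:R^-1.
  rewrite [ltLHS]mx_normrE; apply/bigmax_ltP; split=> // -[i j] _ /=.
  by rewrite !mxE (ord1 i); exact: Hv.
exists (q, \row_i v i, k) => //; rewrite /F asboolT.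
  split; rewrite -ball_normE /=; first by rewrite distrC.
  by rewrite distrC.
move=> [t' y'] [/=]; rewrite -!ball_normE /= => H1 H2; apply: He; rewrite -ball_normE /=.
apply: le_lt_trans (_ : k.+1%:R^-1 + k.+1%:R^-1 < e); last by rewrite [ltRHS]splitr ltrD.
apply: cons_coord_dist; first by rewrite addr_ge0 // ltW.
  rewrite -(subrKA (ratr q)); apply: le_trans (ler_normD _ _) _.
  by apply: lerD; apply: ltW.
rewrite -(subrKA (map_mx ratr (\row_i v i))); apply: le_trans (ler_normD _ _) _.
by apply: lerD; apply: ltW.
Qed.

Lemma rsubmx_cont n : continuous (fun x : 'rV[R]_n.+1 => rsubmx (x : 'rV[R]_(1 + n)) : 'rV[R]_n).
Proof. by move=> x; apply: differentiable_continuous; exact: (@differentiable_rsubmx R 1 1 n). Qed.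

Lemma measurable_uncons n : measurable_fun setT (@uncons n).
Proof.
apply: measurable_fun_pair.
  by apply: (@cont_measurableR 'rV[R]_n.+1 setT) => [|x _]; [exact: openT|exact: coord_continuous].
by apply: (@cont_measurable 'rV[R]_n.+1 'rV[R]_n setT) => [|x _]; [exact: openT|exact: rsubmx_cont].
Qed.

HB.instance Definition _ n := isMeasurableFun.Build _ _ _ _ (@cons_pair n) (@measurable_cons n).

Section Cons.
Variable (n : nat) (m : {sigma_finite_measure set (eucl n) -> \bar R}).

(** Product of Lebesgue measure on the line with [m], carried to row vectors by prepending a
    coordinate. *)
Definition cons_measure : set (eucl n.+1) -> \bar R :=
  pushforward (@lebesgue_measure R \x m)%E (@cons_pair n).

Let cm0 : cons_measure set0 = 0%E.
Proof. by rewrite /cons_measure /pushforward preimage_set0 measure0. Qed.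

Let cm_ge0 A : (0 <= cons_measure A)%E.
Proof. by rewrite /cons_measure /pushforward; exact: measure_ge0. Qed.

Let cm_preimage A : measurable A -> measurable (@cons_pair n @^-1` A).
Proof. by move=> mA; rewrite -[X in measurable X]setTI; exact: measurable_cons. Qed.

Let cm_sigma_additive : semi_sigma_additive cons_measure.
Proof.
move=> F mF tF mUF; rewrite /cons_measure /pushforward preimage_bigcup.
apply: measure_semi_sigma_additive.
- by move=> k; exact: cm_preimage.
- apply/trivIsetP => /= i j _ _ ij; rewrite -preimage_setI.
  by move/trivIsetP : tF => /(_ _ _ _ _ ij) ->//; rewrite preimage_set0.
- by rewrite -preimage_bigcup; exact: cm_preimage.
Qed.

HB.instance Definition _ := isMeasure.Build _ _ _ cons_measure cm0 cm_ge0 cm_sigma_additive.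

Lemma cons_measure_sigma_finite : sigma_finite setT cons_measure.
Proof.
have [G GT HG] := sigma_finiteT m.
have [E ET HE] := sigma_finiteT (@lebesgue_measure R : {sigma_finite_measure set _ -> \bar R}).
pose P k : set (measurableTypeR R * eucl n) :=
  if @unpickle (nat * nat)%type k is Some ij then E ij.1 `*` G ij.2 else set0.
have PT : setT = \bigcup_k P k.
  apply/esym; rewrite -subTset => -[t y] _.
  have : [set: measurableTypeR R] t by []. rewrite ET => -[i _ Ei].
  have : [set: eucl n] y by []. rewrite GT => -[j _ Gj].
  by exists (pickle (i, j)) => //; rewrite /P pickleK.
have HP k : measurable (P k) /\ ((@lebesgue_measure R \x m) (P k) < +oo)%E.
  rewrite /P; case: unpickle => [[i j]|] /=; last by rewrite measure0; split.
  have [mE fE] := HE i; have [mG fG] := HG j; split; first exact: measurableX.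
  by rewrite product_measure1E // lte_mul_pinfty // ge0_fin_numE.
exists (fun k => @uncons n @^-1` (P k)).
  by rewrite -preimage_bigcup -PT preimage_setT.
move=> k; have [mP fP] := HP k; split.
  by rewrite -[X in measurable X]setTI; exact: measurable_uncons.
rewrite /cons_measure /pushforward -comp_preimage.
rewrite (_ : @uncons n \o @cons_pair n = id); last by apply/funext => z /=; rewrite cons_pairK.
by rewrite preimage_id.
Qed.

HB.instance Definition _ := Measure_isSigmaFinite.Build _ _ _ cons_measure cons_measure_sigma_finite.

Definition cons_sfm : {sigma_finite_measure set (eucl n.+1) -> \bar R} := cons_measure.

End Cons.

Definition dirac0 : {sigma_finite_measure set (eucl 0) -> \bar R} := \d_ (0 : eucl 0).

(** Follows the recursion of [lebesgue_int], down to the point mass in dimension 0, so that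
    Tonelli's theorem identifies the two integrals. *)
Fixpoint Leb n : {sigma_finite_measure set (eucl n) -> \bar R} :=
  if n is m.+1 then cons_sfm (Leb m) else dirac0.

Lemma Leb_tonelli n (f : eucl n.+1 -> \bar R) :
  measurable_fun [set: eucl n.+1] f -> (forall x, (0 <= f x)%E) ->
  (\int[Leb n.+1]_x f x = \int[@lebesgue_measure R]_t \int[Leb n]_y f (cons_coord t y))%E.
Proof.
move=> mf f0; rewrite /= /cons_sfm /cons_measure.
rewrite (ge0_integral_pushforward (@measurable_cons n)) //.
rewrite preimage_setT fubini_tonelli1 //.
  by apply: measurableT_comp => //; exact: measurable_cons.
by move=> x; exact: f0.
Qed.

Lemma measurable_section n (f : eucl n.+1 -> \bar R) (t : R) :
  measurable_fun [set: eucl n.+1] f -> measurable_fun [set: eucl n] (fun y : eucl n => f (cons_coord t y)).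
Proof.
move=> mf; apply: (measurableT_comp mf (_ : measurable_fun setT (fun y => cons_pair (t, y)))).
by apply: measurableT_comp; [exact: measurable_cons|exact: measurable_pair1].
Qed.

Lemma lebesgue_intE n (f : eucl n -> \bar R) :
  measurable_fun [set: eucl n] f -> (forall x, (0 <= f x)%E) -> lebesgue_int f = (\int[Leb n]_x f x)%E.
Proof.
elim: n f => [|n IH] f mf f0.
  by rewrite /= /dirac0 integral_dirac // diracE in_setT mul1e.
rewrite Leb_tonelli //=; apply: eq_integral => t _.
by apply: IH => //; exact: measurable_section.
Qed.

End BorelSpace.

(** * Transfer of integrals along a map with a density *)

Section DensityTransfer.
Context d1 d2 (X : measurableType d1) (Y : measurableType d2) (R : realType).
Variables (lam : {measure set X -> \bar R}) (mu : {measure set Y -> \bar R}).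
Variables (phi : X -> Y) (mphi : measurable_fun setT phi).
Variables (D : X -> R) (mD : measurable_fun setT D) (D0 : forall x, 0 <= D x).
Variables (U : set Y) (mU : measurable U).
Hypothesis muE : forall B, measurable B -> B `<=` U ->
  mu B = (\int[lam]_(x in phi @^-1` B) (D x)%:E)%E.
Local Open Scope ereal_scope.
Import HBNNSimple.

Let mpre B : measurable B -> measurable (phi @^-1` B).
Proof. by move=> mB; rewrite -[X in measurable X]setTI; exact: mphi. Qed.

(** Indicators are the hypothesis [muE]; simple functions follow by linearity and general
    nonnegative functions by monotone convergence on both sides. *)
Lemma ge0_integral_density (f : Y -> \bar R) :
  measurable_fun setT f -> (forall y, 0 <= f y) ->
  \int[mu]_(y in U) f y = \int[lam]_(x in phi @^-1` U) (f (phi x) * (D x)%:E).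
Proof.
move=> mf f0.
have mfU : measurable_fun U f by exact: measurable_funTS.
pose f_ := nnsfun_approx measurableT mf.
have cf y : ((f_ n y)%:E @[n --> \oo] --> f y)%E by apply: cvg_nnsfun_approx.
have mphiU := mpre mU.
transitivity (limn (fun n => \int[mu]_(x in U) (f_ n x)%:E)).
  rewrite -monotone_convergence//.
  - by apply: eq_integral => y _; apply/esym/cvg_lim.
  - by move=> n; apply/measurable_EFinP/measurable_funTS.
  - by move=> n y _; rewrite lee_fin.
  - by move=> y _ m n mn; rewrite lee_fin; exact/lefP/nd_nnsfun_approx.
have mDE : measurable_fun setT (EFin \o D) by exact/measurable_EFinP.
have mfphi n : measurable_fun setT (fun x => (f_ n (phi x))%:E).
  by apply/measurable_EFinP; apply: measurableT_comp => //; exact: mphi.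
rewrite [X in limn X](_ : _ =
    (fun n => \int[lam]_(x in phi @^-1` U) ((f_ n (phi x))%:E * (D x)%:E))).
  rewrite -monotone_convergence//.
  - apply: eq_integral => x _; apply/cvg_lim => //.
    by apply: cvgeZr => //; exact: cf.
  - move=> n; apply: measurable_funTS; apply: emeasurable_funM => //.
  - by move=> n x _; rewrite mule_ge0 ?lee_fin.
  - move=> x _ m n mn; rewrite lee_pmul ?lee_fin //.
    exact/lefP/nd_nnsfun_approx.
apply/funext => n.
have mk k : measurable (f_ n @^-1` [set k]) by [].
transitivity (\sum_(k \in range (f_ n)) (k%:E * mu (f_ n @^-1` [set k] `&` U))).
  under eq_integral do rewrite fimfunE -fsumEFin//.
  rewrite ge0_integral_fsum//; last 2 first.
  - by move=> y; apply: measurable_funTS; exact/measurable_EFinP/measurable_funM.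
  - by move=> y x _; rewrite nnfun_muleindic_ge0.
  by apply: eq_fsbigr => r _; rewrite integralZl_indic_nnsfun// integral_indic.
rewrite [RHS](_ : _ = \int[lam]_(x in phi @^-1` U)
   \sum_(k \in range (f_ n)) ((k * \1_(f_ n @^-1` [set k]) (phi x) * D x)%:E)); last first.
  apply: eq_integral => x _; rewrite fsumEFin// -EFinM; congr EFin.
  by rewrite [in LHS](fimfunE (f_ n)) mulr_fsuml.
have mterm k : measurable_fun setT (fun x => (k * \1_(f_ n @^-1` [set k]) (phi x) * D x)%:E).
  apply/measurable_EFinP; apply: measurable_funM => //; apply: measurable_funM => //.
  by apply: measurableT_comp => //; exact: mphi.
have tge0 k x : 0 <= (k * \1_(f_ n @^-1` [set k]) (phi x) * D x)%:E.
  rewrite EFinM mule_ge0 ?lee_fin // indicE.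
  case: (boolP (phi x \in _)) => H; last by rewrite mulr0.
  by move: H; rewrite inE /= => <-; rewrite mulr1.
rewrite ge0_integral_fsum//; last by move=> k; exact: measurable_funTS.
apply: eq_fsbigr => k; rewrite inE => -[y _ yk].
have k0 : (0 <= k)%R by rewrite -yk.
under eq_integral => x _ do rewrite -mulrA EFinM.
rewrite ge0_integralZl_EFin //; last 2 first.
- by move=> x _; rewrite lee_fin mulr_ge0.
- apply: measurable_funTS; apply/measurable_EFinP; apply: measurable_funM => //.
  by apply: measurableT_comp => //; exact: mphi.
congr (_ * _); rewrite muE; last 2 first.
- exact: measurableI.
- by move=> z [].
rewrite [LHS]integral_mkcond [RHS]integral_mkcond; apply: eq_integral => x _.
rewrite !patchE preimage_setI in_setI indicE.
rewrite -[x \in phi @^-1` (f_ n @^-1` _)]/(phi x \in f_ n @^-1` [set k]).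
by case: (phi x \in _); case: (x \in _); rewrite ?mul1r ?mul0r.
Qed.

Lemma integral_density (f : Y -> R) : measurable_fun setT f ->
  (forall y, ~ U y -> f y = 0%R) -> (forall x, ~ U (phi x) -> D x = 0%R) ->
  \int[mu]_y (f y)%:E = \int[lam]_x (f (phi x) * D x)%:E.
Proof.
move=> mf fU DU.
have mfE : measurable_fun setT (EFin \o f) by exact/measurable_EFinP.
have H g : measurable_fun setT g -> (forall y, 0 <= g y) -> (forall y, ~ U y -> g y = 0) ->
    \int[mu]_y g y = \int[lam]_x (g (phi x) * (D x)%:E).
  move=> mg g0 gU.
  have -> : \int[mu]_y g y = \int[mu]_(y in U) g y.
    rewrite [RHS]integral_mkcond; apply: eq_integral => y _; rewrite patchE.
    by case: ifPn => // /negP; rewrite inE => /gU.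
  rewrite ge0_integral_density // [LHS]integral_mkcond; apply: eq_integral => x _.
  rewrite patchE; case: ifPn => // /negP; rewrite inE => /= /DU ->.
  by rewrite mule0.
rewrite [LHS]integralE [RHS]integralE; congr (_ - _).
- rewrite (H (EFin \o f)^\+) //.
  + apply: eq_integral => x _; rewrite !funeposE /= -!EFin_max -EFinM; congr EFin.
    by rewrite maxr_pMl // mul0r.
  + exact: measurable_funepos.
  + by move=> y /fU; rewrite funeposE /= => ->; rewrite maxxx.
- rewrite (H (EFin \o f)^\-) //.
  + apply: eq_integral => x _; rewrite !funenegE /= -!EFin_max -EFinM; congr EFin.
    by rewrite maxr_pMl // mul0r mulNr.
  + exact: measurable_funeneg.
  + by move=> y /fU; rewrite funenegE /= => ->; rewrite oppr0 maxxx.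
Qed.

End DensityTransfer.

Section LebIntegral.
Context {R : realType}.

Definition box n (b : R) : set 'rV[R]_n := [set x | `|x| <= b].

Lemma closed_box n b : closed (@box n b).
Proof.
rewrite (_ : @box n b = (fun x : 'rV[R]_n => `|x|) @^-1` [set r | r <= b]) //.
by apply: closed_comp; [move=> x _; exact: norm_continuous|exact: closed_le].
Qed.

Lemma measurable_box n b : measurable (@box n b : set (eucl n)).
Proof. by apply: (@bspace_closed 'rV[R]_n); exact: closed_box. Qed.

Lemma Leb_box n b : (Leb n (@box n b) < +oo)%E.
Proof.
elim: n => [|n IH]; first by rewrite /= diracE; case: (_ \in _); rewrite ltry.
rewrite /= /cons_sfm /= /cons_measure /pushforward.
have mI : measurable (`[-b, b]%classic : set (measurableTypeR R)) by exact: measurable_itv.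
have mB := @measurable_box n b.
apply: (@le_lt_trans _ _ ((@lebesgue_measure R \x Leb n)%E (`[-b, b]%classic `*` @box n b))).
  apply: le_measure; rewrite ?inE.
  - rewrite -[X in measurable X]setTI; apply: (@measurable_cons R n) => //; exact: measurable_box.
  - exact: measurableX.
  move=> [t y] /=; rewrite /box /cons_pair /= => H; split => /=.
    by rewrite in_itv /= -ler_norml -(cons_coord0 t y); apply: le_trans H; exact: coord_le_norm.
  apply: mx_norm_le => [|i j]; first exact: le_trans H.
  by rewrite (ord1 i) -(cons_coordS t); apply: le_trans H; exact: coord_le_norm.
rewrite product_measure1E // lte_mul_pinfty //.
  pose I : set R := `[-b, b]%classic.
  have : (@lebesgue_measure R I < +oo)%E.
    by rewrite /I lebesgue_measure_itv /=; case: ifP => _; rewrite ?ltry // -EFinB ltry.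
  by rewrite ge0_fin_numE.
Qed.

Lemma cont_bounded_integrable n (F : 'rV[R]_n -> R) (b M : R) :
  measurable_fun [set: eucl n] (F : eucl n -> R) -> (forall x, `|F x| <= M) ->
  (forall x, b < `|x| -> F x = 0) ->
  (Leb n).-integrable setT (fun x : eucl n => (F x)%:E).
Proof.
move=> mF FM Fb.
have I : (Leb n).-integrable (@box n b) (EFin \o (F : eucl n -> R)).
  apply: measurable_bounded_integrable.
  - exact: measurable_box.
  - exact: Leb_box.
  - exact: measurable_funTS.
  - exists M; split; first exact: num_real.
    by move=> r Mr x _ /=; apply: le_trans (ltW Mr).
have := (integrable_mkcond (EFin \o (F : eucl n -> R)) (@measurable_box n b)).1 I.
apply: eq_integrable => // x _; rewrite patchE; case: ifPn => // /negP.
by rewrite inE /box /= => /negP; rewrite -ltNge => /Fb ->.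
Qed.

Lemma Leb_fubini n (f : eucl n.+1 -> R) :
  measurable_fun setT f -> (Leb n.+1).-integrable setT (EFin \o f) ->
  (\int[Leb n.+1]_x (f x)%:E = \int[@lebesgue_measure R]_t \int[Leb n]_y (f (cons_coord t y))%:E)%E /\
  (\int[Leb n.+1]_x (f x)%:E = \int[Leb n]_y \int[@lebesgue_measure R]_t (f (cons_coord t y))%:E)%E.
Proof.
move=> mf intf.
have mf' : measurable_fun setT (EFin \o f) by exact/measurable_EFinP.
have mfc : measurable_fun setT ((EFin \o f) \o @cons_pair R n).
  by apply: measurableT_comp => //; exact: measurable_cons.
have I : (@lebesgue_measure R \x Leb n)%E.-integrable setT ((EFin \o f) \o @cons_pair R n).
  apply/integrableP; split => //.
  move/integrableP : intf => [_].
  rewrite /= /cons_sfm /= /cons_measure (ge0_integral_pushforward (@measurable_cons R n)) //.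
  by apply/measurable_EFinP; exact: measurableT_comp.
have E : (\int[Leb n.+1]_x (f x)%:E =
    \int[(@lebesgue_measure R \x Leb n)%E]_z ((EFin \o f) \o @cons_pair R n) z)%E.
  exact: (@integral_pushforward _ _ _ _ R _ (@measurable_cons R n) _ setT _ mf' I measurableT).
by rewrite E -(integral12_prod_meas1 I) [in X in _ /\ X]integral12_prod_meas1 // -(integral21_prod_meas1 I).
Qed.

Lemma compact_support_bound n (F : 'rV[R]_n -> R) (b : R) : continuous F ->
  (forall x, b < `|x| -> F x = 0) -> exists M, forall x, `|F x| <= M.
Proof.
move=> cF Fb.
have cb : compact (@box n b).
  apply: bounded_closed_compact; last exact: closed_box.
  exists b; split; first exact: num_real.
  by move=> r br x /= xb; apply: le_trans xb (ltW br).
have : compact ((fun x => F x) @` @box n b).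
  by apply: continuous_compact => //; exact: continuous_subspaceT.
move=> /compact_bounded[M [Mr HM]].
exists (`|M| + 1) => x; have [xb|xb] := leP `|x| b.
  by apply: (HM (`|M| + 1)); [rewrite (le_lt_trans (ler_norm M)) // ltrDl|exists x].
by rewrite Fb // normr0 addr_ge0.
Qed.

Lemma integral_derivative_compact (X X' : R -> R) (b : R) :
  (forall t : R, is_derive t 1 X (X' t)) -> continuous X' ->
  (forall t : R, b < `|t| -> X t = 0) -> (forall t : R, b < `|t| -> X' t = 0) ->
  (\int[@lebesgue_measure R]_t (X' t)%:E = 0)%E.
Proof.
move=> dX cX' X0 X'0.
(* Strictly beyond [b], so that [X] vanishes at both endpoints of the interval to which the
   fundamental theorem of calculus is applied. *)
pose c := `|b| + 1.
have bc : b < c by rewrite (le_lt_trans (ler_norm b)) // ltrDl.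
have c0 : 0 < c by rewrite ltr_wpDl.
have cc : - c < c by rewrite (lt_trans _ c0) // oppr_lt0.
pose I : set R := `[-c, c]%classic.
have -> : (\int[@lebesgue_measure R]_t (X' t)%:E = \int[@lebesgue_measure R]_(t in I) (X' t)%:E)%E.
  rewrite [RHS]integral_mkcond; apply: eq_integral => t _; rewrite patchE.
  case: ifPn => // /negP H; rewrite X'0 //; apply: lt_le_trans bc _.
  rewrite leNgt; apply/negP => tc; apply: H; rewrite inE /I /= in_itv /= -ler_norml; exact: ltW.
have cX : continuous X.
  by move=> t; apply: differentiable_continuous; apply/derivable1_diffP; have [] := dX t.
rewrite (@continuous_FTC2 _ X' X) //.
- rewrite !X0 ?subee // ?normrN gtr0_norm //.
- exact: continuous_subspaceT.
- split.
  + by move=> t _; have [] := dX t.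
  + by apply: cvg_at_right_filter; exact: cX.
  + by apply: cvg_at_left_filter; exact: cX.
- by move=> t _; rewrite derive1E; have [_ ->] := dX t.
Qed.

Lemma near_dist (V : normedModType R) (y : V) (e : R) : 0 < e ->
  \forall z \near y, `|y - z| <= e.
Proof. by move=> e0; apply: (cvgrPdist_le _ _).1 => //; exact: cvg_id. Qed.

(** By Fubini the first coordinate is integrated innermost when it is the one differentiated, and
    outermost otherwise; the first case is the fundamental theorem of calculus, the second is the
    induction hypothesis on each slice. *)
Lemma integral_partial n (i : 'I_n) (X : 'rV[R]_n -> R) (b : R) :
  continuous X -> (forall x, derivable X x (delta_mx 0 i)) -> continuous (partial i X) ->
  (forall x, b < `|x| -> X x = 0) ->
  (\int[Leb n]_(x in setT) (partial i X (x : 'rV[R]_n))%:E = 0)%E.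
Proof.
elim: n i X => [|n IH] i X; first by case: i.
move=> cX dX cdX X0.
have dX0 x : b < `|x| -> partial i X x = 0.
  move=> bx; rewrite /partial (@near_eq_derive _ _ _ _ (cst 0)) ?derive_cst //.
  have nb : \forall y \near x, b < `|y|.
    by apply: (@norm_continuous _ 'rV[R]_n.+1 x [set r | b < r]); exact: lt_nbhsr.
  by apply: (@filterS _ (nbhs x) _ _ _ _ nb) => y /X0.
have mF : measurable_fun [set: eucl n.+1] (partial i X : eucl n.+1 -> R).
  by apply: (@cont_measurableR R 'rV[R]_n.+1 setT) => [|x _]; [exact: openT|exact: cdX].
have [M HM] := compact_support_bound cdX dX0.
have intF := cont_bounded_integrable mF HM dX0.
have [E1 E2] := Leb_fubini mF intF.
have cons_norm0 (t : R) (y : 'rV[R]_n) : `|t| <= `|cons_coord t y|.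
  by rewrite -{1}(cons_coord0 t y); exact: coord_le_norm.
have cons_normS (t : R) (y : 'rV[R]_n) : `|y| <= `|cons_coord t y|.
  apply: mx_norm_le => // k j; rewrite (ord1 k) -(cons_coordS t y); exact: coord_le_norm.
have cons_cont_t (y : 'rV[R]_n) : continuous (fun t : R => cons_coord t y).
  move=> t; apply/cvgrPdist_le => e e0.
  apply: (@filterS _ (nbhs t) _ _ _ _ (near_dist t e0)) => z Hz.
  by apply: cons_coord_dist; rewrite ?subrr ?normr0 ?(ltW e0).
have cons_cont_y (t : R) : continuous (fun y : 'rV[R]_n => cons_coord t y).
  move=> y; apply: ((@cvgrPdist_le _ _ _ (nbhs y) (nbhs_filter y) _ _).2) => e e0.
  apply: (@filterS _ (nbhs y) _ _ _ _ (near_dist y e0)) => z Hz.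
  by apply: cons_coord_dist; rewrite ?subrr ?normr0 ?(ltW e0).
case: (unliftP ord0 i) => [j ij|i0].
  rewrite E1 -[RHS](@integral0 _ _ _ (@lebesgue_measure R) setT).
  apply: eq_integral => t _.
  have line (y : 'rV[R]_n) (s : R) : cons_coord t (y + s *: delta_mx 0 j) =
      cons_coord t y + s *: delta_mx 0 i.
    apply/rowP => k; rewrite !mxE ij; case: (unliftP ord0 k) => [l ->|->].
      have := cons_coordS t (y + s *: delta_mx 0 j) l; have := cons_coordS t y l.
      rewrite !mxE => -> ->; rewrite (inj_eq lift_inj) //.
    have := cons_coord0 t (y + s *: delta_mx 0 j); have := cons_coord0 t y.
    by rewrite !mxE => -> -> /=; rewrite mulr0 addr0.
  have D (y : 'rV[R]_n) : is_derive y (delta_mx 0 j) (fun z => X (cons_coord t z)) (partial i X (cons_coord t y)).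
    apply: derivable_line_iff; under eq_fun do rewrite line.
    have dX' : derivable X (cons_coord t y + 0 *: delta_mx 0 i) (delta_mx 0 i) by exact: dX.
    by have := is_derive_line dX'; rewrite scale0r addr0.
  rewrite -(IH j (fun z => X (cons_coord t z))).
  - by apply: eq_integral => y _; have [_ <-] := D y.
  - by move=> y; apply: continuous_comp; [exact: cons_cont_y|exact: cX].
  - by move=> y; have [] := D y.
  - rewrite (_ : partial j _ = (fun z => partial i X (cons_coord t z))).
      by move=> y; apply: continuous_comp; [exact: cons_cont_y|exact: cdX].
    by apply/funext => y; have [_] := D y.
  - by move=> y by_; apply: X0; apply: lt_le_trans by_ _.
rewrite E2 -[RHS](@integral0 _ _ _ (Leb n) setT).
apply: eq_integral => y _; rewrite i0.
apply: (@integral_derivative_compact (fun t => X (cons_coord t y)) _ b).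
- move=> t; under eq_fun do rewrite cons_coord_line.
  have dX' : derivable X (cons_coord 0 y + t *: delta_mx 0 0) (delta_mx 0 0).
    by rewrite -(i0 : i = 0); exact: dX.
  by have := is_derive_line dX'; rewrite -cons_coord_line.
- move=> t; rewrite -i0; apply: continuous_comp; [exact: cons_cont_t|exact: cdX].
- by move=> t bt; apply: X0; apply: lt_le_trans bt _.
- by move=> t bt; rewrite -i0; apply: dX0; apply: lt_le_trans bt _.
Qed.

End LebIntegral.

(** * Riemannian calculus in charts *)

Section FormLemmas.
Context {R : realType}.
Implicit Types n : nat.

Definition posdef n (A : 'M[R]_n) := forall v : 'rV[R]_n, v != 0 -> 0 < (v *m A *m v^T) 0 0.

Lemma posdef_unit n (A : 'M[R]_n) : posdef A -> A \in unitmx.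
Proof.
move=> pA; rewrite -row_free_unit -kermx_eq0; apply/negPn/negP => /rowV0Pn[v /sub_kermxP vA v0].
by have := pA v v0; rewrite vA mul0mx mxE ltxx.
Qed.

Lemma formD n (A B : 'M[R]_n) (u v : 'rV[R]_n) :
  (u *m (A + B) *m v^T) 0 0 = (u *m A *m v^T) 0 0 + (u *m B *m v^T) 0 0.
Proof. by rewrite mulmxDr mulmxDl mxE. Qed.

Lemma formZ n (A : 'M[R]_n) (u v : 'rV[R]_n) c :
  (u *m (c *: A) *m v^T) 0 0 = c * (u *m A *m v^T) 0 0.
Proof. by rewrite -scalemxAr -scalemxAl mxE. Qed.

Lemma norm_form n (v : 'rV[R]_n) : (v *m v^T) 0 0 = \sum_i v 0 i ^+ 2.
Proof. by rewrite mxE; apply: eq_bigr => i _; rewrite mxE expr2. Qed.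

Lemma norm_form_ge0 n (v : 'rV[R]_n) : 0 <= (v *m v^T) 0 0.
Proof. by rewrite norm_form sumr_ge0 // => i _; exact: sqr_ge0. Qed.

Lemma norm_form_gt0 n (v : 'rV[R]_n) : v != 0 -> 0 < (v *m v^T) 0 0.
Proof.
move=> v0; rewrite lt_def norm_form_ge0 andbT; apply: contra_neq v0 => H.
apply/rowP => i; rewrite mxE; apply/eqP; rewrite -sqrf_eq0; move: H; rewrite norm_form.
by move=> /psumr_eq0P -> // j _; exact: sqr_ge0.
Qed.

(** The segment from the identity to [A] consists of positive definite, hence invertible, matrices;
    by the intermediate value theorem the determinant keeps the sign it has at the identity. *)
Lemma posdef_det_gt0 n (A : 'M[R]_n) : posdef A -> 0 < \det A.
Proof.
move=> pA; pose B (t : R) := (1 - t) *: 1%:M + t *: A.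
have pB t : 0 <= t <= 1 -> posdef (B t).
  move=> /andP[t0 t1] v v0; rewrite formD !formZ mulmx1.
  have H1 := norm_form_gt0 v0; have H2 := pA v v0.
  have [->|tn0] := eqVneq t 0; first by rewrite subr0 mul1r mul0r addr0.
  apply: ltr_wpDl; first by apply: mulr_ge0; rewrite ?subr_ge0 // ltW.
  by apply: mulr_gt0 => //; rewrite lt_def tn0.
have dB0 t : 0 <= t <= 1 -> \det (B t) != 0.
  by move=> /pB/posdef_unit; rewrite unitmxE unitfE.
have cB : continuous (fun t : R => \det (B t)).
  have S : smooth_on setT (fun x : 'rV[R]_1 => \det (B (x 0 0))).
    apply: smooth_on_det => [|i j]; first exact: openT.
    rewrite (_ : (fun _ => _) = (fun x : 'rV[R]_1 => (1 + (-1) * x 0 0) * (1%:M : 'M[R]_n) i j + x 0 0 * A i j)).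
      apply: smooth_onD; [exact: openT| |].
        apply: smooth_onM; [exact: openT| |exact: smooth_on_cst].
        apply: smooth_onD; [exact: openT|exact: smooth_on_cst|].
        by apply: smooth_onM; [exact: openT|exact: smooth_on_cst|exact: smooth_on_coord].
      by apply: smooth_onM; [exact: openT|exact: smooth_on_coord|exact: smooth_on_cst].
    by apply/funext => x; rewrite !mxE mulN1r.
  by move=> t; apply: (@smooth1_cont _ setT) => //; exact: smooth1_of_line.
rewrite ltNge; apply/negP => dA.
have [] := @IVT _ (fun t => \det (B t)) 0 1 0 ler01.
- exact: continuous_subspaceT.
- have -> : B 0 = 1%:M by rewrite /B subr0 scale1r scale0r addr0.
  have -> : B 1 = A by rewrite /B subrr scale1r scale0r add0r.
  rewrite det1; apply/andP; split; first by rewrite ge_min dA orbT.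
  by rewrite le_max ler01.
by move=> t; rewrite in_itv /= => /dB0 /negP H /eqP.
Qed.

Lemma form_CS n (B : 'M[R]_n) (u v : 'rV[R]_n) : B^T = B ->
  (forall w : 'rV[R]_n, 0 <= (w *m B *m w^T) 0 0) ->
  (u *m B *m v^T) 0 0 ^+ 2 <= (u *m B *m u^T) 0 0 * (v *m B *m v^T) 0 0.
Proof.
move=> sB pB; set a := (u *m B *m u^T) 0 0; set b := (u *m B *m v^T) 0 0.
set c := (v *m B *m v^T) 0 0.
have sym : (v *m B *m u^T) 0 0 = b.
  by rewrite /b -[in LHS](trmxK (v *m B *m u^T)) mxE !trmx_mul trmxK sB mulmxA.
have add (X Y : 'M[R]_1) : (X + Y) 0 0 = X 0 0 + Y 0 0 by rewrite mxE.
have scl t (X : 'M[R]_1) : (t *: X) 0 0 = t * X 0 0 by rewrite mxE.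
have Q t : 0 <= a + 2 * t * b + t ^+ 2 * c.
  have := pB (u + t *: v); rewrite linearD /= linearZ /= !mulmxDl !mulmxDr.
  rewrite -!scalemxAl -!scalemxAr !add !scl -/a -/b -/c sym.
  by move=> H; rewrite (_ : _ + _ = a + t * b + (t * b + t * (t * c))) //; ring.
have a0 : 0 <= a by exact: pB.
have c0 : 0 <= c by exact: pB.
have [c00|cn0] := eqVneq c 0.
  have [b0|bn0] := eqVneq b 0; first by rewrite b0 expr0n /= mulr_ge0.
  (* In the degenerate case [c = 0] the quadratic is affine in [t]; this value of [t] would make it
     equal to -1. *)
  have := Q (- (a + 1) / (2 * b)); rewrite c00 mulr0 addr0.
  rewrite (_ : 2 * _ * b = - (a + 1)); last by field; rewrite bn0.
  by lra.
have cp : 0 < c by rewrite lt_def cn0.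
have := Q (- b / c); rewrite (_ : _ + _ = (a * c - b ^+ 2) / c); last by field.
by rewrite pmulr_lge0 ?invr_gt0 // subr_ge0.
Qed.

Lemma form_dual n (G : 'M[R]_n) (u : 'rV[R]_n) : G^T = G -> G \in unitmx ->
  (u *m invmx G *m u^T) 0 0 = ((u *m invmx G) *m G *m (u *m invmx G)^T) 0 0.
Proof. by move=> sG uG; rewrite trmx_mul trmx_inv sG mulmxKV // mulmxA. Qed.

Lemma form_dual_ge0 n (G : 'M[R]_n) (u : 'rV[R]_n) : G^T = G -> posdef G ->
  0 <= (u *m invmx G *m u^T) 0 0.
Proof.
move=> sG pG; rewrite form_dual //; last exact: posdef_unit.
have [->|w0] := eqVneq (u *m invmx G) 0; last exact/ltW/pG.
by rewrite !mul0mx mxE.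
Qed.

(** Cauchy-Schwarz for [G] between the basis vector [i] and the raised covector [u G^-1], whose
    [G]-product is [u_i]. It lets [Gam w w] control the coordinate derivatives of [w]. *)
Lemma coord_dual_bound n (G : 'M[R]_n) (u : 'rV[R]_n) i : G^T = G -> posdef G ->
  u 0 i ^+ 2 <= G i i * (u *m invmx G *m u^T) 0 0.
Proof.
move=> sG pG; have uG := posdef_unit pG.
have pG' (w : 'rV[R]_n) : 0 <= (w *m G *m w^T) 0 0.
  by have [->|w0] := eqVneq w 0; [rewrite !mul0mx mxE|exact/ltW/pG].
have := form_CS (delta_mx 0 i) (u *m invmx G) sG pG'.
rewrite -form_dual //.
have -> : ((delta_mx 0 i : 'rV[R]_n) *m G *m (u *m invmx G)^T) 0 0 = u 0 i.
  rewrite trmx_mul trmx_inv sG mulmxA mulmxK // -rowE.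
  by rewrite !mxE.
suff -> : ((delta_mx 0 i : 'rV[R]_n) *m G *m (delta_mx 0 i : 'rV[R]_n)^T) 0 0 = G i i by [].
by rewrite trmx_delta -mulmxA -colE -rowE !mxE.
Qed.

(** The transformation law of the inverse metric, deduced from that of the metric. *)
Lemma inv_congruence n (J G G' : 'M[R]_n) : G \in unitmx -> G = J *m G' *m J^T ->
  J^T *m invmx G *m J = invmx G'.
Proof.
move=> uG E; have [uJ uG'] : J \in unitmx /\ G' \in unitmx.
  by move: uG; rewrite E !unitmx_mul unitmx_tr => /andP[/andP[]].
have H : G' *m (J^T *m invmx G *m J) = 1%:M.
  have : J *m (G' *m (J^T *m invmx G *m J)) = J.
    by rewrite !mulmxA -E mulmxV // mul1mx.
  by move=> /(congr1 (mulmx (invmx J))); rewrite mulKmx // mulVmx.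
by rewrite -[LHS](mulKmx uG') H mulmx1.
Qed.

Lemma differentiable_rV m n (Phi : 'rV[R]_m -> 'rV[R]_n) x :
  (forall k, differentiable (fun y => Phi y 0 k) x) -> differentiable Phi x.
Proof.
move=> H; rewrite (_ : Phi = \sum_k (fun y => Phi y 0 k *: (delta_mx 0 k : 'rV[R]_n))); last first.
  by apply/funext => y; rewrite fct_sumE {1}(row_sum_delta (Phi y)).
by apply: differentiable_sum => k; exact: differentiableZl.
Qed.

Lemma jacobianE m n (Phi : 'rV[R]_m -> 'rV[R]_n) x i k :
  (forall k, differentiable (fun y => Phi y 0 k) x) ->
  jacobian Phi x i k = partial i (fun y => Phi y 0 k) x.
Proof.
move=> H; have dP := differentiable_rV H.
rewrite /jacobian mxE /= -deriveE // derive_mx; last exact: diff_derivable.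
by rewrite mxE.
Qed.

End FormLemmas.

(** * Smooth functions, extension by zero and bump functions on a manifold *)

Section Charts.
Context {R : realType} {N : nat} {M : manifold R N}.
Implicit Types (c : chart R M N) (f h : M -> R) (p : M) (x : 'rV[R]_N).

Lemma cdom_open c : atlas c -> open (cdom c).
Proof. by move=> /atlas_chart[]. Qed.
Lemma cimg_open c : atlas c -> open (cimg c).
Proof. by move=> /atlas_chart[]. Qed.
Lemma cmapK c p : atlas c -> cdom c p -> cinv c (cmap c p) = p.
Proof. by move=> /atlas_chart[_ _ H _ _]; exact: H. Qed.
Lemma cmap_cont c p : atlas c -> cdom c p -> {for p, continuous (cmap c)}.
Proof. by move=> /atlas_chart[_ _ _ H _]; exact: H. Qed.
Lemma cinv_cont c x : atlas c -> cimg c x -> {for x, continuous (cinv c)}.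
Proof. by move=> /atlas_chart[_ _ _ _ H]; exact: H. Qed.
Lemma cimg_map c p : cdom c p -> cimg c (cmap c p).
Proof. by exists p. Qed.
Lemma cdom_inv c x : atlas c -> cimg c x -> cdom c (cinv c x).
Proof. by move=> ac [p dp <-]; rewrite cmapK. Qed.
Lemma cinvK c x : atlas c -> cimg c x -> cmap c (cinv c x) = x.
Proof. by move=> ac [p dp <-]; rewrite cmapK. Qed.

Lemma chart_atP p : atlas (chart_at p) /\ cdom (chart_at p) p.
Proof. by rewrite /chart_at; case: cid => c []. Qed.

Definition cpre c (O : set M) : set 'rV[R]_N := cimg c `&` cinv c @^-1` O.

Lemma cpre_open c O : atlas c -> open O -> open (cpre c O).
Proof.
move=> ac oO; apply: open_restrict_preimage => //; first exact: cimg_open.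
by move=> x; exact: cinv_cont.
Qed.

Lemma cpreE c O : atlas c -> cpre c O = cmap c @` (cdom c `&` O).
Proof.
move=> ac; apply/seteqP; split=> x.
  by move=> [ix Ox]; exists (cinv c x); rewrite ?cinvK //; split=> //; exact: cdom_inv.
by move=> [p [dp Op] <-]; split; [exact: cimg_map|rewrite /= cmapK].
Qed.

Definition trans c c' x := cmap c' (cinv c x).

Lemma trans_smooth c c' j : atlas c -> atlas c' ->
  smooth_on (cpre c (cdom c')) (fun x => trans c c' x 0 j).
Proof. by move=> ac ac'; rewrite cpreE //; exact: atlas_compatible. Qed.

Lemma trans_cont c c' x : atlas c -> atlas c' -> cpre c (cdom c') x ->
  {for x, continuous (trans c c')}.
Proof.
move=> ac ac' [ix dx]; apply: continuous_comp; first exact: cinv_cont.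
exact: cmap_cont.
Qed.

(** Smoothness in one chart near each point passes to every other chart of the atlas by composition
    with the transition maps. *)
Lemma smooth_fun_local f :
  (forall p, exists c, exists O : set 'rV[R]_N, [/\ atlas c, cdom c p, open O, O `<=` cimg c &
     O (cmap c p) /\ smooth_on O (f \o cinv c)]) -> smooth_fun f.
Proof.
move=> H c' ac'; apply: smooth_on_loc => x ix.
have [c [Q [ac dp oO Oi [Op sO]]]] := H (cinv c' x).
pose W := cpre c' (cdom c) `&` trans c' c @^-1` Q.
have oW : open W.
  apply: open_restrict_preimage => //; first exact/cpre_open/cdom_open.
  by move=> y; exact: trans_cont.
exists W; split; first by split.
apply: (@smooth_on_ext _ _ _ ((f \o cinv c) \o trans c' c)) => //.
  by move=> y [[iy dy] Oy] /=; rewrite /trans cmapK.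
apply: (@smooth_on_comp _ _ _ _ Q) => //.
- by move=> y [].
- move=> j; apply: smooth_on_sub (trans_smooth j ac' ac).
  by move=> y [].
- by move=> y [Hy _]; exact: trans_cont.
Qed.

Lemma smooth_fun_ext f h : (forall p, f p = h p) -> smooth_fun f -> smooth_fun h.
Proof. by move=> E; rewrite (_ : h = f) //; apply/funext => p. Qed.

Lemma smooth_fun_cst (a : R) : smooth_fun (fun _ : M => a).
Proof. by move=> c ac; exact: smooth_on_cst. Qed.

Lemma smooth_funD f h : smooth_fun f -> smooth_fun h -> smooth_fun (fun p => f p + h p).
Proof. by move=> sf sh c ac; apply: smooth_onD; [exact: cimg_open|exact: sf|exact: sh]. Qed.

Lemma smooth_funM f h : smooth_fun f -> smooth_fun h -> smooth_fun (fun p => f p * h p).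
Proof. by move=> sf sh c ac; apply: smooth_onM; [exact: cimg_open|exact: sf|exact: sh]. Qed.

Lemma smooth_funN f : smooth_fun f -> smooth_fun (fun p => - f p).
Proof.
move=> sf; apply: (@smooth_fun_ext (fun p => -1 * f p)); first by move=> p; rewrite mulN1r.
by apply: smooth_funM => //; exact: smooth_fun_cst.
Qed.

Lemma smooth_funB f h : smooth_fun f -> smooth_fun h -> smooth_fun (fun p => f p - h p).
Proof. by move=> sf sh; exact: smooth_funD sf (smooth_funN sh). Qed.

Lemma smooth_fun_comp1 (I : set R) (F : R -> R) f : smooth1 I F -> (forall p, I (f p)) ->
  smooth_fun f -> smooth_fun (fun p => F (f p)).
Proof.
move=> sF If sf c ac; apply: (@smooth_on_comp1 _ _ _ I F (f \o cinv c)) => //.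
- exact: cimg_open.
- by move=> x _; exact: If.
- exact: sf.
Qed.

Lemma smooth_fun_cont f : smooth_fun f -> continuous f.
Proof.
move=> sf p; have [ac dp] := chart_atP p; set c := chart_at p in ac dp.
apply: (@near_eq_cont _ _ ((f \o cinv c) \o cmap c)).
  apply: (@filterS _ (nbhs p) _ (cdom c)); last by apply: open_nbhs_nbhs; split=> //; exact: cdom_open.
  by move=> q dq /=; rewrite cmapK.
apply: continuous_comp; first exact: cmap_cont.
by apply: smooth_on_cont (sf c ac) _; exact: cimg_map.
Qed.

Lemma compact_closedM (K : set M) : compact K -> closed K.
Proof. by apply: compact_closed; exact: manifold_hausdorff. Qed.

Definition cball x (e : R) : set 'rV[R]_N := [set y | `|x - y| <= e].

Lemma cball_compact x e : compact (cball x e).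
Proof.
apply: bounded_closed_compact.
  exists (`|x| + e); split; first exact: num_real.
  move=> r Hr y /= Hy; apply: le_trans (ltW Hr).
  rewrite -(subrK x y) [leRHS]addrC; apply: le_trans (ler_normD _ _) _.
  by rewrite lerD2r distrC.
exact: closed_closed_ball_.
Qed.

Lemma cinv_compact c (K : set 'rV[R]_N) : atlas c -> K `<=` cimg c -> compact K ->
  compact (cinv c @` K).
Proof.
move=> ac Ki cK; apply: continuous_compact => //.
apply: continuous_in_subspaceT => x; rewrite inE => Kx.
exact/cinv_cont/Ki.
Qed.

Lemma cmap_compact c (K : set M) : atlas c -> K `<=` cdom c -> compact K -> compact (cmap c @` K).
Proof.
move=> ac Kd cK; apply: continuous_compact => //.
by apply: continuous_in_subspaceT => p; rewrite inE => Kp; exact/cmap_cont/Kd.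
Qed.

Lemma smooth_euclid_quad x (a e : R) : smooth_on setT
  (fun y : 'rV[R]_N => a - e * (\sum_i (y 0 i - x 0 i) ^+ 2)).
Proof.
rewrite (_ : (fun _ => _) = (fun y : 'rV[R]_N => a + (- e) * (\sum_i ((y 0 i + - x 0 i) * (y 0 i + - x 0 i))))); last first.
  by apply/funext => y; rewrite mulNr; under [in RHS]eq_bigr do rewrite -expr2.
apply: smooth_onD; [exact: openT|exact: smooth_on_cst|].
apply: smooth_onM; [exact: openT|exact: smooth_on_cst|].
apply: smooth_on_sum => [|i _]; first exact: openT.
have S : smooth_on setT (fun y : 'rV[R]_N => y 0 i + - x 0 i).
  by apply: smooth_onD; [exact: openT|exact: smooth_on_coord|exact: smooth_on_cst].
by apply: smooth_onM => //; exact: openT.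
Qed.

Lemma smooth_euclid_step x (e : R) : smooth_on setT
  (fun y : 'rV[R]_N => step (2 - e * (\sum_i (y 0 i - x 0 i) ^+ 2))).
Proof.
apply: (@smooth_on_comp1 _ _ _ setT (@step R) (fun y : 'rV[R]_N => 2 - e * (\sum_i (y 0 i - x 0 i) ^+ 2))) => //.
- exact: openT.
- exact: smooth1_step.
- exact: smooth_euclid_quad.
Qed.

(** At points outside the chart domain one uses that the image of [K] in the manifold is compact,
    hence closed by the Hausdorff property: the extension is 0 on its open complement. *)
Lemma smooth_fun_extend c (F : 'rV[R]_N -> R) (K : set 'rV[R]_N) : atlas c -> compact K ->
  K `<=` cimg c -> smooth_on (cimg c) F -> (forall x, cimg c x -> ~ K x -> F x = 0) ->
  smooth_fun (fun p => if `[< cdom c p >] then F (cmap c p) else 0).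
Proof.
move=> ac cK Ki sF F0; apply: smooth_fun_local => p.
have [dp|ndp] := pselect (cdom c p).
  exists c, (cimg c); split => //; first exact: cimg_open.
  split; first exact: cimg_map.
  apply: smooth_on_ext sF; first exact: cimg_open.
  by move=> x ix /=; rewrite asboolT ?cinvK //; exact: cdom_inv.
have [ac' dp'] := chart_atP p; set c' := chart_at p in ac' dp'.
have oC : open (~` (cinv c @` K)).
  by apply: closed_openC; apply: compact_closedM; exact: cinv_compact.
exists c', (cpre c' (~` (cinv c @` K))); split => //; first exact: cpre_open.
  by move=> x [].
split.
  split; first exact: cimg_map.
  rewrite /= cmapK // => -[x Kx xp]; apply: ndp; rewrite -xp; exact/cdom_inv/Ki.
apply: (@smooth_on_ext _ _ _ (fun=> 0)); [exact: cpre_open| |exact: smooth_on_cst].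
move=> x [ix nK] /=; case: asboolP => // dx; rewrite F0 //; first exact: cimg_map.
by move=> Kx; apply: nK; exists (cmap c (cinv c' x)) => //; rewrite cmapK.
Qed.

Lemma bump_exists c p (O : set M) : atlas c -> cdom c p -> open O -> O p ->
  exists b : M -> R, exists K W : set M, [/\ smooth_fun b, (forall q, 0 <= b q <= 1),
    (forall q, ~ K q -> b q = 0), [/\ compact K, K `<=` cdom c & K `<=` O] &
    [/\ open W, W p & forall q, W q -> b q = 1]].
Proof.
move=> ac dp oO Op.
have oC : open (cpre c O) by exact: cpre_open.
have xp : cpre c O (cmap c p) by split; [exact: cimg_map|rewrite /= cmapK].
set x := cmap c p in xp.
have /nbhs_ballP[e /= e0 He] : nbhs x (cpre c O) by exact: open_nbhs_nbhs.
pose r := e / 2.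
have r0 : 0 < r by rewrite divr_gt0.
have re : r < e by rewrite /r ltr_pdivrMr // mulr_natr mulr2n ltrDl.
have Bi : cball x r `<=` cpre c O.
  by move=> y Hy; apply: He; rewrite -ball_normE /=; exact: le_lt_trans re.
(* The argument of [step] is 2 at the centre, so [F] is 1 nearby, and it is nonpositive once some
   coordinate differs from that of [x] by at least [r]. *)
pose F (y : 'rV[R]_N) := step (2 - (2 / r ^+ 2) * (\sum_i (y 0 i - x 0 i) ^+ 2)).
have sF : smooth_on setT F by exact: smooth_euclid_step.
have F0 y : ~ cball x r y -> F y = 0.
  move=> H; rewrite /F step0 // subr_le0.
  have [j Hj] : exists j, r < `|y 0 j - x 0 j|.
    apply: contrapT => nj; apply: H; apply: mx_norm_le => [|i j]; first exact: ltW.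
    by rewrite leNgt; apply/negP => Hj; apply: nj; exists j; move: Hj; rewrite (ord1 i) !mxE distrC.
  have r20 : 0 < r ^+ 2 by rewrite exprn_gt0.
  rewrite mulrAC ler_pdivlMr // ler_pM2l // (bigD1 j) //= -[leLHS]addr0 lerD //.
    by have := ltW Hj; rewrite -ler_sqr ?nnegrE ?(ltW r0) // real_normK ?num_real.
  by rewrite sumr_ge0 // => k _; exact: sqr_ge0.
pose b q := if `[< cdom c q >] then F (cmap c q) else 0.
exists b, (cinv c @` cball x r).
have F1 : \forall y \near x, F y = 1.
  pose S (y : 'rV[R]_N) := 2 - (2 / r ^+ 2) * (\sum_i (y 0 i - x 0 i) ^+ 2).
  have cS : {for x, continuous S}.
    by apply: (@smooth_on_cont _ _ setT) => //; exact: smooth_euclid_quad.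
  have Sx : 1 < S x.
    rewrite /S big1 ?mulr0 ?subr0; last by move=> i _; rewrite subrr expr0n.
    by rewrite ltr1n.
  apply: (@filterS _ (nbhs x) _ [set y | 1 < S y]).
    by move=> y /= /ltW; exact: step1.
  by apply: (cS [set s | 1 < s]); exact: lt_nbhsr.
have : nbhs x [set y | F y = 1] := F1; rewrite nbhsE => -[W [oW Wx] HW].
exists (cdom c `&` cmap c @^-1` W); split.
- apply: (@smooth_fun_extend c F (cball x r)) => //.
  + exact: cball_compact.
  + by move=> y /Bi[].
  + exact: smooth_on_sub sF.
  + by move=> y _; exact: F0.
- by move=> q; rewrite /b; case: ifP => _; rewrite ?step_ge0 ?step_le1 // lexx ler01.
- move=> q H; rewrite /b; case: asboolP => // dq; apply: F0 => Hq.
  by apply: H; exists (cmap c q) => //; rewrite cmapK.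
- split.
  + apply: cinv_compact => //; last exact: cball_compact.
    by move=> y /Bi[].
  + by move=> _ [y /Bi[iy _] <-]; exact: cdom_inv.
  + by move=> _ [y /Bi[_ Oy] <-].
- split => //; first by apply: open_restrict_preimage => // [|q dq]; [exact: cdom_open|exact: cmap_cont].
  by move=> q [dq Wq]; rewrite /b asboolT //; exact: HW.
Qed.

End Charts.

Section Gradient.
Context {R : realType} {N : nat} {M : manifold R N}.
Variable g : metric M.
Implicit Types (c : chart R M N) (f h k : M -> R) (p : M) (x : 'rV[R]_N).

Definition grad c f x : 'rV[R]_N := \row_i partial i (f \o cinv c) x.

(** The carre du champ, that is the product of the differentials of [f] and [h] for the dual metric;
    global gradients enter the proof through this bilinear form. *)
Definition gam c f h x : R := (grad c f x *m invmx (g c x) *m (grad c h x)^T) 0 0.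

(* [Gam], [flux] and [lapc] are sealed to keep unification from unfolding them. *)
Definition Gam_sealed : {F : (M -> R) -> (M -> R) -> M -> R |
  F = fun f h p => gam (chart_at p) f h (cmap (chart_at p) p)}.
Proof. by eexists. Qed.

Definition Gam := sval Gam_sealed.

Lemma GamU f h p : Gam f h p = gam (chart_at p) f h (cmap (chart_at p) p).
Proof. by rewrite /Gam (svalP Gam_sealed). Qed.

Lemma smooth_partial_chart c f i : atlas c -> smooth_fun f ->
  smooth_on (cimg c) (partial i (f \o cinv c)).
Proof. by move=> ac sf; apply: smooth_on_partial; exact: sf. Qed.

Lemma derivable_chart c f i x : atlas c -> smooth_fun f -> cimg c x ->
  derivable (f \o cinv c) x (delta_mx 0 i).
Proof. by move=> ac sf ix; apply: smooth_on_der (sf c ac) ix. Qed.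

Local Arguments derivable_chart [c f] i [x] _ _ _.
Local Arguments smooth_on_der {R n U f x} i _ _.

Lemma g_unit c x : atlas c -> cimg c x -> g c x \in unitmx.
Proof. by move=> ac ix; apply: posdef_unit; exact: gmx_pos. Qed.

Lemma g_inv_sym c x : atlas c -> cimg c x -> (invmx (g c x))^T = invmx (g c x).
Proof. by move=> ac ix; rewrite trmx_inv gmx_sym. Qed.

Lemma g_det_gt0 c x : atlas c -> cimg c x -> 0 < \det (g c x).
Proof. by move=> ac ix; apply: posdef_det_gt0; exact: gmx_pos. Qed.

Lemma g_inv_smooth c i j : atlas c -> smooth_on (cimg c) (fun x => invmx (g c x) i j).
Proof.
move=> ac; apply: smooth_on_inv.
- exact: cimg_open.
- by move=> a b; exact: gmx_smooth.
- by move=> x ix; rewrite gt_eqF // g_det_gt0.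
Qed.

Lemma vol_gt0 c x : atlas c -> cimg c x -> 0 < vol_density g c x.
Proof. by move=> ac ix; rewrite sqrtr_gt0 g_det_gt0. Qed.

Lemma vol_smooth c : atlas c -> smooth_on (cimg c) (vol_density g c).
Proof.
move=> ac; apply: smooth_on_sqrt.
- exact: cimg_open.
- by apply: smooth_on_det; [exact: cimg_open|move=> i j; exact: gmx_smooth].
- by move=> x ix; exact: g_det_gt0.
Qed.

Lemma gamE c f h x : gam c f h x =
  \sum_i \sum_j invmx (g c x) i j * partial i (f \o cinv c) x * partial j (h \o cinv c) x.
Proof.
rewrite /gam mxE exchange_big /=; apply: eq_bigr => j _.
rewrite !mxE mulr_suml; apply: eq_bigr => i _; rewrite !mxE; ring.
Qed.

Lemma gam_smooth c f h : atlas c -> smooth_fun f -> smooth_fun h ->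
  smooth_on (cimg c) (gam c f h).
Proof.
move=> ac sf sh; have oi := cimg_open ac.
apply: (@smooth_on_ext _ _ _ (fun x => \sum_i \sum_j invmx (g c x) i j * partial i (f \o cinv c) x * partial j (h \o cinv c) x)) => //.
  by move=> x _; rewrite gamE.
apply: smooth_on_sum => // i _; apply: smooth_on_sum => // j _.
apply: smooth_onM => //; last exact: smooth_partial_chart.
by apply: smooth_onM => //; [exact: g_inv_smooth|exact: smooth_partial_chart].
Qed.

Lemma grad_trans c c' f p : atlas c -> atlas c' -> smooth_fun f -> cdom c p -> cdom c' p ->
  grad c f (cmap c p) = grad c' f (cmap c' p) *m (jacobian (cmap c' \o cinv c) (cmap c p))^T.
Proof.
move=> ac ac' sf dp dp'; set x := cmap c p.
have xW : cpre c (cdom c') x by split; [exact: cimg_map|rewrite /= cmapK].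
have oW := cpre_open ac (cdom_open ac').
have dT j : differentiable (fun y => trans c c' y 0 j) x.
  by apply: smooth_on_diff (trans_smooth j ac ac') _.
apply/rowP => i; rewrite !mxE.
have E : partial i (f \o cinv c) x = partial i ((f \o cinv c') \o trans c c') x.
  rewrite /partial; apply: near_eq_derive.
  apply: (@filterS _ (nbhs x) _ (cpre c (cdom c'))); last by apply: open_nbhs_nbhs.
  by move=> y [_ dy] /=; rewrite /trans cmapK.
have tx : trans c c' x = cmap c' p by rewrite /trans cmapK.
have dfd : differentiable (f \o cinv c') (trans c c' x).
  rewrite tx; apply: smooth_on_diff (sf c' ac') _; [exact: cimg_open|exact: cimg_map].
have dd j : derivable (fun y => trans c c' y 0 j) x (delta_mx 0 i) by exact: diff_derivable.
have [_ E2] := chain_partial dfd dd.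
rewrite E; apply: etrans E2 _; apply: eq_bigr => k _; rewrite tx.
by rewrite [RHS]mulrC [in RHS]mxE (jacobianE i k dT) mulrC mxE.
Qed.

(** Covectors transform by the Jacobian and the inverse metric by [inv_congruence]; the Jacobians
    cancel. *)
Lemma gam_invariant c c' f h p : atlas c -> atlas c' -> smooth_fun f -> smooth_fun h ->
  cdom c p -> cdom c' p -> gam c f h (cmap c p) = gam c' f h (cmap c' p).
Proof.
move=> ac ac' sf sh dp dp'.
have := gmx_transition g ac ac' dp dp'; set J := jacobian _ _ => /= E.
have uG := g_unit ac (cimg_map dp).
rewrite /gam (grad_trans ac ac' sf dp dp') (grad_trans ac ac' sh dp dp') -/J.
by rewrite trmx_mul trmxK !mulmxA -(inv_congruence uG E) !mulmxA.
Qed.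

Lemma GamE c f h p : atlas c -> smooth_fun f -> smooth_fun h -> cdom c p ->
  Gam f h p = gam c f h (cmap c p).
Proof.
by move=> ac sf sh dp; have [ac' dp'] := chart_atP p; rewrite GamU; exact: gam_invariant.
Qed.

Lemma Gam_smooth f h : smooth_fun f -> smooth_fun h -> smooth_fun (Gam f h).
Proof.
move=> sf sh c ac; apply: smooth_on_ext (gam_smooth ac sf sh); first exact: cimg_open.
by move=> x ix /=; rewrite (GamE ac) // ?cinvK //; exact: cdom_inv.
Qed.

Lemma near_chart c f h p : atlas c -> cdom c p -> (\near p, f p = h p) ->
  \forall y \near cmap c p, (f \o cinv c) y = (h \o cinv c) y.
Proof.
move=> ac dp H.
have := cinv_cont ac (cimg_map dp); rewrite /prop_for /continuous_at cmapK // => C.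
exact: (C _ H).
Qed.

Lemma grad_near c f h p : atlas c -> cdom c p -> (\near p, f p = h p) ->
  grad c f (cmap c p) = grad c h (cmap c p).
Proof.
move=> ac dp H; apply/rowP => i; rewrite !mxE /partial; apply: near_eq_derive.
exact: near_chart.
Qed.

Lemma Gam_near f f' h h' p : (\near p, f p = f' p) -> (\near p, h p = h' p) ->
  Gam f h p = Gam f' h' p.
Proof.
by move=> Hf Hh; have [ac dp] := chart_atP p; rewrite !GamU /gam (grad_near ac dp Hf) (grad_near ac dp Hh).
Qed.

Lemma gradM c f h x : atlas c -> smooth_fun f -> smooth_fun h -> cimg c x ->
  grad c (fun p => f p * h p) x = f (cinv c x) *: grad c h x + h (cinv c x) *: grad c f x.
Proof.
move=> ac sf sh ix; apply/rowP => i; rewrite !mxE.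
have [_ <-] := is_deriveMf (derivableP (derivable_chart i ac sf ix)) (derivableP (derivable_chart i ac sh ix)).
by [].
Qed.

Lemma gradD c f h x : atlas c -> smooth_fun f -> smooth_fun h -> cimg c x ->
  grad c (fun p => f p + h p) x = grad c f x + grad c h x.
Proof.
move=> ac sf sh ix; apply/rowP => i; rewrite !mxE.
have [_ <-] := is_deriveDf (derivableP (derivable_chart i ac sf ix)) (derivableP (derivable_chart i ac sh ix)).
by [].
Qed.

Lemma grad_comp1 c f x (F : R -> R) F' : atlas c -> smooth_fun f -> cimg c x ->
  is_derive (f (cinv c x)) 1 F F' ->
  grad c (fun p => F (f p)) x = F' *: grad c f x.
Proof.
move=> ac sf ix dF; apply/rowP => i; rewrite !mxE.
have [_ <-] := is_derive_compf dF (derivableP (derivable_chart i ac sf ix)).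
by [].
Qed.

Lemma gamC c f h x : atlas c -> cimg c x -> gam c f h x = gam c h f x.
Proof.
move=> ac ix; rewrite /gam -[in LHS](trmxK (_ *m (grad c h x)^T)) mxE !trmx_mul trmxK.
by rewrite (g_inv_sym ac ix) mulmxA.
Qed.

Lemma GamC f h p : Gam f h p = Gam h f p.
Proof. by have [ac dp] := chart_atP p; rewrite !GamU; apply: gamC => //; exact: cimg_map. Qed.

Let mx11D (X Y : 'M[R]_1) : (X + Y) 0 0 = X 0 0 + Y 0 0. Proof. by rewrite mxE. Qed.
Let mx11Z t (X : 'M[R]_1) : (t *: X) 0 0 = t * X 0 0. Proof. by rewrite mxE. Qed.

Lemma GamMl f h k p : smooth_fun f -> smooth_fun h ->
  Gam (fun q => f q * h q) k p = f p * Gam h k p + h p * Gam f k p.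
Proof.
move=> sf sh; have [ac dp] := chart_atP p; rewrite !GamU /gam gradM //; last exact: cimg_map.
by rewrite !mulmxDl -!scalemxAl mx11D !mx11Z cmapK.
Qed.

Lemma GamDl f h k p : smooth_fun f -> smooth_fun h ->
  Gam (fun q => f q + h q) k p = Gam f k p + Gam h k p.
Proof.
move=> sf sh; have [ac dp] := chart_atP p; rewrite !GamU /gam gradD //; last exact: cimg_map.
by rewrite !mulmxDl mx11D.
Qed.

Lemma Gam_comp1l f k p (F : R -> R) F' : smooth_fun f -> is_derive (f p) 1 F F' ->
  Gam (fun q => F (f q)) k p = F' * Gam f k p.
Proof.
move=> sf dF; have [ac dp] := chart_atP p; have dF2 : is_derive (f (cinv (chart_at p) (cmap (chart_at p) p))) 1 F F' by rewrite cmapK.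
rewrite !GamU /gam (grad_comp1 ac sf (cimg_map dp) dF2).
by rewrite -!scalemxAl mx11Z.
Qed.

Lemma GamMr f h k p : smooth_fun f -> smooth_fun h ->
  Gam k (fun q => f q * h q) p = f p * Gam k h p + h p * Gam k f p.
Proof. by move=> sf sh; rewrite GamC GamMl // !(GamC k). Qed.

Lemma Gam_comp1r f k p (F : R -> R) F' : smooth_fun f -> is_derive (f p) 1 F F' ->
  Gam k (fun q => F (f q)) p = F' * Gam k f p.
Proof. by move=> sf dF; rewrite GamC (Gam_comp1l k sf dF) (GamC k). Qed.

Lemma Gam_cstl (a : R) k p : Gam (fun=> a) k p = 0.
Proof.
rewrite !GamU /gam (_ : grad _ (fun=> a) _ = 0) ?mul0mx ?mxE //.
apply/rowP => i; rewrite !mxE /partial.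
by rewrite (_ : (fun=> a) \o cinv _ = cst a) // derive_cst.
Qed.

Lemma Gam_ge0 f p : 0 <= Gam f f p.
Proof.
have [ac dp] := chart_atP p; rewrite GamU; apply: form_dual_ge0; first exact/gmx_sym/cimg_map.
by apply: gmx_pos => //; exact: cimg_map.
Qed.

Lemma Gam_CS f h p : Gam f h p ^+ 2 <= Gam f f p * Gam h h p.
Proof.
have [ac dp] := chart_atP p; rewrite !GamU; apply: form_CS; first exact/g_inv_sym/cimg_map.
move=> w; apply: form_dual_ge0; first exact/gmx_sym/cimg_map.
by apply: gmx_pos => //; exact: cimg_map.
Qed.

(** Components of the gradient multiplied by the volume density: their Euclidean divergence is the
    density times the Laplacian. *)
Definition flux_sealed : {F : chart R M N -> (M -> R) -> 'I_N -> 'rV[R]_N -> R |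
  F = fun c h i x => vol_density g c x * \sum_j invmx (g c x) i j * partial j (h \o cinv c) x}.
Proof. by eexists. Qed.

Definition flux := sval flux_sealed.

Lemma fluxU c h i x : flux c h i x =
  vol_density g c x * \sum_j invmx (g c x) i j * partial j (h \o cinv c) x.
Proof. by rewrite /flux (svalP flux_sealed). Qed.

Definition lapc_sealed : {F : chart R M N -> (M -> R) -> 'rV[R]_N -> R |
  F = fun c h x => (vol_density g c x)^-1 * \sum_i partial i (flux c h i) x}.
Proof. by eexists. Qed.

Definition lapc := sval lapc_sealed.

Lemma lapcU c h x : lapc c h x = (vol_density g c x)^-1 * \sum_i partial i (flux c h i) x.
Proof. by rewrite /lapc (svalP lapc_sealed). Qed.

Lemma laplacianE h p : laplacian g h p = lapc (chart_at p) h (cmap (chart_at p) p).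
Proof.
rewrite lapcU /laplacian; congr (_ * _); apply: eq_bigr => i _.
by congr (partial i _ _); apply/funext => x; rewrite fluxU.
Qed.

Lemma fluxE c h i : flux c h i = fun x =>
  vol_density g c x * \sum_j invmx (g c x) i j * partial j (h \o cinv c) x.
Proof. by apply/funext => x; exact: fluxU. Qed.

Lemma lapcE c h : lapc c h = fun x => (vol_density g c x)^-1 * \sum_i partial i (flux c h i) x.
Proof. by apply/funext => x; exact: lapcU. Qed.

Lemma flux_smooth c h i : atlas c -> smooth_fun h -> smooth_on (cimg c) (flux c h i).
Proof.
move=> ac sh; have oi := cimg_open ac; rewrite fluxE; apply: smooth_onM => //; first exact: vol_smooth.
apply: smooth_on_sum => // j _; apply: smooth_onM => //; first exact: g_inv_smooth.
exact: smooth_partial_chart.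
Qed.

Lemma lapc_smooth c h : atlas c -> smooth_fun h -> smooth_on (cimg c) (lapc c h).
Proof.
move=> ac sh; have oi := cimg_open ac; rewrite lapcE; apply: smooth_onM => //.
  apply: smooth_onV => //; first exact: vol_smooth.
  by move=> x ix; rewrite gt_eqF // vol_gt0.
by apply: smooth_on_sum => // i _; apply: smooth_on_partial; exact: flux_smooth.
Qed.

Lemma sum_grad_flux c f h x :
  \sum_i partial i (f \o cinv c) x * flux c h i x = vol_density g c x * gam c f h x.
Proof.
rewrite gamE mulr_sumr; apply: eq_bigr => i _.
rewrite !fluxU mulrCA; congr (_ * _); rewrite mulr_sumr; apply: eq_bigr => j _; ring.
Qed.

(** The identity [div (f grad h) = f Lap h + <df, dh>] with the volume density multiplied out, ready
    for Lebesgue integration in the chart. *)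
Lemma div_flux c f h x : atlas c -> smooth_fun f -> smooth_fun h -> cimg c x ->
  \sum_i partial i (fun y => f (cinv c y) * flux c h i y) x =
  vol_density g c x * (f (cinv c x) * lapc c h x + gam c f h x).
Proof.
move=> ac sf sh ix.
have E i : partial i (fun y => f (cinv c y) * flux c h i y) x =
    f (cinv c x) * partial i (flux c h i) x + flux c h i x * partial i (f \o cinv c) x.
  have dX := smooth_on_der i (flux_smooth i ac sh) ix.
  by have [_ <-] := is_deriveMf (derivableP (derivable_chart i ac sf ix)) (derivableP dX).
rewrite (eq_bigr _ (fun i _ => E i)) big_split /= -mulr_sumr mulrDr.
rewrite !lapcU; congr (_ + _).
  by rewrite mulrCA; congr (_ * _); rewrite mulVKf // gt_eqF // vol_gt0.
by rewrite -sum_grad_flux; apply: eq_bigr => i _; rewrite mulrC.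
Qed.

Lemma flux_near c f h p i : atlas c -> cdom c p -> (\near p, f p = h p) ->
  \forall y \near cmap c p, flux c f i y = flux c h i y.
Proof.
move=> ac dp H; have : nbhs p [set q | f q = h q] := H; rewrite nbhsE => -[W [oW Wp] HW].
have oc := cpre_open ac oW.
apply: (@filterS _ (nbhs (cmap c p)) _ (cpre c W)); last first.
  by apply: open_nbhs_nbhs; split=> //; split; [exact: cimg_map|rewrite /= cmapK].
move=> x [ix Wx]; rewrite !fluxU; congr (_ * _); apply: eq_bigr => j _; congr (_ * _).
rewrite /partial; apply: near_eq_derive.
apply: (@filterS _ (nbhs x) _ (cpre c W)); last by apply: open_nbhs_nbhs.
by move=> y [_ Wy] /=; exact: HW.
Qed.

Lemma lapc_near c f h p : atlas c -> cdom c p -> (\near p, f p = h p) ->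
  lapc c f (cmap c p) = lapc c h (cmap c p).
Proof.
move=> ac dp H.
have E i : partial i (flux c f i) (cmap c p) = partial i (flux c h i) (cmap c p).
  by apply: near_eq_derive; exact: flux_near.
rewrite !lapcU; exact: (congr1 (fun s => (vol_density g c (cmap c p))^-1 * s) (eq_bigr _ (fun i _ => E i))).
Qed.

Lemma laplacian_near f h p : (\near p, f p = h p) -> laplacian g f p = laplacian g h p.
Proof. by have [ac dp] := chart_atP p; rewrite !laplacianE; exact: lapc_near. Qed.

Lemma fluxM c f h i x : atlas c -> smooth_fun f -> smooth_fun h -> cimg c x ->
  flux c (fun p => f p * h p) i x = f (cinv c x) * flux c h i x + h (cinv c x) * flux c f i x.
Proof.
move=> ac sf sh ix; rewrite !fluxU.
have E j : partial j ((fun p => f p * h p) \o cinv c) x =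
    f (cinv c x) * partial j (h \o cinv c) x + h (cinv c x) * partial j (f \o cinv c) x.
  by have := gradM ac sf sh ix => /rowP/(_ j); rewrite !mxE.
under eq_bigr => j _ do rewrite E mulrDr !(mulrCA _ (_ (cinv c x))).
rewrite big_split /= -!mulr_sumr; ring.
Qed.

Lemma partial_near (U : set 'rV[R]_N) (F G : 'rV[R]_N -> R) i x : open U -> U x ->
  (forall y, U y -> F y = G y) -> partial i F x = partial i G x.
Proof. by move=> oU Ux FG; rewrite /partial; apply: near_eq_derive; exact: open_near_eq FG. Qed.

Lemma lapcM c f h x : atlas c -> smooth_fun f -> smooth_fun h -> cimg c x ->
  lapc c (fun p => f p * h p) x =
  f (cinv c x) * lapc c h x + h (cinv c x) * lapc c f x + 2 * gam c f h x.
Proof.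
move=> ac sf sh ix; have oi := cimg_open ac.
have v0 : vol_density g c x != 0 by rewrite gt_eqF // vol_gt0.
apply: (mulfI v0); rewrite [X in _ * X = _]lapcU mulVKf //.
have E i : partial i (flux c (fun p => f p * h p) i) x =
    partial i (fun y => f (cinv c y) * flux c h i y) x + partial i (fun y => h (cinv c y) * flux c f i y) x.
  rewrite (partial_near i oi ix (fun y iy => fluxM i ac sf sh iy)).
  have D (a b : M -> R) : smooth_fun a -> smooth_fun b ->
      derivable (fun y => a (cinv c y) * flux c b i y) x (delta_mx 0 i).
    move=> sa sb; apply: smooth_on_der ix; apply: smooth_onM => //; first exact: sa.
    exact: flux_smooth.
  by have [_ <-] := is_deriveDf (derivableP (D f h sf sh)) (derivableP (D h f sh sf)).
under eq_bigr => i _ do rewrite E.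
apply: etrans (big_split _ _ _ _ _) _.
apply: etrans (congr2 +%R (div_flux ac sf sh ix) (div_flux ac sh sf ix)) _.
rewrite (gamC h f ac ix).
by move: (vol_density g c x) (f _) (h _) (lapc c h x) (lapc c f x) (gam c f h x) => *; ring.
Qed.

Lemma lapcD c f h x : atlas c -> smooth_fun f -> smooth_fun h -> cimg c x ->
  lapc c (fun p => f p + h p) x = lapc c f x + lapc c h x.
Proof.
move=> ac sf sh ix; have oi := cimg_open ac; rewrite !lapcU -mulrDr -big_split /=.
congr (_ * _); apply: eq_bigr => i _.
have F y : cimg c y -> flux c (fun p => f p + h p) i y = flux c f i y + flux c h i y.
  move=> iy; rewrite !fluxU -mulrDr -big_split /=; congr (_ * _); apply: eq_bigr => j _.
  by rewrite -mulrDr; have := gradD ac sf sh iy => /rowP/(_ j); rewrite !mxE => ->.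
rewrite (partial_near i oi ix F).
have D a : smooth_fun a -> derivable (flux c a i) x (delta_mx 0 i).
  by move=> sa; apply: smooth_on_der (flux_smooth i ac sa) ix.
by have [_ <-] := is_deriveDf (derivableP (D f sf)) (derivableP (D h sh)).
Qed.

Lemma lapc_cst c (a : R) x : atlas c -> cimg c x -> lapc c (fun=> a) x = 0.
Proof.
move=> ac ix; rewrite !lapcU big1 ?mulr0 // => i _.
rewrite (_ : flux c _ i = cst 0); first by rewrite /partial derive_cst.
apply/funext => y; rewrite !fluxU big1 ?mulr0 // => j _.
by rewrite /partial (_ : (fun=> a) \o cinv _ = cst a) // derive_cst mulr0.
Qed.

Lemma lapc_comp1 c f x (F F' : R -> R) F'' (I : set R) : atlas c -> smooth_fun f -> cimg c x ->
  open I -> I (f (cinv c x)) ->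
  (forall t, I t -> is_derive t 1 F (F' t)) -> is_derive (f (cinv c x)) 1 F' F'' ->
  lapc c (fun p => F (f p)) x = F' (f (cinv c x)) * lapc c f x + F'' * gam c f f x.
Proof.
move=> ac sf ix oI Ix dF dF'; have oi := cimg_open ac.
have v0 : vol_density g c x != 0 by rewrite gt_eqF // vol_gt0.
apply: (mulfI v0); rewrite [X in _ * X = _]lapcU mulVKf //.
pose W := cimg c `&` (f \o cinv c) @^-1` I.
have oW : open W.
  apply: open_restrict_preimage => // y iy; exact: smooth_on_cont (sf c ac) iy.
have Wx : W x by split.
have FE i y : W y -> flux c (fun p => F (f p)) i y = F' (f (cinv c y)) * flux c f i y.
  move=> [iy Iy]; rewrite !fluxU mulrCA; congr (_ * _); rewrite mulr_sumr.
  apply: eq_bigr => j _.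
  have := grad_comp1 ac sf iy (dF _ Iy) => /rowP/(_ j); rewrite !mxE => ->; ring.
have E i : partial i (flux c (fun p => F (f p)) i) x =
    F' (f (cinv c x)) * partial i (flux c f i) x + F'' * (partial i (f \o cinv c) x * flux c f i x).
  rewrite (partial_near i oW Wx (FE i)).
  have d1 := is_derive_compf dF' (derivableP (derivable_chart i ac sf ix)).
  have d2 := derivableP (smooth_on_der i (flux_smooth i ac sf) ix).
  have [_] := is_deriveMf d1 d2; rewrite /partial => ->; ring.
rewrite (eq_bigr _ (fun i _ => E i)) big_split /= -!mulr_sumr sum_grad_flux mulrDr.
by congr (_ + _); [rewrite !lapcU mulrCA; congr (_ * _); rewrite mulVKf|ring].
Qed.

End Gradient.

(** * Integration on the manifold and Green's formula *)

Section Integration.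
Context {R : realType} {N : nat} {M : manifold R N}.
Variable g : metric M.
Variable mu : {measure set (borel M) -> \bar R}.
Hypothesis hmu : is_riemannian_measure g mu.
Implicit Types (c : chart R M N) (f h k F : M -> R) (p : M) (x : 'rV[R]_N).

(** Totalised, hence globally measurable, inverse chart. Off the chart image it returns the default
    [point], where [dens] is 0, so integrals against [dens] do not see that value. *)
Definition iota c (x : eucl N) : borel M := if `[< cimg c x >] then cinv c x else point.
Definition dens c (x : eucl N) : R := if `[< cimg c x >] then vol_density g c x else 0.

Lemma measurable_openM (W : set M) : open W -> measurable (W : set (borel M)).
Proof. by move=> oW; exact: sub_sigma_algebra. Qed.

Lemma measurable_closedM (W : set M) : closed W -> measurable (W : set (borel M)).
Proof. by move=> cW; rewrite -[W]setCK; apply: measurableC; apply: measurable_openM; exact: closed_openC. Qed.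

Lemma cont_measurableM F : continuous F -> measurable_fun [set: borel M] (F : borel M -> R).
Proof. by move=> cF; apply: (@cont_measurableR R M setT) => [|x _]; [exact: openT|exact: cF]. Qed.

Lemma iota_measurable c : atlas c -> measurable_fun [set: eucl N] (iota c).
Proof.
move=> ac; apply: (@measurability _ _ (eucl N) (borel M) setT _ (@open M) erefl) => _ [W oW <-].
rewrite setTI.
rewrite (_ : _ @^-1` _ = cpre c W `|` (if `[< W point >] then ~` cimg c else set0)).
  apply: measurableU; first by apply: (@bspace_open 'rV[R]_N); exact: cpre_open.
  case: ifP => _ //; apply: measurableC; apply: (@bspace_open 'rV[R]_N); exact: cimg_open.
apply/seteqP; split=> x; rewrite /iota /=.
  case: asboolP => ix Wx; first by left.
  by right; rewrite asboolT.
move=> [[ix Wx]|]; first by rewrite asboolT.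
by case: asboolP => // Wp ix; rewrite asboolF.
Qed.

Lemma dens_measurable c : atlas c -> measurable_fun [set: eucl N] (dens c).
Proof.
move=> ac; have oi := cimg_open ac.
rewrite (_ : dens c = (vol_density g c : eucl N -> R) \_ (cimg c)); last first.
  by apply/funext => x; rewrite /dens patchE; case: asboolP => H; [rewrite mem_set|rewrite memNset].
apply/(measurable_restrictT _ _).1; first exact: (@bspace_open 'rV[R]_N).
apply: (@cont_measurableR R 'rV[R]_N) => // x ix.
exact: smooth_on_cont (vol_smooth g ac) ix.
Qed.

Lemma dens_ge0 c x : 0 <= dens c x.
Proof. by rewrite /dens; case: ifP => // _; exact: sqrtr_ge0. Qed.

Lemma mu_chart c (B : set (borel M)) : atlas c -> measurable B -> B `<=` cdom c ->
  mu B = (\int[Leb N]_(x in iota c @^-1` B) (dens c x)%:E)%E.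
Proof.
move=> ac mB Bc; rewrite (hmu ac mB Bc).
have mpre : measurable (iota c @^-1` B).
  by rewrite -[X in measurable X]setTI; exact: iota_measurable.
have E x : (\1_(cmap c @` B) x * vol_density g c x)%:E =
    ((fun x => (dens c x)%:E) \_ (iota c @^-1` B)) x.
  rewrite patchE /dens indicE.
  have [ix|nix] := pselect (cimg c x).
    rewrite asboolT //; have -> : (x \in iota c @^-1` B) = (x \in cmap c @` B).
      apply/idP/idP; rewrite !inE /= /iota asboolT // => H.
        by exists (cinv c x); rewrite ?cinvK.
      by case: H => q Bq <-; rewrite cmapK //; exact: Bc.
    by case: (x \in _); rewrite ?mul1r ?mul0r.
  rewrite asboolF // memNset ?mul0r; last first.
    by move=> [q Bq xq]; apply: nix; exists q => //; exact: Bc.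
  by case: ifP.
rewrite [RHS]integral_mkcond (_ : (fun x => _) = ((fun x => (dens c x)%:E) \_ (iota c @^-1` B))); last exact/funext.
rewrite lebesgue_intE //.
  apply/(measurable_restrictT _ _).1 => //.
  by apply: measurable_funTS; apply/measurable_EFinP; exact: dens_measurable.
by move=> x; rewrite patchE; case: ifP => // _; rewrite lee_fin dens_ge0.
Qed.

Lemma dens0 c x : ~ cimg c x -> dens c x = 0.
Proof. by move=> nix; rewrite /dens asboolF. Qed.

Lemma int_chart c F : atlas c -> measurable_fun [set: borel M] (F : borel M -> R) ->
  (forall p, ~ cdom c p -> F p = 0) ->
  (\int[mu]_p (F p)%:E = \int[Leb N]_x (F (iota c x) * dens c x)%:E)%E.
Proof.
move=> ac mF F0.
have mU : measurable (cdom c : set (borel M)) by apply: measurable_openM; exact: cdom_open.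
apply: (integral_density (iota_measurable ac) (dens_measurable ac) (dens_ge0 c) mU) => //.
  by move=> B mB Bc; exact: mu_chart.
move=> x nx; apply: dens0 => ix; apply: nx; rewrite /iota asboolT //.
exact: cdom_inv.
Qed.

(** Each point has a neighbourhood of finite measure, namely a coordinate ball on which the density
    exceeds its central value by at most 1; finitely many of them cover. *)
Lemma mu_compact (K : set M) : compact K -> (mu K < +oo)%E.
Proof.
move=> cK.
have loc p : exists W : set M, [/\ open W, W p & (mu W < +oo)%E].
  have [ac dp] := chart_atP p; set c := chart_at p in ac dp; set x := cmap c p.
  have ix : cimg c x by exact: cimg_map.
  have cv := smooth_on_cont (vol_smooth g ac) ix.
  have [e e0 He] : exists2 e : R, 0 < e & forall y, `|x - y| < e ->
      cimg c y /\ vol_density g c y < vol_density g c x + 1.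
    have : \forall y \near x, cimg c y /\ vol_density g c y < vol_density g c x + 1.
      apply: filterI; first by apply: open_nbhs_nbhs; split => //; exact: cimg_open.
      by apply: (cv [set r | r < vol_density g c x + 1]); apply: lt_nbhsl; rewrite ltrDl.
    move=> /nbhs_ballP[e /= e0 He]; exists e => // y xy; apply: He.
    by rewrite -ball_normE.
  pose W := cdom c `&` cmap c @^-1` (ball x e).
  have oW : open W.
    apply: open_restrict_preimage; [exact: cdom_open|by move=> q; exact: cmap_cont|exact: ball_open].
  exists W; split => //; first by split => //; exact: ballxx.
  rewrite (@mu_chart c) //; [|exact: measurable_openM|by move=> q []].
  have mB := @measurable_box R N (`|x| + e).
  apply: (@le_lt_trans _ _ (\int[Leb N]_(y in @box R N (`|x| + e)) (vol_density g c x + 1)%:E)%E); last first.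
    rewrite integral_cst // lte_mul_pinfty ?lee_fin ?addr_ge0 ?sqrtr_ge0 //.
    exact: Leb_box.
  rewrite [leLHS]integral_mkcond [leRHS]integral_mkcond.
  have md : measurable_fun [set: eucl N] (fun y => (dens c y)%:E).
    by apply/measurable_EFinP; exact: dens_measurable.
  have mpre : measurable (iota c @^-1` (W : set (borel M))).
    rewrite -[X in measurable X]setTI; apply: iota_measurable => //; exact: measurable_openM.
  apply: ge0_le_integral => //.
  - by move=> y _; rewrite patchE; case: ifP => // _; rewrite lee_fin dens_ge0.
  - by apply/(measurable_restrictT _ _).1 => //; exact: measurable_funTS.
  - by apply/(measurable_restrictT _ _).1 => //; exact: measurable_cst.
  move=> y _; rewrite !patchE; case: ifPn => [|_]; last first.
    by case: ifP => // _; rewrite lee_fin addr_ge0 ?sqrtr_ge0.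
  rewrite inE /= /iota /dens; case: asboolP => [iy|niy] H; last first.
    by case: ifP => // _; rewrite lee_fin addr_ge0 ?sqrtr_ge0.
  move: H => [_]; rewrite /= cinvK // -ball_normE /= => xy.
  have [_ vy] := He y xy.
  rewrite mem_set ?lee_fin ?(ltW vy) // /box /=.
  rewrite -(subrK x y) addrC; apply: le_trans (ler_normD _ _) _.
  by rewrite lerD2l distrC ltW.
have /choice[W HW] := loc.
have := cK; rewrite compact_cover => /(_ M setT W) [].
- by move=> p _; have [] := HW p.
- by move=> p _; exists p => //; have [] := HW p.
move=> D _; rewrite /cover; set S := (X in bigcup X _) => KD.
have fS : finite_set S by exact: finite_fset.
pose UW : set (borel M) := bigcup S W.
have oUW : measurable UW.
  by apply: measurable_openM; apply: bigcup_open => p _; have [] := HW p.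
apply: (@le_lt_trans _ _ (mu UW)).
  apply: le_measure => //; rewrite inE //.
  by apply: measurable_closedM; exact: compact_closedM.
apply: (@le_lt_trans _ _ (\sum_(p \in S) mu (W p)))%E.
  apply: content_sub_fsum => //.
  by move=> p _; apply: measurable_openM; have [] := HW p.
rewrite fsbig_finite //= lte_sum_pinfty // => p _; by have [] := HW p.
Qed.

(* The product of an [LB] function and a [cs] function is integrable. *)
Definition LB F := measurable_fun [set: borel M] (F : borel M -> R) /\
  forall K : set M, compact K -> exists B, forall p, K p -> `|F p| <= B.

Definition cs F := exists2 K : set M, compact K & forall p, ~ K p -> F p = 0.

Lemma LB_smooth F : smooth_fun F -> LB F.
Proof.
move=> sF; have cF := smooth_fun_cont sF; split; first exact: cont_measurableM.
move=> K cK; have : compact (F @` K).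
  by apply: continuous_compact => //; exact: continuous_subspaceT.
move=> /compact_bounded[B [Br HB]]; exists (`|B| + 1) => p Kp.
apply: (HB (`|B| + 1)); first by rewrite (le_lt_trans (ler_norm B)) // ltrDl.
by exists p.
Qed.

Lemma LBD F G : LB F -> LB G -> LB (fun p => F p + G p).
Proof.
move=> [mF bF] [mG bG]; split; first exact: measurable_funD.
move=> K cK; have [A HA] := bF K cK; have [B HB] := bG K cK; exists (A + B) => p Kp.
by apply: le_trans (ler_normD _ _) _; rewrite lerD ?HA ?HB.
Qed.

Lemma LBM F G : LB F -> LB G -> LB (fun p => F p * G p).
Proof.
move=> [mF bF] [mG bG]; split; first exact: measurable_funM.
move=> K cK; have [A HA] := bF K cK; have [B HB] := bG K cK; exists (A * B) => p Kp.
by rewrite normrM ler_pM ?HA ?HB.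
Qed.

Lemma LB_bounded F (B : R) : measurable_fun [set: borel M] (F : borel M -> R) ->
  (forall p, `|F p| <= B) -> LB F.
Proof. by move=> mF bF; split => // K _; exists B. Qed.

Lemma LB_cst (a : R) : LB (fun=> a).
Proof. by apply: (@LB_bounded _ `|a|); first exact: measurable_cst. Qed.

Lemma LBN F : LB F -> LB (fun p => - F p).
Proof.
move=> lF; rewrite (_ : (fun p => - F p) = (fun p => -1 * F p)).
  exact: LBM (LB_cst _) lF.
by apply/funext => p; rewrite mulN1r.
Qed.

Lemma LBB F G : LB F -> LB G -> LB (fun p => F p - G p).
Proof. by move=> lF lG; exact: LBD lF (LBN lG). Qed.

Lemma LBX F (k : nat) : LB F -> LB (fun p => F p ^+ k).
Proof.
move=> lF; elim: k => [|k IH]; first by under eq_fun do rewrite expr0; exact: LB_cst.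
by under eq_fun do rewrite exprS; exact: LBM.
Qed.

Lemma LB_norm F : LB F -> LB (fun p => `|F p|).
Proof.
move=> [mF bF]; split; first exact: measurableT_comp.
by move=> K /bF[B HB]; exists B => p /HB; rewrite normr_id.
Qed.

Lemma cs_mull F G : cs F -> cs (fun p => G p * F p).
Proof. by move=> [K cK F0]; exists K => // p /F0 ->; rewrite mulr0. Qed.

Lemma cs_mulr F G : cs F -> cs (fun p => F p * G p).
Proof. by move=> [K cK F0]; exists K => // p /F0 ->; rewrite mul0r. Qed.

Lemma csD F G : cs F -> cs G -> cs (fun p => F p + G p).
Proof.
move=> [K cK F0] [L cL G0]; exists (K `|` L); first exact: compactU.
by move=> p H; rewrite F0 ?G0 ?addr0 // => ?; apply: H; [right|left].
Qed.

Lemma cs_sub F G : cs F -> (forall p, F p = 0 -> G p = 0) -> cs G.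
Proof. by move=> [K cK F0] H; exists K => // p /F0/H. Qed.

Lemma LB_integrable F : LB F -> cs F -> mu.-integrable setT (fun p : borel M => (F p)%:E).
Proof.
move=> [mF bF] [K cK F0].
have mK : measurable (K : set (borel M)) by apply: measurable_closedM; exact: compact_closedM.
have [B HB] := bF K cK.
have I : mu.-integrable (K : set (borel M)) (EFin \o (F : borel M -> R)).
  apply: measurable_bounded_integrable => //.
  - exact: mu_compact.
  - exact: measurable_funTS.
  - exists B; split; first exact: num_real.
    by move=> r Br p Kp /=; apply: le_trans (ltW Br); exact: HB.
have := (integrable_mkcond (EFin \o (F : borel M -> R)) mK).1 I.
apply: eq_integrable => // p _; rewrite patchE; case: ifPn => // /negP.
by rewrite inE => /F0 ->.
Qed.

Definition I F : R := Rintegral mu setT (F : borel M -> R).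

Lemma I_ext F G : (forall p, F p = G p) -> I F = I G.
Proof. by move=> E; congr (Rintegral _ _ _); apply/funext => p. Qed.

Lemma ID F G : LB F -> LB G -> cs F -> cs G -> I (fun p => F p + G p) = I F + I G.
Proof. by move=> lF lG cF cG; rewrite /I RintegralD //; exact: LB_integrable. Qed.

Lemma IZ (a : R) F : LB F -> cs F -> I (fun p => a * F p) = a * I F.
Proof. by move=> lF cF; rewrite /I RintegralZl //; exact: LB_integrable. Qed.

Lemma I_ge0 F : (forall p, 0 <= F p) -> 0 <= I F.
Proof. by move=> F0; apply: Rintegral_ge0 => p _. Qed.

Lemma I_le F G : LB F -> LB G -> cs F -> cs G -> (forall p, F p <= G p) -> I F <= I G.
Proof. by move=> lF lG cF cG FG; apply: le_Rintegral => //; exact: LB_integrable. Qed.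

Lemma I_int F : LB F -> cs F -> (\int[mu]_p (F p)%:E = (I F)%:E)%E.
Proof.
move=> lF cF; rewrite /I /Rintegral fineK //.
apply: integrable_fin_num => //; exact: LB_integrable.
Qed.

Lemma smooth_ext0 n (O K : set 'rV[R]_n) (X : 'rV[R]_n -> R) : open O -> compact K -> K `<=` O ->
  smooth_on O X -> (forall y, O y -> ~ K y -> X y = 0) ->
  smooth_on setT (fun y => if `[< O y >] then X y else 0).
Proof.
move=> oO cK KO sX X0; apply: smooth_on_loc => x _.
have oC : open (~` K).
  by apply: closed_openC; apply: compact_closed => //; exact: norm_hausdorff.
have [Ox|nOx] := pselect (O x).
  exists O; split => //; apply: smooth_on_ext sX => // y Oy; by rewrite asboolT.
exists (~` K); split; first by move=> /KO.
apply: (@smooth_on_ext _ _ _ (fun=> 0)) => //; last exact: smooth_on_cst.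
by move=> y nK; case: asboolP => // Oy; rewrite X0.
Qed.

Lemma compact_norm_bound n (K : set 'rV[R]_n) : compact K -> exists b, forall y, K y -> `|y| <= b.
Proof.
move=> /compact_bounded[B [Br HB]]; exists (`|B| + 1) => x Kx.
by apply: HB Kx; rewrite (le_lt_trans (ler_norm B)) // ltrDl.
Qed.

(* For the Laplacian of the chart [c], not yet known to be independent of [c]. *)
Lemma green_chart c f h (K : set M) : atlas c -> smooth_fun f -> smooth_fun h ->
  compact K -> K `<=` cdom c -> (forall p, ~ K p -> f p = 0) ->
  LB (fun p => f p * lapc g c h (cmap c p)) /\
  I (fun p => f p * lapc g c h (cmap c p) + Gam g f h p) = 0.
Proof.
move=> ac sf sh cK Kc f0; have oi := cimg_open ac.
have cK' : compact (cmap c @` K) by exact: cmap_compact.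
have Ki : cmap c @` K `<=` cimg c by move=> _ [p /Kc dp <-]; exact: cimg_map.
have f0i x : cimg c x -> ~ (cmap c @` K) x -> f (cinv c x) = 0.
  by move=> ix nK; apply: f0 => H; apply: nK; exists (cinv c x); rewrite ?cinvK.
have s1 : smooth_fun (fun p => f p * lapc g c h (cmap c p)).
  apply: smooth_fun_ext (smooth_fun_extend ac cK' Ki (F := fun x => f (cinv c x) * lapc g c h x) _ _).
  - move=> p; case: asboolP => dp; first by rewrite cmapK.
    by rewrite f0 ?mul0r // => /Kc.
  - by apply: smooth_onM => //; [exact: sf|exact: lapc_smooth].
  - by move=> x ix nK; rewrite f0i ?mul0r.
split; first exact: LB_smooth.
have G0 p : ~ K p -> Gam g f h p = 0.
  move=> nK; rewrite (@Gam_near _ _ _ _ _ (fun=> 0) _ h) ?Gam_cstl //.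
    apply: (@filterS _ (nbhs p) _ (~` K)); first by move=> q; exact: f0.
    by apply: open_nbhs_nbhs; split => //; apply: closed_openC; exact: compact_closedM.
  by near=> q.
set F := fun p => f p * lapc g c h (cmap c p) + Gam g f h p.
have sF : smooth_fun F := smooth_funD s1 (Gam_smooth g sf sh).
have F0 p : ~ K p -> F p = 0 by move=> nK; rewrite /F f0 // G0 // mul0r addr0.
have cF : cs F by exists K.
suff : ((I F)%:E = 0)%E by case.
rewrite -I_int //; last exact: LB_smooth.
rewrite (int_chart ac (LB_smooth sF).1); last by move=> p nd; apply: F0 => /Kc.
pose X i x := if `[< cimg c x >] then f (cinv c x) * flux g c h i x else 0.
have sX i : smooth_on setT (X i).
  apply: (smooth_ext0 oi cK' Ki).
    by apply: smooth_onM => //; [exact: sf|exact: flux_smooth].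
  by move=> x ix nK; rewrite f0i ?mul0r.
have [b Hb] := compact_norm_bound cK'.
have X0 i x : b < `|x| -> X i x = 0.
  move=> bx; rewrite /X; case: asboolP => // ix; rewrite f0i ?mul0r // => /Hb.
  by rewrite leNgt bx.
have dX0 i x : b < `|x| -> partial i (X i) x = 0.
  move=> bx; rewrite /partial (@near_eq_derive _ _ _ _ (cst 0)) ?derive_cst //.
  have nb : \forall y \near x, b < `|y|.
    by apply: (@norm_continuous _ 'rV[R]_N x [set r | b < r]); exact: lt_nbhsr.
  by apply: (@filterS _ (nbhs x) _ _ _ _ nb) => y /X0.
have cdX i : continuous (partial i (X i)).
  by move=> x; apply: (@smooth_on_cont _ _ setT) => //; exact: smooth_on_partial.
have E x : F (iota c x) * dens c x = \sum_i partial i (X i) x.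
  have [ix|nix] := pselect (cimg c x).
    rewrite /iota /dens !asboolT // /F cinvK // (GamE g ac sf sh (cdom_inv ac ix)) cinvK //.
    rewrite mulrC -div_flux //; apply: eq_bigr => i _.
    by apply: (partial_near i oi ix) => y iy; rewrite /X asboolT.
  rewrite dens0 // mulr0 big1 // => i _.
  rewrite (@partial_near _ _ (~` (cmap c @` K)) _ (fun=> 0)).
  - by rewrite /partial derive_cst.
  - by apply: closed_openC; apply: compact_closed => //; exact: norm_hausdorff.
  - by move=> /Ki.
  - by move=> y nK; rewrite /X; case: asboolP => // iy; rewrite f0i ?mul0r.
rewrite (_ : (fun x => _) = (fun x => (\sum_i (partial i (X i) x)%:E)%E)); last first.
  by apply/funext => x; rewrite E sumEFin.
rewrite integral_sum //.
  rewrite big1 // => i _; apply: (@integral_partial _ _ i (X i) b) => //.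
  - by move=> x; apply: (@smooth_on_cont _ _ setT).
  - by move=> x; apply: (@smooth_on_der _ _ setT).
  - exact: X0.
move=> i; have [B HB] := compact_support_bound (cdX i) (dX0 i).
apply: (cont_bounded_integrable _ HB (dX0 i)).
by apply: (@cont_measurableR R 'rV[R]_N setT) => [|x _]; [exact: openT|exact: cdX].
Unshelve. all: by end_near. Qed.

End Integration.

Section Laplacian.
Context {R : realType} {N : nat} {M : manifold R N}.
Variable g : metric M.
Variable mu : {measure set (borel M) -> \bar R}.
Hypothesis hmu : is_riemannian_measure g mu.
Implicit Types (c : chart R M N) (f h k F : M -> R) (p : M) (x : 'rV[R]_N).
Local Notation Gam := (Gam g).
Local Notation I := (I mu).

Lemma Leb_ball_pos n (y : 'rV[R]_n) (e : R) : 0 < e -> (0 < Leb n [set z | (`|y - z| <= e)%R])%E.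
Proof.
move=> e0; elim: n y => [|n IH] y.
  rewrite /= diracE mem_set ?lte_fin ?ltr01 //=.
  by apply: mx_norm_le => [|i []]; first exact: ltW.
pose J : set R := `[y 0 0 - e, y 0 0 + e]%classic.
pose B : set (eucl n) := [set z | `|rsubmx (y : 'rV[R]_(1 + n)) - z| <= e].
have mJ : measurable (J : set (measurableTypeR R)) by exact: measurable_itv.
have cl (m : nat) (w : 'rV[R]_m) : measurable ([set z | `|w - z| <= e] : set (eucl m)).
  by apply: (@bspace_closed 'rV[R]_m); exact: closed_closed_ball_.
have mB : measurable B by exact: cl.
rewrite /= /cons_sfm /= /cons_measure /pushforward.
apply: (@lt_le_trans _ _ ((@lebesgue_measure R \x Leb n)%E (J `*` B))).
  rewrite product_measure1E // mule_gt0 //; last exact: IH.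
  suff : (0 < @lebesgue_measure R J)%E by [].
  rewrite /J lebesgue_measure_itv /= lte_fin.
  have yy : y 0 0 - e < y 0 0 + e by lra.
  by rewrite yy -EFinB lte_fin subr_gt0.
apply: le_measure; rewrite ?inE.
- exact: measurableX.
- by rewrite -[X in measurable X]setTI; apply: (@measurable_cons R n) => //; exact: cl.
move=> [t z] [/= Jt Bz]; rewrite /cons_pair /= -(cons_coord_uncons y).
apply: cons_coord_dist => //.
  exact: ltW.
by move: Jt; rewrite /J /= in_itv /= => /andP[A B']; rewrite ler_distl; apply/andP; split; lra.
Qed.

Lemma mu_open_pos (W : set M) p : open W -> W p -> (0 < mu W)%E.
Proof.
move=> oW Wp; have [ac dp] := chart_atP p; set c := chart_at p in ac dp; set x := cmap c p.
have ix : cimg c x by exact: cimg_map.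
have cv := smooth_on_cont (vol_smooth g ac) ix.
have v0 := vol_gt0 g ac ix; set v := vol_density g c x in v0.
have [e e0 He] : exists2 e : R, 0 < e & forall y, `|x - y| <= e ->
    [/\ cimg c y, W (cinv c y) & v / 2 <= vol_density g c y].
  have : \forall y \near x, [/\ cimg c y, W (cinv c y) & v / 2 <= vol_density g c y].
    have N1 : nbhs x (cpre c W).
      by apply: open_nbhs_nbhs; split; [exact: cpre_open|split => //; rewrite /= cmapK].
    have N2 : nbhs x [set y | v / 2 < vol_density g c y].
      apply: (cv [set r | v / 2 < r]); apply: lt_nbhsr; rewrite -/v; lra.
    apply: (@filterS _ (nbhs x) _ _ _ _ (filterI N1 N2)).
    by move=> y [[A B] /= C]; split => //; exact: ltW.
  move=> /nbhs_ballP[e /= e0 He]; exists (e / 2); first by rewrite divr_gt0.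
  move=> y xy; apply: He; rewrite -ball_normE /=; apply: le_lt_trans xy _; lra.
pose B : set (eucl N) := [set z | `|x - z| <= e].
have mB : measurable B by apply: (@bspace_closed 'rV[R]_N); exact: closed_closed_ball_.
pose W' := W `&` cdom c.
have oW' : open W' by apply: openI => //; exact: cdom_open.
apply: (@lt_le_trans _ _ (mu W')); last first.
  by apply: le_measure; rewrite ?inE; [exact: measurable_openM|exact: measurable_openM|move=> q []].
rewrite (mu_chart hmu ac (measurable_openM oW')); last by move=> q [].
apply: (@lt_le_trans _ _ (\int[Leb N]_(y in B) (v / 2)%:E)%E).
  by rewrite integral_cst // mule_gt0 ?lte_fin ?divr_gt0 //; exact: Leb_ball_pos.
rewrite [leLHS]integral_mkcond [leRHS]integral_mkcond.
have mpre : measurable (iota c @^-1` (W' : set (borel M))).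
  rewrite -[X in measurable X]setTI; apply: iota_measurable => //; exact: measurable_openM.
apply: ge0_le_integral => //.
- by move=> y _; rewrite patchE; case: ifP => // _; rewrite lee_fin divr_ge0 // ltW.
- by apply/(measurable_restrictT _ _).1 => //; exact: measurable_cst.
- apply/(measurable_restrictT _ _).1 => //; apply: measurable_funTS; apply/measurable_EFinP.
  exact: dens_measurable.
move=> y _; rewrite !patchE; case: ifPn => [|_]; last first.
  by case: ifP => // _; rewrite lee_fin dens_ge0.
rewrite inE /B /= => /He[iy Wy vy]; rewrite mem_set.
  by rewrite /dens asboolT // lee_fin.
by rewrite /= /iota asboolT //; split => //; exact: cdom_inv.
Qed.

Lemma cont_lapc c h p : atlas c -> smooth_fun h -> cdom c p ->
  {for p, continuous (fun q => lapc g c h (cmap c q))}.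
Proof.
move=> ac sh dp; apply: continuous_comp; first exact: cmap_cont.
by apply: smooth_on_cont (lapc_smooth g ac sh) _; exact: cimg_map.
Qed.

(* Both charts compute the Laplacian weakly through Green's formula. *)
Lemma lapc_le c c' h p : atlas c -> atlas c' -> smooth_fun h -> cdom c p -> cdom c' p ->
  lapc g c h (cmap c p) <= lapc g c' h (cmap c' p).
Proof.
move=> ac ac' sh dp dp'; rewrite leNgt; apply/negP => lt.
set a := lapc g c' h (cmap c' p) in lt; set b := lapc g c h (cmap c p) in lt.
pose phi q := lapc g c h (cmap c q) - lapc g c' h (cmap c' q).
have phip : phi p = b - a by [].
have [d d0 dba] : exists2 d : R, 0 < d & d < b - a.
  clearbody a b; exists ((b - a) / 2); lra.
have cphi : {for p, continuous phi}.
  apply: (@continuousB _ _ _ (fun q => lapc g c h (cmap c q)) (fun q => lapc g c' h (cmap c' q))).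
    exact: cont_lapc.
  exact: cont_lapc.
have : nbhs p (cdom c' `&` [set q | d < phi q]).
  apply: filterI; first by apply: open_nbhs_nbhs; split => //; exact: cdom_open.
  apply: (cphi [set r | d < r]); by apply: lt_nbhsr; rewrite phip.
rewrite nbhsE => -[Q [oO Op] HO].
have [be [K [W [sbe be01 be0 [cK Kc KO] [oW Wp be1]]]]] := bump_exists ac dp oO Op.
have Kc' : K `<=` cdom c' by move=> q /KO/HO[].
have cbe : cs be by exists K.
have [l1 G1] := green_chart hmu ac sbe sh cK Kc be0.
have [l2 G2] := green_chart hmu ac' sbe sh cK Kc' be0.
have lG : LB (Gam be h) by apply: LB_smooth; exact: Gam_smooth.
have cG : cs (Gam be h).
  exists K => // q nK; rewrite (@Gam_near _ _ _ _ _ (fun=> 0) _ h) ?Gam_cstl //.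
    apply: (@filterS _ (nbhs q) _ (~` K)); first by move=> r; exact: be0.
    by apply: open_nbhs_nbhs; split => //; apply: closed_openC; exact: compact_closedM.
  by near=> r.
have c1 : cs (fun q => be q * lapc g c h (cmap c q)) by exact: cs_mulr.
have c2 : cs (fun q => be q * lapc g c' h (cmap c' q)) by exact: cs_mulr.
rewrite (ID hmu) // in G1; rewrite (ID hmu) // in G2.
have E : I (fun q => be q * lapc g c h (cmap c q)) = I (fun q => be q * lapc g c' h (cmap c' q)).
  by apply: (addIr (I (Gam be h))); exact: etrans G1 (esym G2).
have mW : measurable (W : set (borel M)) by exact: measurable_openM.
(* The gap [d] between the two Laplacians, multiplied by the indicator of the set where the bump is
   1; its positive integral contradicts the equality of the two weak forms. *)
pose w (q : M) : R := d * \1_W q.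
have lw : LB w.
  apply: (@LB_bounded _ _ _ _ d).
    by apply: measurable_funM; [exact: measurable_cst|exact: measurable_indic].
  move=> q.
  rewrite /w.
  rewrite indicE.
  case: (q \in W).
    rewrite mulr1.
    by rewrite (ger0_norm (ltW d0)).
  rewrite mulr0.
  rewrite normr0.
  exact: (ltW d0).
have WK q : W q -> K q.
  move=> Wq; apply: contrapT => nK; have := be1 q Wq; rewrite be0 // => /eqP.
  by rewrite eq_sym oner_eq0.
have cw : cs w.
  exists K => // q nK; rewrite /w indicE memNset ?mulr0 // => /WK //.
have : I (fun q => w q + be q * lapc g c' h (cmap c' q)) <= I (fun q => be q * lapc g c h (cmap c q)).
  apply: (I_le hmu) => //; [exact: LBD|exact: csD|].
  move=> q; have [Kq|nK] := pselect (K q); last first.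
    rewrite be0 // !mul0r addr0 /w indicE memNset ?mulr0 // => /WK //.
  have [_ /= dq] := HO _ (KO _ Kq); rewrite /phi in dq.
  have /andP[b0 b1] := be01 q.
  have [Wq|nW] := pselect (W q).
    by rewrite be1 // /w indicE mem_set // mulr1; lra.
  rewrite /w indicE memNset // mulr0 add0r ler_wpM2l //; lra.
rewrite (ID hmu) // E -subr_ge0 opprD addrCA subrr addr0 oppr_ge0.
suff : 0 < I w by rewrite ltNge => /negP.
suff : (0 < (I w)%:E)%E by [].
rewrite -(I_int hmu) //.
have -> : (\int[mu]_q (w q)%:E = d%:E * mu W)%E.
  under eq_integral do rewrite /w EFinM.
  by rewrite ge0_integralZl_EFin ?(ltW d0) // ?integral_indic ?setIT //; apply/measurable_EFinP; exact: measurable_indic.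
by rewrite mule_gt0 ?lte_fin //; exact: mu_open_pos Wp.
Unshelve. all: by end_near. Qed.

Definition Lap_sealed : {L : (M -> R) -> M -> R | L = laplacian g}.
Proof. by eexists. Qed.

Definition Lap := sval Lap_sealed.

Lemma LapU h p : Lap h p = lapc g (chart_at p) h (cmap (chart_at p) p).
Proof. by rewrite /Lap (svalP Lap_sealed) laplacianE. Qed.

Lemma Lap_laplacian : Lap = laplacian g.
Proof. exact: (svalP Lap_sealed). Qed.

Lemma LapE c h p : atlas c -> smooth_fun h -> cdom c p -> Lap h p = lapc g c h (cmap c p).
Proof.
move=> ac sh dp; have [ac' dp'] := chart_atP p.
rewrite LapU; apply/eqP; rewrite eq_le; apply/andP; split.
  exact: (lapc_le ac' ac sh dp' dp).
exact: (lapc_le ac ac' sh dp dp').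
Qed.

Lemma Lap_smooth h : smooth_fun h -> smooth_fun (Lap h).
Proof.
move=> sh c ac; apply: smooth_on_ext (lapc_smooth g ac sh); first exact: cimg_open.
move=> x ix; exact: (esym (etrans (LapE ac sh (cdom_inv ac ix)) (congr1 (lapc g c h) (cinvK ac ix)))).
Qed.

Lemma Gam_cs f h : cs f -> cs (Gam f h).
Proof.
move=> [K cK f0]; exists K => // q nK.
rewrite (@Gam_near _ _ _ _ _ (fun=> 0) _ h) ?Gam_cstl //.
  apply: (@filterS _ (nbhs q) _ (~` K)); first by move=> r; exact: f0.
  by apply: open_nbhs_nbhs; split => //; apply: closed_openC; exact: compact_closedM.
by near=> r.
Unshelve. all: by end_near. Qed.

Lemma Lap_cst (a : R) p : Lap (fun=> a) p = 0.
Proof.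
by have [ac dp] := chart_atP p; rewrite LapU lapc_cst //; exact: cimg_map.
Qed.

Lemma Lap_cs f : cs f -> cs (Lap f).
Proof.
move=> [K cK f0]; exists K => // q nK.
rewrite -(Lap_cst 0 q) Lap_laplacian; apply: laplacian_near.
apply: (@filterS _ (nbhs q) _ (~` K)); first by move=> r; exact: f0.
by apply: open_nbhs_nbhs; split => //; apply: closed_openC; exact: compact_closedM.
Qed.

Lemma LapM f h p : smooth_fun f -> smooth_fun h ->
  Lap (fun q => f q * h q) p = f p * Lap h p + h p * Lap f p + 2 * Gam f h p.
Proof.
move=> sf sh; have [ac dp] := chart_atP p.
by rewrite !LapU GamU lapcM // ?cmapK //; exact: cimg_map.
Qed.

Lemma LapD f h p : smooth_fun f -> smooth_fun h ->
  Lap (fun q => f q + h q) p = Lap f p + Lap h p.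
Proof.
by move=> sf sh; have [ac dp] := chart_atP p; rewrite !LapU lapcD //; exact: cimg_map.
Qed.

Lemma Lap_comp1 f p (F F' : R -> R) (F'' : R) (J : set R) : smooth_fun f ->
  open J -> J (f p) -> (forall t : R, J t -> is_derive t 1 F (F' t)) ->
  is_derive (f p) 1 F' F'' ->
  Lap (fun q => F (f q)) p = F' (f p) * Lap f p + F'' * Gam f f p.
Proof.
move=> sf oJ Jp dF dF'; have [ac dp] := chart_atP p.
have Jp' : J (f (cinv (chart_at p) (cmap (chart_at p) p))) by rewrite cmapK.
have dF2 : is_derive (f (cinv (chart_at p) (cmap (chart_at p) p))) 1 F' F'' by rewrite cmapK.
rewrite !LapU GamU (lapc_comp1 g ac sf (cimg_map dp) oJ Jp' dF dF2).
by rewrite cmapK.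
Qed.

(* The support of [f] is covered by finitely many bumps [b]; then split
   [f = f b + f (1 - b)] until nothing is left. *)
Theorem green f h : smooth_fun f -> smooth_fun h -> cs f ->
  I (fun p => f p * Lap h p) = - I (Gam f h).
Proof.
move=> sf sh cf.
pose good (b : M -> R) := smooth_fun b /\ exists c, exists K : set M,
  [/\ atlas c, compact K, K `<=` cdom c & forall p, ~ K p -> b p = 0].
have loc (p : M) : exists bW : (M -> R) * set M, [/\ good bW.1, open bW.2, bW.2 p & forall q, bW.2 q -> bW.1 q = 1].
  have [ac dp] := chart_atP p.
  have [b [K [W [sb _ b0 [cK Kc _] [oW Wp b1]]]]] := bump_exists ac dp (@openT M) (Logic.I : setT p).
  by exists (b, W); split => //; split => //; exists (chart_at p), K.
have /choice[bW HW] := loc.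
case: (cf) => K cK f0.
have := cK; rewrite compact_cover => /(_ M setT (fun p => (bW p).2)) [].
- by move=> p _; have [] := HW p.
- by move=> p _; exists p => //; have [] := HW p.
move=> D _; rewrite /cover; set S := (X in bigcup X _) => KD.
have /finite_seqP[s0 Ss] : finite_set S by exact: finite_fset.
have lS (u : M -> R) : smooth_fun u -> LB u := @LB_smooth _ _ _ u.
suff H : forall s : seq M, forall u, smooth_fun u -> cs u ->
    (forall p, u p * \prod_(q <- s) (1 - (bW q).1 p) = 0) ->
    I (fun p => u p * Lap h p) + I (Gam u h) = 0.
  have : I (fun p => f p * Lap h p) + I (Gam f h) = 0.
    apply: (H s0) => // p; have [Kp|nK] := pselect (K p); last by rewrite f0 // mul0r.
    have [q qD Wq] := KD _ Kp; rewrite Ss /= in qD.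
    rewrite (big_rem q) //=; have [_ _ _ ->] := HW q; last by [].
    by rewrite subrr mul0r mulr0.
  by move/eqP; rewrite addr_eq0 => /eqP.
elim=> [|q s IH] u su cu u0.
  have u00 p : u p = 0 by have := u0 p; rewrite big_nil mulr1.
  have -> : u = (fun=> 0) by apply/funext.
  rewrite (@I_ext _ _ _ mu _ (fun=> 0 * 0)); last by move=> p; rewrite !mul0r.
  rewrite (@I_ext _ _ _ mu (Gam _ _) (fun=> 0 * 0)); last by move=> p; rewrite Gam_cstl mulr0.
  rewrite (IZ hmu) ?mul0r ?addr0 //; first exact: LB_cst.
  by exists set0 => //; exact: compact0.
have [[sb [c [K' [ac cK' Kc' b0]]]] _ _ _] := HW q; set b := (bW q).1 in sb b0 u0.
have s1 : smooth_fun (fun p => u p * b p) by exact: smooth_funM.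
have s1b : smooth_fun (fun p => 1 - b p) by exact: smooth_funB (smooth_fun_cst _) sb.
have s2 : smooth_fun (fun p => u p * (1 - b p)) by exact: smooth_funM.
have c1 : cs (fun p => u p * b p) by exact: cs_mulr.
have c2 : cs (fun p => u p * (1 - b p)) by exact: cs_mulr.
have E1 : I (fun p => u p * b p * Lap h p) + I (Gam (fun p => u p * b p) h) = 0.
  have b0' p : ~ K' p -> u p * b p = 0 by move=> /b0 ->; rewrite mulr0.
  have [l1 G1] := green_chart hmu ac s1 sh cK' Kc' b0'.
  rewrite -(ID hmu).
  - have EE p : u p * b p * Lap h p = u p * b p * lapc g c h (cmap c p).
      have [Kp|nK] := pselect (K' p).
        exact: (congr1 ( *%R (u p * b p)) (LapE ac sh (Kc' p Kp))).
      have e0 := b0' p nK.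
      rewrite e0.
      rewrite mul0r.
      rewrite mul0r.
      by [].
    apply: etrans G1.
    apply: I_ext => p.
    exact: (congr1 (+%R^~ _) (EE p)).
  - exact: LBM (lS _ s1) (lS _ (Lap_smooth sh)).
  - exact: lS _ (Gam_smooth g s1 sh).
  - exact: cs_mulr.
  - exact: Gam_cs.
have E2 : I (fun p => u p * (1 - b p) * Lap h p) + I (Gam (fun p => u p * (1 - b p)) h) = 0.
  by apply: IH => // p; have := u0 p; rewrite big_cons mulrA.
have -> : I (fun p => u p * Lap h p) = I (fun p => u p * b p * Lap h p) + I (fun p => u p * (1 - b p) * Lap h p).
  rewrite -(ID hmu); first by apply: I_ext => p; ring.
  - exact: LBM (lS _ s1) (lS _ (Lap_smooth sh)).
  - exact: LBM (lS _ s2) (lS _ (Lap_smooth sh)).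
  - exact: cs_mulr.
  - exact: cs_mulr.
have -> : I (Gam u h) = I (Gam (fun p => u p * b p) h) + I (Gam (fun p => u p * (1 - b p)) h).
  rewrite -(ID hmu).
  - apply: I_ext => p; apply: etrans (GamDl g h p s1 s2).
    by apply: Gam_near; near=> y => //; ring.
  - exact: lS _ (Gam_smooth g s1 sh).
  - exact: lS _ (Gam_smooth g s2 sh).
  - exact: Gam_cs.
  - exact: Gam_cs.
lra.
Unshelve. all: by end_near. Qed.

End Laplacian.

(** * Hessian and Carleman identity *)

Section PartialCalculus.
Context {R : realType} {n : nat} (U : set 'rV[R]_n) (x : 'rV[R]_n).
Hypothesis Ux : U x.
Implicit Types (a b : 'rV[R]_n -> R) (i : 'I_n).

Lemma partialM i a b : smooth_on U a -> smooth_on U b ->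
  partial i (fun y => a y * b y) x = a x * partial i b x + b x * partial i a x.
Proof.
move=> sa sb.
by rewrite /partial (@derive_val _ _ _ _ _ _ _ (is_deriveMf (derivableP (smooth_on_der sa Ux)) (derivableP (smooth_on_der sb Ux)))).
Qed.

Lemma partialD i a b : smooth_on U a -> smooth_on U b ->
  partial i (fun y => a y + b y) x = partial i a x + partial i b x.
Proof.
move=> sa sb.
by rewrite /partial (@derive_val _ _ _ _ _ _ _ (is_deriveDf (derivableP (smooth_on_der sa Ux)) (derivableP (smooth_on_der sb Ux)))).
Qed.

Lemma partial_sum (T : Type) (r : seq T) (F : T -> 'rV[R]_n -> R) i : open U ->
  (forall t, smooth_on U (F t)) ->
  partial i (fun y => \sum_(t <- r) F t y) x = \sum_(t <- r) partial i (F t) x.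
Proof.
move=> oU sF; elim: r => [|t r IH].
  rewrite big_nil (_ : (fun y => _) = cst 0); first by rewrite /partial derive_cst.
  by apply/funext => y; rewrite big_nil.
rewrite big_cons (_ : (fun y => _) = (fun y => F t y + \sum_(t <- r) F t y)); last first.
  by apply/funext => y; rewrite big_cons.
rewrite partialD ?IH //; apply: smooth_on_sum => // j _; exact: sF.
Qed.

(** Here [W] is the differential of a function, [X] a vector field and [a] the inverse metric. The
    derivatives of [W] cancel by the symmetry of [a] and of the second derivatives, so what remains
    is a quadratic form in [W] itself. *)
Lemma hes_algebra (W X : 'I_n -> 'rV[R]_n -> R) (a : 'I_n -> 'I_n -> 'rV[R]_n -> R) : open U ->
  (forall i, smooth_on U (W i)) -> (forall i, smooth_on U (X i)) ->
  (forall i j, smooth_on U (a i j)) -> (forall i j, a i j x = a j i x) ->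
  (forall i j, partial i (W j) x = partial j (W i) x) ->
  (\sum_i \sum_k a i k x * W i x * partial k (fun y => \sum_j X j y * W j y) x) -
  2^-1 * (\sum_l X l x * partial l (fun y => \sum_i \sum_j a i j y * (W i y * W j y)) x) =
  \sum_i \sum_j (\sum_k a i k x * partial k (X j) x - 2^-1 * \sum_l X l x * partial l (a i j) x) *
    (W i x * W j x).
Proof.
move=> oU sW sX sa asym WC.
have sXW i : smooth_on U (fun y => X i y * W i y) by exact: smooth_onM oU (sX i) (sW i).
have sWW i j : smooth_on U (fun y => W i y * W j y) by exact: smooth_onM oU (sW i) (sW j).
have saWW i j : smooth_on U (fun y => a i j y * (W i y * W j y)) by exact: smooth_onM oU (sa i j) (sWW i j).
have E1 k : partial k (fun y => \sum_j X j y * W j y) x = \sum_j (X j x * partial k (W j) x + W j x * partial k (X j) x).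
  by rewrite (partial_sum _ _ oU sXW); apply: eq_bigr => j _; exact: partialM (sX j) (sW j).
have E2 l : partial l (fun y => \sum_i \sum_j a i j y * (W i y * W j y)) x =
    \sum_i \sum_j (partial l (a i j) x * (W i x * W j x) +
       a i j x * (W i x * partial l (W j) x + W j x * partial l (W i) x)).
  rewrite (partial_sum _ _ oU (fun i => smooth_on_sum _ oU (fun j _ => saWW i j))); apply: eq_bigr => i _.
  rewrite (partial_sum _ _ oU (saWW i)); apply: eq_bigr => j _.
  rewrite (partialM l (sa i j) (sWW i j)) (partialM l (sW i) (sW j)); ring.
under eq_bigr do under eq_bigr do rewrite E1.
under [X in _ - 2^-1 * X]eq_bigr do rewrite E2.
have H1 : \sum_i \sum_k a i k x * W i x * (\sum_j (X j x * partial k (W j) x + W j x * partial k (X j) x)) =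
    \sum_i \sum_j (\sum_k a i k x * partial k (X j) x) * (W i x * W j x) +
    \sum_l X l x * \sum_i \sum_j a i j x * W i x * partial l (W j) x.
  transitivity (\sum_i \sum_j (\sum_k a i k x * partial k (X j) x) * (W i x * W j x) +
      \sum_i \sum_k \sum_j a i k x * W i x * X j x * partial k (W j) x).
    rewrite -big_split /=; apply: eq_bigr => i _.
    have -> : \sum_j (\sum_k a i k x * partial k (X j) x) * (W i x * W j x) =
        \sum_k \sum_j a i k x * W i x * (W j x * partial k (X j) x).
      rewrite exchange_big /=; apply: eq_bigr => j _; rewrite mulr_suml; apply: eq_bigr => k _; ring.
    rewrite -big_split /=; apply: eq_bigr => k _; rewrite mulr_sumr -big_split /=.
    apply: eq_bigr => j _; ring.
  congr (_ + _).
  transitivity (\sum_i \sum_l \sum_k a i k x * W i x * X l x * partial k (W l) x).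
    by apply: eq_bigr => i _; rewrite exchange_big.
  rewrite exchange_big /=; apply: eq_bigr => l _; rewrite mulr_sumr; apply: eq_bigr => i _.
  rewrite mulr_sumr; apply: eq_bigr => k _; rewrite WC; ring.
have H2 : \sum_l X l x * (\sum_i \sum_j (partial l (a i j) x * (W i x * W j x) +
       a i j x * (W i x * partial l (W j) x + W j x * partial l (W i) x))) =
    \sum_i \sum_j (\sum_l X l x * partial l (a i j) x) * (W i x * W j x) +
    2 * \sum_l X l x * \sum_i \sum_j a i j x * W i x * partial l (W j) x.
  transitivity (\sum_l (X l x * (\sum_i \sum_j partial l (a i j) x * (W i x * W j x)) +
       2 * (X l x * \sum_i \sum_j a i j x * W i x * partial l (W j) x))).
    apply: eq_bigr => l _; rewrite -mulrCA -mulrDr; congr (_ * _).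
    have S : \sum_i \sum_j a i j x * W i x * partial l (W j) x = \sum_i \sum_j a i j x * W j x * partial l (W i) x.
      rewrite exchange_big /=; apply: eq_bigr => i _; apply: eq_bigr => j _; rewrite asym; ring.
    rewrite mulr2n mulrDl mul1r {2}S -!big_split /=; apply: eq_bigr => i _.
    rewrite -!big_split /=; apply: eq_bigr => j _; ring.
  rewrite big_split /= -mulr_sumr; congr (_ + _).
  under eq_bigr do rewrite mulr_sumr.
  rewrite exchange_big /=; apply: eq_bigr => i _.
  under eq_bigr do rewrite mulr_sumr.
  rewrite exchange_big /=; apply: eq_bigr => j _; rewrite mulr_suml; apply: eq_bigr => l _; ring.
rewrite H1 H2.
set Z := \sum_l X l x * _.
have -> : \sum_i \sum_j (\sum_k a i k x * partial k (X j) x - 2^-1 * \sum_l X l x * partial l (a i j) x) * (W i x * W j x) =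
   \sum_i \sum_j (\sum_k a i k x * partial k (X j) x) * (W i x * W j x) -
   2^-1 * \sum_i \sum_j (\sum_l X l x * partial l (a i j) x) * (W i x * W j x).
  rewrite mulr_sumr -sumrB; apply: eq_bigr => i _; rewrite mulr_sumr -sumrB; apply: eq_bigr => j _.
  by rewrite mulrBl -(mulrA 2^-1).
by field.
Qed.

End PartialCalculus.

Section ChartBounded.
Context {R : realType} {N : nat} {M : manifold R N}.

Lemma chart_bounded (c : chart R M N) (K : set M) (F : 'rV[R]_N -> R) : atlas c -> compact K ->
  K `<=` cdom c -> smooth_on (cimg c) F ->
  exists2 B : R, 0 <= B & forall p, K p -> `|F (cmap c p)| <= B.
Proof.
move=> ac cK Kc sF; have : compact (F @` (cmap c @` K)).
  apply: continuous_compact; last exact: cmap_compact.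
  apply: continuous_in_subspaceT => x; rewrite inE => -[p /Kc dp <-].
  by apply: smooth_on_cont sF _; exact: cimg_map.
move=> /compact_bounded[B [Br HB]]; exists (`|B| + 1) => [|p Kp]; first by rewrite addr_ge0.
apply: (HB (`|B| + 1)); first by rewrite (le_lt_trans (ler_norm B)) // ltrDl.
by exists (cmap c p) => //; exists p.
Qed.

End ChartBounded.

Section Hessian.
Context {R : realType} {N : nat} {M : manifold R N}.
Variable g : metric M.
Implicit Types (c : chart R M N) (f h w psi th : M -> R) (p : M) (x : 'rV[R]_N).
Local Notation Gam := (Gam g).

(* Twice-contracted covariant Hessian of [psi] along the gradient of [w]. *)
Definition Hes psi w p := Gam w (Gam psi w) p - 2^-1 * Gam psi (Gam w w) p.

Lemma HesU psi w p : Hes psi w p = Gam w (Gam psi w) p - 2^-1 * Gam psi (Gam w w) p.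
Proof. by []. Qed.

Definition dual_grad c th i x := \sum_j invmx (g c x) i j * partial j (th \o cinv c) x.

(** The symmetric part is minus one half of the Lie derivative of the inverse metric along the
    gradient of [th], that is the Hessian of [th] with both indices raised. *)
Definition hes_coef c th i j x :=
  \sum_k invmx (g c x) i k * partial k (dual_grad c th j) x -
  2^-1 * \sum_l dual_grad c th l x * partial l (fun y => invmx (g c y) i j) x.

Lemma dual_grad_smooth c th i : atlas c -> smooth_fun th -> smooth_on (cimg c) (dual_grad c th i).
Proof.
move=> ac sth; have oi := cimg_open ac; apply: smooth_on_sum => // j _.
apply: smooth_onM => //; [exact: g_inv_smooth|exact: smooth_partial_chart].
Qed.

Lemma hes_coef_smooth c th i j : atlas c -> smooth_fun th -> smooth_on (cimg c) (hes_coef c th i j).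
Proof.
move=> ac sth; have oi := cimg_open ac; apply: smooth_onD => //.
  apply: smooth_on_sum => // k _; apply: smooth_onM => //; first exact: g_inv_smooth.
  by apply: smooth_on_partial; exact: dual_grad_smooth.
rewrite (_ : (fun _ => _) = (fun x => (- 2^-1) * \sum_l dual_grad c th l x * partial l (fun y => invmx (g c y) i j) x)); last first.
  by apply/funext => x; rewrite mulNr.
apply: smooth_onM => //; first exact: smooth_on_cst.
apply: smooth_on_sum => // k _; apply: smooth_onM => //; first exact: dual_grad_smooth.
by apply: smooth_on_partial; exact: g_inv_smooth.
Qed.

Lemma gam_dual c th h x : atlas c -> cimg c x ->
  gam g c th h x = \sum_i dual_grad c th i x * partial i (h \o cinv c) x.
Proof.
move=> ac ix; rewrite gamE exchange_big /=; apply: eq_bigr => i _.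
rewrite /dual_grad mulr_suml; apply: eq_bigr => j _; congr (_ * _ * _).
by rewrite -[in LHS](g_inv_sym g ac ix) mxE.
Qed.

Lemma HesE c th w p : atlas c -> smooth_fun th -> smooth_fun w -> cdom c p ->
  Hes th w p = \sum_i \sum_j hes_coef c th i j (cmap c p) *
    (partial i (w \o cinv c) (cmap c p) * partial j (w \o cinv c) (cmap c p)).
Proof.
move=> ac sth sw dp; have oi := cimg_open ac; have ix : cimg c (cmap c p) by exact: cimg_map.
have asym i j : invmx (g c (cmap c p)) i j = invmx (g c (cmap c p)) j i.
  by rewrite -[in LHS](g_inv_sym g ac ix) mxE.
have WC i j : partial i (partial j (w \o cinv c)) (cmap c p) = partial j (partial i (w \o cinv c)) (cmap c p).
  exact: (partialC _ _ oi ((smooth_onP _ _).1 (sw c ac) 2%N) ix).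
have H := hes_algebra ix (W := fun i => partial i (w \o cinv c)) oi (fun i => smooth_partial_chart i ac sw)
  (fun i => dual_grad_smooth i ac sth) (fun i j => g_inv_smooth g i j ac) asym WC.
apply: etrans H.
rewrite /Hes (GamE g ac sw (Gam_smooth g sth sw) dp) (GamE g ac sth (Gam_smooth g sw sw) dp).
rewrite gamE (gam_dual _ _ ac ix).
have E1 k : partial k (Gam th w \o cinv c) (cmap c p) =
    partial k (fun y => \sum_j dual_grad c th j y * partial j (w \o cinv c) y) (cmap c p).
  apply: (partial_near k oi ix) => y iy /=.
  by rewrite (GamE g ac sth sw (cdom_inv ac iy)) (cinvK ac iy) (gam_dual _ _ ac iy).
have E2 k : partial k (Gam w w \o cinv c) (cmap c p) =
    partial k (fun y => \sum_i \sum_j invmx (g c y) i j * (partial i (w \o cinv c) y * partial j (w \o cinv c) y)) (cmap c p).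
  apply: (partial_near k oi ix) => y iy /=.
  rewrite (GamE g ac sw sw (cdom_inv ac iy)) (cinvK ac iy) gamE.
  by apply: eq_bigr => i _; apply: eq_bigr => j _; rewrite mulrA.
by under eq_bigr do under eq_bigr do rewrite E1; under [X in _ - 2^-1 * X]eq_bigr do rewrite E2.
Qed.

(** [HesE] shows that second derivatives of [w] drop out. The coefficients are bounded on [K], and
    the coordinate derivatives of [w] are controlled by [Gam w w] through [coord_dual_bound]. *)
Lemma Hes_bound c th (K : set M) : atlas c -> smooth_fun th -> compact K -> K `<=` cdom c ->
  exists2 C : R, 0 <= C & forall w p, smooth_fun w -> K p -> `|Hes th w p| <= C * Gam w w p.
Proof.
move=> ac sth cK Kc.
have /choice[b Hb] : forall ij : 'I_N * 'I_N, exists B : R, forall p, K p -> `|hes_coef c th ij.1 ij.2 (cmap c p)| <= B.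
  by move=> ij; have [B _ HB] := chart_bounded ac cK Kc (hes_coef_smooth ij.1 ij.2 ac sth); exists B.
have /choice[d Hd] : forall i : 'I_N, exists B : R, forall p, K p -> `|g c (cmap c p) i i| <= B.
  by move=> i; have [B _ HB] := chart_bounded ac cK Kc (gmx_smooth g ac i i); exists B.
exists (\sum_i \sum_j `|b (i, j)| * (`|d i| + `|d j|)).
  by apply: sumr_ge0 => i _; apply: sumr_ge0 => j _; rewrite mulr_ge0 ?addr_ge0.
move=> w p sw Kp; have dp := Kc p Kp; have ix := cimg_map dp.
rewrite (HesE ac sth sw dp); set x := cmap c p; set G := Gam w w p.
have G0 : 0 <= G by exact: Gam_ge0.
have wb i : partial i (w \o cinv c) x ^+ 2 <= `|d i| * G.
  have := @coord_dual_bound _ _ (g c x) (grad c w x) i (gmx_sym g ac ix) (gmx_pos g ac ix).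
  rewrite -[X in _ <= _ * X -> _]/(gam g c w w x) -(GamE g ac sw sw dp) -/G mxE => H.
  apply: le_trans H _; rewrite ler_wpM2r //; apply: le_trans (ler_norm _) _.
  by apply: le_trans (Hd i p Kp) (ler_norm _).
rewrite mulr_suml; apply: le_trans (ler_norm_sum _ _ _) _; apply: ler_sum => i _.
rewrite mulr_suml; apply: le_trans (ler_norm_sum _ _ _) _; apply: ler_sum => j _.
rewrite normrM -mulrA; apply: ler_pM => //.
  by apply: le_trans (Hb (i, j) p Kp) (ler_norm _).
rewrite mulrDl; move: (wb i) (wb j).
move: (partial i _ x) (partial j _ x) (`|d i| * G) (`|d j| * G) => s t A B.
move=> sA tB; rewrite ler_norml; apply/andP; split; nra.
Qed.

End Hessian.

(** * Integration modulo divergences *)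

Section Divergence.
Context {R : realType} {N : nat} {M : manifold R N}.
Variable g : metric M.
Variable mu : {measure set (borel M) -> \bar R}.
Hypothesis hmu : is_riemannian_measure g mu.
Implicit Types (f h v w psi sg : M -> R) (F G S : M -> R) (p : M).
Local Notation Gam := (Gam g).
Local Notation Lap := (Lap g).
Local Notation Hes := (Hes g).
Local Notation I := (I mu).

Lemma csB F G : cs F -> cs G -> cs (fun p => F p - G p).
Proof.
move=> cF cG; apply: csD cF (cs_sub cG _) => p ->; by rewrite oppr0.
Qed.

Lemma Gam_csr f h : cs h -> cs (Gam f h).
Proof. by move=> ch; apply: cs_sub (Gam_cs g f ch) _ => p E; rewrite GamC. Qed.

(** Retains from a divergence only what integration uses. The class is closed under linear
    combinations, so a pointwise inequality modulo such functions becomes an integral inequality by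
    [I_le_divergence]. *)
Definition divergence F := [/\ LB F, cs F & I F = 0].

Lemma divergence_green f h : smooth_fun f -> smooth_fun h -> cs f ->
  divergence (fun p => f p * Lap h p + Gam f h p).
Proof.
move=> sf sh cf; have l1 : LB (fun p => f p * Lap h p) := LBM (LB_smooth sf) (LB_smooth (Lap_smooth hmu sh)).
have l2 : LB (Gam f h) := LB_smooth (Gam_smooth g sf sh).
have c1 : cs (fun p => f p * Lap h p) := cs_mulr _ cf.
have c2 := Gam_cs g h cf.
split; [exact: LBD|exact: csD|].
by rewrite (ID hmu l1 l2 c1 c2) (green hmu sf sh cf) addNr.
Qed.

Lemma divergenceD F G : divergence F -> divergence G -> divergence (fun p => F p + G p).
Proof.
by move=> [l1 c1 e1] [l2 c2 e2]; split; [exact: LBD|exact: csD|rewrite (ID hmu) // e1 e2 addr0].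
Qed.

Lemma divergenceZ (a : R) F : divergence F -> divergence (fun p => a * F p).
Proof.
by move=> [l1 c1 e1]; split; [exact: LBM (LB_cst _) l1|exact: cs_mull|rewrite (IZ hmu) // e1 mulr0].
Qed.

Lemma I_le_divergence F G S : LB F -> LB G -> cs F -> cs G -> divergence S ->
  (forall p, F p <= G p + S p) -> I F <= I G.
Proof.
move=> lF lG cF cG [lS cS S0] H; rewrite -[leRHS]addr0 -S0 -(ID hmu lG lS cG cS).
by apply: (I_le hmu lF (LBD lG lS) cF (csD cG cS)).
Qed.

Lemma Gam_off f h (K : set M) p : compact K -> (forall q, ~ K q -> f q = 0) -> ~ K p ->
  Gam f h p = 0.
Proof.
move=> cK f0 nK; rewrite -(Gam_cstl g 0 h p); apply: Gam_near; last by near=> r.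
apply: (@filterS _ (nbhs p) _ (~` K)); first by move=> r; exact: f0.
by apply: open_nbhs_nbhs; split => //; apply: closed_openC; exact: compact_closedM.
Unshelve. all: by end_near. Qed.

Lemma Lap_off f (K : set M) p : compact K -> (forall q, ~ K q -> f q = 0) -> ~ K p ->
  Lap f p = 0.
Proof.
move=> cK f0 nK; rewrite -(Lap_cst g 0 p) Lap_laplacian; apply: laplacian_near.
apply: (@filterS _ (nbhs p) _ (~` K)); first by move=> r; exact: f0.
by apply: open_nbhs_nbhs; split => //; apply: closed_openC; exact: compact_closedM.
Qed.

Lemma Hes_off psi w (K : set M) p : compact K -> (forall q, ~ K q -> w q = 0) -> ~ K p ->
  Hes psi w p = 0.
Proof.
move=> cK w0 nK; rewrite /Hes (Gam_off _ cK w0 nK) GamC.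
rewrite (@Gam_off (Gam w w) psi K p cK) // ?mulr0 ?subr0 // => q nq.
exact: Gam_off cK w0 nq.
Qed.

Lemma smooth_exp psi : smooth_fun psi -> smooth_fun (fun p => expR (psi p)).
Proof. by move=> s; apply: (smooth_fun_comp1 (smooth1_expR setT)). Qed.

Lemma Gam_exp psi h p : smooth_fun psi -> Gam (fun q => expR (psi q)) h p = expR (psi p) * Gam psi h p.
Proof. by move=> s; apply: (Gam_comp1l g h s); exact: is_derive_expR. Qed.

Lemma Lap_exp psi p : smooth_fun psi ->
  Lap (fun q => expR (psi q)) p = expR (psi p) * (Lap psi p + Gam psi psi p).
Proof.
move=> s; rewrite (@Lap_comp1 _ _ _ g psi p expR expR (expR (psi p)) setT s) //.
- by rewrite mulrDr.
- exact: openT.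
Qed.

Lemma Lap_conj phi v p : smooth_fun phi -> smooth_fun v ->
  let w q := expR (phi q) * v q in
  Lap w p = expR (phi p) * Lap v p + 2 * Gam phi w p - Gam phi phi p * w p + Lap phi p * w p.
Proof.
move=> sphi sv w; have se := smooth_exp sphi.
rewrite /w (LapM g p se sv) Lap_exp // Gam_exp // (GamMr g phi p se sv) (GamC g phi (fun q => expR _)) Gam_exp //.
ring.
Qed.

Lemma smooth_funX f (k : nat) : smooth_fun f -> smooth_fun (fun p => f p ^+ k).
Proof.
move=> sf; elim: k => [|k IH].
  by under eq_fun do rewrite expr0; exact: smooth_fun_cst.
by under eq_fun do rewrite exprS; exact: smooth_funM sf IH.
Qed.

Lemma csX f (k : nat) : (0 < k)%N -> cs f -> cs (fun p => f p ^+ k).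
Proof. by move=> k0 cf; apply: cs_sub cf _ => p ->; rewrite expr0n gtn_eqF. Qed.

End Divergence.

(* Syntax-directed: plain unification would unfold the definitions of the operators. *)
Ltac hypf f := match goal with H : smooth_fun ?h |- _ => constr_eq f h; exact: H end.
Ltac hypc f := match goal with H : cs ?h |- _ => constr_eq f h; exact: H end.

Ltac smf := lazymatch goal with
  | |- smooth_fun (fun p => ?f p) => first [hypf f | smf_step]
  | |- smooth_fun ?f => first [hypf f | smf_step]
  end
with smf_step := lazymatch goal with
  | |- smooth_fun (fun p => @GRing.add _ (@?f p) (- (@?h p))) => apply: (@smooth_funB _ _ _ f h); smf
  | |- smooth_fun (fun p => @GRing.add _ (@?f p) (@?h p)) => apply: (@smooth_funD _ _ _ f h); smf
  | |- smooth_fun (fun p => @GRing.mul _ (@?f p) (@?h p)) => apply: (@smooth_funM _ _ _ f h); smf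
  | |- smooth_fun (fun p => - (@?f p)) => apply: (@smooth_funN _ _ _ f); smf
  | |- smooth_fun (fun p => @GRing.exp _ (@?f p) ?k) => apply: (@smooth_funX _ _ _ f k); smf
  | |- smooth_fun (fun p => Gam ?g ?f ?h p) => apply: (@Gam_smooth _ _ _ g f h); smf
  | |- smooth_fun (Gam ?g ?f ?h) => apply: (@Gam_smooth _ _ _ g f h); smf
  | H : is_riemannian_measure ?g _ |- smooth_fun (fun p => Lap ?g ?f p) => apply: (Lap_smooth H (h := f)); smf
  | H : is_riemannian_measure ?g _ |- smooth_fun (Lap ?g ?f) => apply: (Lap_smooth H (h := f)); smf
  | |- smooth_fun (fun p => expR (@?f p)) => apply: (@smooth_exp _ _ _ f); smf
  | |- smooth_fun (fun p => _) => exact: smooth_fun_cst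
  end.

Ltac csf := lazymatch goal with
  | |- cs (fun p => ?f p) => first [hypc f | csf_step]
  | |- cs ?f => first [hypc f | csf_step]
  end
with csf_step := lazymatch goal with
  | |- cs (fun p => @GRing.add _ (@?f p) (- (@?h p))) => apply: (@csB _ _ _ f h); csf
  | |- cs (fun p => @GRing.add _ (@?f p) (@?h p)) => apply: (@csD _ _ _ f h); csf
  | |- cs (fun p => @GRing.mul _ (@?f p) (@?h p)) =>
      first [solve [apply: (@cs_mulr _ _ _ f h); csf] | solve [apply: (@cs_mull _ _ _ h f); csf]]
  | |- cs (fun p => @GRing.exp _ (@?f p) ?k) => apply: (@csX _ _ _ f k); [by []|csf]
  | |- cs (fun p => Gam ?g ?f ?h p) =>
      first [solve [apply: (@Gam_cs _ _ _ g f h); csf] | solve [apply: (@Gam_csr _ _ _ g f h); csf]]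
  | |- cs (Gam ?g ?f ?h) =>
      first [solve [apply: (@Gam_cs _ _ _ g f h); csf] | solve [apply: (@Gam_csr _ _ _ g f h); csf]]
  | |- cs (fun p => Lap ?g ?f p) => apply: (@Lap_cs _ _ _ g f); csf
  | |- cs (Lap ?g ?f) => apply: (@Lap_cs _ _ _ g f); csf
  end.

Section Carleman.
Context {R : realType} {N : nat} {M : manifold R N}.
Variable g : metric M.
Variable mu : {measure set (borel M) -> \bar R}.
Hypothesis hmu : is_riemannian_measure g mu.
Implicit Types (f h v w psi sg : M -> R) (p : M).
Local Notation Gam := (Gam g).
Local Notation Lap := (Lap g).
Local Notation Hes := (Hes g).
Local Notation I := (I mu).

(* Integral form of a pointwise identity: multiply the conjugated equation by
   [Y = 2 Gam psi w + (Lap psi + sg) w] and collect the divergences. *)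
Lemma carleman_identity psi sg w (tau : R) : smooth_fun psi -> smooth_fun sg -> smooth_fun w ->
  cs w ->
  let rho q := Lap psi q + sg q in
  let Y q := 2 * Gam psi w q + rho q * w q in
  let G q := Lap w q + tau ^+ 2 * Gam psi psi q * w q - tau * (2 * Gam psi w q + Lap psi q * w q) in
  divergence mu (fun p => G p * Y p + (2 * Hes psi w p + sg p * Gam w w p) +
    tau ^+ 2 * w p ^+ 2 * (2 * Hes psi psi p - sg p * Gam psi psi p)
    - 2^-1 * w p ^+ 2 * Lap rho p + tau * Y p ^+ 2 - tau * sg p * w p * Y p).
Proof.
move=> spsi ssg sw cw rho Y G.
have srho : smooth_fun rho.
  by rewrite /rho; smf.
have sww : smooth_fun (fun q => w q * w q) by smf.
have sP : smooth_fun (Gam psi psi) by smf.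
(* The five fields are [2 <dpsi,dw> grad w], [- |dw|^2 grad psi], [rho w grad w],
   [- (w^2/2) grad rho] and [tau^2 w^2 |dpsi|^2 grad psi]. *)
have d1 : divergence mu (fun p => 2 * (Gam psi w p * Lap w p + Gam (Gam psi w) w p)).
  by apply: (divergenceZ hmu); apply: (divergence_green hmu); [smf|smf|csf].
have d2 : divergence mu (fun p => -1 * (Gam w w p * Lap psi p + Gam (Gam w w) psi p)).
  by apply: (divergenceZ hmu); apply: (divergence_green hmu); [smf|smf|csf].
have d3 : divergence mu (fun p => (rho p * w p) * Lap w p + Gam (fun q => rho q * w q) w p).
  by apply: (divergence_green hmu); [smf|smf|csf].
have d4 : divergence mu (fun p => (- 2^-1) * ((w p * w p) * Lap rho p + Gam (fun q => w q * w q) rho p)).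
  by apply: (divergenceZ hmu); apply: (divergence_green hmu); [smf|smf|csf].
have d5 : divergence mu (fun p => tau ^+ 2 * ((w p * w p * Gam psi psi p) * Lap psi p +
    Gam (fun q => w q * w q * Gam psi psi q) psi p)).
  by apply: (divergenceZ hmu); apply: (divergence_green hmu); [smf|smf|csf].
have := divergenceD hmu (divergenceD hmu (divergenceD hmu (divergenceD hmu d1 d2) d3) d4) d5.
congr (divergence mu _); apply/funext => p.
rewrite (GamMl g w p srho sw) (GamMl g rho p sw sw) (GamMl g psi p sww sP) (GamMl g psi p sw sw).
rewrite !HesU (GamC g w (Gam psi w)) (GamC g psi (Gam w w)) (GamC g psi (Gam psi psi)) (GamC g w psi) (GamC g rho w).
rewrite /G /Y.
move: (Lap rho p) (Gam w rho p) => Lr Gr; rewrite /rho.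
by field.
Qed.

(* Off the support of [w] both sides vanish; on it the commutator terms beat
   the lower order ones as soon as [tau] is large. *)
Lemma carleman psi sg (K : set M) (m B tau : R) : smooth_fun psi -> smooth_fun sg -> compact K ->
  0 < m -> 0 <= B -> 1 <= tau -> 2 * B <= tau * m ->
  (forall w p, smooth_fun w -> K p -> 0 <= 2 * Hes psi w p + sg p * Gam w w p) ->
  (forall p, K p -> m <= 2 * Hes psi psi p - sg p * Gam psi psi p) ->
  (forall p, K p -> `|Lap (fun q => Lap psi q + sg q) p| <= B /\ sg p ^+ 2 <= B) ->
  forall v, smooth_fun v -> (forall p, ~ K p -> v p = 0) ->
  m * tau ^+ 3 * I (fun p => (expR (tau * psi p) * v p) ^+ 2) <=
  I (fun p => (expR (tau * psi p) * Lap v p) ^+ 2).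
Proof.
move=> spsi ssg cK m0 B0 tau1 Btau H1 H2 H3 v sv v0.
have tau0 : 0 < tau by apply: lt_le_trans tau1.
pose phi q := tau * psi q; have sphi : smooth_fun phi by rewrite /phi; smf.
pose w q := expR (phi q) * v q; have sw : smooth_fun w by rewrite /w; smf.
have cv : cs v by exists K.
have cw : cs w by rewrite /w; csf.
have w0 p : ~ K p -> w p = 0 by move=> nK; rewrite /w v0 ?mulr0.
have dv := carleman_identity tau spsi ssg sw cw.
set rho := fun q => Lap psi q + sg q in H3 dv.
have GE p : Lap w p + tau ^+ 2 * Gam psi psi p * w p - tau * (2 * Gam psi w p + Lap psi p * w p) =
    expR (phi p) * Lap v p.
  rewrite (Lap_conj g p sphi sv) -/w.
  have dZ : is_derive (psi p) 1 (fun t : R => tau * t) tau.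
    exact: is_derive_eqf (is_deriveCf tau (is_derive_id _ _)) (mulr1 _).
  rewrite (Gam_comp1l g w spsi dZ) (Gam_comp1l g phi spsi dZ) (Gam_comp1r g psi spsi dZ).
  rewrite (LapM g p (smooth_fun_cst tau) spsi) Lap_cst Gam_cstl.
  rewrite -[expR (phi p) * v p]/(w p).
  move: (w p) (expR _) (Lap v p) => a b c'; ring.
have L (f : M -> R) : smooth_fun f -> LB f by exact: LB_smooth.
set G := fun p => (expR (phi p) * Lap v p) ^+ 2.
have sG : smooth_fun G by rewrite /G; smf.
have cG : cs G by rewrite /G; csf.
have sw2 : smooth_fun (fun p => w p ^+ 2) by smf.
have cw2 : cs (fun p => w p ^+ 2) by csf.
have s1 : smooth_fun (fun p => (m * tau ^+ 3) * w p ^+ 2) by smf.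
have c1 : cs (fun p => (m * tau ^+ 3) * w p ^+ 2) by csf.
rewrite -(IZ hmu _ (L _ sw2) cw2).
apply: (I_le_divergence hmu (L _ s1) (L _ sG) c1 cG (divergenceZ hmu (2 * tau) dv)) => p.
rewrite GE /G.
have [Kp|nK] := pselect (K p); last first.
  rewrite (Lap_off g cK v0 nK) (Hes_off g _ cK w0 nK) (GamC g psi w) !(Gam_off g _ cK w0 nK) (w0 p nK).
  move: (Hes psi psi p) (Gam psi psi p) (Lap rho p) (rho p) (expR _) => a b c' d e; lra.
have [] := H3 p Kp; have := H2 p Kp; have := H1 w p sw Kp.
move: (2 * Hes psi w p + _) (2 * Hes psi psi p - _) (Lap rho p) (expR (phi p) * Lap v p) => h k l e.
move: (2 * Gam psi w p + rho p * w p) => y; move: (w p) (sg p) => z s h0 mk; rewrite ler_norml => /andP[l1 l2] sB.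
clear -m0 B0 tau1 Btau tau0 h0 mk l1 l2 sB.
(* After scaling the identity by [2 tau], one copy of [tau^2 y^2] completes the square with the
   right-hand side [e] and the other absorbs the cross term with [s]. What remains of order [tau] or
   [tau^2] is covered by half of the [tau^3] term. *)
suff : 0 <= (e + tau * y) ^+ 2 + tau ^+ 2 * (y - s * z) ^+ 2 + 2 * tau * h +
   2 * tau ^+ 3 * z ^+ 2 * (k - m) + (z ^+ 2 * tau) * (tau ^+ 2 * m - l - tau * s ^+ 2) by nra.
have z2 := sqr_ge0 z; have t2 : 0 <= tau ^+ 2 by exact: sqr_ge0.
have t3 : 0 <= tau ^+ 3 by rewrite exprn_ge0 // ltW.
have q1 : 0 <= (e + tau * y) ^+ 2 by exact: sqr_ge0.
have q2 : 0 <= tau ^+ 2 * (y - s * z) ^+ 2 by rewrite mulr_ge0 ?sqr_ge0.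
have q3 : 0 <= 2 * tau * h by rewrite mulr_ge0 // mulr_ge0 // ltW.
have q4 : 0 <= 2 * tau ^+ 3 * z ^+ 2 * (k - m) by rewrite mulr_ge0 ?subr_ge0 // mulr_ge0 // mulr_ge0.
suff q5 : 0 <= tau ^+ 2 * m - l - tau * s ^+ 2.
  have : 0 <= (z ^+ 2 * tau) * (tau ^+ 2 * m - l - tau * s ^+ 2) by rewrite mulr_ge0 // mulr_ge0 // ltW.
  by move: q1 q2 q3 q4; lra.
have : tau * (2 * B) <= tau * (tau * m) by rewrite ler_wpM2l ?(ltW tau0).
have : tau * s ^+ 2 <= tau * B by rewrite ler_wpM2l ?(ltW tau0).
have : B <= tau * B by rewrite ler_peMl.
move=> *; lra.
Qed.

End Carleman.

(** * Unique continuation *)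

Section Limits.
Context {R : realType} {N : nat} {M : manifold R N}.
Variable g : metric M.
Variable mu : {measure set (borel M) -> \bar R}.
Hypothesis hmu : is_riemannian_measure g mu.
Variable q : M -> R.
Variable Bq : R.
Hypothesis mq : measurable_fun [set: borel M] (q : borel M -> R).
Hypothesis qB : forall p, `|q p| <= Bq.
Implicit Types (f h u a b F G : M -> R) (p : M).
Local Notation Gam := (Gam g).
Local Notation Lap := (Lap g).
Local Notation I := (I mu).

Definition intg F := mu.-integrable setT (fun p : borel M => (F p)%:E).

Definition bmeas a (A : R) := measurable_fun [set: borel M] (a : borel M -> R) /\
  forall p, `|a p| <= A.

Lemma intg_LB F : LB F -> cs F -> intg F.
Proof. exact: (LB_integrable hmu). Qed.

Lemma intgD F G : intg F -> intg G -> intg (fun p => F p + G p).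
Proof.
move=> iF iG; rewrite /intg (_ : (fun p : borel M => _) = (fun p => (F p)%:E + (G p)%:E)%E); last by [].
exact: integrableD.
Qed.

Lemma intg_meas F : intg F -> measurable_fun [set: borel M] (F : borel M -> R).
Proof. by move=> /integrableP[/measurable_EFinP]. Qed.

Lemma intg_le F G : measurable_fun [set: borel M] (F : borel M -> R) -> intg G ->
  (forall p, `|F p| <= G p) -> intg F.
Proof.
move=> mF iG H; apply: (le_integrable measurableT _ _ iG).
  exact/measurable_EFinP.
by move=> p _ /=; rewrite lee_fin; apply: le_trans (H p) (ler_norm _).
Qed.

Lemma intgM a A F : bmeas a A -> intg F -> intg (fun p => a p * F p).
Proof.
move=> [ma aA] iF.
have iG : intg (fun p => A * `|F p|).
  rewrite /intg (_ : (fun p : borel M => _) = (fun p => A%:E * `|(F p)%:E|)%E); last by [].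
  by apply: integrableZl => //; exact: integrable_abse.
apply: intg_le iG _; first exact: measurable_funM (intg_meas iF).
by move=> p; rewrite normrM ler_wpM2r.
Qed.

Lemma intgZ (a : R) F : intg F -> intg (fun p => a * F p).
Proof. by apply: (@intgM (fun=> a) `|a|); split. Qed.

Lemma JD F G : intg F -> intg G -> I (fun p => F p + G p) = I F + I G.
Proof. by move=> iF iG; rewrite /I RintegralD. Qed.

Lemma JZ (a : R) F : intg F -> I (fun p => a * F p) = a * I F.
Proof. by move=> iF; rewrite /I RintegralZl. Qed.

Lemma J_le F G : intg F -> intg G -> (forall p, F p <= G p) -> I F <= I G.
Proof. by move=> iF iG FG; apply: le_Rintegral. Qed.

Lemma J_int F : intg F -> (\int[mu]_p (F p)%:E = (I F)%:E)%E.
Proof. by move=> iF; rewrite /I /Rintegral fineK //; exact: integrable_fin_num. Qed.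

Lemma intg_ge0 F : measurable_fun [set: borel M] (F : borel M -> R) -> (forall p, 0 <= F p) ->
  (\int[mu]_p (F p)%:E < +oo)%E -> intg F.
Proof.
move=> mF F0 H; apply/integrableP; split; first exact/measurable_EFinP.
apply: le_lt_trans H; apply: ge0_le_integral => //.
- by apply: measurableT_comp => //; exact/measurable_EFinP.
- exact/measurable_EFinP.
- by move=> p _ /=; rewrite ger0_norm.
Qed.

(* Stands in for "[u] solves [Lap u = q u]": essential self-adjointness
   provides it directly, so that no elliptic regularity is needed. *)
Definition approximable u := [/\ measurable_fun [set: borel M] (u : borel M -> R),
  intg (fun p => u p ^+ 2) &
  forall e : R, 0 < e -> exists f, [/\ smooth_fun f, cs f,
    intg (fun p => (u p - f p) ^+ 2), I (fun p => (u p - f p) ^+ 2) <= e &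
    I (fun p => (Lap f p - q p * f p) ^+ 2) <= e]].

Lemma LB_q : LB q.
Proof. exact: LB_bounded mq qB. Qed.

Lemma defect_LB f : smooth_fun f -> LB (fun p => (Lap f p - q p * f p) ^+ 2).
Proof.
move=> sf; apply: LBX; apply: LBB (LB_smooth (Lap_smooth hmu sf)) _.
exact: LBM LB_q (LB_smooth sf).
Qed.

Lemma defect_cs f : cs f -> cs (fun p => (Lap f p - q p * f p) ^+ 2).
Proof. by move=> cf; csf. Qed.

(** Young's inequality compares the weighted norms of [u] and of a smooth approximation at the cost
    of a factor [1 + d]; the approximation error is sent to 0 for fixed [d], and then [d] is sent to
    0. *)
Lemma limit_inequality u a b (A B C : R) : approximable u -> bmeas a A -> bmeas b B ->
  (forall p, 0 <= a p) -> (forall p, 0 <= b p) -> 0 <= C ->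
  (forall f, smooth_fun f -> cs f -> I (fun p => a p * f p ^+ 2) <=
     I (fun p => b p * f p ^+ 2) + C * I (fun p => (Lap f p - q p * f p) ^+ 2)) ->
  I (fun p => a p * u p ^+ 2) <= I (fun p => b p * u p ^+ 2).
Proof.
move=> [mu_ iu Hu] ba bb a0 b0 C0 H.
have A0 : 0 <= A by apply: le_trans (normr_ge0 _) (ba.2 point).
have B0 : 0 <= B by apply: le_trans (normr_ge0 _) (bb.2 point).
set X := I (fun p => a p * u p ^+ 2); set Y := I (fun p => b p * u p ^+ 2).
have Y0 : 0 <= Y by apply: I_ge0 => p; rewrite mulr_ge0 ?sqr_ge0.
have step (c D E d : R) (w : M -> R) (v v' : M -> R) : bmeas w D -> (forall p, 0 <= w p) -> 0 < d ->
    intg (fun p => v p ^+ 2) -> intg (fun p => v' p ^+ 2) -> intg (fun p => (v p - v' p) ^+ 2) ->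
    I (fun p => (v p - v' p) ^+ 2) <= E ->
    I (fun p => w p * v p ^+ 2) <= (1 + d) * I (fun p => w p * v' p ^+ 2) + (1 + d^-1) * (D * E).
  move=> bw w0 d0 iv iv' ivv HE.
  have D0 : 0 <= D by apply: le_trans (normr_ge0 _) (bw.2 point).
  have d1 : 0 <= 1 + d^-1 by rewrite addr_ge0 // invr_ge0 ltW.
  have i1 := intgZ (1 + d) (intgM bw iv').
  have i2 := intgZ (1 + d^-1) (intgZ D ivv).
  apply: (@le_trans _ _ (I (fun p => (1 + d) * (w p * v' p ^+ 2) + (1 + d^-1) * (D * (v p - v' p) ^+ 2)))).
    apply: J_le; [exact: intgM bw iv|exact: intgD|] => p.
    have wD : w p <= D by apply: le_trans (ler_norm _) (bw.2 p).
    apply: (@le_trans _ _ (w p * ((1 + d) * v' p ^+ 2 + (1 + d^-1) * (v p - v' p) ^+ 2))).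
      rewrite ler_wpM2l //; set s := v p - v' p; have -> : v p = v' p + s by rewrite /s; ring.
      rewrite -subr_ge0; have -> : (1 + d) * v' p ^+ 2 + (1 + d^-1) * s ^+ 2 - (v' p + s) ^+ 2 =
        d * (v' p - d^-1 * s) ^+ 2 by field; rewrite gt_eqF.
      by rewrite mulr_ge0 ?sqr_ge0 // ltW.
    rewrite mulrDr lerD //; first by rewrite mulrCA.
    by rewrite mulrCA ler_wpM2l // ler_wpM2r ?sqr_ge0.
  rewrite (JD i1 i2) (JZ _ (intgM bw iv')) (JZ _ (intgZ D ivv)) (JZ D ivv).
  by rewrite lerD2l ler_wpM2l // ler_wpM2l.
have main (d : R) : 0 < d -> X <= (1 + d) ^+ 2 * Y.
  move=> d0; apply/ler_addgt0Pr => e e0.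
  have dv0 : 0 < d^-1 by rewrite invr_gt0.
  (* Total coefficient of the approximation error once the two comparisons and the estimate for [f]
     are chained. *)
  pose K := (1 + d^-1) * A + (1 + d) * ((1 + d^-1) * B + C).
  have K0 : 0 <= K.
    have i1 : 0 <= 1 + d^-1 by rewrite addr_ge0 // ltW.
    have i2 : 0 <= 1 + d by rewrite addr_ge0 // ltW.
    rewrite /K; apply: addr_ge0; first exact: mulr_ge0.
    by apply: mulr_ge0 => //; apply: addr_ge0 => //; exact: mulr_ge0.
  have [f [sf cf iuf E1 E2]] := Hu (e / (K + 1)) (divr_gt0 e0 (ltr_wpDl K0 ltr01)).
  set E := e / (K + 1) in E1 E2.
  have if2 : intg (fun p => f p ^+ 2) by apply: intg_LB; [apply: LB_smooth; smf|csf].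
  have ifu : intg (fun p => (f p - u p) ^+ 2) by under eq_fun do rewrite -sqrrN opprB.
  have E1' : I (fun p => (f p - u p) ^+ 2) <= E.
    by rewrite (@I_ext _ _ _ _ _ (fun p => (u p - f p) ^+ 2)) // => p; rewrite -sqrrN opprB.
  have S1 := step 0 A E d a u f ba a0 d0 iu if2 iuf E1.
  have S2 := step 0 B E d b f u bb b0 d0 if2 iu ifu E1'.
  have S3 := H f sf cf.
  apply: le_trans S1 _.
  have EK : E * K <= e.
    by rewrite /E mulrAC ler_pdivrMr ?(ltr_wpDl K0) // ler_wpM2l ?(ltW e0) // lerDl.
  move: S2 S3; rewrite -/Y; move: (I _) (I _) (I _) E2 => X1 X2 X3 E2 S2 S3.
  have S4 : X1 <= X2 + C * E by apply: le_trans S3 _; rewrite lerD2l ler_wpM2l.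
  apply: (@le_trans _ _ ((1 + d) * ((1 + d) * Y + (1 + d^-1) * (B * E) + C * E) + (1 + d^-1) * (A * E))).
    rewrite lerD2r ler_wpM2l ?addr_ge0 ?(ltW d0) //.
    by apply: le_trans S4 _; rewrite lerD2r.
  by move: EK; rewrite /K; lra.
apply/ler_addgt0Pr => e e0.
(* Since [d <= 1], [(1 + d)^2 Y - Y] is at most [3 d Y], hence at most [e]. *)
pose d := Num.min 1 (e / (3 * (Y + 1))).
have Y1 : 0 < 3 * (Y + 1) by rewrite mulr_gt0 // ltr_wpDl.
have d0 : 0 < d by rewrite lt_min ltr01 divr_gt0.
have d1 : d <= 1 by rewrite ge_min lexx.
have dY : d * (3 * (Y + 1)) <= e by rewrite -ler_pdivlMr // ge_min lexx orbT.
apply: le_trans (main d d0) _.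
have : d * d * Y <= d * Y by rewrite ler_wpM2r // ler_piMl // ltW.
move: dY; rewrite expr2; have := mulr_ge0 (ltW d0) Y0; lra.
Qed.

(** Pair the equation with [eta f]. The cross term [f <deta, df>] is half of [<deta, d(f^2)>], so a
    second integration by parts turns it into [Lap eta]; the bound is linear in [eta] and involves
    no quotient by it. *)
Lemma caccioppoli eta f : smooth_fun eta -> (forall p, 0 <= eta p) -> smooth_fun f -> cs f ->
  I (fun p => eta p * Gam f f p) <=
  I (fun p => ((Bq + 1) * eta p + `|Lap eta p|) * f p ^+ 2) +
  I (fun p => eta p * (Lap f p - q p * f p) ^+ 2).
Proof.
move=> se e0 sf cf.
have cf2 : cs (fun p => f p * f p) by csf.
have s1 : smooth_fun (fun p => eta p * f p) by smf.
have sff : smooth_fun (fun p => f p * f p) by smf.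
have d1 : divergence mu (fun p => (eta p * f p) * Lap f p + Gam (fun p => eta p * f p) f p).
  by apply: (divergence_green hmu); [smf|smf|csf].
have d2 : divergence mu (fun p => (- 2^-1) * ((f p * f p) * Lap eta p + Gam (fun p => f p * f p) eta p)).
  by apply: (divergenceZ hmu); apply: (divergence_green hmu); [smf|smf|csf].
have lE : LB (fun p => eta p * (Lap f p - q p * f p) ^+ 2) := LBM (LB_smooth se) (defect_LB sf).
have cE : cs (fun p => eta p * (Lap f p - q p * f p) ^+ 2) := cs_mull _ (defect_cs cf).
have lk : LB (fun p => ((Bq + 1) * eta p + `|Lap eta p|) * f p ^+ 2).
  apply: LBM; last by apply: LB_smooth; smf.
  apply: LBD; first by apply: LB_smooth; smf.
  by apply: LB_norm; apply: LB_smooth; smf.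
have ck : cs (fun p => ((Bq + 1) * eta p + `|Lap eta p|) * f p ^+ 2) by apply: cs_mull; csf.
rewrite -(ID hmu lk lE ck cE).
apply: (I_le_divergence hmu _ (LBD lk lE) _ (csD ck cE) (divergenceD hmu d1 d2)).
- by apply: LB_smooth; smf.
- by csf.
move=> p; rewrite (GamMl g f p se sf) (GamMl g eta p sf sf) (GamC g eta f).
move: (qB p) (e0 p) (ler_norm (Lap eta p)) (normr_ge0 (Lap eta p)); rewrite ler_norml => /andP[].
move: (Lap f p) (Lap eta p) (`|_|) (Gam f f p) (Gam f eta p) (eta p) (f p) (q p) => Lf Le nL Gf Ge e z Q Q1 Q2 e1 L1 n0.
set s := Lf - Q * z.
have h1 : 0 <= ((nL - Le) + nL) * z ^+ 2 by rewrite mulr_ge0 ?sqr_ge0 // addr_ge0 // subr_ge0.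
have h2 : 0 <= e * (2 * (Bq + Q) * z ^+ 2 + (z ^+ 2 + s ^+ 2 + (z + s) ^+ 2)).
  have Q0 : 0 <= 2 * (Bq + Q) by rewrite mulr_ge0 // -lerBlDl sub0r.
  have := mulr_ge0 Q0 (sqr_ge0 z); have := sqr_ge0 z; have := sqr_ge0 s; have := sqr_ge0 (z + s).
  move=> a1 a2 a3 a4; apply: mulr_ge0 => //; apply: addr_ge0 => //; apply: addr_ge0 => //.
  exact: addr_ge0.
rewrite -subr_ge0; have -> : Lf = s + Q * z by rewrite /s; ring.
move: h1 h2; lra.
Qed.

End Limits.

Ltac hypl f := match goal with H : LB ?h |- _ => constr_eq f h; exact: H end.

Ltac lbf := lazymatch goal with
  | |- LB (fun p => ?f p) => first [hypl f | lbf_step]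
  | |- LB ?f => first [hypl f | lbf_step]
  end
with lbf_step := lazymatch goal with
  | |- LB (fun p => @GRing.add _ (@?f p) (- (@?h p))) => apply: (@LBB _ _ _ f h); lbf
  | |- LB (fun p => @GRing.add _ (@?f p) (@?h p)) => apply: (@LBD _ _ _ f h); lbf
  | |- LB (fun p => @GRing.mul _ (@?f p) (@?h p)) => apply: (@LBM _ _ _ f h); lbf
  | |- LB (fun p => `|@?f p|) => apply: (@LB_norm _ _ _ f); lbf
  | |- LB (fun p => @GRing.exp _ (@?f p) ?k) => apply: (@LBX _ _ _ f k); lbf
  | |- _ => apply: LB_smooth; smf
  end.

Section CarlemanCutoff.
Context {R : realType} {N : nat} {M : manifold R N}.
Variable g : metric M.
Variable mu : {measure set (borel M) -> \bar R}.
Hypothesis hmu : is_riemannian_measure g mu.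
Variable q : M -> R.
Variable Bq : R.
Hypothesis mq : measurable_fun [set: borel M] (q : borel M -> R).
Hypothesis qB : forall p, `|q p| <= Bq.
Implicit Types (f h u a b F G psi sg w : M -> R) (p : M).
Local Notation Gam := (Gam g).
Local Notation Lap := (Lap g).
Local Notation Hes := (Hes g).
Local Notation I := (I mu).

Lemma bmeas_LB F : LB F -> cs F -> exists A, bmeas F A.
Proof.
move=> [mF bF] [K cK F0]; have [B HB] := bF K cK; exists `|B|; split => // p.
have [Kp|nK] := pselect (K p); last by rewrite F0 // normr0.
by apply: le_trans (HB p Kp) (ler_norm _).
Qed.

(** Coefficient of [f^2] in Caccioppoli's inequality for the weight [eta = Gam b b]. *)
Definition cac_weight b p := (Bq + 1) * Gam b b p + `|Lap (Gam b b) p|.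

(** The price of the cutoff [b] in terms of [f^2]. Squaring the four terms of [Lap (z f)] costs a
    factor 4; separating the two cutoffs doubles it for [Lap b], giving 8, and for [2 Gam b f] it
    becomes 4 times 8. *)
Definition cut_weight b p := 8 * Lap b p ^+ 2 + 32 * cac_weight b p.

Lemma cut_weight_LB b : smooth_fun b -> LB (cut_weight b).
Proof. by move=> sb; rewrite /cut_weight /cac_weight; lbf. Qed.

Lemma cac_weight_ge0 b p : 0 <= cac_weight b p.
Proof.
have B0 : 0 <= Bq by apply: le_trans (normr_ge0 _) (qB point).
by rewrite addr_ge0 // mulr_ge0 ?Gam_ge0 // addr_ge0.
Qed.

Lemma cut_weight_ge0 b p : 0 <= cut_weight b p.
Proof. by rewrite addr_ge0 // mulr_ge0 ?sqr_ge0 // cac_weight_ge0. Qed.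

(* [v = z f] with [z = b1 - b0]; the commutator [[Lap, z] f] is controlled by
   [f] itself through Caccioppoli's inequality. *)
Lemma carleman_cutoff psi sg (K : set M) (m B tau : R) (b0 b1 : M -> R) (A0 A1 : R) :
  smooth_fun psi -> smooth_fun sg -> compact K ->
  0 < m -> 0 <= B -> 1 <= tau -> 2 * B <= tau * m -> 4 * Bq ^+ 2 + 1 <= m * tau ^+ 3 ->
  (forall w p, smooth_fun w -> K p -> 0 <= 2 * Hes psi w p + sg p * Gam w w p) ->
  (forall p, K p -> m <= 2 * Hes psi psi p - sg p * Gam psi psi p) ->
  (forall p, K p -> `|Lap (fun q => Lap psi q + sg q) p| <= B /\ sg p ^+ 2 <= B) ->
  smooth_fun b0 -> smooth_fun b1 -> cs b0 -> cs b1 ->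
  (forall p, ~ K p -> b1 p - b0 p = 0) ->
  (forall p, (Gam b0 b0 p = 0 /\ Lap b0 p = 0) \/ psi p <= A0) ->
  (forall p, (Gam b1 b1 p = 0 /\ Lap b1 p = 0) \/ psi p <= A1) ->
  exists2 C : R, 0 <= C & forall f, smooth_fun f -> cs f ->
    I (fun p => (expR (tau * psi p) * (b1 p - b0 p)) ^+ 2 * f p ^+ 2) <=
    I (fun p => (expR (tau * A1) ^+ 2 * cut_weight b1 p + expR (tau * A0) ^+ 2 * cut_weight b0 p) * f p ^+ 2) +
    C * I (fun p => (Lap f p - q p * f p) ^+ 2).
Proof.
move=> spsi ssg cK m0 B0 tau1 Btau Bqtau H1 H2 H3 sb0 sb1 cb0 cb1 zK h0 h1.
have tau0 : 0 < tau by apply: lt_le_trans tau1.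
set W0 := expR (tau * A0) ^+ 2; set W1 := expR (tau * A1) ^+ 2.
have W00 : 0 <= W0 by exact: sqr_ge0.
have W10 : 0 <= W1 by exact: sqr_ge0.
pose z p := b1 p - b0 p; pose E p := expR (tau * psi p).
have sz : smooth_fun z by rewrite /z; smf.
have cz : cs z by rewrite /z; csf.
have sE : smooth_fun E by rewrite /E; smf.
have lq := LB_q mq qB.
have se p : E p ^+ 2 = expR (tau * psi p) ^+ 2 by [].
have [C1 [_ HC1]] : exists A, bmeas (fun p => (E p * z p) ^+ 2) A by apply: bmeas_LB; [lbf|csf].
have [C2 [_ HC2]] : exists A, bmeas (Gam b0 b0) A by apply: bmeas_LB; [lbf|csf].
have [C3 [_ HC3]] : exists A, bmeas (Gam b1 b1) A by apply: bmeas_LB; [lbf|csf].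
exists (4 * C1 + 32 * W0 * C2 + 32 * W1 * C3).
  have C10 : 0 <= C1 by apply: le_trans (normr_ge0 _) (HC1 point).
  have C20 : 0 <= C2 by apply: le_trans (normr_ge0 _) (HC2 point).
  have C30 : 0 <= C3 by apply: le_trans (normr_ge0 _) (HC3 point).
  by rewrite addr_ge0 ?addr_ge0 ?mulr_ge0.
move=> f sf cf.
have ldf : LB (fun p => Lap f p - q p * f p) by lbf.
have cdf : cs (fun p => Lap f p - q p * f p) by csf.
set d := fun p => Lap f p - q p * f p in ldf cdf *.
pose Ez p := (E p * z p) ^+ 2.
have sEz : smooth_fun Ez by rewrite /Ez; smf.
have cEz : cs Ez by rewrite /Ez; csf.
pose X p := Ez p * f p ^+ 2; have lX : LB X by rewrite /X; lbf.
have cX : cs X by rewrite /X; csf.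
have C_ (b : M -> R) (W C : R) : 0 <= W -> smooth_fun b -> cs b -> (forall p, `|Gam b b p| <= C) ->
    I (fun p => W * (8 * Lap b p ^+ 2 * f p ^+ 2 + 32 * (Gam b b p * Gam f f p))) <=
    I (fun p => (W * cut_weight b p) * f p ^+ 2) + 32 * W * C * I (fun p => d p ^+ 2).
  move=> W_0 sb cb HC.
  have lc1 : LB (fun p => 8 * Lap b p ^+ 2 * f p ^+ 2) by lbf.
  have cc1 : cs (fun p => 8 * Lap b p ^+ 2 * f p ^+ 2) by csf.
  have lc2 : LB (fun p => Gam b b p * Gam f f p) by lbf.
  have cc2 : cs (fun p => Gam b b p * Gam f f p) by csf.
  have lc3 : LB (fun p => 32 * (Gam b b p * Gam f f p)) by lbf.
  have cc3 : cs (fun p => 32 * (Gam b b p * Gam f f p)) by csf.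
  have lc4 : LB (cac_weight b) by rewrite /cac_weight; lbf.
  have lc5 : LB (fun p => cac_weight b p * f p ^+ 2) by lbf.
  have cc5 : cs (fun p => cac_weight b p * f p ^+ 2) by csf.
  have lc6 : LB (fun p => 32 * (cac_weight b p * f p ^+ 2)) by lbf.
  have cc6 : cs (fun p => 32 * (cac_weight b p * f p ^+ 2)) by csf.
  have lc7 : LB (fun p => 8 * Lap b p ^+ 2 * f p ^+ 2 + 32 * (cac_weight b p * f p ^+ 2)) by lbf.
  have cc7 : cs (fun p => 8 * Lap b p ^+ 2 * f p ^+ 2 + 32 * (cac_weight b p * f p ^+ 2)) by csf.
  have ld2 : LB (fun p => d p ^+ 2) by lbf.
  have cd2 : cs (fun p => d p ^+ 2) by csf.
  have lgd : LB (fun p => Gam b b p * d p ^+ 2) by lbf.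
  have cgd : cs (fun p => Gam b b p * d p ^+ 2) by csf.
  have Ca := caccioppoli hmu mq qB (Gam_smooth g sb sb) (fun p => Gam_ge0 g b p) sf cf.
  have Cb : I (fun p => Gam b b p * d p ^+ 2) <= C * I (fun p => d p ^+ 2).
    rewrite -(IZ hmu C ld2 cd2); apply: (I_le hmu lgd _ cgd) => [||p]; [lbf|csf|].
    by rewrite ler_wpM2r ?sqr_ge0 //; apply: le_trans (ler_norm _) (HC p).
  rewrite (IZ hmu W (LBD lc1 lc3) (csD cc1 cc3)) (ID hmu lc1 lc3 cc1 cc3) (IZ hmu 32 lc2 cc2).
  rewrite [X in _ <= X + _](@I_ext _ _ _ _ _ (fun p => W * (8 * Lap b p ^+ 2 * f p ^+ 2 + 32 * (cac_weight b p * f p ^+ 2)))); last first.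
    by move=> p; rewrite /cut_weight; ring.
  rewrite (IZ hmu W lc7 cc7) (ID hmu lc1 lc6 cc1 cc6) (IZ hmu 32 lc5 cc5).
  have Cd : I (fun p => Gam b b p * Gam f f p) <= I (fun p => cac_weight b p * f p ^+ 2) + C * I (fun p => d p ^+ 2).
    by apply: le_trans Ca _; rewrite lerD2l.
  move: Cd; move: (I _) (I _) (I _) (I _) => t1 t2 t3 t4 Cd.
  by have := ler_wpM2l W_0 Cd; lra.
have S0 := C_ b0 W0 C2 W00 sb0 cb0 HC2.
have S1 := C_ b1 W1 C3 W10 sb1 cb1 HC3.
pose v p := z p * f p; have sv : smooth_fun v by rewrite /v; smf.
have v0 p : ~ K p -> v p = 0 by move=> nK; rewrite /v /z zK // mul0r.
have := carleman hmu spsi ssg cK m0 B0 tau1 Btau H1 H2 H3 sv v0.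
rewrite (@I_ext _ _ _ _ (fun p => (expR (tau * psi p) * v p) ^+ 2) X); last first.
  by move=> p; rewrite /X /Ez /v /E; ring.
move=> Cm.
pose T0 p := W0 * (8 * Lap b0 p ^+ 2 * f p ^+ 2 + 32 * (Gam b0 b0 p * Gam f f p)).
pose T1 p := W1 * (8 * Lap b1 p ^+ 2 * f p ^+ 2 + 32 * (Gam b1 b1 p * Gam f f p)).
have lT0 : LB T0 by rewrite /T0; lbf.
have lT1 : LB T1 by rewrite /T1; lbf.
have cT0 : cs T0 by rewrite /T0; csf.
have cT1 : cs T1 by rewrite /T1; csf.
have lS : LB (fun p => Ez p * d p ^+ 2) by lbf.
have cS : cs (fun p => Ez p * d p ^+ 2) by csf.
have ld2 : LB (fun p => d p ^+ 2) by lbf.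
have cd2 : cs (fun p => d p ^+ 2) by csf.
have l4S : LB (fun p => 4 * (Ez p * d p ^+ 2)) by lbf.
have c4S : cs (fun p => 4 * (Ez p * d p ^+ 2)) by csf.
have l4X : LB (fun p => 4 * Bq ^+ 2 * X p) by lbf.
have c4X : cs (fun p => 4 * Bq ^+ 2 * X p) by csf.
have Up : I (fun p => (expR (tau * psi p) * Lap v p) ^+ 2) <=
    I (fun p => (4 * (Ez p * d p ^+ 2) + 4 * Bq ^+ 2 * X p) + (T0 p + T1 p)).
  have lL : LB (fun p => (expR (tau * psi p) * Lap v p) ^+ 2) by lbf.
  have cv : cs v by rewrite /v; csf.
  have cL : cs (fun p => (expR (tau * psi p) * Lap v p) ^+ 2) by csf.
  apply: (I_le hmu lL (LBD (LBD l4S l4X) (LBD lT0 lT1)) cL (csD (csD c4S c4X) (csD cT0 cT1))) => p.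
  rewrite (LapM g p sz sf) -/(E p) /T0 /T1 /X /Ez.
  have Ez' : Lap z p = Lap b1 p - Lap b0 p.
    rewrite /z (_ : (fun q => b1 q - b0 q) = (fun q => b1 q + (-1) * b0 q)); last first.
      by apply/funext => r; rewrite mulN1r.
    rewrite (LapD g p sb1); last by smf.
    by rewrite (LapM g p (smooth_fun_cst _) sb0) Lap_cst Gam_cstl; ring.
  have Gz : Gam z f p = Gam b1 f p - Gam b0 f p.
    rewrite /z (_ : (fun q => b1 q - b0 q) = (fun q => b1 q + (-1) * b0 q)); last first.
      by apply/funext => r; rewrite mulN1r.
    rewrite (GamDl g f p sb1); last by smf.
    by rewrite (GamMl g f p (smooth_fun_cst _) sb0) Gam_cstl; ring.
  have CS0 := Gam_CS g b0 f p; have CS1 := Gam_CS g b1 f p.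
  (* Where the derivatives of a cutoff do not vanish, [psi] is at most the level attached to it,
     which bounds the exponential weight there. *)
  have EW (A W : R) (b : M -> R) : W = expR (tau * A) ^+ 2 -> (Gam b b p = 0 /\ Lap b p = 0) \/ psi p <= A ->
      E p ^+ 2 * (Lap b p ^+ 2) <= W * Lap b p ^+ 2 /\ E p ^+ 2 * Gam b b p <= W * Gam b b p.
    move=> -> [[-> ->]|le]; first by rewrite expr0n !mulr0.
    have EE : E p ^+ 2 <= expR (tau * A) ^+ 2.
      rewrite lerXn2r ?nnegrE ?expR_ge0 // /E ler_expR ler_wpM2l // ltW //.
    by split; rewrite ler_wpM2r ?sqr_ge0 ?Gam_ge0.
  have [e1 e2] := EW A0 W0 b0 erefl (h0 p).
  have [e3 e4] := EW A1 W1 b1 erefl (h1 p).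
  rewrite Ez' Gz.
  have -> : Lap f p = d p + q p * f p by rewrite /d; ring.
  have q2 : q p ^+ 2 <= Bq ^+ 2 by rewrite -real_normK ?num_real // lerXn2r ?nnegrE // (le_trans (normr_ge0 _) (qB p)).
  have G0 := Gam_ge0 g f p.
  move: q2 CS0 CS1 e1 e2 e3 e4 G0 (sqr_ge0 (E p)).
  move: (Gam b0 b0 p) (Gam b1 b1 p) (Gam f f p) (Gam b0 f p) (Gam b1 f p) (Lap b0 p) (Lap b1 p) (f p) (z p) (q p) (d p) (E p).
  move=> g0 g1 gf g0f g1f L0 L1 y zz qq s e q2 CS0 CS1 e1 e2 e3 e4 G0 e20.
  have f1 : e ^+ 2 * (2 * (L0 ^+ 2 + L1 ^+ 2) * y ^+ 2) <= 2 * (W0 * L0 ^+ 2 + W1 * L1 ^+ 2) * y ^+ 2.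
    by rewrite mulrA ler_wpM2r ?sqr_ge0 //; lra.
  have f2 : e ^+ 2 * ((g0 + g1) * gf) <= (W0 * g0 + W1 * g1) * gf.
    by rewrite mulrA ler_wpM2r // mulrDr lerD.
  have f3 : e ^+ 2 * (g0f ^+ 2 + g1f ^+ 2) <= e ^+ 2 * ((g0 + g1) * gf).
    by rewrite ler_wpM2l // mulrDl lerD.
  have f4 : e ^+ 2 * (qq ^+ 2 * (zz ^+ 2 * y ^+ 2)) <= e ^+ 2 * (Bq ^+ 2 * (zz ^+ 2 * y ^+ 2)).
    by rewrite ler_wpM2l // ler_wpM2r // mulr_ge0 ?sqr_ge0.
  have f5 : (zz * (s + qq * y) + y * (L1 - L0) + 2 * (g1f - g0f)) ^+ 2 <=
      4 * (zz ^+ 2 * s ^+ 2 + qq ^+ 2 * (zz ^+ 2 * y ^+ 2) + 2 * (L0 ^+ 2 + L1 ^+ 2) * y ^+ 2 + 8 * (g0f ^+ 2 + g1f ^+ 2)).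
    have c4 (a b c' d' : R) : (a + b + c' + d') ^+ 2 <= 4 * (a ^+ 2 + b ^+ 2 + c' ^+ 2 + d' ^+ 2).
      have := sqr_ge0 (a - b); have := sqr_ge0 (a - c'); have := sqr_ge0 (a - d').
      have := sqr_ge0 (b - c'); have := sqr_ge0 (b - d'); have := sqr_ge0 (c' - d'); lra.
    have -> : zz * (s + qq * y) + y * (L1 - L0) + 2 * (g1f - g0f) =
      zz * s + zz * qq * y + y * (L1 - L0) + 2 * (g1f - g0f) by ring.
    apply: le_trans (c4 _ _ _ _) _; rewrite ler_pM2l //.
    have := mulr_ge0 (sqr_ge0 y) (sqr_ge0 (L1 + L0)); have := sqr_ge0 (g1f + g0f); lra.
  have f6 := ler_wpM2l e20 f5.
  rewrite exprMn; apply: le_trans f6 _; lra.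
rewrite (ID hmu (LBD l4S l4X) (LBD lT0 lT1) (csD c4S c4X) (csD cT0 cT1)) (ID hmu l4S l4X c4S c4X)
  (ID hmu lT0 lT1 cT0 cT1) (IZ hmu 4 lS cS) (IZ hmu _ lX cX) in Up.
have lk0 : LB (fun p => W0 * cut_weight b0 p * f p ^+ 2).
  by have := cut_weight_LB sb0; move=> ?; lbf.
have lk1 : LB (fun p => W1 * cut_weight b1 p * f p ^+ 2).
  by have := cut_weight_LB sb1; move=> ?; lbf.
have ck0 : cs (fun p => W0 * cut_weight b0 p * f p ^+ 2) by csf.
have ck1 : cs (fun p => W1 * cut_weight b1 p * f p ^+ 2) by csf.
rewrite (@I_ext _ _ _ _ (fun p => (W1 * cut_weight b1 p + W0 * cut_weight b0 p) * f p ^+ 2)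
   (fun p => W1 * cut_weight b1 p * f p ^+ 2 + W0 * cut_weight b0 p * f p ^+ 2)); last first.
  by move=> p; rewrite mulrDl.
rewrite (ID hmu lk1 lk0 ck1 ck0).
have S2 : I (fun p => Ez p * d p ^+ 2) <= C1 * I (fun p => d p ^+ 2).
  rewrite -(IZ hmu C1 ld2 cd2); apply: (I_le hmu lS _ cS) => [||p]; [lbf|csf|].
  by rewrite ler_wpM2r ?sqr_ge0 //; apply: le_trans (ler_norm _) (HC1 p).
rewrite -[X in X <= _]/(I X).
have X0 : 0 <= I X by apply: I_ge0 => p; rewrite mulr_ge0 ?sqr_ge0.
(* The largeness of [tau] pays for the potential term [4 Bq^2] and leaves the coefficient 1 in front
   of the left-hand side. *)
have S3 : (4 * Bq ^+ 2 + 1) * I X <= m * tau ^+ 3 * I X by rewrite ler_wpM2r.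
rewrite -/T0 in S0; rewrite -/T1 in S1.
by move: Cm Up S0 S1 S2 S3; lra.
Qed.

End CarlemanCutoff.

Section VanishingFromCarleman.
Context {R : realType} {N : nat} {M : manifold R N}.
Variable g : metric M.
Variable mu : {measure set (borel M) -> \bar R}.
Hypothesis hmu : is_riemannian_measure g mu.
Variable q : M -> R.
Variable Bq : R.
Hypothesis mq : measurable_fun [set: borel M] (q : borel M -> R).
Hypothesis qB : forall p, `|q p| <= Bq.
Implicit Types (f h u a b F G psi sg w : M -> R) (p : M).
Local Notation Gam := (Gam g).
Local Notation Lap := (Lap g).
Local Notation Hes := (Hes g).
Local Notation I := (I mu).
Local Notation cut_weight := (cut_weight g Bq).

Lemma J_ae0 F : measurable_fun [set: borel M] (F : borel M -> R) ->
  {ae mu, forall p : borel M, F p = 0} -> I F = 0.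
Proof.
move=> mF F0; rewrite /I /Rintegral (ae_eq_integral (fun=> 0%E)) ?integral0 //.
- exact/measurable_EFinP.
- by apply: filterS F0 => p E _; rewrite E.
Qed.

Lemma ae0_J F : intg mu F -> (forall p, 0 <= F p) -> I F = 0 -> {ae mu, forall p : borel M, F p = 0}.
Proof.
move=> iF F0 E0.
have mF : measurable_fun [set: borel M] (fun p : borel M => (F p)%:E) by apply/measurable_EFinP; exact: intg_meas iF.
have := (ae_eq_integral_abs mu measurableT mF).1.
rewrite (_ : (\int[mu]_(x in setT) `|(F x)%:E|)%E = (I F)%:E).
  rewrite E0 => /(_ erefl); apply: filterS => p /(_ Logic.I) /= [] //.
rewrite -(J_int iF); apply: eq_integral => p _; by rewrite gee0_abs // lee_fin.
Qed.

(** Derivatives of [b0] live where [u] vanishes, so only the outer cutoff contributes: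
    [exp(2 tau A2) X <= exp(2 tau A1) Y] with [X] and [Y] independent of [tau]. As [A1 < A2],
    letting [tau] grow forces [X = 0]. *)
Lemma ucp_vanish psi sg (K : set M) (m B : R) (b0 b1 : M -> R) (A0 A1 A2 : R) (om : M -> R) u :
  smooth_fun psi -> smooth_fun sg -> compact K -> 0 < m -> 0 <= B ->
  (forall w p, smooth_fun w -> K p -> 0 <= 2 * Hes psi w p + sg p * Gam w w p) ->
  (forall p, K p -> m <= 2 * Hes psi psi p - sg p * Gam psi psi p) ->
  (forall p, K p -> `|Lap (fun q => Lap psi q + sg q) p| <= B /\ sg p ^+ 2 <= B) ->
  smooth_fun b0 -> smooth_fun b1 -> cs b0 -> cs b1 ->
  (forall p, ~ K p -> b1 p - b0 p = 0) ->
  (forall p, (Gam b0 b0 p = 0 /\ Lap b0 p = 0) \/ psi p <= A0) ->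
  (forall p, (Gam b1 b1 p = 0 /\ Lap b1 p = 0) \/ psi p <= A1) ->
  A1 < A2 -> bmeas om 1 -> (forall p, 0 <= om p) ->
  (forall p, om p = 0 \/ b1 p - b0 p = 1 /\ A2 <= psi p) ->
  approximable g mu q u -> {ae mu, forall p : borel M, cut_weight b0 p != 0 -> u p = 0} ->
  I (fun p => om p * u p ^+ 2) = 0.
Proof.
move=> spsi ssg cK m0 B0 H1 H2 H3 sb0 sb1 cb0 cb1 zK h0 h1 A12 bom om0 omH au u0.
have [mu_ iu _] := au.
set Y := I (fun p => cut_weight b1 p * u p ^+ 2); set X := I _.
have X0 : 0 <= X by apply: I_ge0 => p; rewrite mulr_ge0 ?sqr_ge0.
have lw0 := cut_weight_LB hmu Bq sb0; have lw1 := cut_weight_LB hmu Bq sb1.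
have cw (b : M -> R) : cs b -> cs (cut_weight b).
  move=> cb; rewrite /cut_weight; apply: csD; first by csf.
  apply: cs_mull; apply: csD; first by csf.
  by apply: cs_sub (Lap_cs g (Gam_cs g b cb)) _ => p ->; rewrite normr0.
have [D0 bw0] := bmeas_LB lw0 (cw _ cb0); have [D1 bw1] := bmeas_LB lw1 (cw _ cb1).
(* Threshold beyond which the three largeness conditions of [carleman_cutoff] on [tau] hold
   together. *)
pose T := 1 + 2 * B / m + (4 * Bq ^+ 2 + 1) / m.
have q40 : 0 <= 4 * Bq ^+ 2 + 1 by rewrite addr_ge0 // mulr_ge0 // sqr_ge0.
have T1 : 1 <= T.
  rewrite /T -addrA lerDl; apply: addr_ge0; last exact: divr_ge0 q40 (ltW m0).
  by apply: divr_ge0 (ltW m0); exact: mulr_ge0.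
have bound tau : T <= tau -> expR (tau * A2) ^+ 2 * X <= expR (tau * A1) ^+ 2 * Y.
  move=> Ttau; have tau1 : 1 <= tau by apply: le_trans Ttau.
  have tau0 : 0 < tau by apply: lt_le_trans tau1.
  have tm : 2 * B + (4 * Bq ^+ 2 + 1) <= tau * m.
    rewrite -ler_pdivrMr // mulrDl; apply: le_trans Ttau.
    by rewrite /T -addrA lerDr.
  have B2 : 2 * B <= tau * m by apply: le_trans tm; rewrite lerDl addr_ge0 // mulr_ge0 // sqr_ge0.
  have B3 : 4 * Bq ^+ 2 + 1 <= m * tau ^+ 3.
    have : 4 * Bq ^+ 2 + 1 <= tau * m by apply: le_trans tm; rewrite lerDr mulr_ge0.
    move=> /le_trans; apply; rewrite mulrC ler_wpM2l ?(ltW m0) //.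
    exact: (ler_weXn2l tau1 (_ : (1 <= 3)%N)).
  have [C C0 HC] := carleman_cutoff hmu mq qB spsi ssg cK m0 B0 tau1 B2 B3 H1 H2 H3 sb0 sb1 cb0 cb1 zK h0 h1.
  set W1 := expR (tau * A1) ^+ 2; set W0 := expR (tau * A0) ^+ 2.
  set W2 := expR (tau * A2) ^+ 2.
  have W10 : 0 <= W1 by exact: sqr_ge0. have W00 : 0 <= W0 by exact: sqr_ge0.
  have [Da ba] : exists A, bmeas (fun p => (expR (tau * psi p) * (b1 p - b0 p)) ^+ 2) A.
    by apply: bmeas_LB; [lbf|csf].
  have [Db bb] : exists A, bmeas (fun p => W1 * cut_weight b1 p + W0 * cut_weight b0 p) A.
    have := cw _ cb0; have := cw _ cb1 => ? ?.
    by apply: bmeas_LB; [lbf|csf].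
  have lim := limit_inequality hmu au ba bb (fun p => sqr_ge0 _)
    (fun p => addr_ge0 (mulr_ge0 W10 (cut_weight_ge0 g qB b1 p)) (mulr_ge0 W00 (cut_weight_ge0 g qB b0 p))) C0 HC.
  have iX : intg mu (fun p => W2 * (om p * u p ^+ 2)) by apply: intgZ; exact: intgM bom iu.
  apply: (@le_trans _ _ (I (fun p => (expR (tau * psi p) * (b1 p - b0 p)) ^+ 2 * u p ^+ 2))).
    rewrite -(JZ _ (intgM bom iu)); apply: (J_le iX (intgM ba iu)) => p.
    rewrite mulrA ler_wpM2r ?sqr_ge0 //.
    case: (omH p) => [->|[-> A2p]]; first by rewrite mulr0 sqr_ge0.
    have om1 : om p <= 1 by apply: le_trans (ler_norm _) (bom.2 p).
    apply: (@le_trans _ _ W2); first by rewrite ler_piMr ?sqr_ge0.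
    by rewrite mulr1 lerXn2r ?nnegrE ?expR_ge0 // ler_expR ler_wpM2l // ltW.
  apply: le_trans lim _.
  rewrite (@I_ext _ _ _ _ _ (fun p => W1 * (cut_weight b1 p * u p ^+ 2) + W0 * (cut_weight b0 p * u p ^+ 2))); last first.
    by move=> p; ring.
  rewrite (JD (intgZ _ (intgM bw1 iu)) (intgZ _ (intgM bw0 iu))) (JZ _ (intgM bw1 iu)) (JZ _ (intgM bw0 iu)).
  rewrite -/Y [X in _ + W0 * X]J_ae0 ?mulr0 ?addr0 //.
    exact: intg_meas (intgM bw0 iu).
  apply: filterS u0 => p Hp; have [->|/Hp ->] := eqVneq (cut_weight b0 p) 0; first by rewrite mul0r.
  by rewrite expr0n mulr0.
have Y0 : 0 <= Y by apply: I_ge0 => p; apply: mulr_ge0; [exact: (cut_weight_ge0 g qB)|exact: sqr_ge0].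
apply/eqP; rewrite eq_le X0 andbT leNgt; apply/negP => Xp.
pose dA := A2 - A1; have dA0 : 0 < dA by rewrite subr_gt0.
(* Chosen so that [tau dA X >= Y], whereas [exp(2 tau dA)] exceeds [tau dA]. *)
pose tau := T + Y / (X * dA).
have Ttau : T <= tau by rewrite lerDl divr_ge0 // mulr_ge0 // ltW.
have tau0 : 0 < tau by apply: lt_le_trans Ttau; apply: lt_le_trans T1.
have := bound tau Ttau.
rewrite (_ : expR (tau * A2) = expR (tau * A1) * expR (tau * dA)); last first.
  by rewrite -expRD; congr expR; rewrite /dA; ring.
rewrite exprMn -mulrA ler_pM2l ?exprn_gt0 ?expR_gt0 // leNgt => /negP; apply.
have e1 : 1 + tau * dA <= expR (tau * dA) by exact: expR_ge1Dx.
have td : 0 < tau * dA by rewrite mulr_gt0.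
have e2 : tau * dA < expR (tau * dA) ^+ 2.
  apply: (@lt_le_trans _ _ (expR (tau * dA))); first by apply: lt_le_trans e1; rewrite ltrDr.
  by rewrite expr2 ler_peMl ?expR_ge0 // (le_trans _ e1) // lerDl ltW.
apply: (@le_lt_trans _ _ (tau * dA * X)); last by rewrite ltr_pM2r.
have -> : Y = Y / (X * dA) * dA * X by field; rewrite !gt_eqF.
rewrite ler_pM2r // ler_pM2r // lerDr; exact: le_trans T1.
Qed.

End VanishingFromCarleman.

(** * Weights and cutoffs on coordinate balls *)

Section ChartBalls.
Context {R : realType} {N : nat} {M : manifold R N}.
Variable g : metric M.
Implicit Types (c : chart R M N) (p : M) (x y : 'rV[R]_N) (a b E : R).
Local Notation Gam := (Gam g).
Local Notation Lap := (Lap g).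

Definition dist2 x y : R := \sum_i (y 0 i - x 0 i) ^+ 2.

Lemma dist2_ge0 x y : 0 <= dist2 x y.
Proof. by apply: sumr_ge0 => i _; exact: sqr_ge0. Qed.

Lemma quad_smooth x a e : smooth_on setT (fun y => a - e * dist2 x y).
Proof. exact: smooth_euclid_quad. Qed.

Lemma dist2_cont x : continuous (dist2 x).
Proof.
move=> y; have -> : dist2 x = (fun y => 0 - -1 * dist2 x y).
  by apply/funext => z; rewrite mulN1r sub0r opprK.
exact: smooth_on_cont (quad_smooth x 0 (-1)) (Logic.I : [set: 'rV[R]_N] y).
Qed.

Lemma is_derive_coord i j y :
  is_derive y (delta_mx 0 i) (fun z : 'rV[R]_N => z 0 j) ((i == j)%:R : R).
Proof.
have D : derivable (fun z : 'rV[R]_N => z 0 j) y (delta_mx 0 i).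
  by apply: diff_derivable; exact: differentiable_coord.
apply: DeriveDef => //.
rewrite deriveE; last exact: differentiable_coord.
have lin : linear (fun z : 'rV[R]_N => z 0 j : R) by move=> t u v; rewrite !mxE.
pose L := GRing.isLinear.Build _ _ _ _ _ lin.
pose fL : {linear 'rV[R]_N -> R} := HB.pack (fun z : 'rV[R]_N => z 0 j : R) L.
rewrite (_ : (fun z : 'rV[R]_N => z 0 j) = fL :> (_ -> _)) //.
rewrite diff_lin; last by move=> z; exact: coord_continuous.
by rewrite /= mxE eqxx /= eq_sym.
Qed.

Lemma partial_quad x a e i y : partial i (fun y => a - e * dist2 x y) y = - (2 * e * (y 0 i - x 0 i)).
Proof.
have dS j : is_derive y (delta_mx 0 i) (fun z : 'rV[R]_N => (z 0 j - x 0 j) ^+ 2)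
    (2%:R * (y 0 j - x 0 j) ^+ 1 * ((i == j)%:R - 0)).
  by apply: is_deriveXf; exact: (is_deriveBf (is_derive_coord i j y) (is_derive_cst _ _ _)).
have dT : is_derive y (delta_mx 0 i) (dist2 x) (\sum_j (2%:R * (y 0 j - x 0 j) ^+ 1 * ((i == j)%:R - 0))).
  rewrite (_ : dist2 x = \sum_j (fun z : 'rV[R]_N => (z 0 j - x 0 j) ^+ 2)).
    exact: is_derive_sum.
  by apply/funext => z; rewrite fct_sumE.
rewrite /partial (@derive_val _ _ _ _ _ _ _ (is_deriveBf (is_derive_cst a y (delta_mx 0 i)) (is_deriveCf e dT))).
rewrite (bigD1 i) //= eqxx subr0 mulr1 expr1 big1 ?addr0; first ring.
by move=> j ji; rewrite eq_sym (negbTE ji) subr0 mulr0.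
Qed.

Lemma dist2_compact x b : compact [set y | dist2 x y <= b].
Proof.
apply: (subclosed_compact _ (@cball_compact _ _ x (1 + `|b|))).
  by apply: (@closed_comp _ _ (dist2 x) [set t | t <= b]); [move=> y _; exact: dist2_cont|exact: closed_le].
move=> y /= H; apply: mx_norm_le => [|i j]; first by rewrite addr_ge0.
rewrite (ord1 i) !mxE distrC.
have : (y 0 j - x 0 j) ^+ 2 <= (1 + `|b|) ^+ 2.
  apply: (@le_trans _ _ b).
    apply: le_trans H; rewrite /dist2 (bigD1 j) //= lerDl sumr_ge0 // => k _; exact: sqr_ge0.
  apply: le_trans (ler_norm b) _; have := normr_ge0 b; have := sqr_ge0 (`|b|); lra.
by rewrite -[_ ^+ 2 in X in X -> _]real_normK ?num_real // ler_sqr ?nnegrE // addr_ge0.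
Qed.

Lemma dist2_center x : dist2 x x = 0.
Proof. by rewrite /dist2 big1 // => i _; rewrite subrr expr0n. Qed.

(** Both thresholds are squared radii: the argument of [step] is affine in [dist2], equal to 1 at
    [a] and to 0 at [b]. *)
Definition ball_cut a b x y : R := step (b / (b - a) - (b - a)^-1 * dist2 x y).

Lemma ball_cut1 a b x y : a < b -> dist2 x y <= a -> ball_cut a b x y = 1.
Proof.
move=> ab H; apply: step1; have d : 0 < b - a by rewrite subr_gt0.
by rewrite mulrC -mulrBr mulrC ler_pdivlMr // mul1r lerD2l lerN2.
Qed.

Lemma ball_cut0 a b x y : a < b -> b <= dist2 x y -> ball_cut a b x y = 0.
Proof.
move=> ab H; apply: step0; have d : 0 < b - a by rewrite subr_gt0.
by rewrite mulrC -mulrBr pmulr_rle0 ?invr_gt0 // subr_le0.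
Qed.

Lemma ball_cut_le1 a b x y : ball_cut a b x y <= 1. Proof. exact: step_le1. Qed.

Definition chart_ext c (F : 'rV[R]_N -> R) p : R := if `[< cdom c p >] then F (cmap c p) else 0.

Lemma chart_ext_in c F p : cdom c p -> chart_ext c F p = F (cmap c p).
Proof. by move=> dp; rewrite /chart_ext asboolT. Qed.

Lemma chart_ext_out c F p : ~ cdom c p -> chart_ext c F p = 0.
Proof. by move=> dp; rewrite /chart_ext asboolF. Qed.

Lemma chart_ext_cut_smooth c x a b F : atlas c -> a < b ->
  [set y | dist2 x y <= b] `<=` cimg c -> smooth_on setT F ->
  smooth_fun (chart_ext c (fun y => F y * ball_cut a b x y)).
Proof.
move=> ac ab H sF; apply: (smooth_fun_extend ac (@dist2_compact x b) H).
  apply: (@smooth_on_sub _ _ setT); first exact: subsetT.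
  apply: (smooth_onM openT sF).
  apply: (@smooth_on_comp1 _ _ _ setT (@step R) (fun y => b / (b - a) - (b - a)^-1 * dist2 x y)) => //.
  - exact: openT.
  - exact: smooth1_step.
  - exact: quad_smooth.
move=> y _ nb; rewrite ball_cut0 ?mulr0 //; apply: ltW; rewrite ltNge; exact/negP.
Qed.

Definition cshell c x a b : set M := [set p | cdom c p /\ a <= dist2 x (cmap c p) <= b].

Lemma cshell_compact c x a b : atlas c -> [set y | dist2 x y <= b] `<=` cimg c -> compact (cshell c x a b).
Proof.
move=> ac H; rewrite (_ : cshell c x a b = cinv c @` ([set y | dist2 x y <= b] `&` [set y | a <= dist2 x y])).
  apply: cinv_compact => //; first by move=> y [/H].
  apply: (subclosed_compact _ (@dist2_compact x b)) => [|y []//].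
  have cA (A : set R) : closed A -> closed (dist2 x @^-1` A).
    by move=> cA; apply: (@closed_comp _ _ (dist2 x) A) => // y _; exact: dist2_cont.
  by apply: closedI; [exact: cA _ (@closed_le _ b)|exact: cA _ (@closed_ge _ a)].
apply/seteqP; split=> p.
  by move=> [dp /andP[A B]]; exists (cmap c p); rewrite ?cmapK.
by move=> [y [/= B A] <-]; have iy := H y B; split; [exact: cdom_inv|rewrite cinvK // A B].
Qed.

Lemma near_inside c x a p : atlas c -> cdom c p -> dist2 x (cmap c p) < a ->
  \forall r \near p, cdom c r /\ dist2 x (cmap c r) < a.
Proof.
move=> ac dp H; apply: filterI.
  by apply: open_nbhs_nbhs; split => //; exact: cdom_open.
have C : {for p, continuous (dist2 x \o cmap c)}.
  by apply: continuous_comp; [exact: cmap_cont|exact: dist2_cont].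
by apply: (C [set t | t < a]); exact: lt_nbhsl.
Qed.

End ChartBalls.

Section BallContinuation.
Context {R : realType} {N : nat} {M : manifold R N}.
Variable g : metric M.
Variable mu : {measure set (borel M) -> \bar R}.
Hypothesis hmu : is_riemannian_measure g mu.
Variable q : M -> R.
Variable Bq : R.
Hypothesis mq : measurable_fun [set: borel M] (q : borel M -> R).
Hypothesis qB : forall p, `|q p| <= Bq.
Implicit Types (c : chart R M N) (f h u b F G psi sg w th : M -> R) (p : M) (x y : 'rV[R]_N).
Local Notation Gam := (Gam g).
Local Notation Lap := (Lap g).
Local Notation Hes := (Hes g).
Local Notation I := (I mu).

(** The rank one term with [F''] is what convexification exploits: a rapidly growing [F] makes the
    Hessian positive along the gradient of [th]. *)
Lemma Hes_comp1 th w p (F F' : R -> R) (F'' : R) (J : set R) : smooth_fun th -> smooth_fun w ->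
  (forall r, J (th r)) -> (forall t : R, J t -> is_derive t 1 F (F' t)) ->
  smooth_fun (fun r => F' (th r)) -> is_derive (th p) 1 F' F'' ->
  Hes (fun r => F (th r)) w p = F' (th p) * Hes th w p + F'' * Gam th w p ^+ 2.
Proof.
move=> sth sw Jth dF sF' dF'; rewrite !HesU.
have E : Gam (fun r => F (th r)) w = (fun r => F' (th r) * Gam th w r).
  by apply/funext => r; exact: (Gam_comp1l g w sth (dF _ (Jth r))).
rewrite E (GamMr g w p sF' (Gam_smooth g sth sw)) (Gam_comp1r g w sth dF') (Gam_comp1l g (Gam w w) sth (dF _ (Jth p))).
rewrite (GamC g w th); ring.
Qed.

Lemma bounded_compact f (K : set M) : smooth_fun f -> compact K -> exists2 B : R, 0 <= B & forall p, K p -> `|f p| <= B.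
Proof.
move=> sf cK; have [_ /(_ K cK) [B HB]] := LB_smooth sf; exists `|B| => // p Kp.
exact: le_trans (HB p Kp) (ler_norm _).
Qed.

Lemma metric_diag_bound c (K : set M) : atlas c -> compact K -> K `<=` cdom c ->
  exists2 D : R, 0 <= D & forall w p, smooth_fun w -> K p ->
    \sum_i partial i (w \o cinv c) (cmap c p) ^+ 2 <= D * Gam w w p.
Proof.
move=> ac cK Kc.
have /choice[d Hd] : forall i : 'I_N, exists B : R, forall p, K p -> `|g c (cmap c p) i i| <= B.
  by move=> i; have [B _ HB] := chart_bounded ac cK Kc (gmx_smooth g ac i i); exists B.
exists (\sum_i `|d i|); first by apply: sumr_ge0.
move=> w p sw Kp; have dp := Kc p Kp; have ix := cimg_map dp.
rewrite mulr_suml; apply: ler_sum => i _.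
have := @coord_dual_bound _ _ (g c (cmap c p)) (grad c w (cmap c p)) i (gmx_sym g ac ix) (gmx_pos g ac ix).
rewrite -[X in _ <= _ * X -> _]/(gam g c w w (cmap c p)) -(GamE g ac sw sw dp) mxE => H.
apply: le_trans H _; rewrite ler_wpM2r ?Gam_ge0 //; apply: le_trans (ler_norm _) _.
by apply: le_trans (Hd i p Kp) (ler_norm _).
Qed.

(** The weight decreases outwards. The inner cutoff varies where [u] is already known to vanish, the
    outer one beyond [E'], where the weight is strictly smaller than on the ball to be reached. *)
Lemma ucp_ball c x (s E' E : R) u : atlas c -> [set y | dist2 x y <= E] `<=` cimg c ->
  0 < s -> s <= E' -> E' < E -> approximable g mu q u ->
  {ae mu, forall p : borel M, cdom c p -> dist2 x (cmap c p) < s -> u p = 0} ->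
  {ae mu, forall p : borel M, cdom c p -> dist2 x (cmap c p) <= E' -> u p = 0}.
Proof.
move=> ac HE s0 sE E'E au u0.
(* Room between [E'] and [E] for two cutoffs one outside the other: [b1] falls between [E1] and
   [E2], while [th] is modified only between [E3] and [E4]. *)
pose e := (E - E') / 5; have e0 : 0 < e by rewrite divr_gt0 // subr_gt0.
pose E1 := E' + e; pose E2 := E' + 2 * e; pose E3 := E' + 3 * e; pose E4 := E' + 4 * e.
have EE : E = E' + 5 * e by rewrite /e; field.
have E12 : E1 < E2 by rewrite /E1 /E2; lra.
have E34 : E3 < E4 by rewrite /E3 /E4; lra.
have s12 : s / 4 < s / 2 by lra.
have sub (b : R) : b <= E -> [set y | dist2 x y <= b] `<=` cimg c.
  by move=> bE y /= H; apply: HE => /=; exact: le_trans bE.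
have E4E : E4 <= E by rewrite EE /E4; lra.
have E2E : E2 <= E by rewrite EE /E2; lra.
have sE2 : s / 2 <= E by rewrite EE; lra.
pose th := chart_ext c (fun y => (E - 1 * dist2 x y) * ball_cut E3 E4 x y).
have sth : smooth_fun th by apply: chart_ext_cut_smooth ac E34 (sub _ E4E) (quad_smooth x E 1).
pose b1 := chart_ext c (fun y => 1 * ball_cut E1 E2 x y).
have sb1 : smooth_fun b1 by exact: (chart_ext_cut_smooth (F := fun=> 1) ac E12 (sub _ E2E) (@smooth_on_cst R N setT 1)).
pose b0 := chart_ext c (fun y => 1 * ball_cut (s / 4) (s / 2) x y).
have sb0 : smooth_fun b0 by exact: (chart_ext_cut_smooth (F := fun=> 1) ac s12 (sub _ sE2) (@smooth_on_cst R N setT 1)).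
pose K := cshell c x (s / 4) E2.
have cK : compact K by exact: cshell_compact ac (sub _ E2E).
have Kc : K `<=` cdom c by move=> p [].
have thK p : K p -> th p = E - dist2 x (cmap c p).
  move=> [dp /andP[_ H]]; rewrite /th chart_ext_in // ball_cut1 // ?mulr1 ?mul1r //.
  by apply: le_trans H _; rewrite /E2 /E3; lra.
have thE p : th p <= E.
  have [dp|ndp] := pselect (cdom c p); last by rewrite /th chart_ext_out // EE; lra.
  rewrite /th chart_ext_in // mul1r; have d0 := dist2_ge0 x (cmap c p).
  have [H|H] := leP (dist2 x (cmap c p)) E.
    apply: (@le_trans _ _ (E - dist2 x (cmap c p))); last by rewrite gerBl.
    by rewrite ler_piMr ?ball_cut_le1 // subr_ge0.
  by rewrite ball_cut0 ?mulr0 //; [rewrite EE; lra|exact: le_trans E4E (ltW H)].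
have thE1 p : (cdom c p /\ dist2 x (cmap c p) < E1) \/ th p <= E - E1.
  have E10 : 0 <= E - E1 by rewrite EE /E1; lra.
  have [dp|ndp] := pselect (cdom c p); last by right; rewrite /th chart_ext_out.
  have [H|H] := ltP (dist2 x (cmap c p)) E1; [by left|right].
  rewrite /th chart_ext_in // mul1r.
  have [H2|H2] := leP (dist2 x (cmap c p)) E.
    apply: (@le_trans _ _ (E - dist2 x (cmap c p))); last by rewrite lerD2l lerN2.
    by rewrite ler_piMr ?ball_cut_le1 // subr_ge0.
  by rewrite ball_cut0 ?mulr0 //; exact: le_trans E4E (ltW H2).
have [C C0 HC] := Hes_bound g ac sth cK Kc.
have [D D0 HD] := metric_diag_bound ac cK Kc.
(* On the shell [dist2 >= s/4] the coordinate gradient of [th] has squared length [4 dist2 >= s],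
   which is at most [D] times [Gam th th]. *)
pose c0 := s / (D + 1); have D1 : 0 < D + 1 by rewrite ltr_wpDl.
have c00 : 0 < c0 by rewrite divr_gt0.
have thG p : K p -> c0 <= Gam th th p.
  move=> Kp; have [dp /andP[sp pE2]] := Kp; have ix := cimg_map dp.
  have oU : open (cimg c `&` [set y | dist2 x y < E3]).
    apply: openI; first exact: cimg_open.
    by apply: (@open_comp _ _ (dist2 x) [set t | t < E3]); [move=> y _; exact: dist2_cont|exact: open_lt].
  have Ux : (cimg c `&` [set y | dist2 x y < E3]) (cmap c p).
    by split => //=; apply: le_lt_trans pE2 _; rewrite /E2 /E3; lra.
  have Dth i : partial i (th \o cinv c) (cmap c p) = - (2 * 1 * (cmap c p 0 i - x 0 i)).
    rewrite -(partial_quad x E 1); apply: (partial_near i oU Ux) => y [iy /= yE].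
    by rewrite /th chart_ext_in; [rewrite cinvK // ball_cut1 ?mulr1 // ltW|exact: cdom_inv].
  have := HD th p sth Kp; under eq_bigr do rewrite Dth.
  rewrite (_ : \sum_i _ = 4 * dist2 x (cmap c p)); last first.
    by rewrite mulr_sumr; apply: eq_bigr => i _; ring.
  have G0 := Gam_ge0 g th p; move=> H; rewrite /c0 ler_pdivrMr //; lra.
(* Makes [ga Gam th th >= 2 C + 1]: the convexifying term beats both the Hessian of [th], bounded by
   [C], and the correction [sg], with one unit to spare. *)
pose ga := (2 * C + 1) / c0; have ga0 : 0 < ga by rewrite divr_gt0 // ltr_wpDl // mulr_ge0.
pose psi p := expR (ga * th p).
have spsi : smooth_fun psi by rewrite /psi; smf.
(* The smallest multiple of [ga psi] that offsets a Hessian of [th] bounded below by [- C]. *)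
pose sg p := 2 * C * ga * psi p.
have ssg : smooth_fun sg by rewrite /sg; smf.
have dexp (t : R) : is_derive t 1 (fun t => expR (ga * t)) (expR (ga * t) * ga).
  apply: is_derive_compf; exact: is_derive_eqf (is_deriveCf ga (is_derive_id _ _)) (mulr1 _).
have dexp2 (t : R) : is_derive t 1 (fun t => expR (ga * t) * ga) (expR (ga * t) * ga * ga).
  apply: is_derive_eqf (is_deriveMf (dexp t) (is_derive_cst ga t 1)) _.
  by rewrite mulr0 add0r mulrC.
have HP w p : smooth_fun w -> Hes psi w p = psi p * ga * Hes th w p + psi p * ga * ga * Gam th w p ^+ 2.
  move=> sw; have sd : smooth_fun (fun r => expR (ga * th r) * ga) by smf.
  exact: (Hes_comp1 sth sw (fun _ => Logic.I : setT _) (fun t _ => dexp t) sd (dexp2 (th p))).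
have GP w p : Gam psi w p = psi p * ga * Gam th w p.
  exact: (Gam_comp1l g w sth (dexp (th p))).
have psi0 p : 0 < psi p by exact: expR_gt0.
have psiK p : K p -> 1 <= psi p.
  move=> Kp; rewrite /psi -expR0 ler_expR mulr_ge0 ?(ltW ga0) // thK // subr_ge0.
  by move: Kp => [_ /andP[_ H]]; exact: le_trans E2E.
have H1 w p : smooth_fun w -> K p -> 0 <= 2 * Hes psi w p + sg p * Gam w w p.
  move=> sw Kp; rewrite HP // /sg; have := HC w p sw Kp; rewrite ler_norml => /andP[h _].
  have q1 : 0 <= psi p * ga * (C * Gam w w p + Hes th w p).
    by rewrite mulr_ge0 ?(mulr_ge0 (ltW (psi0 p)) (ltW ga0)) // -lerBlDl sub0r.
  have q2 : 0 <= psi p * ga * ga * Gam th w p ^+ 2.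
    by rewrite mulr_ge0 ?sqr_ge0 // (mulr_ge0 (mulr_ge0 (ltW (psi0 p)) (ltW ga0)) (ltW ga0)).
  lra.
(* The spare unit of [ga Gam th th - 2 C], using [psi >= 1] and [Gam th th >= c0] on the shell. *)
pose m := 2 * ga ^+ 3 * c0.
have m0 : 0 < m by rewrite /m mulr_gt0 // mulr_gt0 // exprn_gt0.
have H2 p : K p -> m <= 2 * Hes psi psi p - sg p * Gam psi psi p.
  move=> Kp; have := HC psi p spsi Kp; rewrite ler_norml => /andP[h _].
  have E_ : Gam th psi p = psi p * ga * Gam th th p by rewrite GamC GP.
  have EP : Gam psi psi p = (psi p * ga) ^+ 2 * Gam th th p by rewrite GP E_; ring.
  rewrite (HP psi p spsi) EP E_ /sg; rewrite EP in h.
  have tG := thG p Kp; have p1 := psiK p Kp.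
  have gG : 2 * C + 1 <= ga * Gam th th p.
    by apply: (@le_trans _ _ (ga * c0)); [rewrite /ga divfK // gt_eqF|rewrite ler_wpM2l // ltW].
  move: h tG p1 gG; move: (Hes th psi p) (Gam th th p) (psi p) => H G P h tG p1 gG.
  have P0 : 0 <= P by apply: le_trans p1.
  have Pg : 0 <= P * ga by rewrite mulr_ge0 // ltW.
  have k1 : - (C * ((P * ga) ^+ 2 * G)) * (P * ga) <= H * (P * ga) by rewrite ler_wpM2r.
  have G0 : 0 <= G by apply: le_trans tG; exact: ltW.
  have k2 : 0 <= (P * ga) ^+ 3 * G * (ga * G - 2 * C - 1).
    by rewrite mulr_ge0 ?subr_ge0 //; [rewrite mulr_ge0 // exprn_ge0|lra].
  have P3 : 1 <= P ^+ 3 by rewrite exprn_ege1.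
  have k3 : ga ^+ 3 * c0 <= (P * ga) ^+ 3 * G.
    have g3 : 0 <= ga ^+ 3 by rewrite exprn_ge0 // ltW.
    apply: (@le_trans _ _ (ga ^+ 3 * G)); first by rewrite ler_wpM2l.
    suff k4 (t : R) : 0 <= t ^+ 3 -> t ^+ 3 * G <= (P * t) ^+ 3 * G by exact: k4.
    by move=> t3; rewrite exprMn -(mulrA (P ^+ 3)) ler_peMl // mulr_ge0.
  rewrite /m; lra.
have [B1 B10 HB1] : exists2 B : R, 0 <= B & forall p, K p -> `|Lap (fun r => Lap psi r + sg r) p| <= B.
  by apply: bounded_compact cK; smf.
have [B2 B20 HB2] : exists2 B : R, 0 <= B & forall p, K p -> `|sg p ^+ 2| <= B.
  by apply: (@bounded_compact (fun p => sg p ^+ 2) K _ cK); smf.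
have H3 p : K p -> `|Lap (fun r => Lap psi r + sg r) p| <= B1 + B2 /\ sg p ^+ 2 <= B1 + B2.
  move=> Kp; split; first by apply: le_trans (HB1 p Kp) _; rewrite lerDl.
  by apply: le_trans (ler_norm _) _; apply: le_trans (HB2 p Kp) _; rewrite lerDr.
have cut_off (a b : R) p : a < b -> ~ cshell c x 0 b p -> chart_ext c (fun y => 1 * ball_cut a b x y) p = 0.
  move=> ab nK; have [dp|ndp] := pselect (cdom c p); last by rewrite chart_ext_out.
  rewrite chart_ext_in // ball_cut0 ?mulr0 // leNgt; apply/negP => H; apply: nK.
  by split => //; rewrite dist2_ge0 ltW.
have cb (b a : R) : a < b -> b <= E -> cs (chart_ext c (fun y => 1 * ball_cut a b x y)).
  move=> ab bE; exists (cshell c x 0 b); first exact: cshell_compact ac (sub _ bE).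
  by move=> p; exact: cut_off.
have near1 (a b : R) p : a < b -> cdom c p -> dist2 x (cmap c p) < a ->
    \forall r \near p, chart_ext c (fun y => 1 * ball_cut a b x y) r = 1.
  move=> ab dp H; apply: filterS (near_inside ac dp H) => r [dr Hr].
  by rewrite chart_ext_in // ball_cut1 ?mulr1 // ltW.
pose A2 := expR (ga * (E - E')).
pose A1 := expR (ga * (E - E1)).
have h1 p : (Gam b1 b1 p = 0 /\ Lap b1 p = 0) \/ psi p <= A1.
  have [[dp H]|H] := thE1 p; last by right; rewrite /psi /A1 ler_expR ler_wpM2l // ltW.
  left; have n1 := near1 _ _ _ E12 dp H; split.
    by rewrite -(Gam_cstl g 1 b1 p); apply: Gam_near => //; near=> r.
  by rewrite -(Lap_cst g 1 p) !Lap_laplacian; apply: laplacian_near.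
(* The crude upper bound of [psi] is enough for the inner cutoff, whose contribution is killed by
   the vanishing of [u]. *)
have h0 p : (Gam b0 b0 p = 0 /\ Lap b0 p = 0) \/ psi p <= expR (ga * E).
  by right; rewrite /psi ler_expR ler_wpM2l // ltW.
pose Ko := cshell c x (s / 2) E'.
have cKo : compact Ko by apply: cshell_compact ac (sub _ _); exact: ltW.
have mKo : measurable (Ko : set (borel M)) by apply: measurable_closedM; exact: compact_closedM.
pose om p : R := \1_(Ko : set (borel M)) p.
have om01 p : om p = 0 \/ om p = 1 /\ Ko p.
  have [H|H] := pselect (Ko p); last by left; rewrite /om indicE memNset.
  by right; rewrite /om indicE mem_set.
have bom : bmeas om 1.
  split; first exact: measurable_indic.
  by move=> p; case: (om01 p) => [->|[-> _]]; rewrite ?normr0 ?normr1.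
have om0 p : 0 <= om p by case: (om01 p) => [->|[-> _]].
have A12 : A1 < A2 by rewrite /A1 /A2 ltr_expR ltr_pM2l // ltrD2l ltrN2 ltrDl.
have V : I (fun p => om p * u p ^+ 2) = 0.
  apply: (ucp_vanish hmu mq qB spsi ssg cK m0 (addr_ge0 B10 B20) H1 H2 H3 sb0 sb1 _ _ _ h0 h1 A12 bom om0 _ au) => //.
  - exact: cb s12 sE2.
  - exact: cb E12 E2E.
  - move=> p nK; have [dp|ndp] := pselect (cdom c p); last by rewrite /b1 /b0 !chart_ext_out ?subr0.
    rewrite /b1 /b0 !chart_ext_in //.
    have [H|H] := ltP (dist2 x (cmap c p)) (s / 4).
      by rewrite !ball_cut1 ?subrr //; apply: ltW => //; apply: lt_trans H _; rewrite /E1; lra.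
    have H' : E2 < dist2 x (cmap c p).
      by rewrite ltNge; apply/negP => H'; apply: nK; split => //; rewrite H.
    rewrite (ball_cut0 E12 (ltW H')) (ball_cut0 s12) ?subrr //.
    by apply: ltW; apply: le_lt_trans H'; rewrite /E2; lra.

  - move=> p; case: (om01 p) => [->|[_ [dp /andP[a b]]]]; [by left|right].
    rewrite /b1 /b0 !chart_ext_in // !mul1r ball_cut1 ?(ball_cut0 s12 a) ?subr0 //; last first.
      by apply: le_trans b _; rewrite lerDl ltW.
    split => //; rewrite /A2 /psi ler_expR ler_wpM2l ?(ltW ga0) // /th chart_ext_in // ball_cut1 ?mulr1 ?mul1r //.
      by rewrite lerD2l lerN2.
    by apply: le_trans b _; rewrite /E3; lra.
  apply: filterS u0 => p up; have [Kp|nK] := pselect (cshell c x 0 (s / 2) p).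
    move=> _; case: Kp => dp /andP[_ H]; apply: up => //; apply: le_lt_trans H _; lra.
  have ck : compact (cshell c x 0 (s / 2)) := cshell_compact ac (sub _ sE2).
  have b0off r : ~ cshell c x 0 (s / 2) r -> b0 r = 0 by exact: cut_off.
  rewrite /cut_weight /cac_weight (Lap_off g ck b0off nK) (Gam_off g _ ck b0off nK).
  rewrite (Lap_off g ck (fun r nr => Gam_off g b0 ck b0off nr) nK).
  by rewrite expr0n normr0 /= !(mulr0, addr0) eqxx.
have ib : intg mu (fun p => om p * u p ^+ 2) by case: au => _ iu _; exact: intgM bom iu.
have := ae0_J ib (fun p => mulr_ge0 (om0 p) (sqr_ge0 (u p))) V => ae1.
apply: filterS2 u0 ae1 => p up op dp pE.
have [H|H] := ltP (dist2 x (cmap c p)) (s / 2); first by apply: up => //; apply: lt_trans H _; lra.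
have : Ko p by split => //; rewrite H.
move: op; rewrite /om indicE => + Kp; rewrite mem_set // mul1r => /eqP.
by rewrite sqrf_eq0 => /eqP.
Unshelve. all: by end_near. Qed.

End BallContinuation.

(** * From coordinate balls to a connected manifold *)

Section Connected.
Context {R : realType} {N : nat} {M : manifold R N}.
Variable g : metric M.
Variable mu : {measure set (borel M) -> \bar R}.
Hypothesis hmu : is_riemannian_measure g mu.
Variable q : M -> R.
Variable Bq : R.
Hypothesis mq : measurable_fun [set: borel M] (q : borel M -> R).
Hypothesis qB : forall p, `|q p| <= Bq.
Implicit Types (c : chart R M N) (u : M -> R) (p : M) (x y : 'rV[R]_N).

Lemma dist2_norm x y (e : R) : 0 <= e -> dist2 x y <= e ^+ 2 -> `|x - y| <= e.
Proof.
move=> e0 H; apply: mx_norm_le => // i j; rewrite (ord1 i) !mxE distrC.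
rewrite -ler_sqr ?nnegrE // real_normK ?num_real //; apply: le_trans H.
by rewrite /dist2 (bigD1 j) //= lerDl sumr_ge0 // => k _; exact: sqr_ge0.
Qed.

Lemma dist2C x y : dist2 x y = dist2 y x.
Proof. by apply: eq_bigr => i _; rewrite -sqrrN opprB. Qed.

Definition ae_zero_on u (W : set M) := {ae mu, forall p : borel M, W p -> u p = 0}.

Lemma ae_imp (P Q : borel M -> Prop) : (forall p, P p -> Q p) ->
  {ae mu, forall p, P p} -> {ae mu, forall p, Q p}.
Proof. by move=> PQ; apply: filterS => p; exact: PQ. Qed.

(** The set of points near which [u] vanishes almost everywhere is open by definition and closed by
    [ucp_ball] applied around a nearby point of the set. A countable base then turns local vanishing
    almost everywhere into global vanishing. *)
Lemma ucp_connected u (W : set M) p0 : connected [set: M] -> approximable g mu q u ->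
  open W -> W p0 -> ae_zero_on u W -> {ae mu, forall p : borel M, u p = 0}.
Proof.
move=> cM au oW Wp0 uW.
pose Z : set M := [set p | exists O, [/\ open O, O p & ae_zero_on u O]].
have oZ : open Z.
  rewrite openE => p [Q [oQ Qp uQ]]; rewrite /interior nbhsE; exists Q => // r Qr.
  by exists Q.
have clZ : closed Z.
  move=> p clp; have [ac dp] := chart_atP p; set c := chart_at p in ac dp; set x := cmap c p.
  have ix : cimg c x by exact: cimg_map.
  have /nbhs_ballP[e /= e0 He] : nbhs x (cimg c) by apply: open_nbhs_nbhs; split => //; exact: cimg_open.
  have He' y : `|x - y| < e -> cimg c y by move=> H; apply: He; rewrite -ball_normE.
  (* The ball is centred at a point [z] of the set within [e/4] of [x]: radius [e/4] then reaches
     [x], and radius [e/2] stays inside the chart. *)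
  pose E' := (e / 4) ^+ 2; pose E := (e / 2) ^+ 2.
  have E'0 : 0 < E' by rewrite exprn_gt0 // divr_gt0.
  have E'E : E' < E by rewrite /E' /E !expr_div_n; have := exprn_gt0 2 e0; lra.
  have nb : nbhs p [set r | cdom c r /\ dist2 x (cmap c r) < E'].
    by apply: near_inside => //; rewrite dist2_center.
  have [r [[Q [oQ Qr uQ]] [dr xr]]] := clp _ nb.
  set z := cmap c r in xr; have iz : cimg c z by exact: cimg_map.
  have xz : `|x - z| <= e / 4 by apply: dist2_norm; [rewrite divr_ge0 // ltW|exact: ltW].
  have HE : [set y | dist2 z y <= E] `<=` cimg c.
    move=> y /= zy; apply: He'; have zy' : `|z - y| <= e / 2.
      by apply: dist2_norm => //; rewrite divr_ge0 // ltW.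
    by rewrite -(subrKA z); apply: le_lt_trans (ler_normD _ _) _; lra.
  have /nbhs_ballP[d /= d0 Hd] : nbhs z (cpre c Q).
    by apply: open_nbhs_nbhs; split; [exact: cpre_open|split => //=; rewrite cmapK].
  pose s := Num.min E' ((d / 2) ^+ 2).
  have s0 : 0 < s by rewrite lt_min E'0 exprn_gt0 // divr_gt0.
  have sE : s <= E' by rewrite ge_min lexx.
  have u0 : {ae mu, forall p : borel M, cdom c p -> dist2 z (cmap c p) < s -> u p = 0}.
    apply: (ae_imp _ uQ) => t Ht dt zt; apply: Ht.
    have : cpre c Q (cmap c t).
      apply: Hd; rewrite -ball_normE /=; apply: (@le_lt_trans _ _ (d / 2)); last lra.
      apply: dist2_norm; first by rewrite divr_ge0 // ltW.
      by apply: le_trans (ltW zt) _; rewrite ge_min lexx orbT.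
    by move=> [_ /=]; rewrite cmapK.
  have u1 := ucp_ball hmu mq qB ac HE s0 sE E'E au u0.
  exists (cdom c `&` cmap c @^-1` [set y | dist2 z y < E']); split.
  - apply: open_restrict_preimage; [exact: cdom_open|by move=> t; exact: cmap_cont|].
    by apply: (@open_comp _ _ (dist2 z) [set t | t < E']); [move=> y _; exact: dist2_cont|exact: open_lt].
  - by split => //=; rewrite dist2C.
  - by apply: (ae_imp _ u1) => t Ht [dt /ltW]; exact: Ht.
have ZT : Z = setT.
  apply: cM; [by exists p0; exists W|by exists Z; rewrite ?setTI|by exists Z; rewrite ?setTI].
have [B cB [Bo Bb]] := manifold_second_countable M.
have /countable_injP[nu nuI] := cB.
(* Indexing the base by natural numbers makes the exceptional sets a countable family. *)
have P (n : nat) : {ae mu, forall p : borel M, forall U, B U -> nu U = n -> ae_zero_on u U -> U p -> u p = 0}.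
  have [[U [BU nU uU]]|H] := pselect (exists U, [/\ B U, nu U = n & ae_zero_on u U]); last first.
    by apply: filterE => p U BU nU uU; exfalso; apply: H; exists U.
  apply: (ae_imp _ uU) => p Hp U' BU' nU' _ U'p; apply: Hp.
  by rewrite (nuI U U') ?inE // nU nU'.
apply: (ae_imp _ (ae_foralln P)) => p Hp.
have [Q [oQ Qp uQ]] : Z p by rewrite ZT.
have nQ : nbhs p Q by exact: open_nbhs_nbhs.
have [U /= [BU Up] UQ] := Bb p Q nQ.
apply: (Hp (nu U) U) => //; by apply: (ae_imp _ uQ) => r Hr /UQ.
Qed.

End Connected.

(** * Geometry of the conic end *)

Section FirstCoordinate.
Context {R : realType} {N : nat} {M : manifold R N}.
Variable g : metric M.
Variable mu : {measure set (borel M) -> \bar R}.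
Hypothesis hmu : is_riemannian_measure g mu.
Implicit Types (c : chart R M N) (f w th : M -> R) (p : M) (x y : 'rV[R]_N).
Local Notation Gam := (Gam g).
Local Notation Lap := (Lap g).
Local Notation Hes := (Hes g).

Definition partial_mx c (l : 'I_N) x : 'M[R]_N := \matrix_(i, j) partial l (fun y => g c y i j) x.

Lemma partial_inv c l x : atlas c -> cimg c x ->
  (\matrix_(i, j) partial l (fun y => invmx (g c y) i j) x : 'M[R]_N) =
  - (invmx (g c x) *m partial_mx c l x *m invmx (g c x)).
Proof.
move=> ac ix; set DI := (\matrix_(i, j) _); have oi := cimg_open ac.
have uG y : cimg c y -> g c y \in unitmx by exact: g_unit.
have E : g c x *m DI + partial_mx c l x *m invmx (g c x) = 0.
  apply/matrixP => i j; rewrite !mxE -big_split /=.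
  have sI k : smooth_on (cimg c) (fun y => g c y i k * invmx (g c y) k j).
    exact: smooth_onM oi (gmx_smooth g ac i k) (g_inv_smooth g k j ac).
  transitivity (partial l (fun y => \sum_k g c y i k * invmx (g c y) k j) x).
    rewrite (partial_sum ix _ l oi sI); apply: eq_bigr => k _; rewrite !mxE.
    rewrite (partialM ix l (gmx_smooth g ac i k) (g_inv_smooth g k j ac)); ring.
  rewrite (partial_near (G := fun=> (1%:M : 'M[R]_N) i j) l oi ix); last first.
    by move=> y iy; rewrite -(mulmxV (uG y iy)) mxE.
  by rewrite /partial derive_cst.
have : invmx (g c x) *m (g c x *m DI + partial_mx c l x *m invmx (g c x)) = 0 by rewrite E mulmx0.
rewrite mulmxDr mulKmx ?uG // mulmxA => /eqP; rewrite addr_eq0 => /eqP //.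
Qed.

Variables (c : chart R M N) (th : M -> R) (i0 : 'I_N).
Hypothesis ac : atlas c.
Hypothesis sth : smooth_fun th.
Hypothesis thE : forall y, cimg c y -> th (cinv c y) = y 0 i0.
Hypothesis gE : forall y i, cimg c y -> g c y i0 i = (i == i0)%:R.

Lemma partial_th j y : cimg c y -> partial j (th \o cinv c) y = (j == i0)%:R.
Proof.
move=> iy; rewrite (partial_near (G := fun z : 'rV[R]_N => z 0 i0) j (cimg_open ac) iy); last first.
  by move=> z iz; exact: thE.
by rewrite /partial (@derive_val _ _ _ _ _ _ _ (is_derive_coord j i0 y)).
Qed.

Lemma inv_i0 y i : cimg c y -> invmx (g c y) i i0 = (i == i0)%:R.
Proof.
move=> iy; have uG := g_unit g ac iy.
have E : (delta_mx 0 i0 : 'rV[R]_N) *m g c y = delta_mx 0 i0.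
  by rewrite -rowE; apply/rowP => j; rewrite !mxE gE //= eq_sym.
have : (delta_mx 0 i0 : 'rV[R]_N) *m g c y *m invmx (g c y) = delta_mx 0 i0 by rewrite mulmxK.
rewrite E -rowE => /rowP/(_ i); rewrite !mxE /= => H.
by have /matrixP/(_ i i0) := g_inv_sym g ac iy; rewrite mxE H => <-.
Qed.

(** The hypotheses [thE] and [gE] say that [th] is a coordinate whose coordinate field is of unit
    length and orthogonal to the others, as for a distance function; its gradient is then that
    coordinate field. *)
Lemma dual_th i y : cimg c y -> dual_grad g c th i y = (i == i0)%:R.
Proof.
move=> iy; rewrite /dual_grad (bigD1 i0) //= big1 ?addr0; last first.
  by move=> j ji; rewrite partial_th // (negbTE ji) mulr0.
by rewrite partial_th // eqxx mulr1 inv_i0.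
Qed.

Lemma Gam_th w p : smooth_fun w -> cdom c p -> Gam th w p = partial i0 (w \o cinv c) (cmap c p).
Proof.
move=> sw dp; have ix := cimg_map dp.
rewrite (GamE g ac sth sw dp) (gam_dual _ _ _ ac ix) (bigD1 i0) //= big1 ?addr0.
  by rewrite dual_th // eqxx mul1r.
by move=> j ji; rewrite dual_th // (negbTE ji) mul0r.
Qed.

Definition gradvec w p : 'rV[R]_N := grad c w (cmap c p) *m invmx (g c (cmap c p)).

Lemma gradvec_i0 w p : smooth_fun w -> cdom c p -> gradvec w p 0 i0 = Gam th w p.
Proof.
move=> sw dp; have ix := cimg_map dp; rewrite Gam_th // mxE (bigD1 i0) //= big1 ?addr0.
  by rewrite inv_i0 // eqxx mulr1 mxE.
by move=> j ji; rewrite inv_i0 // (negbTE ji) mulr0.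
Qed.

Lemma Gam_gradvec w p : smooth_fun w -> cdom c p ->
  Gam w w p = (gradvec w p *m g c (cmap c p) *m (gradvec w p)^T) 0 0.
Proof.
move=> sw dp; have ix := cimg_map dp; rewrite (GamE g ac sw sw dp) /gam.
by rewrite form_dual //; [exact: gmx_sym|exact: g_unit].
Qed.

(** The gradient of [th] has constant components, so only the derivative of the inverse metric
    survives in [hes_coef]; lowering indices gives half of the derivative of the metric, the second
    fundamental form of the level sets. *)
Lemma Hes_th w p : smooth_fun w -> cdom c p ->
  Hes th w p = 2^-1 * (gradvec w p *m partial_mx c i0 (cmap c p) *m (gradvec w p)^T) 0 0.
Proof.
move=> sw dp; set x := cmap c p; have ix : cimg c x := cimg_map dp.
have oi := cimg_open ac.
have E i j : hes_coef g c th i j x = - 2^-1 * partial i0 (fun y => invmx (g c y) i j) x.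
  rewrite /hes_coef big1 ?sub0r; last first.
    move=> k _; rewrite (partial_near (G := fun=> (j == i0)%:R) k oi ix) ?/partial ?derive_cst ?mulr0 //.
    by move=> y iy; exact: dual_th.
  rewrite (bigD1 i0) //= big1 ?addr0; last by move=> l li; rewrite dual_th // (negbTE li) mul0r.
  by rewrite dual_th // eqxx mul1r mulNr.
rewrite (HesE g ac sth sw dp) -/x.
have PI := partial_inv i0 ac ix.
transitivity (- 2^-1 * (grad c w x *m (\matrix_(i, j) partial i0 (fun y => invmx (g c y) i j) x) *m (grad c w x)^T) 0 0).
  rewrite mxE mulr_sumr exchange_big /=; apply: eq_bigr => j _; rewrite !mxE mulr_suml mulr_sumr.
  apply: eq_bigr => i _; rewrite E !mxE; ring.
rewrite PI mulmxN mulNmx mxE mulrNN; congr (_ * _).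
by rewrite /gradvec -/x trmx_mul (g_inv_sym g ac ix) !mulmxA.
Qed.

(** Only the component [i0] of the flux of [th] is nonzero, and it is the density itself: the mean
    curvature of the level sets is the logarithmic derivative of the volume density. *)
Lemma Lap_th_vol p : cdom c p ->
  Lap th p = (vol_density g c (cmap c p))^-1 * partial i0 (vol_density g c) (cmap c p).
Proof.
move=> dp; set x := cmap c p; have ix : cimg c x := cimg_map dp; have oi := cimg_open ac.
rewrite (LapE hmu ac sth dp) lapcU -/x (bigD1 i0) //= big1 ?addr0; last first.
  move=> j ji; rewrite (partial_near (G := fun=> 0) j oi ix) ?/partial ?derive_cst //.
  by move=> y iy; rewrite fluxU -/(dual_grad g c th j y) dual_th // (negbTE ji) mulr0.
rewrite (partial_near (G := vol_density g c) i0 oi ix) //.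
by move=> y iy; rewrite fluxU -/(dual_grad g c th i0 y) dual_th // eqxx mulr1.
Qed.

Lemma Lap_th p : cdom c p ->
  Lap th p = partial i0 (fun y => \det (g c y)) (cmap c p) / (2 * \det (g c (cmap c p))).
Proof.
move=> dp; rewrite (Lap_th_vol dp); set x := cmap c p; have ix : cimg c x := cimg_map dp; have oi := cimg_open ac.
have d0 := g_det_gt0 g ac ix.
have dd : derivable (fun y => \det (g c y)) x (delta_mx 0 i0).
  apply: (smooth_on_der _ ix); apply: smooth_on_det => //; exact: gmx_smooth.
have ds := is_derive_compf (F := @Num.sqrt R) (f := fun y => \det (g c y)) (is_derive1_sqrt d0) (derivableP dd).
rewrite /partial (@derive_val _ _ _ _ _ _ _ ds) /vol_density.
have s0 : Num.sqrt (\det (g c x)) != 0 by rewrite sqrtr_eq0 -ltNge.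
rewrite -{3}(sqr_sqrtr (ltW d0)).
by field.
Qed.

End FirstCoordinate.

Section DetBounds.
Context {R : realType}.

Lemma prod_deriv_bound (T : Type) (r : seq T) (f : T -> R -> R) (f' : T -> R) (x B d : R) :
  0 <= B -> 0 <= d -> (forall i, is_derive x 1 (f i) (f' i)) ->
  (forall i, `|f i x| <= B) -> (forall i, `|f' i| <= d) ->
  exists D, [/\ is_derive x 1 (fun t => \prod_(i <- r) f i t) D,
    `|\prod_(i <- r) f i x| <= (1 + B) ^+ size r & `|D| <= (size r)%:R * (1 + B) ^+ size r * d].
Proof.
move=> B0 d0 df fB f'd; elim: r => [|i r [D [dD PB DB]]].
  exists 0; split; first by under eq_fun do rewrite big_nil; exact: is_derive_cst.
    by rewrite big_nil normr1 expr0.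
  by rewrite normr0 mul0r mul0r.
have B1 : 0 <= 1 + B by rewrite addr_ge0.
have fB1 : `|f i x| <= 1 + B by apply: le_trans (fB i) _; rewrite lerDr.
exists (f i x * D + (\prod_(j <- r) f j x) * f' i); split.
- by under eq_fun do rewrite big_cons; exact: is_deriveMf (df i) dD.
- by rewrite big_cons normrM exprS ler_pM.
rewrite /= exprS; apply: le_trans (ler_normD _ _) _; rewrite !normrM.
have k1 : `|f i x| * `|D| <= (1 + B) * ((size r)%:R * (1 + B) ^+ size r * d) by rewrite ler_pM.
have k2 : `|\prod_(j <- r) f j x| * `|f' i| <= (1 + B) ^+ size r * d by rewrite ler_pM.
have k3 : (1 + B) ^+ size r * d <= (1 + B) * ((1 + B) ^+ size r * d).
  by rewrite ler_peMl ?mulr_ge0 ?exprn_ge0 // lerDl.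
rewrite -natr1; move: k1 k2 k3; move: (_ * `|D|) (_ * `|f' i|) => a b; move: ((1 + B) ^+ _) => P; lra.
Qed.

(** Crude constant from the Leibniz expansion, with one summand per permutation; what counts is that
    it depends only on the size and on a bound for the entries. *)
Definition detC m (B : R) : R := \sum_(s : 'S_m) m%:R * (1 + B) ^+ m.

Lemma detC_ge0 m B : 0 <= B -> 0 <= detC m B.
Proof. by move=> B0; apply: sumr_ge0 => s _; rewrite mulr_ge0 ?exprn_ge0 ?addr_ge0. Qed.

Lemma det_deriv_bound m (F : R -> 'M[R]_m) (F' : 'M[R]_m) (x B d : R) : 0 <= B -> 0 <= d ->
  (forall i j, is_derive x 1 (fun t => F t i j) (F' i j)) ->
  (forall i j, `|F x i j| <= B) -> (forall i j, `|F' i j| <= d) ->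
  exists2 D, is_derive x 1 (fun t => \det (F t)) D & `|D| <= detC m B * d.
Proof.
move=> B0 d0 dF FB F'd.
have H (s : 'S_m) : exists D, is_derive x 1 (fun t => \prod_(i < m) F t i (s i)) D /\ `|D| <= m%:R * (1 + B) ^+ m * d.
  have [D [dD _]] := @prod_deriv_bound _ (index_enum 'I_m) (fun i t => F t i (s i)) (fun i => F' i (s i)) x B d
     B0 d0 (fun i => dF i (s i)) (fun i => FB i (s i)) (fun i => F'd i (s i)).
  have -> : size (index_enum 'I_m) = m by rewrite -[RHS]card_ord cardT enumT.
  by exists D.
have /choice[D HD] := H.
exists (\sum_(s : 'S_m) (-1) ^+ s * D s).
  rewrite (_ : (fun t => \det (F t)) = \sum_(s : 'S_m) (fun t => (-1) ^+ s * \prod_(i < m) F t i (s i))); last first.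
    by apply/funext => t; rewrite fct_sumE.
  rewrite (_ : \sum_(s : 'S_m) (fun t => _) = fun t => \sum_(s : 'S_m) (-1) ^+ s * \prod_(i < m) F t i (s i)); last first.
    by apply/funext => t; rewrite fct_sumE.
  elim: (index_enum _) => [|s r IH].
    by rewrite big_nil; under eq_fun do rewrite big_nil; exact: is_derive_cst.
  rewrite big_cons; under eq_fun do rewrite big_cons.
  exact: is_deriveDf (is_deriveCf _ (HD s).1) IH.
apply: le_trans (ler_norm_sum _ _ _) _.
rewrite /detC mulr_suml.
by apply: ler_sum => s _; rewrite normrM normrX normrN1 expr1n mul1r; exact: (HD s).2.
Qed.

(** Mean value theorem on the segment from [h] to [h + T], along which the entries stay bounded by
    [B + 1]. *)
Lemma det_perturb m (h T : 'M[R]_m) (B tau : R) : 0 <= B -> 0 <= tau -> tau <= 1 ->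
  (forall i j, `|h i j| <= B) -> (forall i j, `|T i j| <= tau) ->
  `|\det (h + T) - \det h| <= detC m (B + 1) * tau.
Proof.
move=> B0 t0 t1 hB Tt.
pose F (s : R) := h + s *: T.
have dF (x : R) i j : is_derive x 1 (fun s => F s i j) (T i j).
  rewrite (_ : (fun s => F s i j) = (fun s => h i j + T i j * s)); last first.
    by apply/funext => s; rewrite !mxE mulrC.
  apply: is_derive_eqf (is_deriveDf (is_derive_cst _ _ _) (is_deriveCf _ (is_derive_id _ _))) _.
  by rewrite add0r mulr1.
have FB (x : R) i j : 0 <= x <= 1 -> `|F x i j| <= B + 1.
  move=> /andP[x0 x1]; rewrite !mxE; apply: le_trans (ler_normD _ _) _; apply: lerD => //.
  by rewrite normrM (ger0_norm x0) mulr_ile1 // (le_trans (Tt i j)).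
have H (x : R) : 0 <= x <= 1 -> exists2 D, is_derive x 1 (fun t => \det (F t)) D & `|D| <= detC m (B + 1) * tau.
  move=> x01; apply: (@det_deriv_bound m F T x) => // [|i j]; first by rewrite addr_ge0.
  exact: FB.
have /choice[D HD] : forall x : R, exists D, 0 <= x <= 1 ->
    is_derive x 1 (fun t => \det (F t)) D /\ `|D| <= detC m (B + 1) * tau.
  move=> x; have [/H[D d1 d2]|n] := pselect (0 <= x <= 1); first by exists D.
  by exists 0 => /n.
have := @MVT_bound _ (fun t => \det (F t)) D 0 (detC m (B + 1) * tau)
  (fun x x01 => (HD x x01).1).
rewrite /F scale1r scale0r addr0 subr0; apply => x x01; rewrite subr0; exact: (HD x x01).2.
Qed.

Lemma form_bound m (T : 'M[R]_m) (tau : R) (x : 'rV[R]_m) : (forall i j, `|T i j| <= tau) ->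
  `|(x *m T *m x^T) 0 0| <= m%:R * tau * \sum_i x 0 i ^+ 2.
Proof.
move=> Tt.
rewrite mxE; apply: le_trans (ler_norm_sum _ _ _) _.
apply: (@le_trans _ _ (\sum_j \sum_i tau * (2^-1 * (x 0 i ^+ 2 + x 0 j ^+ 2)))).
  apply: ler_sum => j _; rewrite !mxE mulr_suml; apply: le_trans (ler_norm_sum _ _ _) _.
  apply: ler_sum => i _; rewrite mulrAC [X in `|X|]mulrC normrM; apply: ler_pM => //.
  rewrite normrM; have := sqr_ge0 (`|x 0 i| - `|x 0 j|).
  by rewrite sqrrB !real_normK ?num_real //; lra.
have E : \sum_j \sum_i tau * (2^-1 * (x 0 i ^+ 2 + x 0 j ^+ 2)) =
    tau * (2^-1 * (m%:R * \sum_i x 0 i ^+ 2 + m%:R * \sum_i x 0 i ^+ 2)).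
  under eq_bigr do rewrite -mulr_sumr -mulr_sumr big_split /=.
  rewrite -mulr_sumr -mulr_sumr big_split /= sumr_const card_ord mulr_natl; congr (_ * (_ * (_ + _))).
  by rewrite -sumrMnl; apply: eq_bigr => j _; rewrite sumr_const card_ord.
rewrite E; lra.
Qed.

End DetBounds.

Section MetricBounds.
Context {R : realType} {N : nat} {M : manifold R N} (g : metric M).

Lemma split_form m (G : 'M[R]_m.+1) (X : 'rV[R]_m.+1) :
  (forall j, G ord0 (lift ord0 j) = 0) -> (forall i, G (lift ord0 i) ord0 = 0) ->
  (X *m G *m X^T) 0 0 = G ord0 ord0 * X 0 ord0 ^+ 2 +
    ((\row_j X 0 (lift ord0 j)) *m (\matrix_(i, j) G (lift ord0 i) (lift ord0 j)) *m (\row_j X 0 (lift ord0 j))^T) 0 0.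
Proof.
move=> G0 G0'; rewrite mxE big_ord_recl; congr (_ + _).
  by rewrite !mxE big_ord_recl big1 ?addr0 => [|i _]; [rewrite expr2; ring|rewrite G0' mulr0].
rewrite mxE; apply: eq_bigr => j _; rewrite !mxE big_ord_recl G0 mulr0 add0r; congr (_ * _).
by apply: eq_bigr => i _; rewrite !mxE.
Qed.

Lemma posdef_inv m (G : 'M[R]_m) : G^T = G -> posdef G -> posdef (invmx G).
Proof.
move=> sG pG v v0; have uG := posdef_unit pG.
rewrite form_dual //; apply: pG; apply: contraNneq v0 => E.
by rewrite -(mulmxKV uG v) E mul0mx.
Qed.

Lemma metric_lower_bound (c : chart R M N) (K : set M) : atlas c -> compact K -> K `<=` cdom c ->
  exists2 D : R, 0 < D & forall p (x : 'rV[R]_N), K p ->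
    \sum_i x 0 i ^+ 2 <= D * (x *m g c (cmap c p) *m x^T) 0 0.
Proof.
move=> ac cK Kc.
have /choice[d Hd] : forall i : 'I_N, exists B : R, 0 <= B /\ forall p, K p -> `|invmx (g c (cmap c p)) i i| <= B.
  by move=> i; have [B] := chart_bounded ac cK Kc (g_inv_smooth g i i ac); exists B.
exists (1 + \sum_i d i); first by rewrite ltr_pwDl // sumr_ge0 // => i _; have [] := Hd i.
move=> p x Kp; have ix := cimg_map (Kc p Kp).
have pG : posdef (g c (cmap c p)) := gmx_pos g ac ix.
have sG : (g c (cmap c p))^T = g c (cmap c p) := gmx_sym g ac ix.
have F0 : 0 <= (x *m g c (cmap c p) *m x^T) 0 0.
  have [->|x0] := eqVneq x 0; first by rewrite !mul0mx mxE.
  by apply: ltW; exact: pG.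
rewrite mulrDl mul1r; apply: (@le_trans _ _ ((\sum_i d i) * (x *m g c (cmap c p) *m x^T) 0 0)); last by rewrite lerDr.
rewrite mulr_suml; apply: ler_sum => i _.
have sI : (invmx (g c (cmap c p)))^T = invmx (g c (cmap c p)) := g_inv_sym g ac ix.
have := coord_dual_bound x i sI (posdef_inv sG pG); rewrite invmxK => H.
apply: le_trans H _; rewrite ler_wpM2r //; apply: le_trans (ler_norm _) _; exact: (Hd i).2.
Qed.

Lemma metric_det_bound (c : chart R M N) (K : set M) : atlas c -> compact K -> K `<=` cdom c ->
  exists2 b : R, 0 < b & forall p, K p -> b <= \det (g c (cmap c p)).
Proof.
move=> ac cK Kc; have oi := cimg_open ac.
have sd : smooth_on (cimg c) (fun x => (\det (g c x))^-1).
  apply: smooth_onV => //; first by apply: smooth_on_det => // i j; exact: gmx_smooth.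
  by move=> x ix; rewrite gt_eqF // g_det_gt0.
have [B B0 HB] := chart_bounded ac cK Kc sd.
have B1 : 0 < B + 1 by rewrite ltr_wpDl.
exists (B + 1)^-1; first by rewrite invr_gt0.
move=> p Kp; have d0 := g_det_gt0 g ac (cimg_map (Kc p Kp)).
rewrite -[leRHS]invrK lef_pV2 ?posrE ?invr_gt0 //.
by apply: le_trans (ler_norm _) _; apply: le_trans (HB p Kp) _; rewrite lerDl.
Qed.

End MetricBounds.

Section EndGeometry.
Context {R : realType} {n : nat} {sigma0 : R} (M : asymptotically_conic n sigma0).
Hypothesis sigma0_gt0 : 0 < sigma0.
Variable mu : {measure set (borel M) -> \bar R}.
Hypothesis hmu : is_riemannian_measure (ac_g M) mu.
Implicit Types (c : chart R (ac_bd M) n.-1) (t : R) (y : 'rV[R]_n.-1) (x : 'rV[R]_n.-1.+1).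
Implicit Types (p : M) (w : M -> R).
Local Notation g := (ac_g M).
Local Notation Gam := (Gam g).
Local Notation Lap := (Lap g).
Local Notation Hes := (Hes g).
Local Notation K0 := (@ac_K0 _ _ _ M).
Local Notation rad := (@ac_rad _ _ _ M).
Local Notation ang := (@ac_ang _ _ _ M).
Local Notation endpt := (@ac_endpt _ _ _ M).
Local Notation R0 := (ac_R0 M).
Local Notation r := (@ac_weight _ _ _ M).
Local Notation echart c := (end_chart K0 rad ang endpt c).

Lemma echart_inv c t y : cinv (echart c) (cons_coord t y) = endpt t (cinv c y).
Proof. by rewrite /= /cons_coord row_mxKl row_mxKr mxE eqxx. Qed.

Lemma echart_img c t y : atlas c -> R0 < t -> cimg c y -> cimg (echart c) (cons_coord t y).
Proof.
move=> ac Rt [q dq <-]; have [k rt at_] := ac_end_from q Rt.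
by exists (endpt t q) => /=; rewrite ?rt ?at_.
Qed.

Lemma echart_imgE c x : cimg (echart c) x -> R0 < x 0 0 /\ cimg c (rsubmx (x : 'rV[R]_(1 + n.-1))).
Proof.
move=> [p [nk dp] <-]; have [rp _] := ac_end_to nk.
rewrite cons_coord0; split => //; rewrite /cons_coord row_mxKr; exact: cimg_map.
Qed.

Lemma weight_gt_end p : R0 < r p -> ~ K0 p.
Proof. by move=> rp kp; have /andP[_] := ac_weight_K0 kp; rewrite leNgt rp. Qed.

Lemma end_weight_gt p : ~ K0 p -> R0 < r p.
Proof. by move=> nk; rewrite ac_weight_end //; have [] := ac_end_to nk. Qed.

Lemma weight_ge p : 2^-1 <= r p.
Proof.
have R1 := ac_R0_gt1 M; have [kp|nk] := pselect (K0 p).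
  by have /andP[h _] := ac_weight_K0 kp; apply: le_trans h; rewrite ler_pdivlMr // mulVf // ltW.
by apply: le_trans (ltW (end_weight_gt nk)); lra.
Qed.

Lemma weight_gt0 p : 0 < r p.
Proof. by apply: lt_le_trans (weight_ge p); rewrite invr_gt0. Qed.

Lemma weight_cinv c x : atlas c -> cimg (echart c) x -> r (cinv (echart c) x) = x 0 0.
Proof.
move=> ac ix; have [Rx iy] := echart_imgE ix.
rewrite -{1}(cons_coord_uncons x) echart_inv.
have [nk rt _] := ac_end_from (cinv c (rsubmx (x : 'rV[R]_(1 + n.-1)))) Rx.
by rewrite ac_weight_end.
Qed.

Lemma warped00 m (k : 'M[R]_m) : warped_mx k ord0 ord0 = 1.
Proof.
rewrite (_ : ord0 = lshift m (0 : 'I_1)); last exact: val_inj.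
by rewrite /warped_mx (@block_mxEul _ 1 m 1 m) mxE.
Qed.

Lemma warped0S m (k : 'M[R]_m) i : warped_mx k ord0 (lift ord0 i) = 0.
Proof.
rewrite (_ : lift ord0 i = rshift 1 i :> 'I_(1 + m)); last exact: val_inj.
rewrite (_ : ord0 = lshift m (0 : 'I_1)); last exact: val_inj.
by rewrite /warped_mx (@block_mxEur _ 1 m 1 m) mxE.
Qed.

Lemma warpedSS m (k : 'M[R]_m) i j : warped_mx k (lift ord0 i) (lift ord0 j) = k i j.
Proof.
rewrite (_ : lift ord0 i = rshift 1 i :> 'I_(1 + m)); last exact: val_inj.
rewrite (_ : lift ord0 j = rshift 1 j :> 'I_(1 + m)); last exact: val_inj.
by rewrite /warped_mx (@block_mxEdr _ 1 m 1 m).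
Qed.

Lemma det_warped m (k : 'M[R]_m) : \det (warped_mx k) = \det k.
Proof. by rewrite /warped_mx (@det_lblock _ 1 m) det1 mul1r. Qed.

(** The cross-section metric at radius [t], read off from [g] itself so that its regularity in [t]
    comes from that of the metric. *)
Definition slice c t y : 'M[R]_n.-1 := t ^- 2 *: (\matrix_(a, b) g (echart c) (cons_coord t y) (lift ord0 a) (lift ord0 b)).

Lemma sliceE c t y : atlas c -> R0 < t -> cimg c y ->
  slice c t y = ac_h M c y + (t `^ (- (2 * sigma0))) *: ac_e c t y.
Proof.
move=> ac Rt iy; have t0 : t != 0 by rewrite gt_eqF // (lt_trans _ Rt) // (lt_trans _ (ac_R0_gt1 M)).
apply/matrixP => a b; rewrite [LHS]mxE [X in _ * X]mxE ac_g_end // warpedSS !mxE mulrA.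
by rewrite mulVf ?mul1r // expf_neq0.
Qed.

Lemma echart_g c t y : atlas c -> R0 < t -> cimg c y ->
  g (echart c) (cons_coord t y) = warped_mx (t ^+ 2 *: slice c t y).
Proof. by move=> ac Rt iy; rewrite sliceE // ac_g_end. Qed.

Lemma echart_g0 c x i : atlas c -> cimg (echart c) x -> g (echart c) x ord0 i = (i == ord0)%:R.
Proof.
move=> ac ix; have [Rx iy] := echart_imgE ix.
rewrite -(cons_coord_uncons x) echart_g //.
by case: (unliftP ord0 i) => [j ->|->]; rewrite ?warped0S ?warped00 // eqxx.
Qed.

Lemma is_derive_cons m (F : 'rV[R]_m.+1 -> R) t (y : 'rV[R]_m) :
  derivable F (cons_coord t y) (delta_mx 0 0) ->
  is_derive t 1 (fun s => F (cons_coord s y)) (partial ord0 F (cons_coord t y)).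
Proof.
rewrite /partial cons_coord_line => dF; have := is_derive_line dF.
by under eq_fun do rewrite -cons_coord_line; rewrite -cons_coord_line.
Qed.

Definition slice' c t y : 'M[R]_n.-1 := \matrix_(a, b) derive1 (fun s => slice c s y a b) t.

Lemma slice_derive c t y a b : atlas c -> R0 < t -> cimg c y ->
  is_derive t 1 (fun s => slice c s y a b) (slice' c t y a b).
Proof.
move=> ac Rt iy; have ix := echart_img ac Rt iy; have aC := ac_end_atlas ac.
have t0 : t != 0 by rewrite gt_eqF // (lt_trans _ Rt) // (lt_trans _ (ac_R0_gt1 M)).
have dg := is_derive_cons (smooth_on_der (gmx_smooth g aC (lift ord0 a) (lift ord0 b)) ix (i := 0)).
have t2 : t ^+ 2 != 0 by rewrite expf_neq0.
have dV := is_deriveVf (f := fun s : R => s ^+ 2) t2 (is_deriveXf 2 (is_derive_id t 1)).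
have dS := is_deriveMf dV dg.
rewrite mxE derive1E; apply: derivableP.
suff -> : (fun s => slice c s y a b) = (fun s => s ^- 2 * g (echart c) (cons_coord s y) (lift ord0 a) (lift ord0 b)).
  exact: (@ex_derive _ _ _ _ _ _ _ dS).
by apply/funext => s; rewrite [LHS]mxE; congr (_ * _); rewrite mxE.
Qed.

(** The tensor [e] is written as [t^(2 sigma0) (slice - h)] and differentiated by the product rule;
    its differentiability is thereby inferred from that of the metric. *)
Lemma slice'E c t y a b : atlas c -> R0 < t -> cimg c y ->
  t * slice' c t y a b = t `^ (- (2 * sigma0)) *
    (t * derive1 (fun s => ac_e c s y a b) t - 2 * sigma0 * ac_e c t y a b).
Proof.
move=> ac Rt iy; have R1 := ac_R0_gt1 M.
have t0 : 0 < t by lra.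
have dA := slice_derive a b ac Rt iy.
have dP : is_derive t 1 (fun s : R => s `^ (2 * sigma0)) (2 * sigma0 * t `^ (2 * sigma0 - 1)).
  exact: is_derive1_powR.
have dE := is_deriveMf (is_deriveBf dA (is_derive_cst (ac_h M c y a b) t 1)) dP.
have eE s : R0 < s -> (slice c s y a b - ac_h M c y a b) * s `^ (2 * sigma0) = ac_e c s y a b.
  move=> Rs; rewrite sliceE // !mxE addrAC subrr add0r mulrAC powRN mulVf ?mul1r //.
  by rewrite gt_eqF // powR_gt0; lra.
have nE : \forall s \near t, (slice c s y a b - cst (ac_h M c y a b) s) * s `^ (2 * sigma0) = ac_e c s y a b.
  by apply: filterS (lt_nbhsr Rt) => s; exact: eE.
have dE' := is_derive_near nE dE.
rewrite derive1E (@derive_val _ _ _ _ _ _ _ dE').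
rewrite -(eE t Rt) powRN subr0.
have pp : t `^ (2 * sigma0) != 0 by rewrite gt_eqF // powR_gt0.
rewrite (_ : t `^ (2 * sigma0 - 1) = t `^ (2 * sigma0) / t); last first.
  rewrite powRD; last by rewrite (gt_eqF t0) implybT.
  by rewrite powR_inv1 // ltW.
rewrite /=; move: pp; move: (_ `^ _) (slice c t y a b) (slice' c t y a b) (ac_h M c y a b) => P S S' h P0.
by field; rewrite P0 gt_eqF.
Qed.

Lemma powR_small (eta : R) : 0 < eta -> exists2 T : R, 0 < T & forall t : R, T < t -> t `^ (- (2 * sigma0)) <= eta.
Proof.
move=> e0; have s0 : 0 < 2 * sigma0 by rewrite mulr_gt0.
exists (eta^-1 `^ (2 * sigma0)^-1); first by rewrite powR_gt0 // invr_gt0.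
move=> t Tt; have T0 : 0 < eta^-1 `^ (2 * sigma0)^-1 by rewrite powR_gt0 // invr_gt0.
have t0 : 0 < t by apply: lt_trans Tt.
rewrite powRN -[leRHS]invrK lef_pV2 ?posrE ?invr_gt0 ?powR_gt0 //.
rewrite [leLHS](_ : eta^-1 = (eta^-1 `^ (2 * sigma0)^-1) `^ (2 * sigma0)); last first.
  by rewrite -powRrM mulVf ?gt_eqF // powRr1 // invr_ge0 ltW.
by apply: ge0_ler_powR; rewrite ?nnegrE ltW.
Qed.

(** In the coordinates [(r, y)] the metric is [dr^2 + r^2 A] with [A] the slice. Hence [r Lap r] is
    [n - 1] plus half of [r] times the logarithmic derivative of [det A], and [r Hes r] differs from
    the tangential part of the metric by half of [r^2] times the form [r A']. Both errors are of
    order [r^(- 2 sigma0)] by the bounds on [e] and its radial derivative. *)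
Lemma end_local c (K : set (ac_bd M)) (eps : R) : atlas c -> compact K -> K `<=` cdom c -> 0 < eps ->
  exists2 R1 : R, R0 < R1 & forall p, ~ K0 p -> K (ang p) -> R1 < rad p ->
    [/\ Gam r r p = 1, `|r p * Lap r p - n.-1%:R| <= eps &
      forall w, smooth_fun w ->
        `|r p * Hes r w p - (Gam w w p - Gam r w p ^+ 2)| <= eps * (Gam w w p - Gam r w p ^+ 2)].
Proof.
move=> ac cK Kc eps0; have aC := ac_end_atlas ac.
have sr : smooth_fun r := @ac_weight_smooth _ _ _ M.
have /choice[b0 Hb0] : forall ij : 'I_n.-1 * 'I_n.-1, exists B : R, 0 <= B /\ forall q, K q -> `|ac_h M c (cmap c q) ij.1 ij.2| <= B.
  by move=> ij; have [B] := chart_bounded ac cK Kc (gmx_smooth (ac_h M) ac ij.1 ij.2); exists B.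
pose B := \sum_ij b0 ij.
have B0 : 0 <= B by apply: sumr_ge0 => ij _; have [] := Hb0 ij.
have hB q i j : K q -> `|ac_h M c (cmap c q) i j| <= B.
  move=> Kq; apply: le_trans ((Hb0 (i, j)).2 q Kq) _.
  by rewrite /B (bigD1 (i, j)) //= lerDl sumr_ge0 // => ij _; have [] := Hb0 ij.
have [D D0 HD] := metric_lower_bound (ac_h M) ac cK Kc.
have [d d0 Hd] := metric_det_bound (ac_h M) ac cK Kc.
have Ki : cmap c @` K `<=` cimg c by move=> _ [q /Kc dq <-]; exact: cimg_map.
have [C0 HC0] := ac_e_bound ac (cmap_compact ac Kc cK) Ki.
pose C := `|C0|.
have eC t q i j : R0 < t -> K q -> `|ac_e c t (cmap c q) i j| <= C /\
    t * `|derive1 (fun s => ac_e c s (cmap c q) i j) t| <= C.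
  move=> Rt Kq; have := HC0 t (cmap c q) i j Rt (ex_intro2 _ _ q Kq erefl).
  rewrite /=; set v := (X in _ + X <= C0) => H; have v0 : 0 <= v by exact: sqrtr_ge0.
  have t0 : 0 < t by have := ac_R0_gt1 M; lra.
  have := normr_ge0 (ac_e c t (cmap c q) i j).
  have := mulr_ge0 (ltW t0) (normr_ge0 (derive1 (fun s => ac_e c s (cmap c q) i j) t)).
  have := ler_norm C0; rewrite -/C; split; lra.
have C_ge0 : 0 <= C by exact: normr_ge0.
(* Bounds the two terms produced by [t d/dt] acting on [t^(- 2 sigma0) e]. *)
have [C2 C20 C2E] : exists2 C2, 0 <= C2 & C2 = (1 + 2 * sigma0) * C.
  by exists ((1 + 2 * sigma0) * C) => //; rewrite mulr_ge0 // addr_ge0 // mulr_ge0 // ltW.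
pose dC := detC n.-1 (B + 1); have dC0 : 0 <= dC by apply: detC_ge0; rewrite addr_ge0.
(* With [s = t^(- 2 sigma0)], the inequalities [s E1 <= 1] to [s E4 <= 1] secure in turn: the slice
   determinant is at least half of [d]; the error of the Laplacian; the slice form is at least half
   of the limit form; the error of the Hessian. *)
pose E1 := 2 * dC * C / d; pose E2 := dC * C2 / (eps * d).
pose E3 := 2 * (C * n.-1%:R * D); pose E4 := C2 * n.-1%:R * D / eps.
have E10 : 0 <= E1 by rewrite divr_ge0 ?(ltW d0) // !mulr_ge0.
have E20 : 0 <= E2 := divr_ge0 (mulr_ge0 dC0 C20) (ltW (mulr_gt0 eps0 d0)).
have E30 : 0 <= E3 := mulr_ge0 (ler0n _ _) (mulr_ge0 (mulr_ge0 C_ge0 (ler0n _ _)) (ltW D0)).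
have E40 : 0 <= E4 := divr_ge0 (mulr_ge0 (mulr_ge0 C20 (ler0n _ _)) (ltW D0)) (ltW eps0).
pose E := 1 + C + E1 + E2 + E3 + E4.
have E0 : 0 < E by rewrite /E; lra.
have [T T0 HT] := powR_small (eta := E^-1) (ltac:(by rewrite invr_gt0)).
exists (R0 + T) => [|p nk Kp tR]; first by rewrite ltrDl.
set q := ang p in Kp; set t := rad p in tR; set y := cmap c q.
have Rt : R0 < t by apply: lt_trans tR; rewrite ltrDl.
have t0 : 0 < t by have := ac_R0_gt1 M; lra.
have iy : cimg c y := cimg_map (Kc q Kp).
have dp : cdom (echart c) p by split => //; exact: Kc.
have xE : cmap (echart c) p = cons_coord t y by [].
have ix : cimg (echart c) (cons_coord t y) := echart_img ac Rt iy.
have rp : r p = t by exact: ac_weight_end.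
set s := t `^ (- (2 * sigma0)).
have s0 : 0 <= s by exact: powR_ge0.
have sE : s * E <= 1.
  have : s <= E^-1 by apply: HT; apply: le_lt_trans tR; rewrite lerDr ltW // (lt_trans _ (ac_R0_gt1 M)).
  by rewrite -[X in _ <= X -> _]mul1r ler_pdivlMr.
have sub e : 0 <= e -> e <= E -> s * e <= 1.
  by move=> e0 eE; apply: le_trans sE; rewrite ler_wpM2l.
have s1 : s <= 1 by rewrite -[s]mulr1; apply: sub => //; rewrite /E; lra.
have sC1 : s * C <= 1 by apply: sub => //; rewrite /E; lra.
have sE1 : dC * (s * C) <= d / 2.
  have : s * E1 <= 1 by apply: sub => //; rewrite /E; lra.
  by rewrite /E1 mulrA ler_pdivrMr // mul1r; lra.
have sE2 : dC * (s * C2) <= eps * d.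
  have : s * E2 <= 1 by apply: sub => //; rewrite /E; lra.
  by rewrite /E2 mulrA ler_pdivrMr ?mulr_gt0 // mul1r; lra.
have sE3 : s * C * n.-1%:R * D <= 2^-1.
  have : s * E3 <= 1 by apply: sub => //; rewrite /E; lra.
  by rewrite /E3; lra.
have sE4 : s * C2 * n.-1%:R * D <= eps.
  have : s * E4 <= 1 by apply: sub => //; rewrite /E; lra.
  by rewrite /E4 mulrA ler_pdivrMr // mul1r; lra.
pose A := slice c t y; pose A' := slice' c t y.
have AE : A = ac_h M c y + s *: ac_e c t y by exact: sliceE.
have sCe i j : `|(s *: ac_e c t y) i j| <= s * C.
  by rewrite mxE normrM (ger0_norm s0) ler_wpM2l //; exact: (eC t q i j Rt Kp).1.
have AB i j : `|A i j| <= B + 1.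
  by rewrite AE mxE; apply: le_trans (ler_normD _ _) _; rewrite lerD ?hB //; exact: le_trans sC1.
have tA' i j : `|t * A' i j| <= s * C2.
  rewrite slice'E // -/s normrM (ger0_norm s0) ler_wpM2l //.
  have [h1 h2] := eC t q i j Rt Kp.
  apply: le_trans (ler_normB _ _) _; rewrite !normrM (gtr0_norm t0) (gtr0_norm sigma0_gt0) (ger0_norm (_ : 0 <= 2)) //.
  have : 2 * sigma0 * `|ac_e c t y i j| <= 2 * sigma0 * C by rewrite ler_wpM2l // mulr_ge0 // ltW.
  by move: h2; rewrite C2E -/y; lra.
have detA : d / 2 <= \det A.
  have := det_perturb B0 (mulr_ge0 s0 C_ge0) sC1 (fun i j => hB q i j Kp) sCe.
  rewrite -/y -AE -/dC ler_norml => /andP[h _]; have := Hd q Kp; rewrite -/y; lra.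
have detA0 : 0 < \det A by apply: lt_le_trans detA; rewrite divr_gt0.
have thE z : cimg (echart c) z -> r (cinv (echart c) z) = z 0 ord0 by exact: weight_cinv.
have gE z i : cimg (echart c) z -> g (echart c) z ord0 i = (i == ord0)%:R by exact: echart_g0.
split.
- rewrite (Gam_th aC sr thE gE sr dp) (partial_th aC thE ord0 (cimg_map dp)) eqxx //.
- have dA i j : is_derive t 1 (fun z => slice c z y i j) (A' i j) by exact: slice_derive.
  have A'b i j : `|A' i j| <= s * C2 / t.
    by rewrite ler_pdivlMr // mulrC -{1}(gtr0_norm t0) -normrM; exact: tA'.
  have [D1 dD1 D1b] := det_deriv_bound (addr_ge0 B0 ler01) (divr_ge0 (mulr_ge0 s0 C20) (ltW t0)) dA AB A'b.
  rewrite -/dC in D1b.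
  have dT := is_deriveMf (is_deriveXf n.-1 (is_deriveXf 2 (is_derive_id t 1))) dD1.
  have nE : \forall z \near t, (z ^+ 2) ^+ n.-1 * \det (slice c z y) = \det (g (echart c) (cons_coord z y)).
    apply: filterS (lt_nbhsr Rt) => z Rz; rewrite echart_g // det_warped.
    exact: (esym (detZ (z ^+ 2) (slice c z y))).
  have dT' := is_derive_near nE dT.
  have dG := is_derive_cons (smooth_on_der (smooth_on_det (cimg_open aC) (gmx_smooth g aC)) ix (i := 0)).
  have PE := etrans (esym (@derive_val _ _ _ _ _ _ _ dG)) (@derive_val _ _ _ _ _ _ _ dT').
  rewrite (Lap_th hmu aC sr thE gE dp) xE rp PE echart_g // det_warped (detZ (t ^+ 2) (slice c t y)) -/A.
  have tA0 : t * `|D1| <= dC * (s * C2).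
    by rewrite mulrC -ler_pdivlMr // -mulrA.
  have -> : t * (((t ^+ 2) ^+ n.-1 * D1 + \det A * (n.-1%:R * (t ^+ 2) ^+ n.-1.-1 * (2%:R * t ^+ 1 * 1))) / (2 * ((t ^+ 2) ^+ n.-1 * \det A))) - n.-1%:R
      = t * D1 / (2 * \det A).
    have t20 : t ^+ 2 != 0 by rewrite expf_neq0 // gt_eqF.
    move: (\det A) detA0 => dA_ /lt0r_neq0 dA0.
    case: (n.-1) => [|k] /=; first by rewrite expr0 !(mul0r, mulr0) addr0 subr0 !mul1r mulrA.
    rewrite expr1 exprS; have k0 : (t ^+ 2) ^+ k != 0 by rewrite expf_neq0.
    by field; rewrite k0 dA0 gt_eqF.
  rewrite normrM normfV ler_pdivrMr ?normr_gt0 ?mulf_neq0 ?gt_eqF //.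
  rewrite normrM (gtr0_norm t0); apply: le_trans tA0 _; apply: le_trans sE2 _.
  rewrite ler_wpM2l ?(ltW eps0) // gtr0_norm ?mulr_gt0 //; lra.
move=> w sw; set T1 := Gam w w p - Gam r w p ^+ 2.
set X := gradvec g (echart c) w p; pose x : 'rV[R]_n.-1 := \row_j X 0 (lift ord0 j).
have X0 : X 0 ord0 = Gam r w p by exact: gradvec_i0.
have dS i j : is_derive t 1 (fun z => g (echart c) (cons_coord z y) (lift ord0 i) (lift ord0 j))
    (t ^+ 2 * A' i j + A i j * (2 * t)).
  have dT := is_deriveMf (is_deriveXf 2 (is_derive_id t 1)) (slice_derive i j ac Rt iy).
  have nE : \forall z \near t, z ^+ 2 * slice c z y i j = g (echart c) (cons_coord z y) (lift ord0 i) (lift ord0 j).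
    by apply: filterS (lt_nbhsr Rt) => z Rz; rewrite echart_g // warpedSS [RHS]mxE.
  by apply: is_derive_eqf (is_derive_near nE dT) _; rewrite /= expr1 mulr1.
have PS i j : partial ord0 (fun z => g (echart c) z (lift ord0 i) (lift ord0 j)) (cons_coord t y) =
    t ^+ 2 * A' i j + A i j * (2 * t).
  have dG := is_derive_cons (smooth_on_der (gmx_smooth g aC (lift ord0 i) (lift ord0 j)) ix (i := 0)).
  exact: etrans (esym (@derive_val _ _ _ _ _ _ _ dG)) (@derive_val _ _ _ _ _ _ _ (dS i j)).
have P0 i j : (i == ord0) || (j == ord0) -> partial ord0 (fun z => g (echart c) z i j) (cons_coord t y) = 0.
  move=> ij; have [k Hk] : exists k : R, forall z, cimg (echart c) z -> g (echart c) z i j = k.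
    case/orP: ij => /eqP ->; first by exists (j == ord0)%:R => z; exact: gE.
    exists (i == ord0)%:R => z iz; rewrite -(gE z i iz).
    by have /matrixP/(_ ord0 i) := gmx_sym g aC iz; rewrite mxE.
  rewrite (partial_near (G := fun=> k) ord0 (cimg_open aC) ix Hk).
  by rewrite /partial derive_cst.
have TE : T1 = t ^+ 2 * (x *m A *m x^T) 0 0.
  rewrite /T1 (Gam_gradvec g aC sw dp) -/X xE split_form.
  - rewrite X0 gE // eqxx mul1r addrAC subrr add0r -formZ; congr ((_ *m _ *m _) _ _).
    by apply/matrixP => i j; rewrite mxE echart_g // warpedSS.
  - by move=> j; rewrite gE.
  - move=> i; have /matrixP/(_ ord0 (lift ord0 i)) := gmx_sym g aC ix; rewrite mxE => ->; by rewrite gE.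
have HE : Hes r w p = 2^-1 * (2 * t * (x *m A *m x^T) 0 0 + t ^+ 2 * (x *m A' *m x^T) 0 0).
  rewrite (Hes_th aC sr thE gE sw dp) -/X xE split_form.
  - rewrite mxE P0 ?eqxx // mul0r add0r; congr (_ * _); rewrite -!formZ -formD; congr ((_ *m _ *m _) _ _).
    apply/matrixP => i j; rewrite [LHS]mxE [LHS]mxE PS [RHS]mxE [X in _ = X + _]mxE [X in _ = _ + X]mxE.
    by move: (A i j) (A' i j) => a a'; ring.
  - by move=> j; rewrite mxE P0 ?eqxx.
  - by move=> i; rewrite mxE P0 // eqxx orbT.
have -> : r p * Hes r w p - T1 = 2^-1 * t ^+ 2 * (x *m (t *: A') *m x^T) 0 0.
  by rewrite HE TE rp formZ; field.
set xx := \sum_i x 0 i ^+ 2; set H := (x *m ac_h M c y *m x^T) 0 0.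
have xD : xx <= D * H by exact: HD.
have xx0 : 0 <= xx by apply: sumr_ge0 => i _; exact: sqr_ge0.
have H0 : 0 <= H by rewrite -(pmulr_rge0 _ D0); exact: le_trans xD.
have f1 := form_bound x sCe; have f2 : `|(x *m (t *: A') *m x^T) 0 0| <= n.-1%:R * (s * C2) * xx.
  by apply: form_bound => i j; rewrite mxE; exact: tA'.
have xA : 2^-1 * H <= (x *m A *m x^T) 0 0.
  rewrite AE formD -/H; move: f1; rewrite -/xx ler_norml => /andP[f1 _].
  have : n.-1%:R * (s * C) * xx <= n.-1%:R * (s * C) * (D * H) by rewrite ler_wpM2l // !mulr_ge0.
  have : s * C * n.-1%:R * D * H <= 2^-1 * H by rewrite ler_wpM2r.
  lra.
have t20 : 0 <= t ^+ 2 by exact: sqr_ge0.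
rewrite TE normrM (ger0_norm (_ : 0 <= 2^-1 * t ^+ 2)); last by rewrite mulr_ge0 // invr_ge0.
have k1 : n.-1%:R * (s * C2) * xx <= n.-1%:R * (s * C2) * (D * H) by rewrite ler_wpM2l // !mulr_ge0.
have k2 : s * C2 * n.-1%:R * D * H <= eps * H by rewrite ler_wpM2r.
have k3 : eps * (2^-1 * H) <= eps * (x *m A *m x^T) 0 0 by rewrite ler_wpM2l // ltW.
apply: (@le_trans _ _ (t ^+ 2 * (eps * (x *m A *m x^T) 0 0))); last by rewrite mulrCA.
rewrite [X in X * _]mulrC -mulrA ler_wpM2l //.
move: f2 k1 k2 k3; move: (`|_|) (_ * xx) => a b; move: ((x *m A *m _) 0 0) => a' *; lra.
Qed.

End EndGeometry.

Section EndUniform.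
Context {R : realType} {n : nat} {sigma0 : R} (M : asymptotically_conic n sigma0).
Hypothesis sigma0_gt0 : 0 < sigma0.
Variable mu : {measure set (borel M) -> \bar R}.
Hypothesis hmu : is_riemannian_measure (ac_g M) mu.
Implicit Types (c : chart R (ac_bd M) n.-1) (t : R) (y : 'rV[R]_n.-1) (x : 'rV[R]_n.-1.+1).
Implicit Types (p : M) (w : M -> R).
Local Notation g := (ac_g M).
Local Notation Gam := (Gam g).
Local Notation Lap := (Lap g).
Local Notation Hes := (Hes g).
Local Notation K0 := (@ac_K0 _ _ _ M).
Local Notation rad := (@ac_rad _ _ _ M).
Local Notation ang := (@ac_ang _ _ _ M).
Local Notation endpt := (@ac_endpt _ _ _ M).
Local Notation R0 := (ac_R0 M).
Local Notation r := (@ac_weight _ _ _ M).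
Local Notation echart c := (end_chart K0 rad ang endpt c).

Lemma chart_cover N (X : manifold R N) : compact [set: X] ->
  exists (K : X -> set X) (s : seq X), (forall q, compact (K q) /\ K q `<=` cdom (chart_at q)) /\
    forall q, exists2 q', q' \in s & K q' q.
Proof.
move=> cX.
have loc (q : X) : exists KW : set X * set X, [/\ compact KW.1, KW.1 `<=` cdom (chart_at q), open KW.2, KW.2 q & KW.2 `<=` KW.1].
  have [ac dq] := chart_atP q.
  have [b [K [W [_ _ b0 [cK Kc _] [oW Wq b1]]]]] := bump_exists ac dq (@openT X) (Logic.I : setT q).
  exists (K, W); split => //= z Wz; apply: contrapT => /b0; rewrite b1 // => /eqP.
  by rewrite oner_eq0.
have /choice[KW HKW] := loc.
have := cX; rewrite {1}compact_cover => /(_ X setT (fun q => (KW q).2)) [].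
- by move=> q _; have [] := HKW q.
- by move=> q _; exists q => //; have [] := HKW q.
move=> D _; rewrite /cover; set S := (T in bigcup T _) => XD.
have /finite_seqP[s Ss] : finite_set S by exact: finite_fset.
exists (fun q => (KW q).1), s; split=> q; first by have [] := HKW q.
have [q' q'D Wq] := XD q Logic.I; rewrite Ss in q'D; exists q' => //.
by have [_ _ _ _] := HKW q'; apply.
Qed.

Lemma Gam_weight p : R0 < r p -> Gam r r p = 1.
Proof.
move=> /weight_gt_end nk; have [ac dq] := chart_atP (ang p); set c := chart_at (ang p) in ac dq.
have aC := ac_end_atlas ac; have sr : smooth_fun r := @ac_weight_smooth _ _ _ M.
have dp : cdom (echart c) p by split.
have thE z : cimg (echart c) z -> r (cinv (echart c) z) = z 0 ord0 by exact: weight_cinv.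
have gE z i : cimg (echart c) z -> g (echart c) z ord0 i = (i == ord0)%:R by exact: echart_g0.
by rewrite (Gam_th aC sr thE gE sr dp) (partial_th aC thE ord0 (cimg_map dp)) eqxx.
Qed.

Lemma cons_coord_compact m (a b : R) (K : set 'rV[R]_m) : compact K ->
  compact [set z | exists t (y : 'rV[R]_m), [/\ a <= t <= b, K y & z = cons_coord t y]].
Proof.
move=> cK; pose f (ty : R * 'rV[R]_m) := cons_coord ty.1 ty.2.
rewrite (_ : [set z | _] = f @` (`[a, b]%classic `*` K)); last first.
  apply/seteqP; split=> z.
    by move=> [t [y [tab Ky ->]]]; exists (t, y) => //; split => //=; rewrite in_itv.
  by move=> [[t y] [/= tab Ky] <-]; exists t, y; split => //; move: tab; rewrite in_itv.
apply: continuous_compact; last by apply: compact_setX => //; exact: segment_compact.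
apply: continuous_subspaceT => -[t y].
apply/cvgrPdist_le => e e0; exists (ball t e, ball y e); first by split; exact: nbhsx_ballx.
move=> [t' y'] [/=]; rewrite -!ball_normE /= => h1 h2.
by apply: cons_coord_dist; exact: ltW.
Qed.

(** The compact cross-section is covered by finitely many compact sets lying in charts; the shell is
    the union of the images of their products with the interval. *)
Lemma shell_compact (a b : R) : R0 < a -> compact [set p | a <= r p <= b].
Proof.
move=> Ra; have [K [s [HK Hs]]] := chart_cover (@ac_bd_compact _ _ _ M).
rewrite (_ : [set p | _] = [set p | exists2 q, q \in s & [/\ ~ K0 p, K q (ang p) & a <= rad p <= b]]); last first.
  apply/seteqP; split=> p /=.
    move=> /andP[ap pb]; have nk : ~ K0 p by apply: weight_gt_end; exact: lt_le_trans ap.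
    have [q qs Kq] := Hs (ang p); exists q => //; split => //.
    by rewrite -ac_weight_end // ap.
  by move=> [q _ [nk _]]; rewrite -ac_weight_end.
elim: s {Hs} => [|q s IH].
  rewrite (_ : [set p | _] = set0); first exact: compact0.
  by apply/seteqP; split=> p // [].
rewrite (_ : [set p | _] = [set p | [/\ ~ K0 p, K q (ang p) & a <= rad p <= b]] `|`
   [set p | exists2 q, q \in s & [/\ ~ K0 p, K q (ang p) & a <= rad p <= b]]); last first.
  apply/seteqP; split=> p.
    by move=> [z]; rewrite inE => /orP[/eqP -> H|zs H]; [left|right; exists z].
  move=> [H|[z zs H]]; first by exists q => //; rewrite mem_head.
  by exists z => //; rewrite inE zs orbT.
apply: compactU => //; have [cK Kc] := HK q; have [ac _] := chart_atP q.
have aC := ac_end_atlas ac; set c := chart_at q in Kc ac aC.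
have cK' := cmap_compact ac Kc cK.
rewrite (_ : [set p | _] = cinv (echart c) @` [set z | exists t y, [/\ a <= t <= b, (cmap c @` K q) y & z = cons_coord t y]]).
  apply: cinv_compact aC _ (cons_coord_compact cK') => _ [t [_ [/andP[ta _] [z /Kc dz <-] ->]]].
  by apply: echart_img ac _ (cimg_map dz); exact: lt_le_trans ta.
apply/seteqP; split=> p.
  move=> [nk Kp ab]; exists (cons_coord (rad p) (cmap c (ang p))).
    by exists (rad p), (cmap c (ang p)); split => //; exists (ang p).
  have dp : cdom (echart c) p by split => //; exact: Kc.
  exact: (cmapK aC dp).
move=> [_ [t [_ [/andP[ta tb] [z Kz <-] ->]]] <-].
rewrite /mkset echart_inv (cmapK ac (Kc _ Kz)).
have Rt : R0 < t by exact: lt_le_trans ta.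
by have [nk rt at_] := ac_end_from z Rt; rewrite rt at_ ta tb.
Qed.

Lemma end_uniform (eps : R) : 0 < eps -> exists2 R1 : R, R0 < R1 & forall p, R1 < r p ->
  `|r p * Lap r p - n.-1%:R| <= eps /\
  forall w, smooth_fun w ->
    `|r p * Hes r w p - (Gam w w p - Gam r w p ^+ 2)| <= eps * (Gam w w p - Gam r w p ^+ 2).
Proof.
move=> eps0; have [K [s [HK Hs]]] := chart_cover (@ac_bd_compact _ _ _ M).
have /choice[R1 HR1] : forall q : ac_bd M, exists R1 : R, R0 < R1 /\ forall p, ~ K0 p -> K q (ang p) -> R1 < rad p ->
    `|r p * Lap r p - n.-1%:R| <= eps /\
    forall w, smooth_fun w ->
      `|r p * Hes r w p - (Gam w w p - Gam r w p ^+ 2)| <= eps * (Gam w w p - Gam r w p ^+ 2).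
  move=> q; have [cK Kc] := HK q; have [ac _] := chart_atP q.
  have [R1 R01 H] := end_local sigma0_gt0 hmu ac cK Kc eps0.
  by exists R1; split => // p nk Kp Rp; have [] := H p nk Kp Rp.
have R00 : 0 < R0 by exact: lt_trans (ac_R0_gt1 M).
have R1_ge0 q : 0 <= R1 q by apply: ltW; apply: lt_trans (HR1 q).1.
(* The sum of the finitely many nonnegative radii serves as an upper bound for all of them. *)
exists (R0 + 1 + \sum_(q <- s) R1 q).
  by rewrite -addrA ltrDl ltr_wpDr // sumr_ge0.
move=> p Rp; have S0 : 0 <= \sum_(q <- s) R1 q by exact: sumr_ge0.
have nk : ~ K0 p by apply: weight_gt_end; apply: le_lt_trans Rp; lra.
have [q qs Kq] := Hs (ang p); apply: (HR1 q).2 => //.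
rewrite -ac_weight_end //; apply: le_lt_trans Rp.
rewrite (big_rem q) //=; have : 0 <= \sum_(z <- rem q s) R1 z by exact: sumr_ge0.
lra.
Qed.

End EndUniform.

(** * Carleman estimate on the end *)

Section WeightFunction.
Context {R : realType}.
Implicit Types (tau de ka t : R).

(** Interpolates between the rates [tau] and [tau + de]: for [ka > 0] the second term is bounded by
    [de / ka], and it tends to [de t] as [ka] tends to 0. The next three definitions are its
    successive derivatives. *)
Definition wexp tau de ka t := tau * t + de * (t * (1 + ka * t)^-1).
Definition wexp1 tau de ka t := tau + de * (1 + ka * t)^-1 ^+ 2.
Definition wexp2 de ka t := - (2 * de * ka) * (1 + ka * t)^-1 ^+ 3.
Definition wexp3 de ka t := 6 * de * ka ^+ 2 * (1 + ka * t)^-1 ^+ 4.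

Lemma is_derive_frac ka t : 0 <= ka -> 0 < t ->
  is_derive t 1 (fun t => (1 + ka * t)^-1) (- ka * (1 + ka * t)^-1 ^+ 2).
Proof.
move=> k0 t0; have nz : 1 + ka * t != 0 by rewrite gt_eqF // ltr_wpDr ?ltr01 // mulr_ge0 // ltW.
have d1 : is_derive t 1 (fun t => 1 + ka * t) ka.
  by apply: is_derive_eqf (is_deriveDf (is_derive_cst _ _ _) (is_deriveCf ka (is_derive_id t 1))) _; rewrite add0r mulr1.
by apply: is_derive_eqf (is_deriveVf (f := fun t : R => 1 + ka * t) nz d1) _; rewrite mulrC mulrN mulNr.
Qed.

Lemma is_derive_wexp tau de ka t : 0 <= ka -> 0 < t ->
  is_derive t 1 (wexp tau de ka) (wexp1 tau de ka t).
Proof.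
move=> k0 t0; have nz : 1 + ka * t != 0 by rewrite gt_eqF // ltr_wpDr ?ltr01 // mulr_ge0 // ltW.
apply: is_derive_eqf (is_deriveDf (is_deriveCf tau (is_derive_id t 1))
  (is_deriveCf de (is_deriveMf (is_derive_id t 1) (is_derive_frac k0 t0)))) _.
by rewrite /wexp1; field.
Qed.

Lemma is_derive_wexp1 tau de ka t : 0 <= ka -> 0 < t ->
  is_derive t 1 (wexp1 tau de ka) (wexp2 de ka t).
Proof.
move=> k0 t0.
apply: is_derive_eqf (is_deriveDf (is_derive_cst tau t 1)
  (is_deriveCf de (is_deriveXf 2 (is_derive_frac k0 t0)))) _.
by rewrite /wexp2 /=; ring.
Qed.

Lemma is_derive_wexp2 de ka t : 0 <= ka -> 0 < t ->
  is_derive t 1 (wexp2 de ka) (wexp3 de ka t).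
Proof.
move=> k0 t0.
apply: is_derive_eqf (is_deriveCf (- (2 * de * ka)) (is_deriveXf 3 (is_derive_frac k0 t0))) _.
by rewrite /wexp3 /=; ring.
Qed.

(* [q0] is the zeroth order coefficient of the conjugated operator. *)
Definition wq0 tau de ka lam t := wexp1 tau de ka t ^+ 2 - wexp2 de ka t + lam.
Definition wQ' tau de ka lam t :=
  wq0 tau de ka lam t + t * (2 * wexp1 tau de ka t * wexp2 de ka t - wexp3 de ka t).

Lemma is_derive_wQ tau de ka lam t : 0 <= ka -> 0 < t ->
  is_derive t 1 (fun t => t * wq0 tau de ka lam t) (wQ' tau de ka lam t).
Proof.
move=> k0 t0.
apply: is_derive_eqf (is_deriveMf (is_derive_id t 1) (is_deriveDf (is_deriveBf
  (is_deriveXf 2 (is_derive_wexp1 tau de k0 t0)) (is_derive_wexp2 de k0 t0)) (is_derive_cst lam t 1))) _.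
by rewrite /wQ' /wq0 /=; ring.
Qed.

(** The square of the weight's slope [f] is nonnegative and [lam] is the main term. The terms from
    the concavity of the weight are at most multiples of [de f] and [de], because
    [ka t / (1 + ka t) <= 1]; they are absorbed by [f^2] and, thanks to [56 de <= lam], by [lam].
    Nothing depends on the sizes of [tau], [ka] and [t]. *)
Lemma wQ'_bound tau de ka lam t (e e1 : R) : 0 <= tau -> 0 < de -> de <= 1 -> 56 * de <= lam ->
  0 <= ka -> ka <= 1 -> 0 < t -> 0 <= e -> e <= 8^-1 -> e <= lam -> `|e1| <= e ->
  3 / 8 * lam <= wQ' tau de ka lam t + wq0 tau de ka lam t * e1 - 2^-1 * wexp1 tau de ka t * e ^+ 2.
Proof.
move=> tau0 de0 de1 dl k0 k1 t0 e0 e8 el e1e.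
rewrite /wQ' /wq0 /wexp2 /wexp3.
have nz : 0 < 1 + ka * t by rewrite ltr_wpDr ?ltr01 // mulr_ge0 // ltW.
have sp : 0 < (1 + ka * t)^-1 by rewrite invr_gt0.
have s1 : (1 + ka * t)^-1 <= 1 by rewrite invf_le1 // lerDl mulr_ge0 // ltW.
have kts : ka * t * (1 + ka * t)^-1 = 1 - (1 + ka * t)^-1 by field; rewrite gt_eqF.
have f0 : 0 <= wexp1 tau de ka t by rewrite addr_ge0 // mulr_ge0 ?exprn_ge0 // ltW.
move: sp s1 kts f0; move: (wexp1 _ _ _ _) ((1 + ka * t)^-1) => f s sp s1 kts f0.
have -> : t * (2 * f * (- (2 * de * ka) * s ^+ 3) - 6 * de * ka ^+ 2 * s ^+ 4) =
   - (4 * f * de * ((ka * t * s) * s ^+ 2)) - 6 * de * ka * ((ka * t * s) * s ^+ 3) by ring.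
rewrite kts.
have s0 := ltW sp; have s20 : 0 <= s ^+ 2 by exact: sqr_ge0.
have s30 : 0 <= s ^+ 3 by rewrite exprn_ge0.
have s2 : s ^+ 2 <= 1 by rewrite expr_le1.
have s3 : s ^+ 3 <= 1 by rewrite expr_le1.
have c0 : 0 <= 1 - s by rewrite subr_ge0.
have a2 : (1 - s) * s ^+ 2 <= 1 by rewrite mulr_ile1 // lerBlDr lerDl.
have a3 : (1 - s) * s ^+ 3 <= 1 by rewrite mulr_ile1 // lerBlDr lerDl.
have b1 : 4 * f * de * ((1 - s) * s ^+ 2) <= 4 * f * de by rewrite ler_piMr // !mulr_ge0 // ltW.
have dk : de * ka <= de by rewrite ler_piMr // ltW.
have dk0 : 0 <= de * ka by rewrite mulr_ge0 // ltW.
have b2 : 6 * de * ka * ((1 - s) * s ^+ 3) <= 6 * (de * ka) by rewrite -(mulrA 6) ler_piMr // mulr_ge0.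
have b3 : 0 <= 2 * de * ka * s ^+ 3 by rewrite mulr_ge0 // -mulrA mulr_ge0.
have b4 : 2 * de * ka * s ^+ 3 <= 2 * (de * ka) by rewrite -(mulrA 2) ler_piMr // mulr_ge0.
have d2 : de ^+ 2 <= de by rewrite expr2 ler_piMr // ltW.
have am := sqr_ge0 (2^-1 * f - 4 * de).
have e2 : e ^+ 2 <= lam by rewrite expr2; apply: le_trans el; rewrite ler_piMr //; lra.
have e28 : e ^+ 2 <= 64^-1 by have : e * e <= 8^-1 * 8^-1 by [rewrite ler_pM]; rewrite expr2; lra.
have e4 : e ^+ 2 * e ^+ 2 <= 64^-1 * lam by rewrite ler_pM // sqr_ge0.
have am2 := sqr_ge0 (2^-1 * f - 2^-1 * e ^+ 2).
have q0 : 0 <= f ^+ 2 - - (2 * de * ka) * s ^+ 3 + lam by have := sqr_ge0 f; lra.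
move: q0; set q := f ^+ 2 - - (2 * de * ka) * s ^+ 3 + lam => q0.
have q1 : - (8^-1 * q) <= q * e1.
  have : 0 <= q * (8^-1 + e1) by rewrite mulr_ge0 //; move: e1e; rewrite ler_norml => /andP[]; lra.
  by rewrite mulrDr; lra.
have b5 : 4 * f * de <= 4^-1 * f ^+ 2 + 16 * de by move: am d2; lra.
have b6 : 2^-1 * f * e ^+ 2 <= 4^-1 * f ^+ 2 + 4^-1 * (64^-1 * lam) by move: am2 e4; lra.
move: q0 q1; rewrite /q => q0 q1; have f2 := sqr_ge0 f.
lra.
Qed.

(* The pointwise commutator estimate: multiply the conjugated operator by
   [Y = 2 r w_r + m w] and absorb the [Y ^ 2] term, which has a good sign. *)
Lemma end_pointwise (r m x L G H l W D s f q0 q1 z e eta lam : R) : 2^-1 <= r -> 0 <= m ->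
  0 <= e -> e <= 8^-1 -> 0 < eta -> eta <= 8^-1 -> eta <= lam / 16 -> 0 <= f ->
  `|r * l - m| <= e -> x ^+ 2 <= G -> `|r * H - (G - x ^+ 2)| <= e * (G - x ^+ 2) ->
  (r + m) * `|s| <= eta ->
  3 / 8 * lam <= q1 + q0 * (r * l - m) - 2^-1 * f * e ^+ 2 ->
  D = L - 2 * f * x + (q0 - f * l) * W - s * W ->
  3 / 16 * lam * W ^+ 2 <= (1 + m ^+ 2) / eta * (r * D) ^+ 2 +
    (2 * (r * x * L + (r * H + x ^+ 2 + 2^-1 * (r * z))) + -1 * (G * (r * l + 1) + r * z) +
     m * (W * L + G) + (r * q0 * (W * W) * l + (r * q0 * (2 * W * x) + W * W * q1))).
Proof.
move=> r2 m0 e0 e8 eta0 eta8 etal f0; set e1 := r * l - m => e1e xG HT sr qb DE.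
have r0 : 0 < r by apply: lt_le_trans r2; rewrite invr_gt0.
pose Y := 2 * r * x + m * W.
have LE : L = D + 2 * f * x - (q0 - f * l) * W + s * W by rewrite DE; ring.
have lE : r * l = m + e1 by rewrite /e1; ring.
have T0 : 0 <= G - x ^+ 2 by rewrite subr_ge0.
have x20 := sqr_ge0 x; have W20 := sqr_ge0 W.
(* On an exact cone this combination equals the full [|dw|^2]; the errors [e <= 1/8] leave at least
   half of it. *)
have br : 2^-1 * G <= 2 * (r * H + x ^+ 2) - G * (1 + e1).
  move: e1e HT; rewrite !ler_norml => /andP[e11 e12] /andP[H1 _].
  have : 0 <= G * (e - e1) by rewrite mulr_ge0 ?subr_ge0 //; apply: le_trans xG.
  have : 0 <= (G - x ^+ 2) * (8^-1 - e) by rewrite mulr_ge0 ?subr_ge0.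
  have : 0 <= x ^+ 2 * (8^-1 - e) by rewrite mulr_ge0 ?subr_ge0.
  lra.
(* Completing the square absorbs the cross term into the good term [(f / r) Y^2]; the remainder is
   the last term of [wQ'_bound]. *)
have fy : - (f / r) * Y ^+ 2 - f * e1 / r * W * Y <= 2^-1 * f * e ^+ 2 * W ^+ 2.
  have e12 : e1 ^+ 2 <= e ^+ 2 by rewrite -real_normK ?num_real // lerXn2r ?nnegrE.
  apply: (@le_trans _ _ (f / r * 4^-1 * e1 ^+ 2 * W ^+ 2)).
    rewrite -subr_ge0 (_ : _ - _ = f / r * (Y + 2^-1 * e1 * W) ^+ 2); last by field; rewrite gt_eqF.
    by rewrite mulr_ge0 ?sqr_ge0 // divr_ge0 // ltW.
  rewrite ler_wpM2r //; apply: ler_pM; rewrite ?sqr_ge0 //.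
    by rewrite mulr_ge0 ?divr_ge0 // ltW.
  have ri : r^-1 <= 2 by rewrite invf_ple ?posrE // invr_gt0.
  rewrite -mulrA [leRHS]mulrC; apply: ler_wpM2l => //; lra.
have sb : - (s * W * Y) <= eta * (x ^+ 2 + 2 * W ^+ 2).
  have s0 := normr_ge0 s; have sw := normr_ge0 W; have sx := normr_ge0 x.
  apply: (@le_trans _ _ (`|s| * `|W| * (2 * r * `|x| + m * `|W|))).
    apply: le_trans (ler_norm _) _; rewrite normrN !normrM ler_wpM2l ?mulr_ge0 //.
    apply: le_trans (ler_normD _ _) _; rewrite !normrM (gtr0_norm r0) (ger0_norm m0) (ger0_norm (ler0n _ 2)) //.
  apply: (@le_trans _ _ ((r + m) * `|s| * (2 * (`|W| * `|x|) + `|W| ^+ 2))).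
    have : 0 <= m * `|s| * (`|W| * `|x|) by rewrite !mulr_ge0.
    have : 0 <= r * `|s| * `|W| ^+ 2 by rewrite !mulr_ge0 ?sqr_ge0 // ltW.
    lra.
  apply: (@le_trans _ _ (eta * (2 * (`|W| * `|x|) + `|W| ^+ 2))).
    by rewrite ler_wpM2r // addr_ge0 ?sqr_ge0 // !mulr_ge0.
  rewrite ler_wpM2l ?(ltW eta0) //.
  have := sqr_ge0 (`|W| - `|x|); rewrite sqrrB !real_normK ?num_real //; lra.
have db : - (D * Y) <= eta * x ^+ 2 + eta * W ^+ 2 + (1 + m ^+ 2) / eta * (r * D) ^+ 2.
  have d1 : 0 <= eta^-1 * (r * D + eta * x) ^+ 2 by rewrite mulr_ge0 ?sqr_ge0 // invr_ge0 ltW.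
  have d2 : 0 <= eta^-1 * (2^-1 * m * D + eta * W) ^+ 2 by rewrite mulr_ge0 ?sqr_ge0 // invr_ge0 ltW.
  have r4 : 4^-1 <= r ^+ 2.
    have -> : 4^-1 = 2^-1 ^+ 2 :> R by field.
    by rewrite lerXn2r ?nnegrE // ?invr_ge0 // ltW.
  have d3 : 4^-1 * (m ^+ 2 * D ^+ 2 / eta) <= r ^+ 2 * (m ^+ 2 * D ^+ 2 / eta).
    by apply: ler_wpM2r => //; rewrite divr_ge0 ?(ltW eta0) // mulr_ge0 ?sqr_ge0.
  have d4 : (2^-1 * m * D + eta * W) ^+ 2 * eta^-1 = 4^-1 * (m ^+ 2 * D ^+ 2 / eta) + m * D * W + eta * W ^+ 2.
    by field; rewrite gt_eqF.
  have d5 : (r * D + eta * x) ^+ 2 * eta^-1 = (r * D) ^+ 2 / eta + 2 * r * D * x + eta * x ^+ 2.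
    by field; rewrite gt_eqF.
  have d6 : (1 + m ^+ 2) / eta * (r * D) ^+ 2 = (r * D) ^+ 2 / eta + r ^+ 2 * (m ^+ 2 * D ^+ 2 / eta).
    by field; rewrite gt_eqF.
  move: d1 d2; rewrite ![eta^-1 * _]mulrC d4 d5 d6 /Y => d1 d2; lra.
have SE : 2 * (r * x * L + (r * H + x ^+ 2 + 2^-1 * (r * z))) + -1 * (G * (r * l + 1) + r * z) +
     m * (W * L + G) + (r * q0 * (W * W) * l + (r * q0 * (2 * W * x) + W * W * q1)) =
   D * Y + s * W * Y + (2 * (r * H + x ^+ 2) - G * (1 + e1)) + W ^+ 2 * (q1 + q0 * e1) +
   f / r * Y ^+ 2 + f * e1 / r * W * Y.
  by rewrite LE /e1 /Y; field; rewrite gt_eqF.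
rewrite SE.
have q2 : (3 / 8 * lam) * W ^+ 2 <= (q1 + q0 * e1 - 2^-1 * f * e ^+ 2) * W ^+ 2 by rewrite ler_wpM2r.
have g1 : eta * x ^+ 2 <= 8^-1 * G.
  apply: (@le_trans _ _ (8^-1 * x ^+ 2)); first by rewrite ler_wpM2r.
  by rewrite ler_wpM2l // invr_ge0.
have g2 : eta * W ^+ 2 <= lam / 16 * W ^+ 2 by rewrite ler_wpM2r.
have G0 : 0 <= G by apply: le_trans xG.
move: fy; rewrite [- (f / r) * _]mulNr => fy.
lra.
Qed.

End WeightFunction.

Section EndCarleman.
Context {R : realType} {N : nat} {M : manifold R N}.
Variable g : metric M.
Variable mu : {measure set (borel M) -> \bar R}.
Hypothesis hmu : is_riemannian_measure g mu.
Local Notation Gam := (Gam g).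
Local Notation Lap := (Lap g).
Local Notation Hes := (Hes g).
Local Notation I := (I mu).
Implicit Types (v w f h : M -> R) (p : M).
Variables (r q : M -> R) (R1 m e eta lam : R).
Hypothesis sr : smooth_fun r.
Hypothesis r_ge : forall p, 2^-1 <= r p.
Hypothesis m0 : 0 <= m.
Hypothesis e0 : 0 <= e.
Hypothesis e8 : e <= 8^-1.
Hypothesis elam : e <= lam.
Hypothesis Grr : forall p, R1 < r p -> Gam r r p = 1.
Hypothesis Lapr : forall p, R1 < r p -> `|r p * Lap r p - m| <= e.
Hypothesis Hesr : forall p, R1 < r p -> forall w, smooth_fun w ->
  `|r p * Hes r w p - (Gam w w p - Gam r w p ^+ 2)| <= e * (Gam w w p - Gam r w p ^+ 2).
Hypothesis eta0 : 0 < eta.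
Hypothesis eta8 : eta <= 8^-1.
Hypothesis etal : eta <= lam / 16.
Hypothesis q_eta : forall p, R1 < r p -> (r p + m) * `|q p + lam| <= eta.
Hypothesis mq : measurable_fun [set: borel M] (q : borel M -> R).
Variable Bq : R.
Hypothesis qB : forall p, `|q p| <= Bq.

Lemma r_gt0 p : 0 < r p.
Proof. by apply: lt_le_trans (r_ge p); rewrite invr_gt0. Qed.

Lemma smooth_frac (ka : R) : 0 <= ka -> smooth_fun (fun p => (1 + ka * r p)^-1).
Proof.
move=> k0; have s1 : smooth_fun (fun p => 1 + ka * r p) by smf.
apply: (smooth_fun_comp1 smooth1_inv _ s1) => p; rewrite /mkset gt_eqF // ltr_wpDr ?ltr01 //.
by rewrite mulr_ge0 // ltW // r_gt0.
Qed.

Variables (tau de ka : R).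
Hypothesis tau0 : 0 <= tau.
Hypothesis de0 : 0 < de.
Hypothesis de1 : de <= 1.
Hypothesis del : 56 * de <= lam.
Hypothesis ka0 : 0 <= ka.
Hypothesis ka1 : ka <= 1.

Let phi p := wexp tau de ka (r p).

Lemma smooth_wexp : smooth_fun phi.
Proof. by have := smooth_frac ka0; rewrite /phi /wexp => ?; smf. Qed.

(** The constants are free of [tau] and [ka], so the estimate may be iterated over arbitrarily large
    rates. *)
Lemma end_carleman v (K : set M) : smooth_fun v -> compact K -> (forall p, ~ K p -> v p = 0) ->
  (forall p, K p -> R1 < r p) ->
  3 / 16 * lam * I (fun p => (expR (phi p) * v p) ^+ 2) <=
  (1 + m ^+ 2) / eta * I (fun p => (r p * (expR (phi p) * (Lap v p - q p * v p))) ^+ 2).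
Proof.
move=> sv cK v0 KR.
have sphi := smooth_wexp; have sk := smooth_frac ka0.
pose w p := expR (phi p) * v p; have sw : smooth_fun w by rewrite /w; smf.
have cv : cs v by exists K.
have cw : cs w by rewrite /w; csf.
have w0 p : ~ K p -> w p = 0 by move=> nK; rewrite /w v0 ?mulr0.
(* Its gradient is the dilation field [r d_r], and on an exact cone its Hessian is the metric
   itself. *)
pose Psi p := 2^-1 * r p ^+ 2; have sPsi : smooth_fun Psi by rewrite /Psi; smf.
pose Q p := r p * wq0 tau de ka lam (r p).
have sQ : smooth_fun Q by rewrite /Q /wq0 /wexp1 /wexp2; smf.
have sww : smooth_fun (fun q => w q * w q) by smf.
have sPw : smooth_fun (Gam Psi w) by smf.
have sG : smooth_fun (Gam w w) by smf.
(* The four fields are [2 r w_r grad w], [- |dw|^2 grad Psi], [m w grad w] and [r q0 w^2 grad r];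
   the last one produces the positive zeroth order term. *)
have d1 : divergence mu (fun p => 2 * (Gam Psi w p * Lap w p + Gam (Gam Psi w) w p)).
  by apply: (divergenceZ hmu); apply: (divergence_green hmu); [smf|smf|csf].
have d2 : divergence mu (fun p => -1 * (Gam w w p * Lap Psi p + Gam (Gam w w) Psi p)).
  by apply: (divergenceZ hmu); apply: (divergence_green hmu); [smf|smf|csf].
have d3 : divergence mu (fun p => m * (w p * Lap w p + Gam w w p)).
  by apply: (divergenceZ hmu); apply: (divergence_green hmu); [smf|smf|csf].
have d4 : divergence mu (fun p => (Q p * (w p * w p)) * Lap r p + Gam (fun q => Q q * (w q * w q)) r p).
  by apply: (divergence_green hmu); [smf|smf|csf].
have dS := divergenceD hmu (divergenceD hmu (divergenceD hmu d1 d2) d3) d4.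
have lq := LB_q mq qB.
have lF : LB (fun p => w p ^+ 2) by lbf.
have cF : cs (fun p => w p ^+ 2) by csf.
have lX : LB (fun p => (r p * (expR (phi p) * (Lap v p - q p * v p))) ^+ 2) by lbf.
have cX : cs (fun p => (r p * (expR (phi p) * (Lap v p - q p * v p))) ^+ 2).
  by apply: csX => //; csf.
rewrite -(IZ hmu _ lF cF) -(IZ hmu _ lX cX).
apply: (I_le_divergence hmu _ _ _ _ dS) => [||||p]; [lbf|lbf|csf|by apply: cs_mull; exact: cX|].
have [Kp|nK] := pselect (K p); last first.
  rewrite (w0 p nK) !(GamC g _ w) (GamC g (Gam w w)) !(Gam_off g _ cK w0 nK) (v0 p nK) (Lap_off g cK v0 nK).
  rewrite (GamC g Psi); rewrite (@Gam_off _ _ _ g (Gam w w) Psi K p cK) //; last first.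
    by move=> z nz; exact: Gam_off cK w0 nz.
  rewrite (@Gam_off _ _ _ g (fun q => Q q * (w q * w q)) r K p cK) //; last first.
    by move=> z nz; rewrite (w0 z nz) !mulr0.
  by rewrite !(mulr0, mul0r, addr0, subr0, expr0n).
have Rp := KR p Kp; have rp0 := r_gt0 p.
have rpn : 1 + ka * r p != 0 by rewrite gt_eqF // ltr_wpDr ?ltr01 // mulr_ge0 // ltW.
have dW : is_derive (r p) 1 (wexp tau de ka) (wexp1 tau de ka (r p)) by exact: is_derive_wexp.
have dP (t : R) : is_derive t 1 (fun t => 2^-1 * t ^+ 2) t.
  by apply: is_derive_eqf (is_deriveCf 2^-1 (is_deriveXf 2 (is_derive_id t 1))) _; rewrite /=; field.
have GP h : Gam Psi h p = r p * Gam r h p by exact: (Gam_comp1l g h sr (dP (r p))).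
have Gp h : Gam phi h p = wexp1 tau de ka (r p) * Gam r h p by exact: (Gam_comp1l g h sr dW).
have LP : Lap Psi p = r p * Lap r p + 1.
  rewrite (@Lap_comp1 _ _ _ g r p (fun t => 2^-1 * t ^+ 2) (fun t => t) 1 setT sr) ?Grr ?mulr1 //.
  exact: openT.
have Lp : Lap phi p = wexp1 tau de ka (r p) * Lap r p + wexp2 de ka (r p).
  have oJ : open ([set t | 0 < t] : set R) by exact: open_gt.
  have := Lap_comp1 g sr oJ rp0 (fun t t0 => is_derive_wexp tau de ka0 t0) (is_derive_wexp1 tau de ka0 rp0).
  by rewrite Grr // mulr1.
have HP : Gam (Gam Psi w) w p = r p * Hes r w p + Gam r w p ^+ 2 + 2^-1 * (r p * Gam r (Gam w w) p).
  rewrite -(GP (Gam w w)) (GamC g (Gam Psi w)) -[LHS](subrK (2^-1 * Gam Psi (Gam w w) p)) -HesU; congr (_ + _).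
  have jT : forall z, (setT : set R) (r z) by [].
  have := Hes_comp1 g sr sw jT (fun t _ => dP t) sr (is_derive_id (r p) 1).
  by rewrite mul1r.
have GQ : Gam (fun q => Q q * (w q * w q)) r p =
    Q p * (2 * w p * Gam r w p) + w p * w p * wQ' tau de ka lam (r p).
  rewrite (GamMl g r p sQ sww) (GamMl g r p sw sw) (GamC g w r).
  rewrite (_ : Gam Q r p = wQ' tau de ka lam (r p)); last first.
    by rewrite (Gam_comp1l g r sr (is_derive_wQ tau de lam ka0 rp0)) Grr ?mulr1.
  by ring.
have LC := Lap_conj g p sphi sv; rewrite -/w in LC.
rewrite GP LP HP GQ (GamC g (Gam w w)) GP.
have CS : Gam r w p ^+ 2 <= Gam w w p.
  by apply: le_trans (Gam_CS g r w p) _; rewrite Grr // mul1r.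
rewrite /Q; cbv zeta in LC.
have f0 : 0 <= wexp1 tau de ka (r p) by rewrite addr_ge0 // mulr_ge0 ?sqr_ge0 // ltW.
have qb := wQ'_bound tau0 de0 de1 del ka0 ka1 rp0 e0 e8 elam (Lapr Rp).
have DE : expR (phi p) * (Lap v p - q p * v p) = Lap w p - 2 * wexp1 tau de ka (r p) * Gam r w p +
    (wq0 tau de ka lam (r p) - wexp1 tau de ka (r p) * Lap r p) * w p - (q p + lam) * w p.
  move: LC; rewrite !Gp (GamC g r phi) Gp Lp Grr // mulr1 /wq0.
  have -> : expR (phi p) * (Lap v p - q p * v p) = expR (phi p) * Lap v p - q p * w p.
    by rewrite mulrBr mulrCA.
  by move: (expR (phi p) * Lap v p) (w p) (Gam r w p) => E W x ->; ring.
exact: (end_pointwise (Gam r (Gam w w) p) (r_ge p) m0 e0 e8 eta0 eta8 etal f0 (Lapr Rp) CS (Hesr Rp sw) (q_eta Rp) qb DE).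
Qed.

End EndCarleman.

(** * Cutoffs on the end and their commutators *)

Section StepBounds.
Context {R : realType}.

Lemma is_derive_locally_cst (F : R -> R) (c t d : R) : (\forall s \near t, F s = c) -> is_derive t 1 F d -> d = 0.
Proof.
move=> nF dF; have nF' : \forall s \near t, (fun=> c) s = F s by near=> s; symmetry; near: s; exact: nF.
have dc := is_derive_near nF' (is_derive_cst c t 1).
by rewrite -(@derive_val _ _ _ _ _ _ _ dF) (@derive_val _ _ _ _ _ _ _ dc).
Unshelve. all: by end_near. Qed.

Lemma step_bounds : exists (T1 T2 : R -> R) (S : R), [/\ 0 <= S,
  (forall t : R, is_derive t 1 step (T1 t)), (forall t : R, is_derive t 1 T1 (T2 t)),
  (forall t, `|T1 t| <= S /\ `|T2 t| <= S) & forall t, t < 0 \/ 1 < t -> T1 t = 0 /\ T2 t = 0].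
Proof.
have [T T0 TD] := @smooth1_step R.
have D0 (t : R) : is_derive t 1 step (T 1%N t) by rewrite -T0; exact: TD.
have D1 (t : R) : is_derive t 1 (T 1%N) (T 2%N t) by exact: TD.
have z1 (t : R) : t < 0 \/ 1 < t -> T 1%N t = 0.
  move=> [t0|t1].
    apply: (is_derive_locally_cst (F := step) (c := 0) _ (D0 t)); near=> s; rewrite step0 // ltW //.
    by near: s; exact: lt_nbhsl.
  apply: (is_derive_locally_cst (F := step) (c := 1) _ (D0 t)); near=> s; rewrite step1 // ltW //.
  by near: s; exact: lt_nbhsr.
have z2 (t : R) : t < 0 \/ 1 < t -> T 2%N t = 0.
  move=> [t0|t1].
    apply: (is_derive_locally_cst (F := T 1%N) (c := 0) _ (D1 t)); near=> s; apply: z1; left.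
    by near: s; exact: lt_nbhsl.
  apply: (is_derive_locally_cst (F := T 1%N) (c := 0) _ (D1 t)); near=> s; apply: z1; right.
  by near: s; exact: lt_nbhsr.
have bd (k : nat) : (forall t, t < 0 \/ 1 < t -> T k t = 0) -> exists2 S : R, 0 <= S & forall t, `|T k t| <= S.
  move=> zk; have ck : {within `[0, 1]%classic, continuous (fun t => `|T k t|)}.
    apply: continuous_subspaceT => t; apply: continuous_comp; last exact: norm_continuous.
    by apply: differentiable_continuous; apply/derivable1_diffP; exact: (@ex_derive _ _ _ _ _ _ _ (TD k t _)).
  have [c _ Hc] := EVT_max (@ler01 R) ck.
  exists `|T k c| => // t; have [t0|t0] := ltP t 0; first by rewrite zk ?normr0 //; left.
  have [t1|t1] := ltP 1 t; first by rewrite zk ?normr0 //; right.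
  by apply: Hc; rewrite in_itv /= t0.
have [S1 S10 HS1] := bd 1%N z1; have [S2 S20 HS2] := bd 2%N z2.
exists (T 1%N), (T 2%N), (S1 + S2); split => //; first exact: addr_ge0.
  by move=> t; split; [apply: le_trans (HS1 t) _; rewrite lerDl|apply: le_trans (HS2 t) _; rewrite lerDr].
by move=> t H; rewrite z1 // z2.
Unshelve. all: by end_near. Qed.

End StepBounds.

Section EnergyPointwise.
Context {R : realType}.

(* [y ^ 2 * Lf + ...] are the integrands of the two Green identities that
   control the gradient; the cross term is split by Cauchy-Schwarz. *)
Lemma energy_pointwise (B w h G Gf y Q x Lf : R) : 0 <= w -> 0 <= G -> 0 <= Gf -> `|Q| <= B ->
  x ^+ 2 <= G * Gf ->
  (w + h ^+ 2) * (y ^+ 2 + Gf) <= (w * (B + 2) + (4 * G + (2 * B + 2) * h ^+ 2)) * y ^+ 2 +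
    (w + h ^+ 2) * (Lf - Q * y) ^+ 2 +
    (w * (y * Lf + Gf) + 2 * (h ^+ 2 * y * Lf + (h ^+ 2 * Gf + y * (2 * h * x)))).
Proof.
move=> w0 G0 Gf0; rewrite ler_norml => /andP[Q1 Q2] CS.
set F := Lf - Q * y; have -> : Lf = F + Q * y by rewrite /F; ring.
have y2 := sqr_ge0 y; have h0 := sqr_ge0 h; have BQ : 0 <= (B + Q) * y ^+ 2 by rewrite mulr_ge0 //; lra.
have h1 : 0 <= w * ((B + Q) * y ^+ 2 + 2^-1 * (F + y) ^+ 2 + 2^-1 * y ^+ 2 + 2^-1 * F ^+ 2).
  apply: mulr_ge0 => //; have := sqr_ge0 (F + y); have := sqr_ge0 F; lra.
have h2 : 0 <= h ^+ 2 * (2 * ((B + Q) * y ^+ 2) + (F + y) ^+ 2).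
  apply: mulr_ge0 => //; have := sqr_ge0 (F + y); lra.
have h3 : 0 <= h ^+ 2 * Gf + 4 * G * y ^+ 2 + 4 * (y * h * x).
  have [a aG] : exists a, a ^+ 2 = G by exists (Num.sqrt G); rewrite sqr_sqrtr.
  have [b bG] : exists b, b ^+ 2 = Gf by exists (Num.sqrt Gf); rewrite sqr_sqrtr.
  have xab : `|x| <= `|a * b|.
    by rewrite -ler_sqr ?nnegrE // !real_normK ?num_real // exprMn aG bG.
  have : - (y * h * x) <= `|y * h| * `|a * b|.
    by apply: le_trans (ler_norm _) _; rewrite normrN normrM ler_wpM2l.
  have := sqr_ge0 (`|h * b| - 2 * `|a * y|); rewrite -normrM -aG -bG.
  have -> : (`|h * b| - 2 * `|a * y|) ^+ 2 = `|h * b| ^+ 2 + 4 * `|a * y| ^+ 2 - 4 * (`|h * b| * `|a * y|) by ring.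
  rewrite -!normrM !real_normK ?num_real //.
  have -> : h * b * (a * y) = y * h * (a * b) by ring.
  lra.
move: h1 h2 h3; lra.
Qed.

End EnergyPointwise.

Section EndCutoff.
Context {R : realType} {N : nat} {M : manifold R N}.
Variable g : metric M.
Variable mu : {measure set (borel M) -> \bar R}.
Hypothesis hmu : is_riemannian_measure g mu.
Local Notation Gam := (Gam g).
Local Notation Lap := (Lap g).
Local Notation Hes := (Hes g).
Local Notation I := (I mu).
Implicit Types (v w f h : M -> R) (p : M).
Variables (r q : M -> R) (R1 m e eta lam : R).
Hypothesis sr : smooth_fun r.
Hypothesis r_ge : forall p, 2^-1 <= r p.
Hypothesis m0 : 0 <= m.
Hypothesis e0 : 0 <= e.
Hypothesis e8 : e <= 8^-1.
Hypothesis elam : e <= lam.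
Hypothesis Grr : forall p, R1 < r p -> Gam r r p = 1.
Hypothesis Lapr : forall p, R1 < r p -> `|r p * Lap r p - m| <= e.
Hypothesis Hesr : forall p, R1 < r p -> forall w, smooth_fun w ->
  `|r p * Hes r w p - (Gam w w p - Gam r w p ^+ 2)| <= e * (Gam w w p - Gam r w p ^+ 2).
Hypothesis eta0 : 0 < eta.
Hypothesis eta8 : eta <= 8^-1.
Hypothesis etal : eta <= lam / 16.
Hypothesis q_eta : forall p, R1 < r p -> (r p + m) * `|q p + lam| <= eta.
Hypothesis mq : measurable_fun [set: borel M] (q : borel M -> R).
Variable Bq : R.
Hypothesis qB : forall p, `|q p| <= Bq.

Hypothesis shellK : forall a b, R1 < a -> compact [set p | a <= r p <= b].

Definition shell (a b : R) p : R := ((a <= r p) && (r p <= b))%:R.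

Lemma shell_meas a b : bmeas (shell a b) 1.
Proof.
split; last by move=> p; rewrite /shell; case: (_ && _); rewrite ?normr1 ?normr0.
have cr : continuous r := smooth_fun_cont sr.
have mA : measurable ([set p | a <= r p <= b] : set (borel M)).
  apply: measurable_closedM; rewrite (_ : [set p | _] = [set p | a <= r p] `&` [set p | r p <= b]).
    apply: closedI; [apply: (@closed_comp _ _ r [set t | a <= t])|apply: (@closed_comp _ _ r [set t | t <= b])];
      by [move=> p _; exact: cr|exact: closed_ge|exact: closed_le].
  by apply/seteqP; split=> p /=; [move/andP|move=> [-> ->]].
rewrite (_ : shell a b = \1_[set p | a <= r p <= b]); first exact: measurable_indic.
by apply/funext => p; rewrite /shell indicE; congr (_%:R); apply/esym; case: (boolP (_ && _)) => H; [rewrite mem_set|rewrite memNset //=; exact/negP].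
Qed.

Lemma shell_smooth_meas a b h : R1 < a -> smooth_fun h -> exists D, bmeas (fun p => shell a b p * h p) D.
Proof.
move=> Ra sh; have [mS _] := shell_meas a b; have [mh _] := LB_smooth sh.
have [D D0 HD] := bounded_compact sh (shellK (b := b) Ra).
exists D; split; first exact: measurable_funM.
move=> p; rewrite /shell; case: (boolP (_ && _)) => [H|_]; last by rewrite mul0r normr0.
by rewrite mul1r; exact: HD.
Qed.

Variables (tau de ka : R).
Hypothesis tau0 : 0 <= tau.
Hypothesis de0 : 0 < de.
Hypothesis de1 : de <= 1.
Hypothesis del : 56 * de <= lam.
Hypothesis ka0 : 0 <= ka.
Hypothesis ka1 : ka <= 1.

Local Notation E p := (expR (wexp tau de ka (r p))).

Lemma wexp1_ge0 t : 0 <= wexp1 tau de ka t.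
Proof. by rewrite addr_ge0 // mulr_ge0 ?sqr_ge0 // ltW. Qed.

Lemma wexp1_le t : 0 < t -> wexp1 tau de ka t <= tau + de.
Proof.
move=> t0; rewrite lerD2l ler_piMr ?(ltW de0) // expr_le1 ?invr_ge0 ?addr_ge0 ?mulr_ge0 ?(ltW t0) //.
by rewrite invf_le1 ?lerDl ?mulr_ge0 ?(ltW t0) // ltr_wpDr // mulr_ge0 // ltW.
Qed.

Lemma wexp_homo s t : 0 < s -> s <= t -> wexp tau de ka s <= wexp tau de ka t.
Proof.
move=> s0 st; have t0 : 0 < t by exact: lt_le_trans st.
have d (x : R) : 0 < x -> 0 < 1 + ka * x by move=> x0; rewrite ltr_wpDr // mulr_ge0 // ltW.
rewrite lerD ?ler_wpM2l ?(ltW de0) // -subr_ge0.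
rewrite (_ : _ - _ = (t - s) * ((1 + ka * t)^-1 * (1 + ka * s)^-1)); last first.
  by field; rewrite !gt_eqF ?d.
by rewrite mulr_ge0 ?subr_ge0 // mulr_ge0 // invr_ge0 ltW // d.
Qed.

(** Rises from 0 at [r = a] to 1 at [r = a + 1/s], so [1/s] is the width of the transition. *)
Definition cutf (a s : R) p := step (s * (r p - a)).

Lemma smooth_cutf a s : smooth_fun (cutf a s).
Proof. by apply: (smooth_fun_comp1 (f := fun p => s * (r p - a)) smooth1_step) => //; smf. Qed.

Variables (T1 T2 : R -> R) (S : R).
Hypothesis S0 : 0 <= S.
Hypothesis dT1 : forall t : R, is_derive t 1 step (T1 t).
Hypothesis dT2 : forall t : R, is_derive t 1 T1 (T2 t).
Hypothesis TS : forall t, `|T1 t| <= S /\ `|T2 t| <= S.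
Hypothesis Tz : forall t, t < 0 \/ 1 < t -> T1 t = 0 /\ T2 t = 0.

Lemma is_derive_affine (a s t : R) : is_derive t 1 (fun t => s * (t - a)) s.
Proof. by apply: is_derive_eqf (is_deriveCf s (is_deriveBf (is_derive_id t 1) (is_derive_cst a t 1))) _; rewrite subr0 mulr1. Qed.

Lemma Gam_cutf a s h p : Gam (cutf a s) h p = s * T1 (s * (r p - a)) * Gam r h p.
Proof.
rewrite (Gam_comp1l g h sr (is_derive_compf (dT1 _) (is_derive_affine a s (r p)))).
by rewrite (mulrC (T1 _)).
Qed.

Lemma Lap_cutf a s p : Lap (cutf a s) p =
  s * T1 (s * (r p - a)) * Lap r p + s ^+ 2 * T2 (s * (r p - a)) * Gam r r p.
Proof.
have d1 (t : R) : is_derive t 1 (fun t => step (s * (t - a))) (s * T1 (s * (t - a))).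
  by apply: is_derive_eqf (is_derive_compf (dT1 _) (is_derive_affine a s t)) (mulrC _ _).
have d2 : is_derive (r p) 1 (fun t => s * T1 (s * (t - a))) (s ^+ 2 * T2 (s * (r p - a))).
  by apply: is_derive_eqf (is_deriveCf s (is_derive_compf (dT2 _) (is_derive_affine a s (r p)))) _; ring.
exact: (Lap_comp1 g sr (@openT R) Logic.I (fun t _ => d1 t) d2).
Qed.

Variables (Rr L : R).
Hypothesis Rr1 : 1 <= Rr.
Hypothesis R1r : R1 < Rr.
Hypothesis LR : 2 * (Rr + 1) <= L.

(** The cutoff [z] is 1 for [Rr + 1 <= r <= L] and 0 unless [Rr <= r <= 2 L]. On its outer
    transition region [L <= r <= 2 L] the function [et] coincides with the exponential weight; on
    the inner one the square of the weight is at most [W]. The constant [Cb] bounds [r] times the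
    first derivative and the Laplacian of [z]. *)
Let z p := cutf Rr 1 p - cutf L L^-1 p.
Let et p := E p * (cutf (L / 2) (2 / L) p * (1 - cutf (2 * L) L^-1 p)).
Let W := expR (wexp tau de ka (Rr + 1)) ^+ 2.
Let Cb := (Rr + 1) * S + S * (m + 1).

Let L0 : 0 < L.
Proof. by have := LR; have := Rr1; lra. Qed.

Let smooth_z : smooth_fun z.
Proof. by have := smooth_cutf => sc; apply: smooth_funB; exact: sc. Qed.

Let smooth_et : smooth_fun et.
Proof.
apply: smooth_funM; first by have := smooth_wexp sr r_ge tau de ka0 => ?; smf.
apply: smooth_funM; first exact: smooth_cutf.
by apply: smooth_funB; [exact: smooth_fun_cst|exact: smooth_cutf].
Qed.

Lemma scaled_lt0 (a s t : R) : 0 < s -> t < a -> s * (t - a) < 0.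
Proof. by move=> s0 ta; rewrite pmulr_rlt0 // subr_lt0. Qed.

Lemma scaled_gt1 (a s t : R) : 0 < s -> a + s^-1 < t -> 1 < s * (t - a).
Proof. by move=> s0 ta; rewrite mulrC -ltr_pdivrMr // div1r ltrBrDl. Qed.

Let LapN p : Lap z p = Lap (cutf Rr 1) p - Lap (cutf L L^-1) p.
Proof.
rewrite /z (_ : (fun p => _) = (fun p => cutf Rr 1 p + (-1) * cutf L L^-1 p)); last first.
  by apply/funext => x; rewrite mulN1r.
have sc := smooth_cutf L L^-1.
rewrite (LapD g p (smooth_cutf Rr 1)); last by smf.
by rewrite (LapM g p (smooth_fun_cst _) sc) Lap_cst Gam_cstl; ring.
Qed.

Let GamN f p : Gam z f p = Gam (cutf Rr 1) f p - Gam (cutf L L^-1) f p.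
Proof.
rewrite /z (_ : (fun p => _) = (fun p => cutf Rr 1 p + (-1) * cutf L L^-1 p)); last first.
  by apply/funext => x; rewrite mulN1r.
have sc := smooth_cutf L L^-1.
rewrite (GamDl g f p (smooth_cutf Rr 1)); last by smf.
by rewrite (GamMl g f p (smooth_fun_cst _) sc) Gam_cstl; ring.
Qed.

Let Lv0 : 0 < L^-1.
Proof. by rewrite invr_gt0 L0. Qed.

Let E_et p : L <= r p <= 2 * L -> et p = E p.
Proof.
move=> /andP[Lp pL]; rewrite /et /cutf step1; last first.
  rewrite mulrC mulrA ler_pdivlMr ?L0 // mul1r; lra.
by rewrite step0 ?subr0 ?mulr1 // mulr_ge0_le0 ?(ltW Lv0) // subr_le0.
Qed.

(** The inner transition has width 1 and [r <= Rr + 1]; the outer one has width [L] and [r <= 2 L].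
    So [r |dz|] and [r |Lap z|] are bounded uniformly in [L], and there the squared weight is at
    most [W + et^2]. *)
Lemma cut_comm f p :
  E p ^+ 2 * (r p * Lap z p) ^+ 2 <= (4 * Cb ^+ 2) * (W + et p ^+ 2) /\
  E p ^+ 2 * (2 * r p * Gam z f p) ^+ 2 <= (4 * Cb ^+ 2) * (W + et p ^+ 2) * Gam f f p.
Proof.
have := LR; have := Rr1; have := R1r; have := S0; have := m0; have := L0 => L_0 m_0 S_0 R_1 R_2 L_R.
have W0 : 0 <= W by exact: sqr_ge0.
have e20 := sqr_ge0 (et p); have G0 := Gam_ge0 g f p.
have Cb0 : 0 <= Cb by rewrite addr_ge0 // mulr_ge0 //; lra.
have rp0 := r_gt0 r_ge p.
have main (d l : R) : R1 < r p -> Gam z f p = d * Gam r f p -> Lap z p = l -> `|r p * d| <= Cb -> `|r p * l| <= Cb ->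
    E p ^+ 2 <= W + et p ^+ 2 ->
    E p ^+ 2 * (r p * Lap z p) ^+ 2 <= (4 * Cb ^+ 2) * (W + et p ^+ 2) /\
    E p ^+ 2 * (2 * r p * Gam z f p) ^+ 2 <= (4 * Cb ^+ 2) * (W + et p ^+ 2) * Gam f f p.
  move=> Rp -> -> dC lC EW.
  have sq (a : R) : `|a| <= Cb -> a ^+ 2 <= Cb ^+ 2.
    by move=> H; rewrite -real_normK ?num_real // lerXn2r ?nnegrE.
  have d2 := sq _ dC; have l2 := sq _ lC.
  have CS : Gam r f p ^+ 2 <= Gam f f p by apply: le_trans (Gam_CS g r f p) _; rewrite Grr // mul1r.
  have WE : 0 <= W + et p ^+ 2 by exact: addr_ge0.
  split.
    rewrite mulrC; apply: ler_pM; rewrite ?sqr_ge0 //.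
    by apply: le_trans l2 _; rewrite ler_peMl ?sqr_ge0 // (ler_nat R 1 4).
  rewrite (_ : (2 * r p * (d * Gam r f p)) ^+ 2 = 4 * (r p * d) ^+ 2 * Gam r f p ^+ 2); last by ring.
  rewrite mulrA; apply: ler_pM (sqr_ge0 _) _ CS; first exact: mulr_ge0 (sqr_ge0 _) (mulr_ge0 (ler0n _ 4) (sqr_ge0 _)).
  rewrite mulrC; apply: ler_pM (mulr_ge0 (ler0n _ 4) (sqr_ge0 _)) (sqr_ge0 _) _ EW.
  by rewrite ler_pM2l.
have triv : Gam z f p = 0 -> Lap z p = 0 ->
    E p ^+ 2 * (r p * Lap z p) ^+ 2 <= (4 * Cb ^+ 2) * (W + et p ^+ 2) /\
    E p ^+ 2 * (2 * r p * Gam z f p) ^+ 2 <= (4 * Cb ^+ 2) * (W + et p ^+ 2) * Gam f f p.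
  by move=> -> ->; rewrite !mulr0 expr0n mulr0; split; rewrite !mulr_ge0 ?sqr_ge0 // addr_ge0.
have in0 : (r p < Rr \/ Rr + 1 < r p) -> T1 (1 * (r p - Rr)) = 0 /\ T2 (1 * (r p - Rr)) = 0.
  by move=> [H|H]; apply: Tz; [left; exact: scaled_lt0|right; apply: scaled_gt1; rewrite ?invr1].
have out0 : (r p < L \/ 2 * L < r p) -> T1 (L^-1 * (r p - L)) = 0 /\ T2 (L^-1 * (r p - L)) = 0.
  by move=> [H|H]; apply: Tz; [left; exact: scaled_lt0|right; apply: scaled_gt1; rewrite ?invrK //; lra].
have rl : R1 < r p -> `|r p * Lap r p| <= m + 1.
  move=> Rp; have := e8; have := Lapr Rp; rewrite !ler_norml => /andP[h1 h2] e_8; apply/andP; split; lra.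
have [lt1|ge1] := ltP (r p) Rr.
  have [a1 a2] := in0 (or_introl lt1); have [|b1 b2] := out0; first by left; lra.
  by apply: triv; rewrite ?GamN ?LapN ?Gam_cutf ?Lap_cutf a1 ?a2 b1 ?b2 !(mulr0, mul0r, addr0, subr0).
have Rp : R1 < r p by lra.
have [le2|gt2] := leP (r p) (Rr + 1).
  have [|b1 b2] := out0; first by left; lra.
  have [s1 s2] := TS (1 * (r p - Rr)).
  apply: (main (T1 (1 * (r p - Rr))) (T1 (1 * (r p - Rr)) * Lap r p + T2 (1 * (r p - Rr)))) => //.
  - by rewrite GamN !Gam_cutf b1 mulr0 mul0r subr0 mul1r.
  - by rewrite LapN !Lap_cutf b1 b2 Grr // !(mulr0, mul0r, addr0, subr0, mul1r, expr1n, mulr1).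
  - rewrite normrM (gtr0_norm rp0); apply: (@le_trans _ _ ((Rr + 1) * S)).
      by apply: ler_pM; rewrite ?(ltW rp0).
    by rewrite /Cb lerDl mulr_ge0 // addr_ge0.
  - rewrite mulrDr; apply: le_trans (ler_normD _ _) _; rewrite mulrCA !normrM (gtr0_norm rp0) addrC /Cb.
    apply: lerD; first by apply: ler_pM; rewrite ?(ltW rp0).
    apply: ler_pM => //; first by rewrite mulr_ge0 // ltW.
    by move: (rl Rp); rewrite normrM (gtr0_norm rp0).
  - apply: (@le_trans _ _ W); last by rewrite lerDl.
    by rewrite lerXn2r ?nnegrE ?expR_ge0 // ler_expR; exact: wexp_homo.
have [a1 a2] := in0 (or_intror gt2).
have [lt3|ge3] := ltP (r p) L.
  have [b1 b2] := out0 (or_introl lt3).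
  by apply: triv; rewrite ?GamN ?LapN ?Gam_cutf ?Lap_cutf a1 ?a2 b1 ?b2 !(mulr0, mul0r, addr0, subr0).
have [le4|gt4] := leP (r p) (2 * L); last first.
  have [b1 b2] := out0 (or_intror gt4).
  by apply: triv; rewrite ?GamN ?LapN ?Gam_cutf ?Lap_cutf a1 ?a2 b1 ?b2 !(mulr0, mul0r, addr0, subr0).
have [s1 s2] := TS (L^-1 * (r p - L)).
have rL : r p * L^-1 <= 2 by rewrite ler_pdivrMr.
have rL0 : 0 <= r p * L^-1 by rewrite mulr_ge0 // ltW.
have L1 : L^-1 <= 1 by rewrite invf_le1 //; lra.
have h1 : `|r p * (L^-1 * T1 (L^-1 * (r p - L)))| <= (Rr + 1) * S.
  by rewrite mulrA normrM (ger0_norm rL0); apply: ler_pM => //; apply: le_trans rL _; lra.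
apply: (main (- (L^-1 * T1 (L^-1 * (r p - L)))) (- (L^-1 * T1 (L^-1 * (r p - L)) * Lap r p + L^-1 ^+ 2 * T2 (L^-1 * (r p - L))))) => //.
- by rewrite GamN !Gam_cutf a1 mulr0 mul0r sub0r mulNr.
- by rewrite LapN !Lap_cutf a1 a2 Grr // !(mulr0, mul0r, addr0, sub0r, mulr1).
- by rewrite mulrN normrN; apply: le_trans h1 _; rewrite /Cb lerDl mulr_ge0 // addr_ge0.
- rewrite mulrN normrN mulrDr; apply: le_trans (ler_normD _ _) _; rewrite addrC /Cb; apply: lerD.
    rewrite (_ : r p * (L^-1 ^+ 2 * _) = (r p * L^-1) * (L^-1 * T2 (L^-1 * (r p - L)))); last by ring.
    rewrite normrM (ger0_norm rL0); apply: ler_pM => //; first by lra.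
    by rewrite normrM (gtr0_norm Lv0); apply: le_trans s2; rewrite ler_piMl.
  rewrite (_ : _ * (_ * _ * _) = (L^-1 * T1 (L^-1 * (r p - L))) * (r p * Lap r p)); last by ring.
  rewrite normrM; apply: ler_pM => //; last exact: rl.
  by rewrite normrM (gtr0_norm Lv0); apply: le_trans s1; rewrite ler_piMl.
- by rewrite E_et ?ge3 // lerDr.
Qed.

(** The slope of the weight is at most [tau + de], and the slopes of the two cutoffs are at most
    [2 S / L] and [S / L], with [L >= 1]. *)
Lemma et_bound p : et p ^+ 2 <= shell (L / 2) (3 * L) p * E p ^+ 2 /\
  Gam et et p <= (tau + de + 3 * S) ^+ 2 * (shell (L / 2) (3 * L) p * E p ^+ 2).
Proof.
have := LR; have := Rr1; have := R1r; have := S0; have := m0; have := L0 => L_0 m_0 S_0 R_1 R_2 L_R.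
have sphi := smooth_wexp sr r_ge tau de ka0.
have sE : smooth_fun (fun p => E p) by smf.
have s1 := smooth_cutf (L / 2) (2 / L); have s2 := smooth_cutf (2 * L) L^-1.
have s3 : smooth_fun (fun p => 1 - cutf (2 * L) L^-1 p) by smf.
have sb : smooth_fun (fun p => cutf (L / 2) (2 / L) p * (1 - cutf (2 * L) L^-1 p)) by smf.
have rp0 := r_gt0 r_ge p; have L2 : 0 < 2 / L by rewrite divr_gt0.
pose b1 := 2 / L * T1 (2 / L * (r p - L / 2)); pose b2 := L^-1 * T1 (L^-1 * (r p - 2 * L)).
have GE h : Gam et h p = E p * (wexp1 tau de ka (r p) * (cutf (L / 2) (2 / L) p * (1 - cutf (2 * L) L^-1 p)) +
    (b1 * (1 - cutf (2 * L) L^-1 p) - cutf (L / 2) (2 / L) p * b2)) * Gam r h p.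
  rewrite (GamMl g h p sE sb) (Gam_exp g h p sphi) (Gam_comp1l g h sr (is_derive_wexp tau de ka0 rp0)).
  rewrite (GamMl g h p s1 s3) Gam_cutf.
  have -> : Gam (fun p => 1 - cutf (2 * L) L^-1 p) h p = - Gam (cutf (2 * L) L^-1) h p.
    rewrite (_ : (fun p => _) = (fun p => 1 + (-1) * cutf (2 * L) L^-1 p)); last first.
      by apply/funext => x; rewrite mulN1r.
    rewrite (GamDl g h p (smooth_fun_cst 1)); last by smf.
    by rewrite (GamMl g h p (smooth_fun_cst _) s2) !Gam_cstl; ring.
  by rewrite Gam_cutf /b1 /b2; ring.
rewrite GE (GamC g r) GE /shell.
have c1 : 0 <= cutf (L / 2) (2 / L) p <= 1 by rewrite step_ge0 step_le1.
have c2 : 0 <= 1 - cutf (2 * L) L^-1 p <= 1 by rewrite subr_ge0 step_le1 gerBl step_ge0.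
have zero : r p < L / 2 \/ 3 * L < r p -> cutf (L / 2) (2 / L) p * (1 - cutf (2 * L) L^-1 p) = 0 /\
    b1 * (1 - cutf (2 * L) L^-1 p) - cutf (L / 2) (2 / L) p * b2 = 0.
  move=> [H|H].
    have n1 := scaled_lt0 L2 H; have n2 : L^-1 * (r p - 2 * L) < 0 by apply: scaled_lt0 => //; lra.
    rewrite /b1 /b2 /cutf step0 ?(ltW n1) // (Tz (or_introl n1)).1.
    by rewrite !(mulr0, mul0r, subr0).
  have n1 : 1 < 2 / L * (r p - L / 2) by apply: scaled_gt1 => //; rewrite invf_div; lra.
  have n2 : 1 < L^-1 * (r p - 2 * L) by apply: scaled_gt1 => //; rewrite invrK; lra.
  rewrite /b1 /b2 /cutf (step1 (ltW n2)) (Tz (or_intror n1)).1 (Tz (or_intror n2)).1.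
  by rewrite subrr !(mulr0, mul0r, subr0).
case: (boolP ((L / 2 <= r p) && (r p <= 3 * L))) => [/andP[h1 h2]|]; last first.
  rewrite negb_and -!ltNge => /orP H; have [z1 z2] := zero H.
  by rewrite /et z1 z2 !(mulr0, addr0, mul0r, expr0n).
have Rp : R1 < r p by lra.
rewrite Grr // mulr1 !mul1r; split.
  rewrite /et exprMn ler_piMr ?sqr_ge0 //; move: c1 c2 => /andP[h3 h4] /andP[h5 h6].
  by apply: exprn_ile1; [exact: mulr_ge0|exact: mulr_ile1].
have f0 := wexp1_ge0 (r p); have f1 := wexp1_le rp0.
have [t1 _] := TS (2 / L * (r p - L / 2)); have [t2 _] := TS (L^-1 * (r p - 2 * L)).
have L1 : L^-1 <= 1 by rewrite invf_le1 //; lra.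
have n1 : `|b1| <= 2 * S.
  by rewrite normrM (gtr0_norm L2); apply: ler_pM => //; [exact: ltW|rewrite ler_piMr].
have n2 : `|b2| <= S by rewrite normrM (gtr0_norm Lv0); apply: le_trans t2; rewrite ler_piMl.
set k := wexp1 _ _ _ _ * _ + _.
have kb : `|k| <= tau + de + 3 * S.
  move: c1 c2 => /andP[h3 h4] /andP[h5 h6].
  apply: le_trans (ler_normD _ _) _; rewrite -addrA addrA; apply: lerD.
    rewrite ger0_norm; last exact: mulr_ge0 f0 (mulr_ge0 h3 h5).
    by apply: le_trans f1; rewrite ler_piMr //; exact: mulr_ile1.
  apply: le_trans (ler_normB _ _) _; rewrite (_ : 3 * S = 2 * S + S); last by ring.
  apply: lerD; rewrite normrM; first by apply: le_trans n1; rewrite ler_piMr // ger0_norm.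
  by apply: le_trans n2; rewrite ler_piMl // ger0_norm.
have k2 : k ^+ 2 <= (tau + de + 3 * S) ^+ 2.
  by rewrite -real_normK ?num_real // lerXn2r ?nnegrE // (le_trans _ kb).
rewrite (_ : _ * (E p * k) = k ^+ 2 * E p ^+ 2); last by ring.
by rewrite ler_wpM2r ?sqr_ge0.
Qed.

Lemma cutoff_pointwise f p : smooth_fun f ->
  (r p * (E p * (Lap (fun p => z p * f p) p - q p * (z p * f p)))) ^+ 2 <=
  3 * (r p * (E p * z p)) ^+ 2 * (Lap f p - q p * f p) ^+ 2 +
  12 * Cb ^+ 2 * (W + et p ^+ 2) * (f p ^+ 2 + Gam f f p).
Proof.
move=> sf; have [c1 c2] := cut_comm f p.
rewrite (LapM g p smooth_z sf).
have c3 := ler_wpM2r (sqr_ge0 (f p)) c1.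
rewrite (_ : 12 * Cb ^+ 2 = 3 * (4 * Cb ^+ 2)); last by ring.
move: c2 c3; move: (r p) (Lap z p) (Gam z f p) (Gam f f p) (W + _) (4 * Cb ^+ 2) (E p) (z p) (f p) (Lap f p) (q p).
move=> t Lz Gz G w K Ep zp y Lf Q c2 c3.
set a := t * (Ep * zp) * (Lf - Q * y); set b := Ep * (t * Lz) * y; set c := Ep * (2 * t * Gz).
rewrite (_ : t * _ = a + b + c); last by rewrite /a /b /c; ring.
have -> : 3 * (t * (Ep * zp)) ^+ 2 * (Lf - Q * y) ^+ 2 = 3 * a ^+ 2 by rewrite /a; ring.
have b2 : b ^+ 2 = Ep ^+ 2 * (t * Lz) ^+ 2 * y ^+ 2 by rewrite /b; ring.
have d2 : c ^+ 2 = Ep ^+ 2 * (2 * t * Gz) ^+ 2 by rewrite /c; ring.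
rewrite -b2 in c3; rewrite -d2 in c2.
have := sqr_ge0 (a - b); have := sqr_ge0 (a - c); have := sqr_ge0 (b - c).
move: c2 c3; lra.
Qed.

Let bw p := (1 + m ^+ 2) / eta * (12 * Cb ^+ 2) *
  (W * (Bq + 2) + (4 * Gam et et p + (2 * Bq + 2) * et p ^+ 2)).
Let aw p := (1 + m ^+ 2) / eta * (3 * (r p * (E p * z p)) ^+ 2 + 12 * Cb ^+ 2 * (W + et p ^+ 2)).

Let z_off p : ~ (Rr <= r p <= 2 * L) -> z p = 0.
Proof.
move=> /negP; rewrite negb_and -!ltNge => /orP[H|H]; rewrite /z /cutf.
  have L1 : r p < L by have := LR; have := Rr1; lra.
  by rewrite !step0 ?subrr // ltW // scaled_lt0.
have L1 : Rr + 1^-1 < r p by have := LR; have := Rr1; rewrite invr1; lra.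
by rewrite !step1 ?subrr // ltW // scaled_gt1 // invrK; have := H; lra.
Qed.

Let cs_z : cs z.
Proof. by exists [set p | Rr <= r p <= 2 * L]; [exact: shellK|exact: z_off]. Qed.

Let cs_et : cs et.
Proof.
exists [set p | L / 2 <= r p <= 3 * L]; first by apply: shellK; have := LR; have := R1r; have := Rr1; lra.
move=> p /negP/negbTE np; have [h _] := et_bound p; move: h; rewrite /shell np mul0r => h.
by apply/eqP; rewrite -sqrf_eq0 eq_le h sqr_ge0.
Qed.

Let Bq0 : 0 <= Bq.
Proof. by apply: le_trans (normr_ge0 _) (qB point). Qed.

Let C00 : 0 <= (1 + m ^+ 2) / eta.
Proof. by rewrite divr_ge0 ?(ltW eta0) // addr_ge0 // sqr_ge0. Qed.

Let sE : smooth_fun (fun p => E p).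
Proof. by have := smooth_wexp sr r_ge tau de ka0 => ?; smf. Qed.

(** The commutator with [z] leaves a gradient of [f] weighted by [W + et^2]. Two energy identities,
    one over all of [M] with the constant weight [W] and one with the weight [et^2], replace it by
    [f^2] and the defect of the equation. *)
Lemma end_cutoff_test f : smooth_fun f -> cs f ->
  I (fun p => 3 / 16 * lam * (E p * z p) ^+ 2 * f p ^+ 2) <=
  I (fun p => bw p * f p ^+ 2) + I (fun p => aw p * (Lap f p - q p * f p) ^+ 2).
Proof.
move=> sf cf; have sE' := sE; have sz := smooth_z; have se := smooth_et; have lq := LB_q mq qB.
have cz := cs_z; have ce := cs_et.
set v := fun p => z p * f p; have sv : smooth_fun v by rewrite /v; smf.
have cv : cs v by rewrite /v; csf.
have v0 p : ~ (Rr <= r p <= 2 * L) -> v p = 0 by move=> H; rewrite /v z_off // mul0r.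
have KR p : Rr <= r p <= 2 * L -> R1 < r p by move=> /andP[H _]; apply: lt_le_trans H.
have := end_carleman hmu sr r_ge m0 e0 e8 elam Grr Lapr Hesr eta0 eta8 etal q_eta mq qB tau0 de0 de1 del ka0 ka1 sv
  (shellK (b := 2 * L) R1r) v0 KR.
have s1 : smooth_fun (fun p => (E p * v p) ^+ 2) by smf.
have c1 : cs (fun p => (E p * v p) ^+ 2) by csf.
rewrite -(IZ hmu _ (LB_smooth s1) c1) => H.
rewrite (@I_ext _ _ _ _ _ (fun p => 3 / 16 * lam * (E p * v p) ^+ 2)); last by move=> p; rewrite /v; ring.
apply: le_trans H _.
have lX : LB (fun p => (r p * (E p * (Lap v p - q p * v p))) ^+ 2) by lbf.
have cX : cs (fun p => (r p * (E p * (Lap v p - q p * v p))) ^+ 2) by csf.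
have l1 : LB (fun p => bw p * f p ^+ 2) by rewrite /bw; lbf.
have cb : cs (fun p => bw p * f p ^+ 2) by csf.
have l2 : LB (fun p => aw p * (Lap f p - q p * f p) ^+ 2) by rewrite /aw; lbf.
have c2 : cs (fun p => aw p * (Lap f p - q p * f p) ^+ 2) by csf.
rewrite -(IZ hmu _ lX cX) -(ID hmu l1 l2 cb c2).
have d1 : divergence mu (fun p => W * (f p * Lap f p + Gam f f p)).
  by apply: (divergenceZ hmu); apply: (divergence_green hmu); [smf|smf|csf].
have se2 : smooth_fun (fun p => et p ^+ 2) by smf.
have d2 : divergence mu (fun p => 2 * (et p ^+ 2 * f p * Lap f p + Gam (fun p => et p ^+ 2 * f p) f p)).
  by apply: (divergenceZ hmu); apply: (divergence_green hmu); [smf|smf|csf].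
have dS := divergenceZ hmu ((1 + m ^+ 2) / eta * (12 * Cb ^+ 2)) (divergenceD hmu d1 d2).
apply: (I_le_divergence hmu _ (LBD l1 l2) _ (csD cb c2) dS) => [||p]; [lbf|csf|].
have P1 := ler_wpM2l C00 (cutoff_pointwise p sf); apply: le_trans P1 _.
have dX : is_derive (et p) 1 (fun t : R => t ^+ 2) (2 * et p).
  by apply: is_derive_eqf (is_deriveXf 2 (is_derive_id (et p) 1)) _; rewrite /= mulr1 expr1.
rewrite (GamMl g f p se2 sf) (Gam_comp1l g f se dX).
have W0 : 0 <= W by exact: sqr_ge0.
have P2 := energy_pointwise (et p) (f p) (Lap f p) W0 (Gam_ge0 g et p) (Gam_ge0 g f p) (qB p) (Gam_CS g et f p).
have P3 : 0 <= (1 + m ^+ 2) / eta * (12 * Cb ^+ 2) by rewrite mulr_ge0 ?C00 // mulr_ge0 // sqr_ge0.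
have := ler_wpM2l P3 P2; rewrite /bw /aw.
move: (Gam et et p) (Gam et f p) (Gam f f p) (et p) (z p) (E p) ((1 + m ^+ 2) / eta) (12 * Cb ^+ 2).
move=> a1 a2 a3 a4 a5 a6 a7 a8; lra.
Qed.

Lemma end_cutoff u : approximable g mu q u ->
  3 / 16 * lam * I (fun p => shell (Rr + 1) L p * E p ^+ 2 * u p ^+ 2) <=
  (1 + m ^+ 2) / eta * (12 * Cb ^+ 2) * (Bq + 2) * (W * I (fun p => u p ^+ 2) +
   (4 * (tau + de + 3 * S) ^+ 2 + 2 * Bq + 2) * I (fun p => shell (L / 2) (3 * L) p * E p ^+ 2 * u p ^+ 2)).
Proof.
move=> au; have [mu_ iu _] := au.
have sE' := sE; have sz := smooth_z; have se := smooth_et.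
have cz := cs_z; have ce := cs_et.
have lam0 : 0 <= lam by have := del; have := de0; lra.
have W0 : 0 <= W by exact: sqr_ge0.
have [A ba] : exists A, bmeas (fun p => 3 / 16 * lam * (E p * z p) ^+ 2) A.
  by apply: bmeas_LB; [lbf|csf].
have [B bb'] : exists B, bmeas (fun p => 4 * Gam et et p + (2 * Bq + 2) * et p ^+ 2) B.
  by apply: bmeas_LB; [lbf|csf].
have [C [_ bC]] : exists C, bmeas (fun p => 3 * (r p * (E p * z p)) ^+ 2 + 12 * Cb ^+ 2 * et p ^+ 2) C.
  by apply: bmeas_LB; [lbf|csf].
have C_0 := C00; have B_0 := Bq0.
set C0 := (1 + m ^+ 2) / eta * (12 * Cb ^+ 2).
have C0_ge0 : 0 <= C0 by rewrite mulr_ge0 // mulr_ge0 // sqr_ge0.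
have bb : bmeas bw (C0 * (W * (Bq + 2) + B)).
  split; first by have [] : LB bw by rewrite /bw; lbf.
  move=> p; rewrite /bw normrM (ger0_norm C0_ge0) ler_wpM2l //.
  apply: le_trans (ler_normD _ _) _; apply: lerD; last exact: bb'.2.
  by rewrite ger0_norm // mulr_ge0 // addr_ge0.
have b0 p : 0 <= bw p.
  by apply: mulr_ge0 C0_ge0 (addr_ge0 (mulr_ge0 W0 (addr_ge0 B_0 (ler0n _ 2))) (addr_ge0 (mulr_ge0 (ler0n _ 4) (Gam_ge0 g et p))
    (mulr_ge0 (addr_ge0 (mulr_ge0 (ler0n _ 2) B_0) (ler0n _ 2)) (sqr_ge0 _)))).
have a0 p : 0 <= 3 / 16 * lam * (E p * z p) ^+ 2.
  by apply: mulr_ge0 (sqr_ge0 _); rewrite mulr_ge0.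
have Cge0 : 0 <= C by apply: le_trans (normr_ge0 _) (bC point).
have C'0 : 0 <= (1 + m ^+ 2) / eta * (C + 12 * Cb ^+ 2 * W).
  by apply: mulr_ge0 C_0 (addr_ge0 Cge0 (mulr_ge0 (mulr_ge0 (ler0n _ 12) (sqr_ge0 _)) W0)).
have lq := LB_q mq qB.
have test f : smooth_fun f -> cs f -> I (fun p => 3 / 16 * lam * (E p * z p) ^+ 2 * f p ^+ 2) <=
    I (fun p => bw p * f p ^+ 2) + (1 + m ^+ 2) / eta * (C + 12 * Cb ^+ 2 * W) * I (fun p => (Lap f p - q p * f p) ^+ 2).
  move=> sf cf; apply: le_trans (end_cutoff_test sf cf) _; rewrite lerD2l.
  have lF : LB (fun p => (Lap f p - q p * f p) ^+ 2) by lbf.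
  have cF : cs (fun p => (Lap f p - q p * f p) ^+ 2) by csf.
  have l2 : LB (fun p => aw p * (Lap f p - q p * f p) ^+ 2) by rewrite /aw; lbf.
  have c2 : cs (fun p => aw p * (Lap f p - q p * f p) ^+ 2) by csf.
  rewrite -(IZ hmu _ lF cF).
  apply: (I_le hmu l2 _ c2) => [||p]; [lbf|csf|].
  apply: ler_wpM2r (sqr_ge0 _) _ _ _; apply: ler_wpM2l C_0 _ _ _.
  have := le_trans (ler_norm _) (bC p); move: (E p) (z p) (et p) => x1 x2 x3; lra.
have lim := limit_inequality hmu au ba bb a0 b0 C'0 test.
have sE2 : smooth_fun (fun p => E p ^+ 2) by smf.
have bE a b (Ra : R1 < a) := shell_smooth_meas b Ra sE2.
have [RR1 RL2] : R1 < Rr + 1 /\ R1 < L / 2 by have := LR; have := R1r; have := Rr1; lra.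
have [D1 bE1] := bE _ L RR1; have [D2 bE2] := bE _ (3 * L) RL2.
have zs p : shell (Rr + 1) L p * E p ^+ 2 <= (E p * z p) ^+ 2.
  rewrite /shell; case: andP => [[h1 h2]|_]; last by rewrite mul0r sqr_ge0.
  rewrite mul1r /z /cutf step1; last by rewrite mul1r lerBrDl.
  by rewrite step0 ?subr0 ?mulr1 // mulr_ge0_le0 ?(ltW Lv0) // subr_le0.
have i1 := intgM bE1 iu; have i2 := intgM bE2 iu.
rewrite -(JZ _ i1); apply: le_trans (le_trans _ lim) _.
  apply: (J_le (intgZ _ i1) (intgM ba iu)) => p; rewrite mulrA; apply: ler_wpM2r (sqr_ge0 _) _ _ _.
  by rewrite ler_wpM2l // mulr_ge0.
set Kt := 4 * _ + _ + _.
have i3 := intgD (intgZ W iu) (intgZ Kt i2).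
rewrite -(JZ _ i2) -(JZ _ iu) -(JD (intgZ W iu) (intgZ Kt i2)) -(JZ _ i3).
apply: (J_le (intgM bb iu) (intgZ _ i3)) => p.
have [e1 e2] := et_bound p; have X0 : 0 <= shell (L / 2) (3 * L) p * E p ^+ 2.
  by apply: mulr_ge0 (sqr_ge0 _); rewrite /shell ler0n.
rewrite [X in _ <= _ * X](_ : _ = (W + Kt * (shell (L / 2) (3 * L) p * E p ^+ 2)) * u p ^+ 2); last by ring.
rewrite [leRHS]mulrA; apply: ler_wpM2r (sqr_ge0 _) _ _ _; rewrite /bw -[leRHS]mulrA; apply: ler_wpM2l C0_ge0 _ _ _.
rewrite [leRHS]mulrDr [(Bq + 2) * W]mulrC lerD2l.
apply: (@le_trans _ _ (Kt * (shell (L / 2) (3 * L) p * E p ^+ 2))).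
  have h1 := ler_wpM2l (ler0n R 4) e2.
  have h2 := ler_wpM2l (addr_ge0 (mulr_ge0 (ler0n R 2) B_0) (ler0n R 2)) e1.
  by apply: le_trans (lerD h1 h2) _; rewrite /Kt le_eqVlt; apply/orP; left; apply/eqP; ring.
have Kt0 : 0 <= Kt.
  by apply: addr_ge0 (addr_ge0 (mulr_ge0 (ler0n _ 4) (sqr_ge0 _)) (mulr_ge0 (ler0n _ 2) B_0)) (ler0n _ 2).
have KX := mulr_ge0 Kt0 X0; rewrite ler_peMl //.
by apply: le_trans (_ : 1 <= 2) _; [rewrite (ler_nat R 1 2)|rewrite lerDr].
Qed.

End EndCutoff.

(** * Vanishing on the end and absence of eigenfunctions *)

Section MonotoneSequences.
Context {R : realType}.

Lemma exists_nat_gt (x : R) : exists k : nat, x < k%:R.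
Proof. by exists (Num.bound `|x|); exact: le_lt_trans (ler_norm _) (archi_boundP (normr_ge0 _)). Qed.

Lemma bounded_increments (x : nat -> R) (B eps : R) : (forall j, x j <= B) -> 0 < eps ->
  exists j, x j.+1 - x j <= eps.
Proof.
move=> xB e0; apply: contrapT => H.
have inc j : x 0%N + eps *+ j <= x j.
  elim: j => [|j IH]; first by rewrite addr0.
  have : eps < x j.+1 - x j by rewrite ltNge; apply/negP => h; apply: H; exists j.
  by rewrite mulrSr; lra.
have [k Hk] := exists_nat_gt ((B - x 0%N) / eps).
have := inc k; have := xB k; move: Hk; rewrite ltr_pdivrMr // -mulr_natl; lra.
Qed.

End MonotoneSequences.

Section EndVanish.
Context {R : realType} {N : nat} {M : manifold R N}.
Variable g : metric M.
Variable mu : {measure set (borel M) -> \bar R}.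
Hypothesis hmu : is_riemannian_measure g mu.
Local Notation Gam := (Gam g).
Local Notation Lap := (Lap g).
Local Notation Hes := (Hes g).
Local Notation I := (I mu).
Implicit Types (v w f h : M -> R) (p : M).
Variables (r q : M -> R) (R1 m e eta lam : R).
Hypothesis sr : smooth_fun r.
Hypothesis r_ge : forall p, 2^-1 <= r p.
Hypothesis m0 : 0 <= m.
Hypothesis e0 : 0 <= e.
Hypothesis e8 : e <= 8^-1.
Hypothesis elam : e <= lam.
Hypothesis Grr : forall p, R1 < r p -> Gam r r p = 1.
Hypothesis Lapr : forall p, R1 < r p -> `|r p * Lap r p - m| <= e.
Hypothesis Hesr : forall p, R1 < r p -> forall w, smooth_fun w ->
  `|r p * Hes r w p - (Gam w w p - Gam r w p ^+ 2)| <= e * (Gam w w p - Gam r w p ^+ 2).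
Hypothesis eta0 : 0 < eta.
Hypothesis eta8 : eta <= 8^-1.
Hypothesis etal : eta <= lam / 16.
Hypothesis q_eta : forall p, R1 < r p -> (r p + m) * `|q p + lam| <= eta.
Hypothesis mq : measurable_fun [set: borel M] (q : borel M -> R).
Variable Bq : R.
Hypothesis qB : forall p, `|q p| <= Bq.

Hypothesis shellK : forall a b, R1 < a -> compact [set p | a <= r p <= b].

Variables (T1 T2 : R -> R) (S : R).
Hypothesis S0 : 0 <= S.
Hypothesis dT1 : forall t : R, is_derive t 1 step (T1 t).
Hypothesis dT2 : forall t : R, is_derive t 1 T1 (T2 t).
Hypothesis TS : forall t, `|T1 t| <= S /\ `|T2 t| <= S.
Hypothesis Tz : forall t, t < 0 \/ 1 < t -> T1 t = 0 /\ T2 t = 0.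
Variable (de Rr : R).
Hypothesis de0 : 0 < de.
Hypothesis de1 : de <= 1.
Hypothesis del : 56 * de <= lam.
Hypothesis Rr1 : 1 <= Rr.
Hypothesis R1r : R1 < Rr.
Variable u : M -> R.
Hypothesis au : approximable g mu q u.

Local Notation shell := (shell r).
Let Cb := (Rr + 1) * S + S * (m + 1).
Let C1 := (1 + m ^+ 2) / eta * (12 * Cb ^+ 2) * (Bq + 2).

Let mass tau L := I (fun p => shell (Rr + 1) L p * expR (tau * r p) ^+ 2 * u p ^+ 2).

Let intg_shell h a b : R1 < a -> smooth_fun h -> intg mu (fun p => shell a b p * h p * u p ^+ 2).
Proof. by move=> Ra sh; have [D bD] := shell_smooth_meas sr shellK b Ra sh; have [_ iu _] := au; exact: intgM bD iu. Qed.

Let R1r1 : R1 < Rr + 1.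
Proof. by apply: lt_trans R1r _; rewrite ltrDl. Qed.

Let smooth_e tau : smooth_fun (fun p => expR (tau * r p) ^+ 2).
Proof. by smf. Qed.

(* [tau -> tau + de]: the outer error lives on disjoint annuli carrying a
   convergent sum, so it disappears along a sequence of cutoff radii. *)
Lemma mass_step tau B : 0 <= tau -> (forall L, 2 * (Rr + 1) <= L -> mass tau L <= B) ->
  forall L, 2 * (Rr + 1) <= L -> 3 / 16 * lam * mass (tau + de) L <=
    expR de ^+ 2 * C1 * (expR ((tau + de) * (Rr + 1)) ^+ 2 * I (fun p => u p ^+ 2)).
Proof.
move=> tau0 HB L0 RL0; have := Rr1; have := m0 => m_0 R_1.
have L01 : 1 <= L0 by lra.
have L00 : 0 < L0 by lra.
have lam0 : 0 <= lam by have := del; have := de0; lra.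
(* With [ka L0^2 = 1] the weight loses at most [de] against [(tau + de) r] on [r <= L0], and
   everywhere it exceeds [tau r] by at most [de L0^2], so the outer error is still measured at the
   old rate [tau]. *)
pose ka := L0^-1 ^+ 2.
have ka0 : 0 <= ka by exact: sqr_ge0.
have ka1 : ka <= 1 by rewrite /ka exprn_ile1 ?invr_ge0 ?invf_le1 // ltW.
have kaL : ka * L0 ^+ 2 = 1 by rewrite /ka -exprMn mulVf ?expr1n // gt_eqF.
have dpos (t : R) : 0 < t -> 0 < 1 + ka * t by move=> t0; rewrite ltr_wpDr // mulr_ge0 // ltW.
have wup (t : R) : 0 < t -> wexp tau de ka t <= (tau + de) * t.
  move=> t0; rewrite /wexp mulrDl lerD2l ler_wpM2l ?(ltW de0) // ler_piMr ?(ltW t0) //.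
  by rewrite invf_le1 ?dpos // lerDl mulr_ge0 // ltW.
have wout (t : R) : 0 < t -> wexp tau de ka t <= tau * t + de * L0 ^+ 2.
  move=> t0; rewrite /wexp lerD2l ler_wpM2l ?(ltW de0) // ler_pdivrMr ?dpos //.
  rewrite mulrDr mulrA [L0 ^+ 2 * ka]mulrC kaL mul1r; have := sqr_ge0 L0; lra.
have wlow (t : R) : 0 < t -> t <= L0 -> (tau + de) * t - de <= wexp tau de ka t.
  move=> t0 tL; rewrite /wexp mulrDl -addrA lerD2l -[X in _ - X]mulr1 -mulrBr ler_wpM2l ?(ltW de0) //.
  rewrite ler_pdivlMr ?dpos //; have t2 : ka * t ^+ 2 <= 1.
    by rewrite -kaL ler_wpM2l // lerXn2r ?nnegrE // ltW.
  by have := mulr_ge0 ka0 (ltW t0); move: t2; lra.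
have C10 : 0 <= C1.
  have B_0 : 0 <= Bq by apply: le_trans (normr_ge0 _) (qB point).
  apply: mulr_ge0 (addr_ge0 B_0 (ler0n _ 2)); apply: mulr_ge0 _ (mulr_ge0 (ler0n _ 12) (sqr_ge0 _)).
  by rewrite divr_ge0 ?(ltW eta0) // addr_ge0 // sqr_ge0.
have [_ iu _] := au.
(* The partial masses at geometric radii increase and are bounded by [B], so some annulus carries
   arbitrarily little mass. *)
pose x j := mass tau (L0 * 7 ^+ j).
have L7 j : L0 <= L0 * 7 ^+ j by rewrite ler_peMr ?(ltW L00) // exprn_ege1 // (ler_nat R 1 7).
have xB j : x j <= B by apply: HB; apply: le_trans (L7 j).
set Y := expR de ^+ 2 * C1 * _.
apply/ler_addgt0Pr => e' e'0.
set Kt := 4 * (tau + de + 3 * S) ^+ 2 + 2 * Bq + 2.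
have Kt0 : 0 <= Kt.
  have B_0 : 0 <= Bq by apply: le_trans (normr_ge0 _) (qB point).
  by apply: addr_ge0 (addr_ge0 (mulr_ge0 (ler0n _ 4) (sqr_ge0 _)) (mulr_ge0 (ler0n _ 2) B_0)) (ler0n _ 2).
pose Z := expR de ^+ 2 * (C1 * (Kt * expR (de * L0 ^+ 2) ^+ 2)).
have Z0 : 0 <= Z by apply: mulr_ge0 (sqr_ge0 _) (mulr_ge0 C10 (mulr_ge0 Kt0 (sqr_ge0 _))).
have [j xj] := bounded_increments xB (divr_gt0 e'0 (ltr_wpDl Z0 ltr01)).
pose s := L0 * 7 ^+ j; have L0s : L0 <= s by exact: L7.
(* The error annulus from [L / 2 = 9 s / 8] to [3 L = 27 s / 4] then lies strictly beyond [s] and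
   below [7 s], inside a single step of the radii. *)
pose L := 9 / 4 * s; have LR : 2 * (Rr + 1) <= L by rewrite /L; lra.
have H := end_cutoff hmu sr r_ge m0 e0 e8 elam Grr Lapr Hesr eta0 eta8 etal q_eta mq qB shellK tau0 de0 de1 del ka0 ka1
  S0 dT1 dT2 TS Tz Rr1 R1r LR au.
have [RL2 RL1] : R1 < L / 2 /\ R1 < L by have := R1r; lra.
have sE2 : smooth_fun (fun p => expR (wexp tau de ka (r p)) ^+ 2).
  by have := smooth_wexp sr r_ge tau de ka0 => ?; smf.
have outer : I (fun p => shell (L / 2) (3 * L) p * expR (wexp tau de ka (r p)) ^+ 2 * u p ^+ 2) <=
    expR (de * L0 ^+ 2) ^+ 2 * (x j.+1 - x j).
  have i1 := intg_shell (L0 * 7 ^+ j.+1) R1r1 (smooth_e tau).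
  have i2 := intg_shell s R1r1 (smooth_e tau).
  rewrite (_ : x j.+1 - x j = I (fun p => shell (Rr + 1) (L0 * 7 ^+ j.+1) p * expR (tau * r p) ^+ 2 * u p ^+ 2 +
     -1 * (shell (Rr + 1) s p * expR (tau * r p) ^+ 2 * u p ^+ 2))); last first.
    by rewrite (JD i1 (intgZ (-1) i2)) (JZ (-1) i2) mulN1r.
  rewrite -(JZ _ (intgD i1 (intgZ (-1) i2))).
  apply: (J_le (intg_shell _ RL2 sE2) (intgZ _ (intgD i1 (intgZ (-1) i2)))) => p.
  rewrite [leRHS](_ : _ = expR (de * L0 ^+ 2) ^+ 2 * expR (tau * r p) ^+ 2 *
     (shell (Rr + 1) (L0 * 7 ^+ j.+1) p - shell (Rr + 1) s p) * u p ^+ 2); last by ring.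
  apply: ler_wpM2r (sqr_ge0 _) _ _ _; rewrite mulrC; apply: ler_pM; rewrite ?sqr_ge0 ?ler0n //.
    rewrite -exprMn -expRD lerXn2r ?nnegrE ?expR_ge0 // ler_expR [leRHS]addrC; exact: wout (r_gt0 r_ge p).
  rewrite exprS (_ : L0 * (7 * 7 ^+ j) = 7 * s); last by rewrite /s; ring.
  rewrite /shell /L; case: (boolP ((_ <= r p) && (r p <= 3 * _))) => [/andP[h1 h2]|_].
    have -> : (Rr + 1 <= r p) && (r p <= 7 * s) by apply/andP; split; lra.
    by have -> : (r p <= s) = false; [apply/negbTE; rewrite -ltNge; lra|rewrite andbF subr0].
  rewrite subr_ge0 ler_nat; case: (boolP (_ && _)) => // /andP[h1 h2].
  by rewrite h1 /= (le_trans h2) //; lra.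
have inner : mass (tau + de) L0 <= expR de ^+ 2 * I (fun p => shell (Rr + 1) L p * expR (wexp tau de ka (r p)) ^+ 2 * u p ^+ 2).
  rewrite -(JZ _ (intg_shell _ R1r1 sE2)).
  apply: (J_le (intg_shell _ R1r1 (smooth_e _)) (intgZ _ (intg_shell _ R1r1 sE2))) => p.
  rewrite [leRHS]mulrA; apply: ler_wpM2r (sqr_ge0 _) _ _ _.
  rewrite /shell; case: (boolP ((_ <= _) && (_ <= L0))) => [/andP[h1 h2]|_]; last first.
    by rewrite mul0r mulr_ge0 ?sqr_ge0 // mulr_ge0 ?ler0n ?sqr_ge0.
  have -> : (Rr + 1 <= r p) && (r p <= L) by rewrite h1 /L; lra.
  rewrite !mul1r -exprMn -expRD lerXn2r ?nnegrE ?expR_ge0 // ler_expR -lerBlDl.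
  exact: wlow (r_gt0 r_ge p) h2.
have W2 : expR (wexp tau de ka (Rr + 1)) ^+ 2 <= expR ((tau + de) * (Rr + 1)) ^+ 2.
  by rewrite lerXn2r ?nnegrE ?expR_ge0 // ler_expR wup //; lra.
have U0 : 0 <= I (fun p => u p ^+ 2) by apply: I_ge0 => p; exact: sqr_ge0.
have h1 := ler_wpM2l (mulr_ge0 (divr_ge0 (ler0n R 3) (ler0n R 16)) lam0) inner.
apply: le_trans h1 _.
have h2 : expR de ^+ 2 * (3 / 16 * lam * I (fun p => shell (Rr + 1) L p * expR (wexp tau de ka (r p)) ^+ 2 * u p ^+ 2)) <=
   expR de ^+ 2 * (C1 * (expR ((tau + de) * (Rr + 1)) ^+ 2 * I (fun p => u p ^+ 2) + Kt * (expR (de * L0 ^+ 2) ^+ 2 * (x j.+1 - x j)))).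
  rewrite ler_wpM2l ?sqr_ge0 //; apply: le_trans H _; rewrite -/C1 ler_wpM2l // lerD //.
    by rewrite ler_wpM2r.
  by rewrite ler_wpM2l.
rewrite mulrCA; apply: le_trans h2 _.
have h3 : Z * (x j.+1 - x j) <= e'.
  apply: le_trans (ler_wpM2l Z0 xj) _; rewrite mulrCA ler_piMr ?(ltW e'0) //.
  by rewrite ler_pdivrMr ?mul1r ?lerDl // ltr_wpDl.
by move: h3; rewrite /Z /Y; lra.
Qed.

(** By [mass_step] the mass is finite at every rate [de *+ k], with a bound growing like
    [exp(2 t (Rr + 1))] at rate [t]. On the shell beyond [Rr + 2] the weight is at least
    [exp(2 t (Rr + 2))], and the ratio [exp(2 t)] is unbounded. *)
Lemma end_vanish (L : R) : I (fun p => shell (Rr + 2) L p * u p ^+ 2) = 0.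
Proof.
have lam0 : 0 < lam by have := del; have := de0; lra.
have [_ iu _] := au.
have C10 : 0 <= C1.
  have B_0 : 0 <= Bq by apply: le_trans (normr_ge0 _) (qB point).
  apply: mulr_ge0 (addr_ge0 B_0 (ler0n _ 2)); apply: mulr_ge0 _ (mulr_ge0 (ler0n _ 12) (sqr_ge0 _)).
  by rewrite divr_ge0 ?(ltW eta0) // addr_ge0 // sqr_ge0.
have U0 : 0 <= I (fun p => u p ^+ 2) by apply: I_ge0 => p; exact: sqr_ge0.
have l3 : 0 < 3 / 16 * lam by rewrite mulr_gt0.
have grow (k : nat) : exists B, forall L, 2 * (Rr + 1) <= L -> mass (de *+ k) L <= B.
  elim: k => [|k [B HB]].
    exists (I (fun p => u p ^+ 2)) => L' _; rewrite /mass.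
    apply: (J_le (intg_shell _ R1r1 (smooth_e _)) iu) => p.
    by rewrite mulr0n mul0r expR0 expr1n mulr1 ler_piMl ?sqr_ge0 // (le_trans (ler_norm _)) //; exact: (shell_meas sr _ _).2.
  have k0 : 0 <= de *+ k by rewrite mulrn_wge0 // ltW.
  have H := mass_step k0 HB.
  exists ((3 / 16 * lam)^-1 * (expR de ^+ 2 * C1 * (expR ((de *+ k + de) * (Rr + 1)) ^+ 2 * I (fun p => u p ^+ 2)))).
  by move=> L' RL; rewrite mulrSr ler_pdivlMl //; exact: H.
set X := I _; have X0 : 0 <= X by apply: I_ge0 => p; rewrite mulr_ge0 ?sqr_ge0 // ler0n.
(* Of the gain [exp(2 t)] only linear growth in [k] is retained, which suffices for the
   contradiction. *)
have key (k : nat) : 3 / 16 * lam * X * (1 + de *+ k) <= expR de ^+ 2 * C1 * I (fun p => u p ^+ 2).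
  have [B HB] := grow k; have k0 : 0 <= de *+ k by rewrite mulrn_wge0 // ltW.
  pose L' := `|L| + 2 * (Rr + 1); have RL : 2 * (Rr + 1) <= L' by rewrite /L' lerDr.
  have H := mass_step k0 HB RL; set t := de *+ k + de in H.
  have t0 : 0 <= t by rewrite addr_ge0 // ltW.
  have low : expR (t * (Rr + 2)) ^+ 2 * X <= mass t L'.
    have bs := shell_meas sr (Rr + 2) L.
    rewrite -(JZ _ (intgM bs iu)).
    apply: (J_le (intgZ _ (intgM bs iu)) (intg_shell _ R1r1 (smooth_e _))) => p.
    rewrite mulrA; apply: ler_wpM2r (sqr_ge0 _) _ _ _; rewrite /shell.
    case: (boolP ((_ <= _) && (_ <= L))) => [/andP[h1 h2]|_]; last by rewrite mulr0 mulr_ge0 ?ler0n ?sqr_ge0.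
    have -> : (Rr + 1 <= r p) && (r p <= L').
      apply/andP; split; first by lra.
      by apply: le_trans h2 _; apply: le_trans (ler_norm _) _; have := Rr1; rewrite /L'; lra.
    by rewrite mul1r mulr1 lerXn2r ?nnegrE ?expR_ge0 // ler_expR ler_wpM2l.
  have e1 : expR (t * (Rr + 2)) ^+ 2 = expR (t * (Rr + 1)) ^+ 2 * expR t ^+ 2.
    by rewrite -exprMn -expRD; congr (expR _ ^+ 2); ring.
  have ep : 0 < expR (t * (Rr + 1)) ^+ 2 by rewrite exprn_gt0 // expR_gt0.
  have e2 : 1 + de *+ k <= expR t ^+ 2.
    apply: (@le_trans _ _ (expR t)); first by apply: le_trans (expR_ge1Dx t); rewrite /t lerD2l lerDl ltW.
    by rewrite expr2 ler_peMl ?expR_ge0 // -expR0 ler_expR.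
  rewrite -(ler_pM2l ep); apply: (@le_trans _ _ (3 / 16 * lam * (expR (t * (Rr + 2)) ^+ 2 * X))).
    rewrite e1; have := ler_wpM2l (mulr_ge0 (ltW l3) (mulr_ge0 X0 (ltW ep))) e2; lra.
  apply: le_trans (ler_wpM2l (ltW l3) low) _; apply: le_trans H _.
  by rewrite le_eqVlt; apply/orP; left; apply/eqP; ring.
apply/eqP; rewrite eq_le X0 andbT leNgt; apply/negP => Xp.
set Y := expR de ^+ 2 * C1 * _ in key.
have a0 : 0 < 3 / 16 * lam * X * de by rewrite !mulr_gt0.
have [k Hk] := exists_nat_gt (Y / (3 / 16 * lam * X * de)).
have := key k; move: Hk; rewrite ltr_pdivrMr // -[de *+ k]mulr_natl; have := mulr_gt0 l3 Xp; lra.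
Qed.

End EndVanish.

Section EmbeddedEigenvalues.
Context {R : realType} {n : nat} {sigma0 : R} (M : asymptotically_conic n sigma0).
Hypothesis sigma0_gt0 : 0 < sigma0.
Variable mu : {measure set (borel M) -> \bar R}.
Hypothesis hmu : is_riemannian_measure (ac_g M) mu.
Variables (A lam : R).
Hypothesis A0 : 0 <= A.
Hypothesis lam0 : 0 < lam.
Variable V : M -> R.
Hypothesis mV : measurable_fun [set: borel M] (V : borel M -> R).
Implicit Types (p : M) (u : M -> R).
Local Notation g := (ac_g M).
Local Notation r := (@ac_weight _ _ _ M).
Hypothesis hV : forall p, `|V p| <= A * (r p `^ (- 2 - 2 * sigma0) + Num.sqrt lam * r p `^ (- 1 - 2 * sigma0)).

Lemma powR_weight_le (b : R) p : 0 <= b -> r p `^ (- b) <= 2^-1 `^ (- b).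
Proof.
move=> b0; have h2 : 0 < 2^-1 :> R by rewrite invr_gt0.
rewrite !powRN lef_pV2 ?posrE ?powR_gt0 ?weight_gt0 //.
by rewrite ge0_ler_powR ?nnegrE ?(ltW h2) ?(ltW (weight_gt0 p)) // weight_ge.
Qed.

Lemma potential_bounded : exists B : R, forall p, `|V p - lam| <= B.
Proof.
exists (A * (2^-1 `^ (- 2 - 2 * sigma0) + Num.sqrt lam * 2^-1 `^ (- 1 - 2 * sigma0)) + lam) => p.
apply: le_trans (ler_normB _ _) _; rewrite (gtr0_norm lam0) lerD2r.
apply: le_trans (hV p) _; rewrite ler_wpM2l // -!opprD.
have s0 := ltW sigma0_gt0.
by apply: lerD; [|rewrite ler_wpM2l ?sqrtr_ge0 //]; apply: powR_weight_le; rewrite addr_ge0 // mulr_ge0.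
Qed.

(** For [r >= 1] both powers in the hypothesis are at most [r^(- 1 - 2 sigma0)], so [r |V|] is at
    most a multiple of [r^(- 2 sigma0)]. *)
Lemma potential_decay (m eta : R) : 0 <= m -> 0 < eta -> exists2 T : R, 0 < T &
  forall p, T < r p -> (r p + m) * `|V p| <= eta.
Proof.
move=> m0 eta0; pose D := (1 + m) * (A * (1 + Num.sqrt lam)).
have D0 : 0 <= D by rewrite mulr_ge0 ?addr_ge0 // mulr_ge0 // addr_ge0 // sqrtr_ge0.
have [T T0 HT] := powR_small sigma0_gt0 (divr_gt0 eta0 (ltr_wpDl D0 ltr01)).
exists (T + 1) => [|p Tp]; first by rewrite addr_gt0.
have rp0 := weight_gt0 p; have r1 : 1 <= r p by lra.
have rT : T < r p by lra.
have P := HT _ rT; set s := r p `^ (- (2 * sigma0)) in P.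
have s0 : 0 <= s by exact: powR_ge0.
have e1 : r p `^ (- 1 - 2 * sigma0) = (r p)^-1 * s.
  by rewrite powRD ?(gt_eqF rp0) ?implybT // powR_inv1 // ltW.
have e2 : r p `^ (- 2 - 2 * sigma0) <= (r p)^-1 * s.
  by rewrite -e1 ler_powR // lerD2r lerN2 (ler_nat R 1 2).
have V1 : `|V p| <= A * (1 + Num.sqrt lam) * ((r p)^-1 * s).
  apply: le_trans (hV p) _; rewrite -[leRHS]mulrA ler_wpM2l // [leRHS]mulrDl mul1r.
  by apply: lerD e2 _; rewrite e1.
apply: (@le_trans _ _ ((r p * (1 + m)) * (A * (1 + Num.sqrt lam) * ((r p)^-1 * s)))).
  apply: ler_pM => //; first by rewrite addr_ge0 // ltW.
  by rewrite mulrDr mulr1 lerD2l ler_peMl.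
have -> : r p * (1 + m) * (A * (1 + Num.sqrt lam) * ((r p)^-1 * s)) = D * s.
  by rewrite /D; field; rewrite gt_eqF.
apply: le_trans (ler_wpM2l D0 P) _.
by rewrite mulrCA ler_piMr ?(ltW eta0) // ler_pdivrMr ?mul1r ?lerDl // ltr_wpDl.
Qed.

Lemma approximable_ae0 u : approximable g mu (fun p => V p - lam) u ->
  {ae mu, forall p : borel M, u p = 0}.
Proof.
(* One small number serves as geometric error, as bound for the potential and as Young parameter in
   the estimate on the end. *)
move=> au; pose e := Num.min 8^-1 (lam / 16).
have e0 : 0 < e by rewrite lt_min invr_gt0 ltr0n divr_gt0.
have e8 : e <= 8^-1 by rewrite ge_min lexx.
have el : e <= lam / 16 by rewrite ge_min lexx orbT.
have elam : e <= lam by lra.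
have m0 : 0 <= n.-1%:R :> R by exact: ler0n.
have [R1 R01 HR1] := end_uniform sigma0_gt0 hmu e0.
have [T T0 HT] := potential_decay m0 e0.
have [Bq qB] := potential_bounded.
have R00 : 0 < ac_R0 M by apply: lt_trans (ac_R0_gt1 M).
pose R2 := R1 + T; have R12 : R1 < R2 by rewrite ltrDl.
have mq : measurable_fun [set: borel M] ((fun p => V p - lam) : borel M -> R).
  by apply: measurable_funB => //; exact: measurable_cst.
have sr : smooth_fun r := @ac_weight_smooth _ _ _ M.
have Grr p : R2 < r p -> Gam g r r p = 1.
  by move=> H; apply: Gam_weight; apply: lt_trans H; exact: lt_trans R12.
have Lapr p : R2 < r p -> `|r p * Lap g r p - n.-1%:R| <= e.
  by move=> H; have [] := HR1 p (lt_trans R12 H).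
have Hesr p : R2 < r p -> forall w, smooth_fun w ->
    `|r p * Hes g r w p - (Gam g w w p - Gam g r w p ^+ 2)| <= e * (Gam g w w p - Gam g r w p ^+ 2).
  by move=> H; have [] := HR1 p (lt_trans R12 H).
have qe p : R2 < r p -> (r p + n.-1%:R) * `|V p - lam + lam| <= e.
  by move=> H; rewrite subrK; apply: HT; apply: lt_trans H; rewrite ltrDr; lra.
have shellK a b : R2 < a -> compact [set p | a <= r p <= b].
  by move=> H; apply: shell_compact; apply: lt_trans R01 (lt_trans R12 H).
have [T1 [T2 [S [S0 dT1 dT2 TS Tz]]]] := @step_bounds R.
pose de := Num.min 1 (lam / 56).
have de0 : 0 < de by rewrite lt_min ltr01 divr_gt0.
have de1 : de <= 1 by rewrite ge_min lexx.
have del : 56 * de <= lam.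
  have : de <= lam / 56 by rewrite ge_min lexx orbT.
  lra.
pose Rr := R2 + 1; have R2r : R2 < Rr by rewrite ltrDl.
have Rr1 : 1 <= Rr by rewrite /Rr /R2; lra.
have van := end_vanish hmu sr (@weight_ge _ _ _ M) m0 (ltW e0) e8 elam Grr Lapr Hesr e0 e8 el qe mq qB shellK
  S0 dT1 dT2 TS Tz de0 de1 del Rr1 R2r au (Rr + 4).
have [_ iu _] := au; have bs := shell_meas (r := r) sr (Rr + 2) (Rr + 4).
have z := ae0_J (intgM bs iu) (fun p => mulr_ge0 (ler0n _ _) (sqr_ge0 _)) van.
(* A nonempty open shell on which [u] vanishes, the starting point of unique continuation; it
   contains the points of radius [Rr + 3]. *)
pose W : set M := [set p | Rr + 2 < r p < Rr + 4].
have cr : continuous r := smooth_fun_cont sr.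
have oW : open W.
  rewrite (_ : W = [set p | Rr + 2 < r p] `&` [set p | r p < Rr + 4]); last first.
    by apply/seteqP; split=> p; rewrite /W /=; [move/andP|move=> [-> ->]].
  by apply: openI; [apply: (@open_comp _ _ r [set t | Rr + 2 < t])|apply: (@open_comp _ _ r [set t | t < Rr + 4])];
    by [move=> p _; exact: cr|exact: open_gt|exact: open_lt].
have Rt : ac_R0 M < Rr + 3 by rewrite /Rr; lra.
have [nk rt _] := ac_end_from (point : ac_bd M) Rt.
have Wp : W (ac_endpt (Rr + 3) (point : ac_bd M)).
  by rewrite /W /= ac_weight_end // rt; apply/andP; split; lra.
apply: (ucp_connected hmu mq qB (@ac_connected _ _ _ M) au oW Wp).
apply: (ae_imp _ z) => p Hp /andP[h1 h2]; move: Hp; rewrite /shell (ltW h1) (ltW h2) mul1r.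
by move/eqP; rewrite sqrf_eq0 => /eqP.
Qed.

End EmbeddedEigenvalues.

(** * Weak solutions and essential self-adjointness *)

Section WeakGraphs.
Local Open Scope complex_scope.
Context {R : realType} {N : nat} {M : manifold R N}.
Variable g : metric M.
Variable mu : {measure set (borel M) -> \bar R}.
Hypothesis hmu : is_riemannian_measure g mu.
Variable V : M -> R.
Variable BV : R.
Hypothesis mV : measurable_fun [set: borel M] (V : borel M -> R).
Hypothesis VB : forall p, `|V p| <= BV.
Implicit Types (a b f v F G : M -> R) (p : M).
Local Notation Lap := (Lap g).
Local Notation I := (I mu).
Local Notation intg := (intg mu).
Local Notation meas F := (measurable_fun [set: borel M] (F : borel M -> R)).
Local Notation cmp H := (complexify H : (M -> R[i]) -> M -> R[i]).

Definition Hop f p := - Lap f p + V p * f p.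

(** Membership in the graph of the adjoint for real functions. The operator has real coefficients,
    so a complex statement is a pair of these. *)
Definition weak_graph v F := forall f, smooth_fun f -> cs f -> I (fun p => v p * Hop f p) = I (fun p => F p * f p).

Definition sqint v := meas v /\ intg (fun p => v p ^+ 2).

(** Membership in the graph of the closure of the operator on test functions. *)
Definition graph_limit v F := forall e : R, 0 < e -> exists f, [/\ smooth_fun f, cs f,
  sqint (fun p => v p - f p) /\ I (fun p => (v p - f p) ^+ 2) <= e &
  sqint (fun p => F p - Hop f p) /\ I (fun p => (F p - Hop f p) ^+ 2) <= e].

Lemma intg_mul v F : sqint v -> sqint F -> intg (fun p => v p * F p).
Proof.
move=> [mv iv] [mF iF]; apply: intg_le (intgD iv iF) _; first exact: measurable_funM.
move=> p; rewrite normrM -(real_normK (num_real (v p))) -(real_normK (num_real (F p))).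
have := sqr_ge0 (`|v p| - `|F p|); have := sqr_ge0 (`|v p|); have := sqr_ge0 (`|F p|).
by rewrite sqrrB; move=> *; lra.
Qed.

Lemma sqint_LB F : LB F -> cs F -> sqint F.
Proof. by move=> lF cF; split; [have [] := lF|apply: (intg_LB hmu); [lbf|csf]]. Qed.

Lemma LB_Hop f : smooth_fun f -> LB (Hop f).
Proof.
move=> sf; have lV : LB V := LB_bounded mV VB.
rewrite /Hop; apply: LBD; last by lbf.
by apply: LB_smooth; smf.
Qed.

Lemma cs_Hop f : cs f -> cs (Hop f).
Proof.
move=> cf; rewrite /Hop; apply: csD; last by csf.
by apply: cs_sub (Lap_cs g cf) _ => p ->; rewrite oppr0.
Qed.

Lemma sqint_Hop f : smooth_fun f -> cs f -> sqint (Hop f).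
Proof. by move=> sf cf; apply: sqint_LB; [exact: LB_Hop|exact: cs_Hop]. Qed.

Lemma sqint_smooth f : smooth_fun f -> cs f -> sqint f.
Proof. by move=> sf cf; apply: sqint_LB => //; lbf. Qed.

Lemma sqintN v : sqint v -> sqint (fun p => - v p).
Proof.
move=> [mv iv]; split; first exact: measurable_funN.
by under eq_fun do rewrite sqrrN.
Qed.

Lemma JN v : intg v -> I (fun p => - v p) = - I v.
Proof. by move=> iv; under eq_fun do rewrite -mulN1r; rewrite JZ // mulN1r. Qed.

Lemma intgN v : intg v -> intg (fun p => - v p).
Proof. by move=> iv; under eq_fun do rewrite -mulN1r; exact: intgZ. Qed.

(** A form of Cauchy-Schwarz free of square roots: [|v F|] is at most [t v^2 + F^2 / t], and the
    integral of [F^2] is at most [t^2]. *)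
Lemma young_bound v F (t e : R) : 0 < t -> sqint v -> sqint F -> I (fun p => F p ^+ 2) <= t ^+ 2 ->
  `|I (fun p => v p * F p)| <= t * (I (fun p => v p ^+ 2) + 1).
Proof.
move=> t0 sv sF HF; have [_ iv] := sv; have [_ iF] := sF; have ivF := intg_mul sv sF.
have bnd (s : R) : s ^+ 2 = 1 -> s * I (fun p => v p * F p) <= t * (I (fun p => v p ^+ 2) + 1).
  move=> s1; rewrite -(JZ _ ivF).
  apply: (@le_trans _ _ (I (fun p => t * v p ^+ 2 + t^-1 * F p ^+ 2))).
    apply: (J_le (intgZ _ ivF) (intgD (intgZ _ iv) (intgZ _ iF))) => p.
    have h : 0 <= t^-1 * ((t * v p - s * F p) ^+ 2 + (t * v p) ^+ 2 + F p ^+ 2).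
      by rewrite mulr_ge0 ?invr_ge0 ?(ltW t0) // !addr_ge0 ?sqr_ge0.
    have e1 : t^-1 * ((t * v p - s * F p) ^+ 2 + (t * v p) ^+ 2 + F p ^+ 2) =
       2 * (t * v p ^+ 2 + t^-1 * F p ^+ 2 - s * (v p * F p)) + (s ^+ 2 - 1) * (t^-1 * F p ^+ 2).
      by field; rewrite gt_eqF.
    by move: h; rewrite e1 s1 subrr mul0r addr0 pmulr_rge0 // subr_ge0.
  rewrite (JD (intgZ _ iv) (intgZ _ iF)) !JZ // mulrDr mulr1 lerD2l.
  apply: (@le_trans _ _ (t^-1 * t ^+ 2)); first by rewrite ler_wpM2l // invr_ge0 ltW.
  by rewrite expr2 mulKf // gt_eqF.
rewrite ler_norml; apply/andP; split; last by have := bnd 1 (expr1n _ _); rewrite mul1r.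
by have := bnd (-1) (sqrr_sign _ 1); rewrite mulN1r lerNl.
Qed.

(** The adjoint is symmetric against the closure. Since essential self-adjointness puts weak
    solutions into the closure, this is Green's identity for a pair of functions neither of which is
    smooth. *)
Lemma graph_limit_pair v F v' F' : sqint v -> sqint F -> sqint v' -> sqint F' ->
  weak_graph v F -> graph_limit v' F' -> I (fun p => v p * F' p) = I (fun p => F p * v' p).
Proof.
move=> sv sF sv' sF' wv H; have [mv iv] := sv; have [mF iF] := sF.
set X := I _; set Y := I _; apply/eqP; rewrite -subr_eq0 -normr_le0; apply/ler_addgt0Pr => e e0; rewrite add0r.
pose D := I (fun p => v p ^+ 2) + I (fun p => F p ^+ 2) + 2.
have D0 : 0 < D by rewrite ltr_wpDl // addr_ge0 //; apply: I_ge0 => p; exact: sqr_ge0.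
pose t := e / D; have t0 : 0 < t by exact: divr_gt0.
have [f [sf cf [s1 h1] [s2 h2]]] := H (t ^+ 2) (exprn_gt0 _ t0).
have sHf := sqint_Hop sf cf; have sff := sqint_smooth sf cf.
have -> : X - Y = I (fun p => v p * (F' p - Hop f p)) - I (fun p => F p * (v' p - f p)).
  have -> : I (fun p => v p * (F' p - Hop f p)) = X - I (fun p => v p * Hop f p).
    rewrite -JN ?(intg_mul sv sHf) // -JD; [|exact: intg_mul|exact: intgN (intg_mul sv sHf)].
    by apply: I_ext => p; ring.
  have -> : I (fun p => F p * (v' p - f p)) = Y - I (fun p => F p * f p).
    rewrite -JN ?(intg_mul sF sff) // -JD; [|exact: intg_mul|exact: intgN (intg_mul sF sff)].
    by apply: I_ext => p; ring.
  by rewrite (wv f sf cf); ring.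
apply: le_trans (ler_normB _ _) _.
apply: le_trans (lerD (young_bound 0 t0 sv s2 h2) (young_bound 0 t0 sF s1 h1)) _.
rewrite -mulrDr (_ : _ + 1 + (_ + 1) = D); last by rewrite /D; ring.
by rewrite /t divfK // gt_eqF.
Qed.

(** [Lap f - (V - lam) f] equals [(lam v - H f) - lam (v - f)], a combination of the two
    approximation errors; [D] collects the constants from squaring it. *)
Lemma graph_limit_approximable v (lam : R) : sqint v -> graph_limit v (fun p => lam * v p) ->
  approximable g mu (fun p => V p - lam) v.
Proof.
move=> [mv iv] H; split => // e e0.
pose D := 2 * (1 + lam ^+ 2) + 1; have D0 : 1 <= D.
  by rewrite /D lerDr mulr_ge0 // addr_ge0 // sqr_ge0.
have Dp : 0 < D by apply: lt_le_trans D0.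
have [f [sf cf [s1 h1] [s2 h2]]] := H (e / D) (divr_gt0 e0 Dp).
have [_ i1] := s1; have [_ i2] := s2.
exists f; split => //; first by apply: le_trans h1 _; rewrite ler_pdivrMr // ler_peMr // ltW.
have lV : LB V := LB_bounded mV VB.
have iF : intg (fun p => (Lap f p - (V p - lam) * f p) ^+ 2).
  apply: (intg_LB hmu); last by csf.
  have lq : LB (fun p => V p - lam) by apply: LBB => //; exact: LB_cst.
  by apply: LBX; apply: LBB; [lbf|apply: (@LBM _ _ _ (fun p => V p - lam)) => //; lbf].
apply: (@le_trans _ _ (I (fun p => 2 * (lam * v p - Hop f p) ^+ 2 + 2 * lam ^+ 2 * (v p - f p) ^+ 2))).
  apply: (J_le iF (intgD (intgZ _ i2) (intgZ _ i1))) => p; rewrite /Hop.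
  have := sqr_ge0 ((lam * v p - (- Lap f p + V p * f p)) + lam * (v p - f p)).
  by move: (Lap f p) (V p) (f p) (v p) => x1 x2 x3 x4; lra.
rewrite (JD (intgZ _ i2) (intgZ _ i1)) !JZ //.
apply: (@le_trans _ _ (D * (e / D))); last by rewrite mulrC divfK // gt_eqF.
rewrite /D mulrDl mul1r; have := ler_wpM2l (sqr_ge0 lam) h1; have : 0 <= e / D by rewrite divr_ge0 // ltW.
by move: h2; lra.
Qed.

Lemma adjoint_weak (u f : M -> R[i]) :
  adjoint_graph mu (cmp (fun f x => - laplacian g f x + V x * f x)) u f ->
  weak_graph (ReF u) (ReF f) /\ weak_graph (ImF u) (ImF f).
Proof.
move=> H; suff K h : smooth_fun h -> cs h -> I (fun p => ReF u p * Hop h p) = I (fun p => ReF f p * h p) /\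
    I (fun p => ImF u p * Hop h p) = I (fun p => ImF f p * h p).
  by split=> h sh ch; have [] := K h sh ch.
(* Testing against real functions already separates real and imaginary parts. *)
move=> sh [C cC C0]; have tf : test_fun setT (fun x => (h x)%:C).
  by split; [exact: sh|exact: smooth_fun_cst|exists C; split => // x /C0 ->].
have := H _ tf; rewrite (_ : complexify _ _ = fun x => (Hop h x)%:C) => [[E1 E2]|]; last first.
  apply/funext => x; rewrite /complexify -Lap_laplacian (_ : ImF _ = fun=> 0) // Lap_cst.
  by rewrite mulr0 oppr0 addr0.
split; [apply: etrans (etrans E1 _)|apply: etrans (etrans E2 _)]; apply: I_ext => x; rewrite /ReF /ImF;
  by case: (u x) (f x) => ? ? [? ?] /=; ring.
Qed.

Lemma weak_adjoint (a b F G : M -> R) : sqint a -> sqint b -> sqint F -> sqint G ->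
  weak_graph a F -> weak_graph b G ->
  adjoint_graph mu (cmp (fun f x => - laplacian g f x + V x * f x)) (fun x => a x +i* b x) (fun x => F x +i* G x).
Proof.
move=> sa sb sF sG wa wb phi [s1 s2 [C [cC _ C0]]].
have c1 : cs (ReF phi) by exists C => // x /C0; rewrite /ReF => ->.
have c2 : cs (ImF phi) by exists C => // x /C0; rewrite /ImF => ->.
have h1 := sqint_Hop s1 c1; have h2 := sqint_Hop s2 c2.
have k1 := sqint_smooth s1 c1; have k2 := sqint_smooth s2 c2.
rewrite /inner; congr (_ +i* _).
  transitivity (I (fun p => a p * Hop (ReF phi) p + b p * Hop (ImF phi) p)).
    by apply: I_ext => x; rewrite /ReF /complexify /Hop /= -Lap_laplacian; ring.
  rewrite JD ?(intg_mul sa h1) ?(intg_mul sb h2) // (wa _ s1 c1) (wb _ s2 c2) -JD; [|exact: intg_mul|exact: intg_mul].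
  by apply: I_ext => x; rewrite /ReF /ImF; case: (phi x) => y z /=; ring.
transitivity (I (fun p => b p * Hop (ReF phi) p + - (a p * Hop (ImF phi) p))).
  by apply: I_ext => x; rewrite /ImF /complexify /Hop /= -Lap_laplacian; ring.
rewrite JD ?(intg_mul sb h1) //; last exact: intgN (intg_mul sa h2).
rewrite JN ?(intg_mul sa h2) // (wb _ s1 c1) (wa _ s2 c2) -JN; last exact: intg_mul.
rewrite -JD; [|exact: intg_mul|exact: intgN (intg_mul sF k2)].
by apply: I_ext => x; rewrite /ReF /ImF; case: (phi x) => y z /=; ring.
Qed.

Lemma in_L2_sqint (u : M -> R[i]) : in_L2 mu setT u <-> sqint (ReF u) /\ sqint (ImF u).
Proof.
split=> [[m1 m2 fin]|[[m1 i1] [m2 i2]]].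
  have mR2 : meas (fun p => ReF u p ^+ 2 + ImF u p ^+ 2).
    by apply: measurable_funD; apply: measurable_funX.
  have i12 : intg (fun p => ReF u p ^+ 2 + ImF u p ^+ 2).
    by apply: intg_ge0 => // p; rewrite addr_ge0 ?sqr_ge0.
  split; split => //; apply: intg_le i12 _; try exact: measurable_funX.
    by move=> p; rewrite ger0_norm ?sqr_ge0 // lerDl sqr_ge0.
  by move=> p; rewrite ger0_norm ?sqr_ge0 // lerDr sqr_ge0.
split => //; rewrite /L2norm2 (J_int (intgD i1 i2)); exact: ltry.
Qed.

Lemma L2norm2_lt (u : M -> R[i]) (e : R) : meas (ReF u) -> meas (ImF u) -> (L2norm2 mu setT u < e%:E)%E ->
  [/\ sqint (ReF u), I (fun p => ReF u p ^+ 2) <= e, sqint (ImF u) & I (fun p => ImF u p ^+ 2) <= e].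
Proof.
move=> m1 m2 lt; have iu : in_L2 mu setT u by split => //; apply: lt_le_trans lt _; exact: leey.
have [s1 s2] := (in_L2_sqint u).1 iu; have [_ i1] := s1; have [_ i2] := s2.
have : I (fun p => ReF u p ^+ 2 + ImF u p ^+ 2) < e.
  by rewrite -lte_fin -(J_int (intgD i1 i2)).
rewrite JD // => H.
have p1 : 0 <= I (fun p => ReF u p ^+ 2) by apply: I_ge0 => p; exact: sqr_ge0.
have p2 : 0 <= I (fun p => ImF u p ^+ 2) by apply: I_ge0 => p; exact: sqr_ge0.
by split => //; lra.
Qed.

Lemma esa_graph_limit (u f : M -> R[i]) :
  essentially_self_adjoint mu (cmp (fun f x => - laplacian g f x + V x * f x)) ->
  in_L2 mu setT u -> in_L2 mu setT f ->
  adjoint_graph mu (cmp (fun f x => - laplacian g f x + V x * f x)) u f ->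
  graph_limit (ReF u) (ReF f) /\ graph_limit (ImF u) (ImF f).
Proof.
move=> hH iu jf ag.
have [[mu1 _] [mu2 _]] := (in_L2_sqint u).1 iu; have [[mf1 _] [mf2 _]] := (in_L2_sqint f).1 jf.
suff K (e : R) : 0 < e -> exists phi : M -> R[i], [/\ smooth_fun (ReF phi) /\ cs (ReF phi), smooth_fun (ImF phi) /\ cs (ImF phi),
    [/\ sqint (fun p => ReF u p - ReF phi p), I (fun p => (ReF u p - ReF phi p) ^+ 2) <= e,
        sqint (fun p => ImF u p - ImF phi p) & I (fun p => (ImF u p - ImF phi p) ^+ 2) <= e] &
    [/\ sqint (fun p => ReF f p - Hop (ReF phi) p), I (fun p => (ReF f p - Hop (ReF phi) p) ^+ 2) <= e,
        sqint (fun p => ImF f p - Hop (ImF phi) p) & I (fun p => (ImF f p - Hop (ImF phi) p) ^+ 2) <= e]].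
  split=> e e0; have [phi [[s1 c1] [s2 c2] [h1 h2 h3 h4] [h5 h6 h7 h8]]] := K e e0.
    by exists (ReF phi).
  by exists (ImF phi).
move=> e0; have [phi [[s1 s2 [C [cC _ C0]]] n1 n2]] := hH u f iu jf ag e e0.
have c1 : cs (ReF phi) by exists C => // x /C0; rewrite /ReF => ->.
have c2 : cs (ImF phi) by exists C => // x /C0; rewrite /ImF => ->.
have [m1 _] := sqint_smooth s1 c1; have [m2 _] := sqint_smooth s2 c2.
have [m3 _] := sqint_Hop s1 c1; have [m4 _] := sqint_Hop s2 c2.
exists phi; split => //.
  have E1 : ReF (fun x => u x - phi x) = fun p => ReF u p - ReF phi p.
    by apply/funext => x; rewrite /ReF; case: (u x) (phi x) => [? ?] [? ?].
  have E2 : ImF (fun x => u x - phi x) = fun p => ImF u p - ImF phi p.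
    by apply/funext => x; rewrite /ImF; case: (u x) (phi x) => [? ?] [? ?].
  have := @L2norm2_lt (fun x => u x - phi x) e; rewrite E1 E2; apply => //; exact: measurable_funB.
set Hp := complexify _ phi in n2.
have E1 : ReF (fun x => f x - Hp x) = fun p => ReF f p - Hop (ReF phi) p.
  by apply/funext => x; rewrite /ReF /Hp /complexify /Hop Lap_laplacian; case: (f x).
have E2 : ImF (fun x => f x - Hp x) = fun p => ImF f p - Hop (ImF phi) p.
  by apply/funext => x; rewrite /ImF /Hp /complexify /Hop Lap_laplacian; case: (f x).
have := @L2norm2_lt (fun x => f x - Hp x) e; rewrite E1 E2; apply => //; exact: measurable_funB.
Qed.

Lemma eigenfunction_approximable (u : M -> R[i]) (lam : R) :
  essentially_self_adjoint mu (cmp (fun f x => - laplacian g f x + V x * f x)) ->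
  eigenfunction mu (cmp (fun f x => - laplacian g f x + V x * f x)) lam u ->
  approximable g mu (fun p => V p - lam) (ReF u) /\ approximable g mu (fun p => V p - lam) (ImF u).
Proof.
move=> hH [iu su]; have [s1 s2] := (in_L2_sqint u).1 iu.
have E1 : ReF (fun x => lam%:C * u x) = fun p => lam * ReF u p.
  by apply/funext => x; rewrite /ReF; case: (u x) => a b /=; rewrite mul0r subr0.
have E2 : ImF (fun x => lam%:C * u x) = fun p => lam * ImF u p.
  by apply/funext => x; rewrite /ImF; case: (u x) => a b /=; rewrite mul0r addr0.
have Z v : sqint v -> sqint (fun p => lam * v p).
  move=> [mv iv]; split; first by apply: measurable_funM => //; exact: measurable_cst.
  by under eq_fun do rewrite exprMn; exact: intgZ.
have jf : in_L2 mu setT (fun x => lam%:C * u x).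
  by apply/in_L2_sqint; rewrite E1 E2; split; exact: Z.
have [g1 g2] := esa_graph_limit hH iu jf su.
by rewrite E1 in g1; rewrite E2 in g2; split; exact: graph_limit_approximable.
Qed.

End WeakGraphs.

(** * Resonances *)

Section SmoothPowers.
Context {R : realType}.

Lemma smooth1_ln : smooth1 [set t : R | 0 < t] (@ln R).
Proof.
have [T T0 TD] := @smooth1_inv R.
exists (fun k => if k is k'.+1 then T k' else @ln R) => // -[|k] t t0.
  rewrite T0; exact: is_derive1_ln.
by apply: TD; rewrite /mkset gt_eqF.
Qed.

Lemma smooth1_powR (a : R) : smooth1 [set t : R | 0 < t] (fun t => t `^ a).
Proof.
have o : open ([set t | 0 < t] : set R) by exact: open_gt.
have [T T0 TD] : smooth1 [set t : R | 0 < t] (fun t => expR (a * ln t)).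
  apply: (@smooth1_comp _ _ setT (@expR R)) => //; first exact: openT.
    exact: smooth1_expR.
  by apply: smooth1M => //; [exact: smooth1_cst|exact: smooth1_ln].
exists (fun k => if k is 0 then (fun t => t `^ a) else T k) => // -[|k] t t0; last exact: TD.
have nE : \forall s \near t, T 0%N s = s `^ a.
  rewrite T0; near=> s; rewrite /powR gt_eqF //; near: s; exact: lt_nbhsr.
exact: is_derive_near nE (TD 0%N t t0).
Unshelve. all: by end_near. Qed.

Lemma is_derive_powR (a t : R) : 0 < t -> is_derive t 1 (fun t => t `^ a) (a * t `^ (a - 1)).
Proof.
move=> t0; have nE : \forall s \near t, (fun s => expR (a * ln s)) s = s `^ a.
  near=> s; rewrite /powR gt_eqF //; near: s; exact: lt_nbhsr.
apply: is_derive_near nE _.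
apply: is_derive_eqf (is_derive_compf (is_derive_expR _) (is_deriveCf a (is_derive1_ln t0))) _.
have -> : t `^ (a - 1) = t `^ a / t by rewrite powRD ?(gt_eqF t0) ?implybT // powRN powRr1 // ltW.
by rewrite /powR gt_eqF //; ring.
Unshelve. all: by end_near. Qed.

Lemma smooth1_step_affine (J : set R) (s a : R) : smooth1 J (fun t => step (s * (t - a))).
Proof.
apply: (smooth1_sub (I := setT)) => //; have oT := @openT R.
apply: (@smooth1_comp _ setT setT) => //; first exact: smooth1_step.
apply: (@smooth1M _ _ (fun=> s)) => //; first exact: smooth1_cst.
by apply: smooth1D => //; [exact: smooth1_id|exact: smooth1_cst].
Qed.

(** Constant, and not zero, on the inside: composed with [r] it keeps the solution over [K_0] and
    cuts it off only at infinity, so its derivatives are supported in a compact shell of the end. *)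
Definition radial_cutoff (h : R -> R) (a b D : R) :=
  [/\ smooth1 [set t : R | 0 < t] h, (forall t, t <= a -> h t = D) & (forall t, b <= t -> h t = 0)].

Lemma radial_cutoff_derivs h a b D : 0 < a -> a <= b -> radial_cutoff h a b D ->
  exists h1 h2 : R -> R, [/\ (forall t : R, 0 < t -> is_derive t 1 h (h1 t)),
    (forall t : R, 0 < t -> is_derive t 1 h1 (h2 t)), smooth1 [set t : R | 0 < t] h1 &
    forall t, 0 < t -> t < a \/ b < t -> h1 t = 0 /\ h2 t = 0].
Proof.
move=> a0 ab [[T T0 TD] hD h0]; exists (T 1%N), (T 2%N).
have d1 (t : R) : 0 < t -> is_derive t 1 h (T 1%N t) by move=> t0; rewrite -T0; exact: TD.
have z1 (t : R) : 0 < t -> t < a \/ b < t -> T 1%N t = 0.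
  move=> t0 [ta|bt].
    apply: (is_derive_locally_cst (F := h) (c := D) _ (d1 t t0)); near=> s; apply: hD; rewrite ltW //.
    by near: s; exact: lt_nbhsl.
  apply: (is_derive_locally_cst (F := h) (c := 0) _ (d1 t t0)); near=> s; apply: h0; rewrite ltW //.
  by near: s; exact: lt_nbhsr.
split => //; first by move=> t t0; exact: TD.
  by exists (fun k => T k.+1) => // k t t0; exact: TD.
move=> t t0 H; split; first exact: z1.
case: (H) => [ta|bt].
  apply: (is_derive_locally_cst (F := T 1%N) (c := 0) _ (TD 1%N t t0)); near=> s.
  apply: z1; last left; near: s; [exact: lt_nbhsr|exact: lt_nbhsl].
apply: (is_derive_locally_cst (F := T 1%N) (c := 0) _ (TD 1%N t t0)); near=> s.
apply: z1; last right; near: s; exact: lt_nbhsr.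
Unshelve. all: by end_near. Qed.

End SmoothPowers.

Section LocalSquareIntegrable.
Context {R : realType} {N : nat} {M : manifold R N}.
Variable g : metric M.
Variable mu : {measure set (borel M) -> \bar R}.
Hypothesis hmu : is_riemannian_measure g mu.
Implicit Types (v w f F G : M -> R) (p : M).
Local Notation I := (I mu).
Local Notation intg := (intg mu).
Local Notation sqint := (sqint mu).

(** Local square integrability, phrased as multiplication by the class of compactly supported,
    bounded functions for which integrability is available. *)
Definition loc2 v := measurable_fun [set: borel M] (v : borel M -> R) /\
  forall G, LB G -> cs G -> sqint (fun p => G p * v p).

Lemma sqintD v w : sqint v -> sqint w -> sqint (fun p => v p + w p).
Proof.
move=> sv sw; have [mv iv] := sv; have [mw iw] := sw; split; first exact: measurable_funD.
rewrite (_ : (fun p => _) = (fun p => v p ^+ 2 + (2 * (v p * w p) + w p ^+ 2))); last first.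
  by apply/funext => p; ring.
by apply: intgD => //; apply: intgD => //; apply: intgZ; exact: intg_mul.
Qed.

Lemma sqintM f (B : R) v : bmeas f B -> sqint v -> sqint (fun p => f p * v p).
Proof.
move=> bf [mv iv]; have [mf HB] := bf; split; first exact: measurable_funM.
under eq_fun do rewrite exprMn.
apply: (@intgM _ _ _ _ _ (B ^+ 2)) iv; split; first exact: measurable_funX.
move=> p; rewrite normrX lerXn2r ?nnegrE ?HB //; exact: le_trans (normr_ge0 _) (HB p).
Qed.

Lemma loc2D v w : loc2 v -> loc2 w -> loc2 (fun p => v p + w p).
Proof.
move=> [mv lv] [mw lw]; split=> [|G lG cG]; first exact: measurable_funD.
by under eq_fun do rewrite mulrDr; exact: sqintD (lv G lG cG) (lw G lG cG).
Qed.

Lemma loc2M f (B : R) v : bmeas f B -> loc2 v -> loc2 (fun p => f p * v p).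
Proof.
move=> bf [mv lv]; have [mf _] := bf; split=> [|G lG cG]; first exact: measurable_funM.
by under eq_fun do rewrite mulrCA; exact: sqintM bf (lv G lG cG).
Qed.

(** Multiplying by the indicator of the support of [G] exhibits the integrand as a product of two
    square integrable functions. *)
Lemma intg_loc v G : loc2 v -> LB G -> cs G -> intg (fun p => v p * G p).
Proof.
move=> [mv lv] lG [K cK G0]; have mK : measurable (K : set (borel M)).
  by apply: measurable_closedM; exact: compact_closedM.
have l1 : LB (\1_K : M -> R).
  by apply: (@LB_bounded _ _ _ _ 1) => [|p]; [exact: measurable_indic|rewrite indicE ger0_norm ?ler0n // lern1 leq_b1].
have c1 : cs (\1_K : M -> R) by exists K => // p nK; rewrite indicE memNset.
rewrite (_ : (fun p => _) = (fun p => (G p * v p) * \1_K p)); last first.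
  apply/funext => p; rewrite mulrC; have [Kp|nK] := pselect (K p); first by rewrite indicE mem_set // mulr1.
  by rewrite G0 // !mul0r.
apply: (intg_mul (mu := mu)); last exact: sqint_LB hmu _ l1 c1.
by apply: lv => //; exists K.
Qed.

End LocalSquareIntegrable.

Section ResonanceFlux.
Context {R : realType} {n : nat} {sigma0 : R} (M : asymptotically_conic n sigma0).
Variable mu : {measure set (borel M) -> \bar R}.
Hypothesis hmu : is_riemannian_measure (ac_g M) mu.
Variable V : M -> R.
Variable BV : R.
Hypothesis mV : measurable_fun [set: borel M] (V : borel M -> R).
Hypothesis VB : forall p, `|V p| <= BV.
Variable lam : R.
Implicit Types (p : M) (a b c d v f : M -> R) (h k : R -> R) (m : R).
Local Notation g := (ac_g M).
Local Notation Gam := (Gam g).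
Local Notation Lap := (Lap g).
Local Notation I := (I mu).
Local Notation intg := (intg mu).
Local Notation sqint := (sqint mu).
Local Notation loc2 := (loc2 mu).
Local Notation K0 := (@ac_K0 _ _ _ M).
Local Notation R0 := (ac_R0 M).
Local Notation r := (@ac_weight _ _ _ M).

Let sr : smooth_fun r := @ac_weight_smooth _ _ _ M.

Lemma smooth_radial h : smooth1 [set t : R | 0 < t] h -> smooth_fun (fun p => h (r p)).
Proof. by move=> sh; exact: (smooth_fun_comp1 sh (@weight_gt0 _ _ _ M) sr). Qed.

Definition weighted_sqint m v := sqint (fun p => r p `^ m * v p).

Lemma weighted_meas m v : weighted_sqint m v -> measurable_fun [set: borel M] (v : borel M -> R).
Proof.
move=> [mv _]; have [mp _] := LB_smooth (smooth_radial (smooth1_powR (- m))).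
rewrite (_ : v = fun p => r p `^ (- m) * (r p `^ m * v p)); first exact: measurable_funM.
apply/funext => p; rewrite mulrA -powRD ?(gt_eqF (weight_gt0 p)) ?implybT //.
by rewrite addNr powRr0 mul1r.
Qed.

Lemma weighted_mul m v f (B : R) : measurable_fun [set: borel M] (f : borel M -> R) ->
  (forall p, `|f p| <= B * r p `^ m) -> weighted_sqint m v -> sqint (fun p => f p * v p).
Proof.
move=> mf fB wv; have mv := weighted_meas wv; have [_ iv] := wv.
split; first exact: measurable_funM.
apply: intg_le (intgZ (B ^+ 2) iv) _; first by apply: measurable_funX; exact: measurable_funM.
move=> p; rewrite ger0_norm ?sqr_ge0 // !exprMn [leRHS]mulrA; apply: ler_wpM2r (sqr_ge0 _) _ _ _.
rewrite -exprMn -(real_normK (num_real (f p))) lerXn2r ?nnegrE //.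
exact: le_trans (normr_ge0 _) (fB p).
Qed.

Lemma weighted_loc2 m v : weighted_sqint m v -> loc2 v.
Proof.
move=> wv; split=> [|G lG cG]; first exact: weighted_meas wv.
have sp := smooth_radial (smooth1_powR (- m)).
have lGp : LB (fun p => G p * r p `^ (- m)) by lbf.
have cGp : cs (fun p => G p * r p `^ (- m)) by csf.
have [B [_ HB]] := bmeas_LB lGp cGp; have [mG _] := lG.
apply: (weighted_mul (B := B) mG _ wv) => p.
have p0 : 0 < r p `^ m by rewrite powR_gt0 // weight_gt0.
rewrite -ler_pdivrMr //; have := HB p; rewrite normrM powRN (gtr0_norm (_ : 0 < (r p `^ m)^-1)) ?invr_gt0 //.
Qed.

Lemma radial_bounded m h (b0 : R) : smooth1 [set t : R | 0 < t] h -> (forall t, b0 <= t -> h t = 0) ->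
  exists B : R, forall p, `|h (r p)| <= B * r p `^ m.
Proof.
move=> sh h0; have sp := @smooth1_powR R (- m).
pose b' := Num.max 2^-1 b0; have b1 : 2^-1 <= b' by rewrite le_max lexx.
have pos (t : R) : 2^-1 <= t -> 0 < t by move=> H; apply: lt_le_trans H; rewrite invr_gt0.
have ck : {within `[2^-1, b']%classic, continuous (fun t => `|h t| * t `^ (- m))}.
  apply/subspace_continuousP => t; rewrite /mkset in_itv /= => /andP[t1 _].
  apply: cvg_within_filter; apply: cvgM; last exact: smooth1_cont sp (pos t t1).
  by apply: cvg_norm; exact: smooth1_cont sh (pos t t1).
have [t0 _ Ht] := EVT_max b1 ck; exists (`|h t0| * t0 `^ (- m)) => p.
have p0 : 0 < r p `^ m by rewrite powR_gt0 // weight_gt0.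
rewrite -ler_pdivrMr //; have [H|H] := leP b0 (r p).
  by rewrite h0 // normr0 mul0r mulr_ge0 ?powR_ge0.
rewrite -powRN; apply: Ht; rewrite in_itv /= weight_ge le_max.
by rewrite (ltW H) orbT.
Qed.

Lemma sqint_radial m h (a0 b0 D : R) v : radial_cutoff h a0 b0 D -> weighted_sqint m v -> sqint (fun p => h (r p) * v p).
Proof.
move=> [sh _ h0] wv; have [B HB] := radial_bounded m sh h0.
by apply: weighted_mul HB wv; have [] := LB_smooth (smooth_radial sh).
Qed.

(** The operator [f |-> - (Gam r f + f Lap r)] is the formal adjoint of the radial derivative, so
    [c] is the distributional radial derivative of [a] on the end. *)
Definition weak_radial a c := forall f (K : set M), smooth_fun f -> compact K -> K `<=` ~` K0 ->
  (forall p, ~ K p -> f p = 0) ->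
  I (fun p => a p * (Gam r f p + f p * Lap r p)) = - I (fun p => c p * f p).

Section Cut.
Variables (h h1 h2 : R -> R) (Rr L D : R).
Hypothesis ch : radial_cutoff h Rr L D.
Hypothesis RR : R0 < Rr.
Hypothesis RL : Rr <= L.
Hypothesis d1 : forall t : R, 0 < t -> is_derive t 1 h (h1 t).
Hypothesis d2 : forall t : R, 0 < t -> is_derive t 1 h1 (h2 t).
Hypothesis s1 : smooth1 [set t : R | 0 < t] h1.
Hypothesis z1 : forall t, 0 < t -> t < Rr \/ L < t -> h1 t = 0 /\ h2 t = 0.

Let chi p := h (r p).
Let schi : smooth_fun chi.
Proof. by have [sh _ _] := ch; exact: smooth_radial. Qed.
Let sh1 : smooth_fun (fun p => h1 (r p)).
Proof. exact: smooth_radial. Qed.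

(** What the distributional operator gives on [chi a]: the term in [lam] comes from the equation,
    the others are the commutator, in which [c] stands for the radial derivative of [a]. *)
Definition cut_graph a c p := lam * (chi p * a p) - 2 * (h1 (r p) * c p) - Lap chi p * a p.

Lemma Lap_chi p : Lap chi p = h1 (r p) * Lap r p + h2 (r p) * Gam r r p.
Proof.
have oJ : open ([set t | 0 < t] : set R) by exact: open_gt.
exact: (Lap_comp1 g sr oJ (weight_gt0 p) d1 (d2 (weight_gt0 p))).
Qed.

Lemma shell_off p : ~ (Rr <= r p <= L) -> h1 (r p) = 0 /\ h2 (r p) = 0.
Proof.
move=> /negP; rewrite negb_and -!ltNge => /orP[H|H]; apply: z1; rewrite ?weight_gt0 //; by [left|right].
Qed.

Lemma cs_h1 : cs (fun p => h1 (r p)).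
Proof. by exists [set p | Rr <= r p <= L]; [exact: shell_compact|move=> p /shell_off[]]. Qed.

Lemma cs_Lap_chi : cs (Lap chi).
Proof.
exists [set p | Rr <= r p <= L]; first exact: shell_compact.
by move=> p /shell_off[e1 e2]; rewrite Lap_chi e1 e2 !mul0r addr0.
Qed.

(** The equation for [a] is tested against [chi f], and the definition of the radial derivative
    against [2 h1(r) f]; the latter is legitimate because [h1] is supported in the end. The two add
    up to the commutator formula. *)
Lemma weak_cut a c : loc2 a -> loc2 c -> weak_graph g mu V a (fun p => lam * a p) -> weak_radial a c ->
  weak_graph g mu V (fun p => chi p * a p) (cut_graph a c).
Proof.
move=> la lc wa wr f sf cf; have sc := schi; have sh := sh1; have srr := sr.
have ccf : cs (fun p => chi p * f p) by csf.
have scf : smooth_fun (fun p => chi p * f p) by smf.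
pose f0 p := 2 * h1 (r p) * f p.
have sf0 : smooth_fun f0 by rewrite /f0; smf.
have cf0 : cs f0 by rewrite /f0; csf.
pose X p := Gam r f0 p + f0 p * Lap r p.
have sX : smooth_fun X by rewrite /X; smf.
have cX : cs X by rewrite /X; csf.
have sY : smooth_fun (fun p => f p * Lap chi p) by smf.
have cY : cs (fun p => f p * Lap chi p) by csf.
have X_ : I (fun p => a p * X p) = - I (fun p => c p * f0 p).
  apply: (wr f0 [set p | Rr <= r p <= L] sf0); first exact: shell_compact.
    by move=> p /= /andP[H _]; apply: weight_gt_end; exact: lt_le_trans H.
  by move=> p /shell_off[e1 _]; rewrite /f0 e1 mulr0 mul0r.
have pt p : chi p * a p * Hop g V f p = a p * Hop g V (fun p => chi p * f p) p + (a p * X p + - (a p * (f p * Lap chi p))).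
  have s2h : smooth_fun (fun p => 2 * h1 (r p)) by smf.
  have G0 : Gam r f0 p = 2 * h1 (r p) * Gam r f p + f p * (2 * (h2 (r p) * Gam r r p)).
    rewrite (GamMr g r p s2h sf) (GamMr g r p (smooth_fun_cst 2) sh1) (GamC g r (fun=> 2)) Gam_cstl mulr0 addr0.
    by rewrite (Gam_comp1r g r sr (d2 (weight_gt0 p))); ring.
  have G1 : Gam chi f p = h1 (r p) * Gam r f p := Gam_comp1l g f sr (d1 (weight_gt0 p)).
  rewrite /Hop (LapM g p sc sf) /X /f0 -/f0 G0 G1 Lap_chi; ring.
have ia : intg (fun p => a p * Hop g V (fun p => chi p * f p) p).
  by apply: (intg_loc hmu la); [exact: (LB_Hop hmu mV VB scf)|exact: cs_Hop].
have iX : intg (fun p => a p * X p) by apply: (intg_loc hmu la) => //; exact: LB_smooth.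
have iY : intg (fun p => a p * (f p * Lap chi p)) by apply: (intg_loc hmu la) => //; exact: LB_smooth.
have ic : intg (fun p => c p * f0 p) by apply: (intg_loc hmu lc) => //; exact: LB_smooth.
have iaf : intg (fun p => a p * (chi p * f p)) by apply: (intg_loc hmu la) => //; exact: LB_smooth.
rewrite (I_ext _ pt) (JD ia (intgD iX (intgN iY))) (JD iX (intgN iY)) (JN iY) X_ (wa _ scf ccf).
rewrite [in RHS](@I_ext _ _ _ _ _ (fun p => lam * (a p * (chi p * f p)) + (- (c p * f0 p) + - (a p * (f p * Lap chi p))))).
  rewrite (JD (intgZ _ iaf) (intgD (intgN ic) (intgN iY))) (JD (intgN ic) (intgN iY)) !JN //.
  by congr (_ + _); apply: I_ext => p; ring.
by move=> p; rewrite /cut_graph /f0; ring.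
Qed.

Lemma sqint_cut_graph m a c : weighted_sqint m a -> loc2 c -> sqint (cut_graph a c).
Proof.
move=> wa [mc lc]; have [ma la] := weighted_loc2 wa; have sc := schi; have sh := sh1.
have q1 := sqint_radial ch wa.
have q2 := lc _ (LB_smooth sh) cs_h1.
have q3 := la _ (LB_smooth (Lap_smooth hmu sc)) cs_Lap_chi.
have bl (x : R) : bmeas ((fun=> x) : M -> R) `|x| by split => //; exact: measurable_cst.
apply: sqintD; last exact: sqintN.
apply: sqintD; first exact: sqintM (bl lam) q1.
by apply: sqintN; exact: sqintM (bl 2) q2.
Qed.

End Cut.

(** The cut solution [h(r) (a + i b)] is square integrable and weakly in the graph, hence in the
    closure by essential self-adjointness; it may therefore be paired with the weak solutions
    [k(r) a] and [k(r) b]. The terms in [lam] and [Lap chi] cancel, and twice the flux weighted by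
    [h1] remains. *)
Lemma flux_identity a b c d h h1 h2 (m Rr L D : R) :
  essentially_self_adjoint mu (complexify (fun f x => - laplacian g f x + V x * f x) : (M -> R[i]) -> M -> R[i]) ->
  weighted_sqint m a -> weighted_sqint m b -> loc2 c -> loc2 d ->
  weak_graph g mu V a (fun p => lam * a p) -> weak_graph g mu V b (fun p => lam * b p) ->
  weak_radial a c -> weak_radial b d -> R0 < Rr -> Rr <= L -> radial_cutoff h Rr L D ->
  (forall t : R, 0 < t -> is_derive t 1 h (h1 t)) ->
  (forall t : R, 0 < t -> is_derive t 1 h1 (h2 t)) -> smooth1 [set t : R | 0 < t] h1 ->
  (forall t, 0 < t -> t < Rr \/ L < t -> h1 t = 0 /\ h2 t = 0) ->
  intg (fun p => h1 (r p) * (a p * d p - b p * c p)) /\ I (fun p => h1 (r p) * (a p * d p - b p * c p)) = 0.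
Proof.
move=> hH wa wb lc ld ga gb ra rb RR RL ch d1 d2 s1 z1.
have [sh hD h0] := ch.
have L0 : 0 < L by apply: lt_le_trans RL; apply: lt_trans RR; apply: lt_trans (ac_R0_gt1 M).
(* A second cutoff, equal to 1 wherever [h] lives, because [a] and [b] are themselves not square
   integrable; its own derivatives meet only the region where [h] vanishes. *)
pose k (t : R) := 1 + (-1) * step (1 * (t - (L + 1))).
have k_1 (t : R) : t <= L + 1 -> k t = 1 by move=> H; rewrite /k mul1r step0 ?mulr0 ?addr0 // subr_le0.
have ck : radial_cutoff k (L + 1) (L + 2) 1.
  split => // [|t H]; last by rewrite /k mul1r step1 ?mulr1 ?subrr // lerBrDl; move: H; lra.
  have o : open ([set t | 0 < t] : set R) by exact: open_gt.
  apply: smooth1D => //; first exact: smooth1_cst.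
  by apply: smooth1M => //; [exact: smooth1_cst|exact: smooth1_step_affine].
have L10 : 0 < L + 1 by rewrite addr_gt0.
have L12 : L + 1 <= L + 2 by rewrite lerD2l (ler_nat R 1 2).
have RL1 : R0 < L + 1 by apply: lt_le_trans RR _; apply: le_trans RL _; rewrite lerDl.
have [k1 [k2 [dk1 dk2 sk1 zk1]]] := radial_cutoff_derivs L10 L12 ck.
have la := weighted_loc2 wa; have lb := weighted_loc2 wb.
have qa := sqint_radial ch wa; have qb := sqint_radial ch wb.
have ka := sqint_radial ck wa; have kb := sqint_radial ck wb.
have Fa := sqint_cut_graph ch RR d1 d2 s1 z1 wa lc; have Fb := sqint_cut_graph ch RR d1 d2 s1 z1 wb ld.
have Ga := sqint_cut_graph ck RL1 dk1 dk2 sk1 zk1 wa lc; have Gb := sqint_cut_graph ck RL1 dk1 dk2 sk1 zk1 wb ld.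
have W1 := weak_cut ch RR d1 d2 s1 z1 la lc ga ra.
have W2 := weak_cut ch RR d1 d2 s1 z1 lb ld gb rb.
have W3 := weak_cut ck RL1 dk1 dk2 sk1 zk1 la lc ga ra.
have W4 := weak_cut ck RL1 dk1 dk2 sk1 zk1 lb ld gb rb.
have ag := weak_adjoint hmu mV VB qa qb Fa Fb W1 W2.
have iu : in_L2 mu setT (fun p => (h (r p) * a p) +i* (h (r p) * b p))%C by apply/in_L2_sqint; split.
have jf : in_L2 mu setT (fun p => (cut_graph h h1 a c p) +i* (cut_graph h h1 b d p))%C.
  by apply/in_L2_sqint; split.
have [g1 g2] := esa_graph_limit hmu mV VB hH iu jf ag.
have E1 := graph_limit_pair hmu mV VB kb Gb qa Fa W4 g1.
have E2 := graph_limit_pair hmu mV VB ka Ga qb Fb W3 g2.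
have i1 := intg_mul kb Fa; have i2 := intg_mul ka Fb; have i3 := intg_mul Gb qa; have i4 := intg_mul Ga qb.
have iS := intgD (intgD i1 (intgN i2)) (intgD (intgN i3) i4).
have E : I (fun p => (k (r p) * b p * cut_graph h h1 a c p + - (k (r p) * a p * cut_graph h h1 b d p)) +
   (- (cut_graph k k1 b d p * (h (r p) * a p)) + cut_graph k k1 a c p * (h (r p) * b p))) = 0.
  rewrite (JD (intgD i1 (intgN i2)) (intgD (intgN i3) i4)) (JD i1 (intgN i2)) (JD (intgN i3) i4).
  by rewrite (JN i2) (JN i3) E1 E2; ring.
have pt p : h1 (r p) * (a p * d p - b p * c p) = 2^-1 * (
   (k (r p) * b p * cut_graph h h1 a c p + - (k (r p) * a p * cut_graph h h1 b d p)) +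
   (- (cut_graph k k1 b d p * (h (r p) * a p)) + cut_graph k k1 a c p * (h (r p) * b p))).
  rewrite /cut_graph; have rp0 := weight_gt0 p.
  have [rL|Lr] := leP (r p) L.
    have r1 : r p < L + 1 by apply: le_lt_trans rL _; rewrite ltrDl.
    rewrite (Lap_chi dk1 dk2) (k_1 (r p) (ltW r1)).
    by have [-> ->] := zk1 _ rp0 (or_introl r1); field.
  rewrite (h0 _ (ltW Lr)) (Lap_chi d1 d2) //.
  by have [-> ->] := z1 _ rp0 (or_intror Lr); field.
rewrite (funext pt).
by split; [exact: intgZ|rewrite (JZ _ iS) E mulr0].
Qed.

End ResonanceFlux.

(** * Decay of resonances from the vanishing of the flux *)

Section StepMonotone.
Context {R : realType}.

Lemma step_deriv_ge0 (t d : R) : is_derive t 1 (@step R) d -> 0 <= d.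
Proof.
move=> dS; have F1 (x : R) := @flat_derive R 1 x.
set f' := flat (flat_next 1) in F1.
have f'0 x : 0 <= f' x.
  rewrite /f' /flat; case: ifP => // _; rewrite mulr_ge0 ?expR_ge0 //.
  by rewrite /flat_next derivC subr0 mulr1 hornerXn sqr_ge0.
have dr : is_derive t 1 (fun x : R => flat 1 (1 - x)) (f' (1 - t) * -1).
  apply: is_derive_compf (F1 _) _.
  by apply: is_derive_eqf (is_deriveBf (is_derive_cst (1 : R) t 1) (is_derive_id t 1)) _; rewrite sub0r.
have nz : flat 1 t + flat 1 (1 - t) != 0 by rewrite gt_eqF // step_den.
have dD := is_deriveMf (F1 t) (is_deriveVf (f := fun x : R => flat 1 x + flat 1 (1 - x)) nz (is_deriveDf (F1 t) dr)).
rewrite -(@derive_val _ _ _ _ _ _ _ dS) (@derive_val _ _ _ _ _ _ _ dD).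
have p1 := step_den t; have q1 := flat1_ge0 t; have q2 := flat1_ge0 (1 - t).
have -> : flat 1 t * (- (flat 1 t + flat 1 (1 - t))^-1 ^+ 2 * (f' t + f' (1 - t) * -1)) +
   (flat 1 t + flat 1 (1 - t))^-1 * f' t =
   (f' t * flat 1 (1 - t) + flat 1 t * f' (1 - t)) / (flat 1 t + flat 1 (1 - t)) ^+ 2 by field.
by rewrite divr_ge0 ?sqr_ge0 // addr_ge0 // mulr_ge0.
Qed.

(** A decreasing radial cutoff whose slope is comparable to [t^(b - 1)] up to the radius [L] and
    dominated by it everywhere, with a constant independent of [L]. The sign of the slope is what
    turns the flux identity into an estimate. *)
Lemma power_cutoff (b Rr : R) : 0 < b -> 1 <= Rr -> exists2 C : R, 0 <= C & forall L : R, Rr + 1 <= L ->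
  exists (h h1 h2 : R -> R) (D : R), [/\ radial_cutoff h Rr (2 * L) D,
    (forall t : R, 0 < t -> is_derive t 1 h (h1 t)) /\ (forall t : R, 0 < t -> is_derive t 1 h1 (h2 t)),
    smooth1 [set t : R | 0 < t] h1,
    (forall t, 0 < t -> t < Rr \/ 2 * L < t -> h1 t = 0 /\ h2 t = 0) &
    forall t, 0 < t -> [/\ 0 <= - h1 t, - h1 t <= C * t `^ (b - 1) & Rr + 1 <= t <= L -> b * t `^ (b - 1) <= - h1 t]].
Proof.
move=> b0 Rr1; have [T1 [T2 [S [S0 dT1 _ TS Tz]]]] := @step_bounds R.
have T0 t : 0 <= T1 t by exact: step_deriv_ge0 (dT1 t).
exists (S * (2 * 2 `^ b) + S * (Rr + 1) + b).
  by rewrite addr_ge0 ?(ltW b0) // addr_ge0 // mulr_ge0 ?mulr_ge0 ?powR_ge0 // addr_ge0 // ltW // (lt_le_trans ltr01).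
move=> L RL; have L0 : 0 < L by lra. have Lv0 : 0 < L^-1 by rewrite invr_gt0.
(* Large enough that [D - t^b] stays nonnegative on the support of [h], so that the cutoff at scale
   [L] also contributes with the right sign. *)
pose D := (2 * L) `^ b.
pose h (t : R) := (1 + (-1) * step (L^-1 * (t - L))) * (D + (-1) * (step (1 * (t - Rr)) * t `^ b)).
have etaL t : t <= L -> step (L^-1 * (t - L)) = 0.
  by move=> H; rewrite step0 // mulr_ge0_le0 ?(ltW Lv0) // subr_le0.
have etaR t : 2 * L <= t -> step (L^-1 * (t - L)) = 1.
  by move=> H; rewrite step1 // mulrC ler_pdivlMr // mul1r; lra.
have ch : radial_cutoff h Rr (2 * L) D.
  split=> [|t tR|t tL]; last 2 first.
  - by rewrite /h etaL ?mul1r ?step0 ?mul0r ?mulr0 ?addr0 ?mul1r ?subr_le0 //; lra.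
  - by rewrite /h etaR // mulr1 subrr mul0r.
  have o : open ([set t | 0 < t] : set R) by exact: open_gt.
  apply: smooth1M => //.
    by apply: smooth1D => //; [exact: smooth1_cst|apply: smooth1M => //; [exact: smooth1_cst|exact: smooth1_step_affine]].
  apply: smooth1D => //; first exact: smooth1_cst.
  apply: smooth1M => //; first exact: smooth1_cst.
  by apply: smooth1M => //; [exact: smooth1_step_affine|exact: smooth1_powR].
have R0 : 0 < Rr by lra. have R2 : Rr <= 2 * L by lra.
have [h1 [h2 [d1 d2 s1 z1]]] := radial_cutoff_derivs R0 R2 ch.
exists h, h1, h2, D; split => // t t0.
have dst (s a : R) : is_derive t 1 (fun t => step (s * (t - a))) (s * T1 (s * (t - a))).
  apply: is_derive_eqf (is_derive_compf (dT1 _) _) (mulrC _ _).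
  by apply: is_derive_eqf (is_deriveCf s (is_deriveBf (is_derive_id t 1) (is_derive_cst a t 1))) _; rewrite subr0 mulr1.
set et := step (L^-1 * (t - L)); set sg := step (1 * (t - Rr)).
have hE : - h1 t = L^-1 * T1 (L^-1 * (t - L)) * (D - sg * t `^ b) +
    (1 - et) * (T1 (1 * (t - Rr)) * t `^ b + sg * (b * t `^ (b - 1))).
  have dh := is_deriveMf (is_deriveDf (is_derive_cst (1 : R) t 1) (is_deriveCf (-1) (dst L^-1 L)))
    (is_deriveDf (is_derive_cst D t 1) (is_deriveCf (-1) (is_deriveMf (dst 1 Rr) (is_derive_powR b t0)))).
  rewrite -(@derive_val _ _ _ _ _ _ _ (d1 t t0)) (@derive_val _ _ _ _ _ _ _ dh) -/et -/sg.
  by rewrite /cst; ring.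
have tb0 : 0 <= t `^ b by exact: powR_ge0. have tb1 : 0 <= t `^ (b - 1) by exact: powR_ge0.
have tbE : t `^ b = t * t `^ (b - 1).
  by rewrite -{2}(powRr1 (ltW t0)) -powRD ?(gt_eqF t0) ?implybT // addrC subrK.
have sg0 : 0 <= sg by exact: step_ge0. have sg1 : sg <= 1 by exact: step_le1.
have et0 : 0 <= et by exact: step_ge0. have et1 : et <= 1 by exact: step_le1.
have A0 : 0 <= L^-1 * T1 (L^-1 * (t - L)) * (D - sg * t `^ b).
  have [H|H] := leP t (2 * L); last first.
    rewrite (Tz _ (or_intror _)).1 ?mulr0 ?mul0r //.
    by rewrite mulrC ltr_pdivlMr // mul1r; lra.
  rewrite mulr_ge0 ?mulr_ge0 ?(ltW Lv0) // subr_ge0; apply: (@le_trans _ _ (t `^ b)); first by rewrite ler_piMl.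
  by rewrite ge0_ler_powR ?nnegrE ?(ltW b0) ?(ltW t0) // mulr_ge0 // ltW.
have B1 : 0 <= T1 (1 * (t - Rr)) * t `^ b by rewrite mulr_ge0.
have B2 : 0 <= b * t `^ (b - 1) by rewrite mulr_ge0 // ltW.
have B3 : 0 <= sg * (b * t `^ (b - 1)) by rewrite mulr_ge0.
have B0 := addr_ge0 B1 B3.
rewrite hE; split.
- by rewrite addr_ge0 // mulr_ge0 // subr_ge0.
- have U1 : L^-1 * T1 (L^-1 * (t - L)) * (D - sg * t `^ b) <= S * (2 * 2 `^ b) * t `^ (b - 1).
    have [H1|H1] := ltP t L.
      rewrite (Tz _ (or_introl _)).1 ?mulr0 ?mul0r ?mulr_ge0 ?powR_ge0 //.
      by rewrite pmulr_rlt0 // subr_lt0.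
    have [H2|H2] := leP t (2 * L); last first.
      rewrite (Tz _ (or_intror _)).1 ?mulr0 ?mul0r ?mulr_ge0 ?powR_ge0 //.
      by rewrite mulrC ltr_pdivlMr // mul1r; lra.
    have DE : D <= 2 `^ b * t `^ b.
      rewrite -powRM ?(ltW t0) // /D ge0_ler_powR ?nnegrE ?(ltW b0) ?mulr_ge0 ?(ltW L0) ?(ltW t0) //.
      by rewrite ler_wpM2l.
    have LE : L^-1 <= 2 * t^-1 by rewrite ler_pdivlMr // mulrC ler_pdivrMr.
    have Dp : 0 <= D - sg * t `^ b.
      rewrite subr_ge0; apply: (@le_trans _ _ (t `^ b)); first by rewrite ler_piMl.
      by rewrite ge0_ler_powR ?nnegrE ?(ltW b0) ?(ltW t0) // mulr_ge0 // ltW.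
    have -> : S * (2 * 2 `^ b) * t `^ (b - 1) = (2 * t^-1 * S) * (2 `^ b * t `^ b).
      by rewrite tbE; field; rewrite gt_eqF.
    apply: ler_pM; rewrite ?mulr_ge0 ?(ltW Lv0) //.
      apply: ler_pM; rewrite ?(ltW Lv0) //; exact: le_trans (ler_norm _) (TS _).1.
    by apply: le_trans DE; rewrite gerBl mulr_ge0.
  have U2 : T1 (1 * (t - Rr)) * t `^ b <= S * (Rr + 1) * t `^ (b - 1).
    have [H|H] := leP t (Rr + 1); last first.
      rewrite (Tz _ (or_intror _)).1 ?mul0r ?mulr_ge0 // ?addr_ge0 ?(ltW R0) //.
      by rewrite mul1r ltrBrDl.
    rewrite tbE mulrA; apply: ler_wpM2r => //; apply: ler_pM; rewrite ?(ltW t0) //.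
    exact: le_trans (ler_norm _) (TS _).1.
  have U3 : (1 - et) * (T1 (1 * (t - Rr)) * t `^ b + sg * (b * t `^ (b - 1))) <=
      T1 (1 * (t - Rr)) * t `^ b + b * t `^ (b - 1).
    apply: (@le_trans _ _ (T1 (1 * (t - Rr)) * t `^ b + sg * (b * t `^ (b - 1)))).
      by rewrite ler_piMl // gerBl.
    by rewrite lerD2l ler_piMl.
  rewrite !mulrDl; move: U1 U2 U3; lra.
- move=> /andP[H1 H2]; have sgE : sg = 1 by rewrite /sg step1 // mul1r lerBrDl.
  rewrite /et etaL // subr0 mul1r; move: A0 B1; rewrite sgE mul1r; lra.
Qed.

End StepMonotone.

Section ResonanceDecay.
Context {R : realType} {n : nat} {sigma0 : R} (M : asymptotically_conic n sigma0).
Variable mu : {measure set (borel M) -> \bar R}.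
Hypothesis hmu : is_riemannian_measure (ac_g M) mu.
Variable V : M -> R.
Variable BV : R.
Hypothesis mV : measurable_fun [set: borel M] (V : borel M -> R).
Hypothesis VB : forall p, `|V p| <= BV.
Variable lam : R.
Implicit Types (p : M) (a b c d v f F : M -> R) (m : R).
Local Notation g := (ac_g M).
Local Notation I := (I mu).
Local Notation intg := (intg mu).
Local Notation sqint := (sqint mu).
Local Notation weighted_sqint := (weighted_sqint mu).
Local Notation R0 := (ac_R0 M).
Local Notation r := (@ac_weight _ _ _ M).

Let sr : smooth_fun r := @ac_weight_smooth _ _ _ M.

Definition inner_ind (k : R) p : R := (r p <= k)%R%:R.

Lemma inner_ind_meas k : bmeas (inner_ind k) 1.
Proof.
split; last by move=> p; rewrite /inner_ind ger0_norm ?ler0n // lern1 leq_b1.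
have mA : measurable ([set p | r p <= k] : set (borel M)).
  apply: measurable_closedM; apply: (@closed_comp _ _ r [set t | t <= k]); last exact: closed_le.
  by move=> p _; exact: smooth_fun_cont sr p.
rewrite (_ : inner_ind k = \1_[set p | r p <= k]); first exact: measurable_indic.
by apply/funext => p; rewrite /inner_ind indicE; congr (_%:R); apply/esym; case: (boolP (_ <= _)) => H; [rewrite mem_set|rewrite memNset //=; exact/negP].
Qed.

(** Fatou's lemma along the exhaustion by [r <= k]; the truncations are eventually equal to [F] at
    each point. *)
Lemma intg_exhaust F (B : R) : measurable_fun [set: borel M] (F : borel M -> R) -> (forall p, 0 <= F p) ->
  (forall k : nat, intg (fun p => inner_ind k%:R p * F p) /\ I (fun p => inner_ind k%:R p * F p) <= B) -> intg F.
Proof.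
move=> mF F0 HB; apply: intg_ge0 => //.
pose G (k : nat) p := (inner_ind k%:R p * F p)%:E.
have FE p : (F p)%:E = limn_einf (G ^~ p).
  rewrite limn_einf_lim; apply/esym/cvg_lim => //; apply: cvg_near_cst.
  have [k Hk] := exists_nat_gt (r p).
  near=> j; rewrite /einfs; apply/eqP; rewrite eq_le; apply/andP; split.
    apply: ereal_inf_lbound; exists j => //=; rewrite /G /inner_ind.
    rewrite (_ : r p <= j%:R) ?mul1r //; apply: le_trans (ltW Hk) _; rewrite ler_nat.
    by near: j; exact: nbhs_infty_ge.
  apply: le_ereal_inf_tmp => _ [i /= ji <-]; rewrite /G /inner_ind.
  rewrite (_ : r p <= i%:R) ?mul1r //; apply: le_trans (ltW Hk) _; rewrite ler_nat.
  by apply: leq_trans ji; near: j; exact: nbhs_infty_ge.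
under eq_integral do rewrite FE.
apply: (@le_lt_trans _ _ B%:E); last exact: ltry.
have fat := @fatou _ _ _ mu setT measurableT G.
apply: le_trans (fat _ _) _.
- by move=> k; apply/measurable_EFinP; exact: intg_meas (HB k).1.
- by move=> k p _; rewrite lee_fin mulr_ge0 // ler0n.
rewrite limn_einf_lim; apply: lime_le; first exact: is_cvg_einfs.
apply: nearW => k; apply: le_trans (ereal_inf_lbound _) _; first by exists k => //=.
by rewrite /G (J_int (HB k).1) lee_fin (HB k).2.
Unshelve. all: by end_near. Qed.

(** With radial derivatives [e1 - eps kappa b] and [e2 + eps kappa a] the flux density is
    [eps kappa (a^2 + b^2) + a e2 - b e1]. Its integral against a slope of size [r^(2 s - 1)]
    vanishes, so [kappa^2 (a^2 + b^2)] is controlled by [e1^2 + e2^2] in that weight, uniformly in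
    the outer radius. Only [eps^2 = 1] matters, which treats both radiation conditions at once. *)
Lemma resonance_decay a b e1 e2 (kappa eps s m : R) :
  essentially_self_adjoint mu (complexify (fun f x => - laplacian g f x + V x * f x) : (M -> R[i]) -> M -> R[i]) ->
  0 < kappa -> eps ^+ 2 = 1 -> 0 < s ->
  weighted_sqint m a -> weighted_sqint m b ->
  weighted_sqint (- (1 / 2) + s) e1 -> weighted_sqint (- (1 / 2) + s) e2 ->
  weak_graph g mu V a (fun p => lam * a p) -> weak_graph g mu V b (fun p => lam * b p) ->
  weak_radial mu a (fun p => e1 p - eps * kappa * b p) -> weak_radial mu b (fun p => e2 p + eps * kappa * a p) ->
  weighted_sqint (- (1 / 2) + s) a /\ weighted_sqint (- (1 / 2) + s) b.
Proof.
move=> hH k0 eps1 s0 wa wb we1 we2 ga gb ra rb.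
have bl (x : R) : bmeas ((fun=> x) : M -> R) `|x| by split => //; exact: measurable_cst.
have la := weighted_loc2 wa; have lb := weighted_loc2 wb.
have lc : loc2 mu (fun p => e1 p - eps * kappa * b p).
  under eq_fun do rewrite -mulNr.
  exact: loc2D (weighted_loc2 we1) (loc2M (bl _) lb).
have ld : loc2 mu (fun p => e2 p + eps * kappa * a p).
  exact: loc2D (weighted_loc2 we2) (loc2M (bl _) la).
pose Rr := R0 + 1; have R01 := ac_R0_gt1 M.
have RR : R0 < Rr by rewrite ltrDl.
have Rr1 : 1 <= Rr by rewrite /Rr; lra.
have s20 : 0 < 2 * s by rewrite mulr_gt0.
have [C C0 HC] := power_cutoff s20 Rr1.
set ms := - (1 / 2) + s in we1 we2 *.
pose W p := r p `^ (2 * s - 1).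
have WE p : W p = r p `^ ms ^+ 2.
  by rewrite /W expr2 -powRD ?(gt_eqF (weight_gt0 p)) ?implybT //; congr (_ `^ _); rewrite /ms; field.
have [me1 ie1] := we1; have [me2 ie2] := we2.
pose Q p := W p * (a p ^+ 2 + b p ^+ 2).
pose P p := (r p `^ ms * e1 p) ^+ 2 + (r p `^ ms * e2 p) ^+ 2.
have iP : intg P by exact: intgD.
have ma := weighted_meas wa; have mb := weighted_meas wb.
have [mW _] : LB W by apply: LB_smooth; exact: (smooth_radial (smooth1_powR _)).
have mQ : measurable_fun [set: borel M] (Q : borel M -> R).
  by apply: measurable_funM => //; apply: measurable_funD; exact: measurable_funX.
have Q0 p : 0 <= Q p by rewrite mulr_ge0 ?powR_ge0 // addr_ge0 // sqr_ge0.
have outer L : Rr + 1 <= L -> intg (fun p => shell r (Rr + 1) L p * Q p) /\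
    I (fun p => shell r (Rr + 1) L p * Q p) <= (2 * s * kappa ^+ 2)^-1 * (C * I P).
  move=> RL; have [h [h1 [h2 [D [ch [d1 d2] s1 z1 bd]]]]] := HC L RL.
  have R2L : Rr <= 2 * L by lra.
  have [iX X0] := flux_identity hmu mV VB hH wa wb lc ld ga gb ra rb RR R2L ch d1 d2 s1 z1.
  pose X p := h1 (r p) * (a p * (e2 p + eps * kappa * a p) - b p * (e1 p - eps * kappa * b p)).
  (* The multiple [2 eps / kappa] of the flux makes the difference of the two sides a sum of
     squares; this flux has zero integral. *)
  have iK := intgZ (2 * s)^-1 (intgD (intgZ (- (2 * eps / kappa)) iX) (intgZ (kappa ^- 2 * C) iP)).
  have pt p : shell r (Rr + 1) L p * Q p <= (2 * s)^-1 * (- (2 * eps / kappa) * X p + kappa ^- 2 * C * P p).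
    have [q1 q2 q3] := bd _ (weight_gt0 p); rewrite /X.
    have E2 : 0 <= e1 p ^+ 2 + e2 p ^+ 2 by rewrite addr_ge0 ?sqr_ge0.
    have A2 : 0 <= a p ^+ 2 + b p ^+ 2 by rewrite addr_ge0 ?sqr_ge0.
    have PE : P p = W p * (e1 p ^+ 2 + e2 p ^+ 2) by rewrite /P WE; ring.
    rewrite ler_pdivlMl //; apply: (@le_trans _ _ (- h1 (r p) * (a p ^+ 2 + b p ^+ 2))).
      rewrite /Q mulrCA mulrA mulrA mulrC [leRHS]mulrC; apply: ler_wpM2l A2 _ _ _.
      rewrite /shell; case: (boolP (_ && _)) => H; last by rewrite mul0r mul0r.
      by rewrite mul1r; exact: q3.
    have h3 : kappa ^- 2 * (- h1 (r p) * (e1 p ^+ 2 + e2 p ^+ 2)) <= kappa ^- 2 * C * P p.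
      rewrite PE -[leRHS]mulrA; apply: ler_wpM2l; first by rewrite invr_ge0 sqr_ge0.
      by rewrite [leRHS]mulrA; exact: ler_wpM2r.
    have h4 := lerD (lexx (- (2 * eps / kappa) * X p)) h3; rewrite /X in h4.
    apply: le_trans h4; rewrite -subr_ge0.
    have -> : - (2 * eps / kappa) * (h1 (r p) * (a p * (e2 p + eps * kappa * a p) - b p * (e1 p - eps * kappa * b p))) +
       kappa ^- 2 * (- h1 (r p) * (e1 p ^+ 2 + e2 p ^+ 2)) - - h1 (r p) * (a p ^+ 2 + b p ^+ 2) =
       - h1 (r p) * ((a p * 1 + eps / kappa * e2 p) ^+ 2 + (b p - eps / kappa * e1 p) ^+ 2) +
       h1 (r p) * ((eps ^+ 2 - 1) * ((e1 p ^+ 2 + e2 p ^+ 2) / kappa ^+ 2 - 2 * (a p ^+ 2 + b p ^+ 2))).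
      by field; rewrite gt_eqF.
    by rewrite eps1 subrr mul0r mulr0 addr0 mulr_ge0 // addr_ge0 ?sqr_ge0.
  have [msh _] := shell_meas sr (Rr + 1) L.
  have iS : intg (fun p => shell r (Rr + 1) L p * Q p).
    apply: intg_le iK _; first exact: measurable_funM.
    by move=> p; rewrite ger0_norm ?pt // mulr_ge0 // ler0n.
  split => //; apply: le_trans (J_le iS iK pt) _.
  rewrite (JZ _ (intgD (intgZ _ iX) (intgZ _ iP))) (JD (intgZ _ iX) (intgZ _ iP)) (JZ _ iX) (JZ _ iP) X0.
  by rewrite le_eqVlt; apply/orP; left; apply/eqP; field; rewrite !gt_eqF.
have [ma2 ia2] := wa; have [mb2 ib2] := wb.
(* On the bounded region [r <= Rr + 1] all powers of [r] are comparable, so the a priori weight of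
   exponent [m] suffices there. *)
have [B HB] : exists B : R, forall p, r p <= Rr + 1 -> r p `^ ms <= B * r p `^ m.
  pose h (t : R) := t `^ ms * (1 + (-1) * step (1 * (t - (Rr + 1)))).
  have sh : smooth1 [set t : R | 0 < t] h.
    have o : open ([set t | 0 < t] : set R) by exact: open_gt.
    apply: smooth1M => //; first exact: smooth1_powR.
    by apply: smooth1D => //; [exact: smooth1_cst|apply: smooth1M => //; [exact: smooth1_cst|exact: smooth1_step_affine]].
  have h0 (t : R) : Rr + 1 + 1 <= t -> h t = 0.
    by move=> H; rewrite /h step1 ?mulr1 ?subrr ?mulr0 // mul1r lerBrDl addrC; move: H; lra.
  have [B HB] := radial_bounded M m sh h0; exists B => p H; apply: le_trans (HB p).
  by rewrite /h step0 ?mulr0 ?addr0 ?mulr1 ?ler_norm // mul1r subr_le0.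
pose Pm p := B ^+ 2 * ((r p `^ m * a p) ^+ 2 + (r p `^ m * b p) ^+ 2).
have iPm : intg Pm by apply: intgZ; exact: intgD.
have iQ : intg Q.
  apply: (@intg_exhaust _ (I Pm + (2 * s * kappa ^+ 2)^-1 * (C * I P))) => // k.
  have RL : Rr + 1 <= Rr + 1 + k%:R by rewrite lerDl.
  have [io Io] := outer _ RL; have [mi _] := inner_ind_meas k%:R.
  have pt p : inner_ind k%:R p * Q p <= Pm p + shell r (Rr + 1) (Rr + 1 + k%:R) p * Q p.
    have Pm0 : 0 <= Pm p by rewrite mulr_ge0 ?sqr_ge0 // addr_ge0 ?sqr_ge0.
    have S0 : 0 <= shell r (Rr + 1) (Rr + 1 + k%:R) p * Q p by rewrite mulr_ge0 // ler0n.
    rewrite /inner_ind; case: (boolP (r p <= k%:R)) => H; last by rewrite mul0r addr_ge0.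
    rewrite mul1r; have [H1|H1] := leP (r p) (Rr + 1).
      apply: ler_wpDr => //; rewrite /Q WE /Pm !exprMn -mulrDr mulrA; apply: ler_wpM2r.
        by rewrite addr_ge0 ?sqr_ge0.
      rewrite -exprMn lerXn2r ?nnegrE ?powR_ge0 ?HB //.
      exact: le_trans (powR_ge0 _ _) (HB p H1).
    rewrite /shell (ltW H1) (_ : r p <= Rr + 1 + k%:R) ?mul1r ?lerDr //.
    by apply: le_trans H _; rewrite lerDr; lra.
  have ii : intg (fun p => inner_ind k%:R p * Q p).
    apply: intg_le (intgD iPm io) _; first exact: measurable_funM.
    by move=> p; rewrite ger0_norm ?pt // mulr_ge0 // ler0n.
  split => //; apply: le_trans (J_le ii (intgD iPm io) pt) _.
  by rewrite (JD iPm io) lerD2l.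
have [mp _] : LB (fun p => r p `^ ms) by apply: LB_smooth; exact: (smooth_radial (smooth1_powR _)).
split; (split; first exact: measurable_funM); apply: intg_le iQ _; try (by apply: measurable_funX; exact: measurable_funM).
  by move=> p; rewrite ger0_norm ?sqr_ge0 // exprMn /Q WE ler_wpM2l ?sqr_ge0 // lerDl sqr_ge0.
by move=> p; rewrite ger0_norm ?sqr_ge0 // exprMn /Q WE ler_wpM2l ?sqr_ge0 // lerDr sqr_ge0.
Qed.

End ResonanceDecay.

Section Resonances.
Local Open Scope complex_scope.
Context {R : realType} {n : nat} {sigma0 : R} (M : asymptotically_conic n sigma0).
Variable mu : {measure set (borel M) -> \bar R}.
Hypothesis hmu : is_riemannian_measure (ac_g M) mu.
Variable V : M -> R.
Variable BV : R.
Hypothesis mV : measurable_fun [set: borel M] (V : borel M -> R).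
Hypothesis VB : forall p, `|V p| <= BV.
Implicit Types (p : M) (f : M -> R) (u v w : M -> R[i]) (m : R).
Local Notation g := (ac_g M).
Local Notation Gam := (Gam g).
Local Notation Lap := (Lap g).
Local Notation I := (I mu).
Local Notation weighted_sqint := (weighted_sqint mu).
Local Notation K0 := (@ac_K0 _ _ _ M).
Local Notation R0 := (ac_R0 M).
Local Notation r := (@ac_weight _ _ _ M).
Local Notation echart c := (end_chart K0 (@ac_rad _ _ _ M) (@ac_ang _ _ _ M) (@ac_endpt _ _ _ M) c).
Local Notation D := (~` K0).

Let sr : smooth_fun r := @ac_weight_smooth _ _ _ M.

(** By the product rule the formal adjoint is [- d_r f] minus [f] times the logarithmic radial
    derivative of the volume density, and the latter is [Lap r] by [Lap_th_vol]. *)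
Lemma radial_adjointE f p : smooth_fun f -> D p ->
  radial_adjoint f p = - (Gam r f p + f p * Lap r p).
Proof.
move=> sf nk; have [ac dq] := chart_atP (ac_ang p).
rewrite /radial_adjoint; set c := chart_at (ac_ang p) in ac dq *.
have aC := ac_end_atlas ac; have dp : cdom (echart c) p by split.
have ip : cimg (echart c) (cmap (echart c) p) := cimg_map dp.
have thE z : cimg (echart c) z -> r (cinv (echart c) z) = z 0 ord0 by exact: weight_cinv.
have gE z i : cimg (echart c) z -> g (echart c) z ord0 i = (i == ord0)%:R by exact: echart_g0.
rewrite (Gam_th aC sr thE gE sf dp) (Lap_th_vol hmu aC sr thE gE dp).
have v0 := vol_gt0 g aC ip.
have fE : (f \o cinv (echart c)) (cmap (echart c) p) = f p by rewrite /comp (cmapK aC dp).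
rewrite (partialM ip ord0 (vol_smooth g aC) (sf _ aC)) fE; congr (- _).
by field; rewrite gt_eqF.
Qed.

Lemma open_end : open D.
Proof. by apply: closed_openC; apply: compact_closedM; exact: ac_K0_compact. Qed.

Lemma in_H0_weighted m u : in_H0 mu m setT u <-> weighted_sqint m (ReF u) /\ weighted_sqint m (ImF u).
Proof.
have E1 : ReF (fun x => (r x `^ m)%:C * u x) = fun x => r x `^ m * ReF u x.
  by apply/funext => x; rewrite /ReF; case: (u x) => a b /=; rewrite mul0r subr0.
have E2 : ImF (fun x => (r x `^ m)%:C * u x) = fun x => r x `^ m * ImF u x.
  by apply/funext => x; rewrite /ImF; case: (u x) => a b /=; rewrite mul0r addr0.
by have := in_L2_sqint mu (fun x => (r x `^ m)%:C * u x); rewrite E1 E2.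
Qed.

Lemma in_H0_end_weighted m v : in_H0 mu m D v ->
  weighted_sqint m (ReF v \_ D) /\ weighted_sqint m (ImF v \_ D).
Proof.
move=> [m1 m2 fin]; have mD : measurable (D : set (borel M)) by apply: measurable_openM; exact: open_end.
pose v' x : R[i] := (ReF v \_ D) x +i* (ImF v \_ D) x.
suff : in_H0 mu m setT v' by move/in_H0_weighted.
have E1 : ReF (fun x => (r x `^ m)%:C * v' x) = ReF (fun x => (r x `^ m)%:C * v x) \_ D.
  apply/funext => x; rewrite /ReF /= /patch; case: ifP => _; last by rewrite !(mulr0, mul0r, subr0).
  by rewrite /ReF /ImF; case: (v x) => a b /=.
have E2 : ImF (fun x => (r x `^ m)%:C * v' x) = ImF (fun x => (r x `^ m)%:C * v x) \_ D.
  apply/funext => x; rewrite /ImF /= /patch; case: ifP => _; last by rewrite !(mulr0, mul0r, addr0).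
  by rewrite /ReF /ImF; case: (v x) => a b /=.
split; rewrite ?E1 ?E2; try exact: (measurable_restrictT _ mD).1.
apply: le_lt_trans fin; rewrite le_eqVlt; apply/orP; left; apply/eqP.
rewrite /L2norm2 E1 E2 [RHS]integral_mkcond; apply: eq_integral => x _.
by rewrite /patch; case: ifP => // _; rewrite expr0n addr0.
Qed.

Lemma radial_adjoint0 p : radial_adjoint (fun=> 0) p = 0 :> R.
Proof.
rewrite /radial_adjoint (_ : (fun x => _ * 0) = fun=> 0); last by apply/funext => x; rewrite mulr0.
by rewrite /partial derive_cst mulr0 oppr0.
Qed.

(** Test functions supported in the end make integrals over the end and over [M] agree, so the
    values of [e] over [K_0] are immaterial. *)
Lemma weak_radial_of (a c e : M -> R) : loc2 mu a -> (forall p, D p -> e p = c p) ->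
  (forall f (K : set M), smooth_fun f -> compact K -> K `<=` D -> (forall p, ~ K p -> f p = 0) ->
    Rintegral mu D (fun x : borel M => a x * radial_adjoint f x) = Rintegral mu D (fun x : borel M => c x * f x)) ->
  weak_radial mu a e.
Proof.
move=> la ec H f K sf cK KD f0; have := H f K sf cK KD f0.
rewrite [X in X = _ -> _]Rintegral_mkcond [X in _ = X -> _]Rintegral_mkcond => E.
have -> : I (fun p => e p * f p) = Rintegral mu setT ((fun x : borel M => c x * f x) \_ D).
  apply: I_ext => p; rewrite /patch; case: ifPn => [/set_mem Dp|/negP nD]; first by rewrite ec.
  by rewrite f0 ?mulr0 // => /KD Dp; apply: nD; exact: mem_set.
have off p : ~ D p -> Gam r f p + f p * Lap r p = 0.
  by move=> nD; have nK : ~ K p by [move/KD]; rewrite GamC (Gam_off g r cK f0 nK) f0 // mul0r addr0.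
have srr := sr; have cf : cs f by exists K.
have iX : intg mu (fun p => a p * (Gam r f p + f p * Lap r p)).
  by apply: (intg_loc hmu la); [apply: LB_smooth; smf|csf].
rewrite -E -[LHS]opprK -(JN iX); congr (- _); apply: I_ext => p.
rewrite /patch; case: ifPn => [/set_mem Dp|/negP nD].
  by rewrite (radial_adjointE sf Dp) mulrN.
by rewrite off ?mulr0 ?oppr0 // => Dp; apply: nD; exact: mem_set.
Qed.

(** Real and imaginary parts of [w = v + i t u], where [v] is the defect in the radiation condition,
    extended by zero over [K_0]. *)
Lemma radial_weak u w (t : R) : loc2 mu (ReF u) -> loc2 mu (ImF u) -> is_radial_derivative mu u w ->
  let v x := w x - (0 +i* t) * u x in
  weak_radial mu (ReF u) (fun p => (ReF v \_ D) p - t * ImF u p) /\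
  weak_radial mu (ImF u) (fun p => (ImF v \_ D) p + t * ReF u p).
Proof.
move=> l1 l2 H v.
have key f (K : set M) : smooth_fun f -> compact K -> K `<=` D -> (forall p, ~ K p -> f p = 0) ->
    Rintegral mu D (fun x : borel M => ReF u x * radial_adjoint f x) = Rintegral mu D (fun x : borel M => ReF w x * f x) /\
    Rintegral mu D (fun x : borel M => ImF u x * radial_adjoint f x) = Rintegral mu D (fun x : borel M => ImF w x * f x).
  move=> sf cK KD f0.
  have tf : test_fun D (fun x => (f x)%:C).
    by split; [exact: sf|exact: smooth_fun_cst|exists K; split => // x /f0 ->].
  have := H _ tf; rewrite (_ : complexify _ _ = fun x => (radial_adjoint f x)%:C) => [[E1 E2]|]; last first.
    by apply/funext => x; rewrite /complexify (_ : ImF _ = fun=> 0) // radial_adjoint0.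
  split; [apply: etrans (etrans E1 _)|apply: etrans (etrans E2 _)]; congr Rintegral; apply/funext => x; rewrite /ReF /ImF;
    by [case: (u x) => ? ? /=; ring|case: (w x) => ? ? /=; ring].
have vE p : D p -> (ReF v \_ D) p = ReF w p + t * ImF u p /\ (ImF v \_ D) p = ImF w p - t * ReF u p.
  move=> Dp; rewrite /patch mem_set // /v /ReF /ImF.
  by case: (w p) (u p) => ? ? [? ?] /=; split; ring.
split.
  apply: (weak_radial_of (c := ReF w) l1) => [p /vE[-> _]|f K sf cK KD f0]; first by ring.
  by have [] := key f K sf cK KD f0.
apply: (weak_radial_of (c := ImF w) l2) => [p /vE[_ ->]|f K sf cK KD f0]; first by ring.
by have [] := key f K sf cK KD f0.
Qed.

(** The decay obtained from the vanishing flux is exactly what the third clause of [resonance]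
    forbids; [lam > 0] makes [kappa] nonzero. *)
Lemma no_resonance (lam eps : R) : 0 < lam -> eps ^+ 2 = 1 ->
  essentially_self_adjoint mu (schrodinger V : (M -> R[i]) -> M -> R[i]) ->
  ~ resonance mu eps (schrodinger V : (M -> R[i]) -> M -> R[i]) lam.
Proof.
move=> lam0 eps1 hH [kappa [k0 lamE [u [[sigma [_ /in_H0_weighted[wa wb]]] su nu [w [rw [s [s0 hw]]]]]]]].
have kp : 0 < kappa.
  by rewrite lt_neqAle k0 andbT eq_sym; apply/eqP => z; move: lam0; rewrite lamE z expr0n ltxx.
have [ga gb] := adjoint_weak su.
have E1 : ReF (fun x => lam%:C * u x) = fun p => lam * ReF u p.
  by apply/funext => x; rewrite /ReF; case: (u x) => a b /=; rewrite mul0r subr0.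
have E2 : ImF (fun x => lam%:C * u x) = fun p => lam * ImF u p.
  by apply/funext => x; rewrite /ImF; case: (u x) => a b /=; rewrite mul0r addr0.
rewrite E1 in ga; rewrite E2 in gb.
have [w1 w2] := in_H0_end_weighted hw.
have [r1 r2] := radial_weak (eps * kappa) (weighted_loc2 wa) (weighted_loc2 wb) rw.
have [da db] := resonance_decay hmu mV VB hH kp eps1 s0 wa wb w1 w2 ga gb r1 r2.
by apply: nu; exists s; split => //; apply/in_H0_weighted.
Qed.

End Resonances.

Theorem proposition1p30 (R : realType) (n : nat) (hn : (3 <= n)%N)
    (sigma0 A lam : R) (hsigma0 : 0 < sigma0) (hA : 0 < A) (hlam : 0 < lam)
    (M : asymptotically_conic n sigma0)
    (mu : {measure set (borel M) -> \bar R})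
    (hmu : is_riemannian_measure (ac_g M) mu)
    (V : M -> R) (hV : short_range mu V)
    (hVbound : forall x : M, `|V x| <=
       A * (ac_weight x `^ (- 2 - 2 * sigma0) +
            Num.sqrt lam * ac_weight x `^ (- 1 - 2 * sigma0)))
    (hH : essentially_self_adjoint mu (schrodinger V)) :
  ~ (exists u : M -> complex R, eigenfunction mu (schrodinger V) lam u /\
       ~ {ae mu, forall x : borel M, u x = 0}) /\
  ~ outgoing_resonance mu (schrodinger V) lam /\
  ~ incoming_resonance mu (schrodinger V) lam.
Proof.
have [mV _] := hV; have A0 := ltW hA.
have [B HB] := potential_bounded hsigma0 A0 hlam hVbound.
have VB p : `|V p| <= B + lam.
  rewrite -(subrK lam (V p)); apply: le_trans (ler_normD _ _) _.
  by rewrite (gtr0_norm hlam) lerD2r.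
split; last by split; apply: (no_resonance hmu mV VB) => //; rewrite ?expr1n ?sqrrN ?expr1n.
move=> [u [eu]]; apply.
have [a1 a2] := eigenfunction_approximable hmu mV VB hH eu.
have z1 := approximable_ae0 hsigma0 hmu A0 hlam mV hVbound a1.
have z2 := approximable_ae0 hsigma0 hmu A0 hlam mV hVbound a2.
apply: filterS2 z1 z2 => x; rewrite /ReF /ImF.
by case: (u x) => a b /= -> ->.
Qed.
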